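(* Let $\mathcal B=\mathcal P[B]$ be a 011-PI operator with parameters $B\in\mathcal N_{011}$ whose components $B_{11},B_{22}$ are separable, and which defines well-posed boundary conditions (i.e. $\mathcal B\mathcal H_1$ is invertible, with inverse $(\mathcal B\mathcal H_1)^{-1}=\mathcal P[\hat E]$ for some $\hat E\in\mathcal N_{011}$). Let $\mathcal T=\mathcal K_2-\mathcal K_1(\mathcal B\mathcal H_1)^{-1}\mathcal B\mathcal H_2$, let $A_{ij}$ ($i,j\in\{0,1,2\}$) be real matrices of compatible sizes, and let $$\mathcal A=\sum_{i,j=0}^2A_{ij}\big(\partial_x^i\partial_y^j[N_{\max\{i,j\}}\mathcal T]\big),$$ where $N_0=I_{n_0+n_1+n_2}$, $N_1=[\,0_{(n_1+n_2)\times n_0}\ \ I_{n_1+n_2}]$, $N_2=[\,0_{n_2\times n_0}\ \ 0_{n_2\times n_1}\ \ I_{n_2}]$. Then, given $\hat u_{\mathrm I}\in L_2^{n_0+n_1+n_2}([a,b]\times[c,d])$, $\hat u(t)$ solves the PIE defined by $\{\mathcal T,\mathcal A\}$, $$\mathcal T\dot{\hat u}(t)=\mathcal A\hat u(t),$$ with the initial condition $\hat u_{\mathrm I}$ if and only if $u(t)=\mathcal T\hat u(t)$ satisfies the PDE defined by $\{A_{ij},\mathcal B\}$ with the initial condition $u_{\mathrm I}=\mathcal T\hat u_{\mathrm I}$.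
   Context: Solutions. The PDE defined by $\{A_{ij},\mathcal B\}$ is $\dot u(t,x,y)=\sum_{i,j=0}^2A_{ij}\,\partial_x^i\partial_y^j\big(N_{\max\{i,j\}}u(t,x,y)\big)$ with $u(t)\in X(\mathcal B)$. For a given initial condition $u_{\mathrm I}\in X(\mathcal B)$, a function $u(t)$ satisfies the PDE defined by $\{A_{ij},\mathcal B\}$ if $u$ is Fréchet differentiable, $u(0)=u_{\mathrm I}$, $u(t)\in X(\mathcal B)$ for all $t\ge0$, and the equation is satisfied for all $t\ge0$. For PI operators $\mathcal T,\mathcal A$ and an initial condition $\hat u_{\mathrm I}$, $\hat u(t)$ solves the PIE defined by $\{\mathcal T,\mathcal A\}$ for initial condition $\hat u_{\mathrm I}$ if $\hat u(0)=\hat u_{\mathrm I}$, $\hat u(t)\in L_2^{n_0+n_1+n_2}([a,b]\times[c,d])$ for all $t\ge0$, and $\mathcal T\dot{\hat u}(t)=\mathcal A\hat u(t)$ for all $t\ge0$. $\partial_x^i\partial_y^j[N_{\max\{i,j\}}\mathcal T]$ denotes the composition $\hat u\mapsto\partial_x^i\partial_y^j(N_{\max\{i,j\}}\mathcal T\hat u)$. Setting. $a<b$, $c<d$; $L_2,H_k$ are over $[a,b]\times[c,d]$ with $H_k^m=\{u:\partial_x^{\alpha_1}\partial_y^{\alpha_2}u\in L_2^m\ \forall\,\max(\alpha_1,\alpha_2)\le k\}$. States are partitioned as $u=(u_0,u_1,u_2)$ with $u_i$ having $n_i$ components. 011-PI operators. Parameters in $\mathcal N_{011}$ are arrays $B=(B_{ij})_{i,j=0}^2$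 with $B_{00}$ a constant matrix, $B_{01},B_{10}$ matrix-valued $L_2$ functions of $x\in[a,b]$, $B_{02},B_{20}$ matrix-valued $L_2$ functions of $y\in[c,d]$, $B_{12},B_{21}$ matrix-valued $L_2$ functions of both $x$ and $y$, $B_{11}=\{B_{11}^0(x),B_{11}^1(x,\theta),B_{11}^2(x,\theta)\}$ and $B_{22}=\{B_{22}^0(y),B_{22}^1(y,\nu),B_{22}^2(y,\nu)\}$ triples of matrix-valued $L_2$ functions. The operator $\mathcal P[B]$ maps $(w_0,w_1,w_2)$ to $\big(B_{00}w_0+\int_a^bB_{01}(x)w_1(x)dx+\int_c^dB_{02}(y)w_2(y)dy$, $\ B_{10}(x)w_0+B_{11}^0(x)w_1(x)+\int_a^xB_{11}^1(x,\theta)w_1(\theta)d\theta+\int_x^bB_{11}^2(x,\theta)w_1(\theta)d\theta+\int_c^dB_{12}(x,y)w_2(y)dy$, $\ B_{20}(y)w_0+\int_a^bB_{21}(x,y)w_1(x)dx+B_{22}^0(y)w_2(y)+\int_c^yB_{22}^1(y,\nu)w_2(\nu)d\nu+\int_y^dB_{22}^2(y,\nu)w_2(\nu)d\nu\big)$. Separable means $B_{11}^2=B_{11}^1$ and $B_{22}^2=B_{22}^1$. Here $\mathcal B:\mathbb R^{4n_1+16n_2}\times L_2^{2n_1+4n_2}[a,b]\times L_2^{2n_1+4n_2}[c,d]\to\mathbb R^{n_1+4n_2}\times L_2^{n_1+2n_2}[a,b]\times L_2^{n_1+2n_2}[c,d]$. Boundary conditions. With $\Lambda_1f=(f(a,c),f(b,c),f(a,d),f(b,d))$,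 $(\Lambda_2f)(x)=(f(x,c),f(x,d))$, $(\Lambda_3f)(y)=(f(a,y),f(b,y))$, $\Lambda_{\mathrm{bf}}u=\big((\Lambda_1u_1,\Lambda_1u_2,\Lambda_1\partial_xu_2,\Lambda_1\partial_yu_2,\Lambda_1\partial_x\partial_yu_2),\ (\Lambda_2\partial_xu_1,\Lambda_2\partial_x^2u_2,\Lambda_2\partial_x^2\partial_yu_2),\ (\Lambda_3\partial_yu_1,\Lambda_3\partial_y^2u_2,\Lambda_3\partial_x\partial_y^2u_2)\big)$, $X(\mathcal B)=\{u\in L_2^{n_0}\times H_1^{n_1}\times H_2^{n_2}:\mathcal B\Lambda_{\mathrm{bf}}u=0\}$. Operators in $\mathcal T$. $(\mathcal K_1(v_0,v_1,v_2))(x,y)=K_{30}(x,y)v_0+\int_a^xK_{31}(x,y,\theta)v_1(\theta)d\theta+\int_c^yK_{32}(x,y,\nu)v_2(\nu)d\nu$ and $(\mathcal K_2\hat u)(x,y)=\mathrm{diag}(I_{n_0},0,0)\hat u(x,y)+\int_a^x\int_c^yK_{33}(x,y,\theta,\nu)\hat u(\theta,\nu)d\nu d\theta$, with (block rows $n_0,n_1,n_2$; scalars in the last row multiply $I_{n_2}$) $$K_{30}=\begin{bmatrix}0&0&0&0&0\\ I_{n_1}&0&0&0&0\\0&I_{n_2}&(x-a)&(y-c)&(y-c)(x-a)\end{bmatrix},\quad K_{31}=\begin{bmatrix}0&0&0\\ I_{n_1}&0&0\\0&(x-\theta)&(y-c)(x-\theta)\end{bmatrix},$$ $$K_{32}=\begin{bmatrix}0&0&0\\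 I_{n_1}&0&0\\0&(y-\nu)&(x-a)(y-\nu)\end{bmatrix},\quad K_{33}=\begin{bmatrix}0&0&0\\0&I_{n_1}&0\\0&0&(x-\theta)(y-\nu)\end{bmatrix}.$$ $\mathcal H_1(v_0,v_1,v_2)=(H_{00}v_0+\int_a^bH_{01}v_1dx+\int_c^dH_{02}v_2dy,\ H_{11}v_1,\ H_{22}v_2)$ on $\mathbb R^{n_1+4n_2}\times L_2^{n_1+2n_2}[a,b]\times L_2^{n_1+2n_2}[c,d]$, and $\mathcal H_2\hat u=\big(\int_a^b\int_c^dH_{03}\hat u\,dydx,\ \int_c^dH_{13}(y)\hat u(x,y)dy,\ \int_a^bH_{23}(x)\hat u(x,y)dx\big)$, where column-vector entries in the first block row are read as (vector)$\otimes I_{n_1}$, in other block rows as (vector)$\otimes I_{n_2}$, and with $e=(1,1,1,1)^T$, $p=(0,b-a,0,b-a)^T$, $g'=(0,0,d-c,d-c)^T$, $m=(0,0,0,(d-c)(b-a))^T$, $f=(0,1,0,1)^T$, $f_d=(0,0,0,d-c)^T$, $g=(0,0,1,1)^T$, $g_b=(0,0,0,b-a)^T$, $h=(0,0,0,1)^T$, $s=(1,1)^T$, $t=(0,1)^T$: $$H_{00}=\begin{bmatrix}e&0&0&0&0\\0&e&p&g'&m\\0&0&e&0&g'\\0&0&0&e&p\\0&0&0&0&e\end{bmatrix},\ H_{01}(x)=\begin{bmatrix}f&0&0\\0&(b-x)f&(b-x)f_d\\0&f&f_d\\0&0&(b-x)f\\0&0&f\end{bmatrix},\ H_{02}(y)=\begin{bmatrix}g&0&0\\0&(d-y)g&(d-y)g_b\\0&0&(d-y)g\\0&g&g_b\\0&0&g\end{bmatrix},$$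 $$H_{03}(x,y)=\begin{bmatrix}0&h&0\\0&0&(d-y)(b-x)h\\0&0&(d-y)h\\0&0&(b-x)h\\0&0&h\end{bmatrix},\quad H_{11}=\begin{bmatrix}s&0&0\\0&s&(d-c)t\\0&0&s\end{bmatrix},\quad H_{22}=\begin{bmatrix}s&0&0\\0&s&(b-a)t\\0&0&s\end{bmatrix},$$ $$H_{13}(y)=\begin{bmatrix}0&t&0\\0&0&(d-y)t\\0&0&t\end{bmatrix},\quad H_{23}(x)=\begin{bmatrix}0&t&0\\0&0&(b-x)t\\0&0&t\end{bmatrix}$$ (column block widths $n_1,n_2,n_2,n_2,n_2$ for $H_{00}$; $n_1,n_2,n_2$ for $H_{01},H_{02},H_{11},H_{22}$; $n_0,n_1,n_2$ for $H_{03},H_{13},H_{23}$). *)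

(* Defs.v *)
From HB Require Import structures.
From mathcomp Require Import all_boot all_order all_algebra.
From mathcomp Require Import all_classical all_reals all_analysis.

Set Implicit Arguments.
Unset Strict Implicit.
Unset Printing Implicit Defensive.

Import Order.TTheory GRing.Theory Num.Theory.
Import numFieldNormedType.Exports.

Local Open Scope classical_set_scope.
Local Open Scope ring_scope.

(* Elements of L2 are represented by Borel functions; two of them are the same
   element when they agree almost everywhere (`f = g %[ae mu in D]`).  Functions
   are total, and only their values on [a, b], [c, d], or on the rectangle
   [a, b] x [c, d], matter. *)

Notation two n := (n + n)%N (only parsing).
Notation four n := (n + (n + (n + n)))%N (only parsing).

Definition leb1 (R : realType) : {measure set (measurableTypeR R) -> \bar R} :=
  @lebesgue_measure R.

Definition leb2 (R : realType) :
    {measure set (measurableTypeR R * measurableTypeR R) -> \bar R} :=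
  (@lebesgue_measure R \x @lebesgue_measure R)%E.

Section L2.
Context (R : realType) (dp : measure_display) (T : measurableType dp)
  (mu : {measure set T -> \bar R}).

Definition L2 (D : set T) (f : T -> R) : Prop := f \_ D \in Lfun mu 2%:E.

Definition L2mx m n (D : set T) (F : T -> 'M[R]_(m, n)) : Prop :=
  forall i j, L2 D (fun z => F z i j).

Definition intmx m n (D : set T) (F : T -> 'M[R]_(m, n)) : 'M[R]_(m, n) :=
  \matrix_(i, j) (\int[mu]_(z in D) F z i j).

Definition L2normsq m n (D : set T) (F : T -> 'M[R]_(m, n)) : R :=
  \sum_i \sum_j \int[mu]_(z in D) (F z i j) ^+ 2.

Definition L2norm m n (D : set T) (F : T -> 'M[R]_(m, n)) : R :=
  Num.sqrt (L2normsq D F).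

End L2.

(* v is the Frechet derivative at time t of the curve u, defined on [0, +oo[,
   for the norm N (one-sided at t = 0). *)
Definition is_frechet (R : realType) (V : lmodType R) (N : V -> R)
    (u : R -> V) (t : R) (v : V) : Prop :=
  (fun h : R => N (u (t + h) - u t - h *: v) / `|h|)
    @ within [set h : R | 0 <= t + h] 0^' --> (0 : R).

Section BlockMatrices.
Context (R : realType).

Definition col4 m n (A B C D : 'M[R]_(m, n)) : 'M[R]_(four m, n) :=
  col_mx A (col_mx B (col_mx C D)).

Definition row4 m n (A B C D : 'M[R]_(m, n)) : 'M[R]_(m, four n) :=
  row_mx A (row_mx B (row_mx C D)).

(* (v0, v1, v2, v3)^T (x) I_n *)
Definition kron4 n (v0 v1 v2 v3 : R) : 'M[R]_(four n, n) :=
  col4 v0%:M v1%:M v2%:M v3%:M.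

(* (v0, v1)^T (x) I_n *)
Definition kron2 n (v0 v1 : R) : 'M[R]_(two n, n) := col_mx v0%:M v1%:M.

End BlockMatrices.

Section Operators011.
Context (R : realType) (a b c d : R).

(* The spaces R^m0 x L2^m1[a, b] x L2^m2[c, d]. *)
Definition Ztype (m0 m1 m2 : nat) : Type :=
  ('cV[R]_m0 * (R -> 'cV[R]_m1) * (R -> 'cV[R]_m2))%type.

Definition in_Z m0 m1 m2 (w : Ztype m0 m1 m2) : Prop :=
  L2mx (leb1 R) `[a, b] w.1.2 /\ L2mx (leb1 R) `[c, d] w.2.

Definition eqZ m0 m1 m2 (w w' : Ztype m0 m1 m2) : Prop :=
  [/\ w.1.1 = w'.1.1, w.1.2 = w'.1.2 %[ae leb1 R in `[a, b]%classic] &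
      w.2 = w'.2 %[ae leb1 R in `[c, d]%classic]].

Record params011 (m0 m1 m2 q0 q1 q2 : nat) := Params011 {
  B00 : 'M[R]_(m0, q0);
  B01 : R -> 'M[R]_(m0, q1);
  B02 : R -> 'M[R]_(m0, q2);
  B10 : R -> 'M[R]_(m1, q0);
  B11_0 : R -> 'M[R]_(m1, q1);
  B11_1 : R * R -> 'M[R]_(m1, q1);
  B11_2 : R * R -> 'M[R]_(m1, q1);
  B12 : R * R -> 'M[R]_(m1, q2);
  B20 : R -> 'M[R]_(m2, q0);
  B21 : R * R -> 'M[R]_(m2, q1);
  B22_0 : R -> 'M[R]_(m2, q2);
  B22_1 : R * R -> 'M[R]_(m2, q2);
  B22_2 : R * R -> 'M[R]_(m2, q2) }.

Definition N011 m0 m1 m2 q0 q1 q2 (B : params011 m0 m1 m2 q0 q1 q2) : Prop :=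
  [/\ L2mx (leb1 R) `[a, b] (B01 B), L2mx (leb1 R) `[c, d] (B02 B),
      L2mx (leb1 R) `[a, b] (B10 B) & L2mx (leb1 R) `[c, d] (B20 B)] /\
  [/\ L2mx (leb1 R) `[a, b] (B11_0 B),
      L2mx (leb2 R) (`[a, b] `*` `[a, b]) (B11_1 B) &
      L2mx (leb2 R) (`[a, b] `*` `[a, b]) (B11_2 B)] /\
  [/\ L2mx (leb1 R) `[c, d] (B22_0 B),
      L2mx (leb2 R) (`[c, d] `*` `[c, d]) (B22_1 B) &
      L2mx (leb2 R) (`[c, d] `*` `[c, d]) (B22_2 B)] /\
  (L2mx (leb2 R) (`[a, b] `*` `[c, d]) (B12 B) /\
   L2mx (leb2 R) (`[a, b] `*` `[c, d]) (B21 B)).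

Definition separable011 m0 m1 m2 q0 q1 q2
    (B : params011 m0 m1 m2 q0 q1 q2) : Prop :=
  B11_2 B = B11_1 B %[ae leb2 R in `[a, b] `*` `[a, b]] /\
  B22_2 B = B22_1 B %[ae leb2 R in `[c, d] `*` `[c, d]].

Definition PI011 m0 m1 m2 q0 q1 q2 (B : params011 m0 m1 m2 q0 q1 q2)
    (w : Ztype q0 q1 q2) : Ztype m0 m1 m2 :=
  let: (w0, w1, w2) := w in
  (B00 B *m w0 + intmx (leb1 R) `[a, b] (fun x => B01 B x *m w1 x)
     + intmx (leb1 R) `[c, d] (fun y => B02 B y *m w2 y),
   fun x => B10 B x *m w0 + B11_0 B x *m w1 x
     + intmx (leb1 R) `[a, x] (fun th => B11_1 B (x, th) *m w1 th)
     + intmx (leb1 R) `[x, b] (fun th => B11_2 B (x, th) *m w1 th)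
     + intmx (leb1 R) `[c, d] (fun y => B12 B (x, y) *m w2 y),
   fun y => B20 B y *m w0
     + intmx (leb1 R) `[a, b] (fun x => B21 B (x, y) *m w1 x)
     + B22_0 B y *m w2 y
     + intmx (leb1 R) `[c, y] (fun nu => B22_1 B (y, nu) *m w2 nu)
     + intmx (leb1 R) `[y, d] (fun nu => B22_2 B (y, nu) *m w2 nu)).

Definition maps_Z m0 m1 m2 q0 q1 q2
    (P : Ztype q0 q1 q2 -> Ztype m0 m1 m2) : Prop :=
  forall w, in_Z w -> in_Z (P w).

Definition inverse_on_Z m0 m1 m2 (P Q : Ztype m0 m1 m2 -> Ztype m0 m1 m2) :
    Prop :=
  maps_Z Q /\ forall w, in_Z w -> eqZ (Q (P w)) w /\ eqZ (P (Q w)) w.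

End Operators011.

Section WeakDerivatives.
Context (R : realType) (a b c d : R).

Definition Omega : set (R * R) := `[a, b] `*` `[c, d].

(* C^oo: every iterated directional derivative is differentiable. *)
Definition smooth (phi : R * R -> R) : Prop :=
  forall (vs : seq (R * R)) (z : R * R),
    differentiable (foldr (fun v f => 'D_v f) phi vs) z.

Definition test_function (phi : R * R -> R) : Prop :=
  smooth phi /\
  exists K : set (R * R),
    [/\ compact K, K `<=` `]a, b[ `*` `]c, d[ &
        forall z, ~ K z -> phi z = 0].

(* The classical derivative d_x^i d_y^j. *)
Definition partial_xy (i j : nat) (phi : R * R -> R) : R * R -> R :=
  iter i (fun f : R * R -> R => 'D_((1, 0) : R * R) f)
    (iter j (fun f : R * R -> R => 'D_((0, 1) : R * R) f) phi).

Definition is_wderiv (i j : nat) (f g : R * R -> R) : Prop :=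
  forall phi, test_function phi ->
    \int[leb2 R]_(z in Omega) (f z * partial_xy i j phi z) =
    (-1) ^+ (i + j) * \int[leb2 R]_(z in Omega) (g z * phi z).

(* The L2 weak derivative d_x^i d_y^j f, unique almost everywhere on the
   rectangle; zero when there is none. *)
Definition wderiv (i j : nat) (f : R * R -> R) : R * R -> R :=
  xget (fun=> 0) [set g | L2 (leb2 R) Omega g /\ is_wderiv i j f g].

Definition wderivmx n (i j : nat) (f : R * R -> 'cV[R]_n) : R * R -> 'cV[R]_n :=
  fun z => \col_k wderiv i j (fun z' => f z' k 0) z.

Definition in_H (k : nat) (f : R * R -> R) : Prop :=
  L2 (leb2 R) Omega f /\
  forall i j, (i <= k)%N -> (j <= k)%N ->
    exists g, L2 (leb2 R) Omega g /\ is_wderiv i j f g.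

Definition in_Hmx n (k : nat) (f : R * R -> 'cV[R]_n) : Prop :=
  forall l, in_H k (fun z => f z l 0).

Definition Hnormsq n (k : nat) (f : R * R -> 'cV[R]_n) : R :=
  \sum_(i < k.+1) \sum_(j < k.+1) L2normsq (leb2 R) Omega (wderivmx i j f).

(* Traces.  The values at a corner are those of the continuous representative;
   the values on an edge y = y0 (resp. x = x0) are those of a representative
   which is continuous in y for almost every x (resp. in x for almost every y).  Such traces are unique (almost everywhere); they are set to zero when
   there is none. *)
Definition is_trace_corner (f : R * R -> R) (z0 : R * R) (r : R) : Prop :=
  exists F : R * R -> R,
    [/\ F = f %[ae leb2 R in Omega], {within Omega, continuous F} & F z0 = r].

Definition is_trace_y (f : R * R -> R) (y0 : R) (g : R -> R) : Prop :=
  L2 (leb1 R) `[a, b] g /\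
  exists F : R * R -> R,
    F = f %[ae leb2 R in Omega] /\
    {ae leb1 R, forall x, x \in `[a, b] ->
       {within `[c, d], continuous (fun y => F (x, y))} /\ F (x, y0) = g x}.

Definition is_trace_x (f : R * R -> R) (x0 : R) (g : R -> R) : Prop :=
  L2 (leb1 R) `[c, d] g /\
  exists F : R * R -> R,
    F = f %[ae leb2 R in Omega] /\
    {ae leb1 R, forall y, y \in `[c, d] ->
       {within `[a, b], continuous (fun x => F (x, y))} /\ F (x0, y) = g y}.

Definition trace_corner n (f : R * R -> 'cV[R]_n) (z0 : R * R) : 'cV[R]_n :=
  \col_k xget 0 (is_trace_corner (fun z => f z k 0) z0).

Definition trace_y n (f : R * R -> 'cV[R]_n) (y0 : R) : R -> 'cV[R]_n :=
  fun x => \col_k xget (fun=> 0) (is_trace_y (fun z => f z k 0) y0) x.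

Definition trace_x n (f : R * R -> 'cV[R]_n) (x0 : R) : R -> 'cV[R]_n :=
  fun y => \col_k xget (fun=> 0) (is_trace_x (fun z => f z k 0) x0) y.

Definition Lambda1 n (f : R * R -> 'cV[R]_n) : 'cV[R]_(four n) :=
  col4 (trace_corner f (a, c)) (trace_corner f (b, c))
       (trace_corner f (a, d)) (trace_corner f (b, d)).

Definition Lambda2 n (f : R * R -> 'cV[R]_n) : R -> 'cV[R]_(two n) :=
  fun x => col_mx (trace_y f c x) (trace_y f d x).

Definition Lambda3 n (f : R * R -> 'cV[R]_n) : R -> 'cV[R]_(two n) :=
  fun y => col_mx (trace_x f a y) (trace_x f b y).

End WeakDerivatives.

(* The domain R^(4 n1 + 16 n2) x L2^(2 n1 + 4 n2)[a, b] x L2^(2 n1 + 4 n2)[c, d]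
   and codomain R^(n1 + 4 n2) x L2^(n1 + 2 n2)[a, b] x L2^(n1 + 2 n2)[c, d] of
   the boundary operator. *)
Definition ZBF (R : realType) (n1 n2 : nat) : Type :=
  Ztype R (four n1 + four (four n2))
    (two n1 + two (two n2)) (two n1 + two (two n2)).

Definition ZBC (R : realType) (n1 n2 : nat) : Type :=
  Ztype R (n1 + four n2) (n1 + two n2) (n1 + two n2).

Definition BCparams (R : realType) (n1 n2 : nat) : Type :=
  params011 R (n1 + four n2) (n1 + two n2) (n1 + two n2)
    (four n1 + four (four n2)) (two n1 + two (two n2)) (two n1 + two (two n2)).

Definition BCinvparams (R : realType) (n1 n2 : nat) : Type :=
  params011 R (n1 + four n2) (n1 + two n2) (n1 + two n2)
    (n1 + four n2) (n1 + two n2) (n1 + two n2).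

Section PDE.
Context (R : realType) (a b c d : R) (n0 n1 n2 : nat).

Local Notation ns := (n0 + (n1 + n2))%N.
Local Notation state := (R * R -> 'cV[R]_(n0 + (n1 + n2))).
Local Notation Om := (Omega a b c d).

Local Notation Zbf := (ZBF R n1 n2).
Local Notation Zbc := (ZBC R n1 n2).
Local Notation BCparams := (BCparams R n1 n2).
Local Notation BCinvparams := (BCinvparams R n1 n2).

Definition state0 (u : state) : R * R -> 'cV[R]_n0 := fun z => usubmx (u z).
Definition state1 (u : state) : R * R -> 'cV[R]_n1 :=
  fun z => usubmx (dsubmx (u z)).
Definition state2 (u : state) : R * R -> 'cV[R]_n2 :=
  fun z => dsubmx (dsubmx (u z)).

Definition Lambda_bf (u : state) : Zbf :=
  let u1 := state1 u in
  let u2 := state2 u in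
  let D1 (i j : nat) := wderivmx a b c d i j u1 in
  let D2 (i j : nat) := wderivmx a b c d i j u2 in
  (col_mx (Lambda1 a b c d u1)
     (col4 (Lambda1 a b c d u2) (Lambda1 a b c d (D2 1%N 0%N))
           (Lambda1 a b c d (D2 0%N 1%N)) (Lambda1 a b c d (D2 1%N 1%N))),
   fun x => col_mx (Lambda2 a b c d (D1 1%N 0%N) x)
     (col_mx (Lambda2 a b c d (D2 2%N 0%N) x) (Lambda2 a b c d (D2 2%N 1%N) x)),
   fun y => col_mx (Lambda3 a b c d (D1 0%N 1%N) y)
     (col_mx (Lambda3 a b c d (D2 0%N 2%N) y) (Lambda3 a b c d (D2 1%N 2%N) y))).

Definition zeroZ m0 m1 m2 : Ztype R m0 m1 m2 := (0, fun=> 0, fun=> 0).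

Definition in_X (B : BCparams) (u : state) : Prop :=
  [/\ L2mx (leb2 R) Om (state0 u), in_Hmx a b c d 1 (state1 u),
      in_Hmx a b c d 2 (state2 u) &
      eqZ a b c d (PI011 a b c d B (Lambda_bf u)) (zeroZ _ _ _)].

(* The norm of X(B), inherited from L2^n0 x H_1^n1 x H_2^n2. *)
Definition Xnorm (u : state) : R :=
  Num.sqrt (L2normsq (leb2 R) Om (state0 u)
            + Hnormsq a b c d 1 (state1 u) + Hnormsq a b c d 2 (state2 u)).

Definition K30 (z : R * R) : 'M[R]_(ns, n1 + four n2) :=
  let: (x, y) := z in
  col_mx 0 (block_mx 1%:M 0
    0 (row4 1%:M (x - a)%:M (y - c)%:M ((y - c) * (x - a))%:M)).

Definition K31 (z : R * R) (th : R) : 'M[R]_(ns, n1 + two n2) :=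
  let: (x, y) := z in
  col_mx 0 (block_mx 1%:M 0
    0 (row_mx (x - th)%:M ((y - c) * (x - th))%:M)).

Definition K32 (z : R * R) (v : R) : 'M[R]_(ns, n1 + two n2) :=
  let: (x, y) := z in
  col_mx 0 (block_mx 1%:M 0
    0 (row_mx (y - v)%:M ((x - a) * (y - v))%:M)).

Definition K33 (z : R * R) (th v : R) : 'M[R]_ns :=
  let: (x, y) := z in
  block_mx 0 0
    0 (block_mx 1%:M 0
         0 ((x - th) * (y - v))%:M).

Definition opK1 (w : Zbc) : state := fun z =>
  let: (v0, v1, v2) := w in
  K30 z *m v0 + intmx (leb1 R) `[a, z.1] (fun th => K31 z th *m v1 th)
    + intmx (leb1 R) `[c, z.2] (fun v => K32 z v *m v2 v).

Definition opK2 (uh : state) : state := fun z =>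
  block_mx 1%:M 0 0 0 *m uh z
    + intmx (leb1 R) `[a, z.1] (fun th =>
        intmx (leb1 R) `[c, z.2] (fun v => K33 z th v *m uh (th, v))).

Definition H00 : 'M[R]_(four n1 + four (four n2), n1 + four n2) :=
  let I := kron4 n2 1 1 1 1 in
  let p := kron4 n2 0 (b - a) 0 (b - a) in
  let g' := kron4 n2 0 0 (d - c) (d - c) in
  let m := kron4 n2 0 0 0 ((d - c) * (b - a)) in
  block_mx (kron4 n1 1 1 1 1) 0
    0 (col4 (row4 I p g' m)
            (row4 0 I 0 g')
            (row4 0 0 I p)
            (row4 0 0 0 I)).

Definition H01 (x : R) : 'M[R]_(four n1 + four (four n2), n1 + two n2) :=
  let f := kron4 n2 0 1 0 1 in
  let fd := kron4 n2 0 0 0 (d - c) in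
  block_mx (kron4 n1 0 1 0 1) 0
    0 (col4 (row_mx ((b - x) *: f) ((b - x) *: fd))
            (row_mx f fd)
            (row_mx 0 ((b - x) *: f))
            (row_mx 0 f)).

Definition H02 (y : R) : 'M[R]_(four n1 + four (four n2), n1 + two n2) :=
  let g := kron4 n2 0 0 1 1 in
  let gb := kron4 n2 0 0 0 (b - a) in
  block_mx (kron4 n1 0 0 1 1) 0
    0 (col4 (row_mx ((d - y) *: g) ((d - y) *: gb))
            (row_mx 0 ((d - y) *: g))
            (row_mx g gb)
            (row_mx 0 g)).

Definition H03 (z : R * R) : 'M[R]_(four n1 + four (four n2), ns) :=
  let: (x, y) := z in
  let h := kron4 n2 0 0 0 1 in
  row_mx 0 (block_mx (kron4 n1 0 0 0 1) 0
    0 (col4 (((d - y) * (b - x)) *: h)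
            ((d - y) *: h)
            ((b - x) *: h)
            h)).

Definition H11 : 'M[R]_(two n1 + two (two n2), n1 + two n2) :=
  block_mx (kron2 n1 1 1) 0
    0 (block_mx (kron2 n2 1 1) ((d - c) *: kron2 n2 0 1)
                0 (kron2 n2 1 1)).

Definition H22 : 'M[R]_(two n1 + two (two n2), n1 + two n2) :=
  block_mx (kron2 n1 1 1) 0
    0 (block_mx (kron2 n2 1 1) ((b - a) *: kron2 n2 0 1)
                0 (kron2 n2 1 1)).

Definition H13 (y : R) : 'M[R]_(two n1 + two (two n2), ns) :=
  row_mx 0 (block_mx (kron2 n1 0 1) 0
    0 (col_mx ((d - y) *: kron2 n2 0 1) (kron2 n2 0 1))).

Definition H23 (x : R) : 'M[R]_(two n1 + two (two n2), ns) :=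
  row_mx 0 (block_mx (kron2 n1 0 1) 0
    0 (col_mx ((b - x) *: kron2 n2 0 1) (kron2 n2 0 1))).

Definition opH1 (w : Zbc) : Zbf :=
  let: (v0, v1, v2) := w in
  (H00 *m v0 + intmx (leb1 R) `[a, b] (fun x => H01 x *m v1 x)
     + intmx (leb1 R) `[c, d] (fun y => H02 y *m v2 y),
   fun x => H11 *m v1 x,
   fun y => H22 *m v2 y).

Definition opH2 (uh : state) : Zbf :=
  (intmx (leb1 R) `[a, b] (fun x =>
     intmx (leb1 R) `[c, d] (fun y => H03 (x, y) *m uh (x, y))),
   fun x => intmx (leb1 R) `[c, d] (fun y => H13 y *m uh (x, y)),
   fun y => intmx (leb1 R) `[a, b] (fun x => H23 x *m uh (x, y))).

(* The boundary conditions are well-posed: B H1 is invertible on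
   R^(n1 + 4 n2) x L2^(n1 + 2 n2)[a, b] x L2^(n1 + 2 n2)[c, d], with inverse
   P[E]. *)
Definition well_posed_bc (B : BCparams) (E : BCinvparams) : Prop :=
  inverse_on_Z a b c d (fun w => PI011 a b c d B (opH1 w)) (PI011 a b c d E).

Definition opT (B : BCparams) (E : BCinvparams) (uh : state) : state :=
  opK2 uh - opK1 (PI011 a b c d E (PI011 a b c d B (opH2 uh))).

Definition Ndim (k : nat) : nat :=
  match k with 0 => ns | 1 => n1 + n2 | _ => n2 end.

Definition Nmx (k : nat) : 'M[R]_(Ndim k, ns) :=
  match k return 'M[R]_(Ndim k, ns) with
  | 0 => 1%:M
  | 1 => row_mx 0 1%:M
  | _ => row_mx 0 (row_mx 0 1%:M)
  end.

Definition PDEcoefs : Type :=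
  forall i j : 'I_3, 'M[R]_(ns, Ndim (maxn i j)).

Definition PDErhs (A : PDEcoefs) (u : state) : state := fun z =>
  \sum_(i < 3) \sum_(j < 3)
    A i j *m wderivmx a b c d i j (fun z' => Nmx (maxn i j) *m u z') z.

(* sum_ij A_ij (d_x^i d_y^j [N_max(i,j) T]) *)
Definition opA (A : PDEcoefs) (T : state -> state) (uh : state) : state :=
  PDErhs A (T uh).

Definition satisfies_PDE (A : PDEcoefs) (B : BCparams) (uI : state)
    (u : R -> state) : Prop :=
  exists du : R -> state,
    [/\ u 0 = uI %[ae leb2 R in Om],
        forall t, 0 <= t -> in_X B (u t),
        forall t, 0 <= t -> in_X B (du t) /\ is_frechet Xnorm u t (du t) &
        forall t, 0 <= t -> du t = PDErhs A (u t) %[ae leb2 R in Om]].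

Definition solves_PIE (T A : state -> state) (uI : state) (u : R -> state) :
    Prop :=
  exists du : R -> state,
    [/\ u 0 = uI %[ae leb2 R in Om],
        forall t, 0 <= t -> L2mx (leb2 R) Om (u t),
        forall t, 0 <= t -> L2mx (leb2 R) Om (du t) /\
          is_frechet (L2norm (leb2 R) Om) u t (du t) &
        forall t, 0 <= t -> T (du t) = A (u t) %[ae leb2 R in Om]].

End PDE.

(* Main.v *)
Require Import Defs.
From HB Require Import structures.
From mathcomp Require Import all_boot all_order all_algebra.
From mathcomp Require Import all_classical all_reals all_analysis.
From mathcomp Require Import measurable_realfun ring lra.

Set Implicit Arguments.
Unset Strict Implicit.
Unset Printing Implicit Defensive.

Import Order.TTheory GRing.Theory Num.Theory.
Import numFieldNormedType.Exports.

Local Open Scope classical_set_scope.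
Local Open Scope ring_scope.

(* Write w := - (B H1)^(-1) B H2 v, so that T v = K2 v + K1 w.  A function belongs
   to H_1 (resp. H_2) exactly when it is, almost everywhere, K1 w + K2 v for some
   w and some v in L2; here v consists of the highest mixed derivatives and w of
   lower derivatives at the corner (a, c) and on the edges y = c and x = a.  The
   boundary values of K1 w + K2 v are H1 w + H2 v, so the boundary conditions hold
   if and only if w is given by v as above: T is a bijection of L2 onto X(B).  It
   is bounded, as a composition of operators which are bounded on L2, and its
   inverse is bounded because the components of v are among the derivatives that
   define the norm of X(B).  Hence T and its inverse preserve Frechet derivatives,
   and the PIE is the PDE rewritten in terms of T.

   That P[B] and P[E] are bounded uses the fact that multiplication by a function
   which maps L2 into L2 is a bounded operator on L2. *)

(** * Square-integrable functions *)

(** L2 is never formed as a quotient. [wderiv] and the traces choose representatives with [xget], so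
    most identities hold almost everywhere only, and restricting to an edge requires a well chosen
    representative. Two devices answer this. Operators are handled through [good]: linearity up to
    almost everywhere equality together with a bound on squared norms. This notion is stable under
    composition and implies compatibility with almost everywhere equality. Identities that are later
    evaluated on an edge are proved with an exceptional set in one variable alone. The
    representation of H_1 and H_2 functions rests on one fact: a function whose weak x-derivative
    vanishes depends on y alone. Tensor products of one-variable test functions suffice to prove it,
    and the fundamental lemma behind it uses countably many explicit bumps. Integration by parts
    against a test function is Fubini on a triangle. On the PDE side the Frechet derivative is taken
    in the norm of X(B). In that norm T does not decrease the L2 norm, so the derivative of [uh] is
    recovered by applying [opD] to that of [T uh]. *)

Section L2theory.
Context (R : realType) (dp : measure_display) (T : measurableType dp).
Variables (mu : {measure set T -> \bar R}) (D : set T).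
Hypothesis mD : measurable D.
Implicit Types f g : T -> R.

Let itg f := mu.-integrable D (EFin \o f).

Lemma integrableZ_EFin k f : itg f -> itg (fun x => k * f x).
Proof. exact: (@integrableZl _ _ _ mu D mD k (EFin \o f)). Qed.

Lemma integrableD_EFin f g : itg f -> itg g -> itg (fun x => f x + g x).
Proof. exact: (@integrableD _ _ _ mu D mD (EFin \o f) (EFin \o g)). Qed.

Lemma integrableB_EFin f g : itg f -> itg g -> itg (fun x => f x - g x).
Proof. exact: (@integrableB _ _ _ mu D mD (EFin \o f) (EFin \o g)). Qed.

Lemma integrable_sum_EFin (I : Type) (s : seq I) (F : I -> T -> R) :
  (forall i, itg (F i)) -> itg (fun x => \sum_(i <- s) F i x).
Proof.
move=> iF; elim: s => [|i s ih].
  by apply: eq_integrable (integrable0 mu D) => // x _ /=; rewrite big_nil.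
by apply: eq_integrable (integrableD_EFin (iF i) ih) => // x _ /=; rewrite big_cons.
Qed.

Lemma Rintegral_sum_EFin (I : Type) (s : seq I) (F : I -> T -> R) :
  (forall i, itg (F i)) ->
  \int[mu]_(x in D) (\sum_(i <- s) F i x) = \sum_(i <- s) \int[mu]_(x in D) F i x.
Proof.
move=> iF; elim: s => [|i s ih].
  under eq_Rintegral do rewrite big_nil.
  by rewrite big_nil Rintegral_cst// mul0r.
under eq_Rintegral do rewrite big_cons.
by rewrite big_cons RintegralD// ?ih//; [exact: iF|exact: integrable_sum_EFin].
Qed.

Definition nsq f : R := \int[mu]_(x in D) (f x) ^+ 2.

Lemma nsq_ge0 f : 0 <= nsq f.
Proof. by apply: Rintegral_ge0 => x _; exact: sqr_ge0. Qed.

(** [L2] speaks of the restriction [f \_ D] on the whole space. Measurability and integrability of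
    the square on [D] is the form used from here on. *)
Lemma L2P f : L2 mu D f <->
  measurable_fun D f /\ mu.-integrable D (EFin \o (fun x => f x ^+ 2)).
Proof.
have sqD : EFin \o (fun x => (f \_ D) x ^+ 2) =
           (EFin \o (fun x => f x ^+ 2)) \_ D :> (T -> \bar R).
  by apply/funext => x /=; rewrite !patchE; case: ifP => //; rewrite expr0n.
split=> [Lf|[mf intf]].
  split.
    move: Lf; rewrite /L2 inE => /andP[]; rewrite inE/= => + _.
    exact: (measurable_restrictT _ _).2.
  move/Lfun2_integrable_sqr: Lf => /=.
  by rewrite sqD => /(integrable_mkcond _ mD).
have mfD : measurable_fun [set: T] (f \_ D) by exact/(measurable_restrictT _ _).1.
rewrite /L2 inE; apply/andP; split; first by rewrite inE.
rewrite inE /= /finite_norm.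
move/(integrable_mkcond _ mD) : intf; rewrite -sqD => /integrableP[_ intf].
rewrite unlock; apply: poweR_lty.
apply: le_lt_trans intf; apply: ge0_le_integral => //=.
- apply/measurable_EFinP.
  apply: (@measurableT_comp _ _ _ _ _ _ (fun x : R => x `^ 2)%R) => //.
  exact: measurableT_comp.
- apply/measurable_EFinP; apply: measurableT_comp => //.
  exact: measurable_funX.
- move=> t _; by rewrite lee_fin powR_mulrn// normrX.
Qed.

Lemma L2_measurable f : L2 mu D f -> measurable_fun D f.
Proof. by case/L2P. Qed.

Lemma L2_sqr_integrable f : L2 mu D f ->
  mu.-integrable D (EFin \o (fun x => f x ^+ 2)).
Proof. by case/L2P. Qed.

Lemma L2M_integrable f g : L2 mu D f -> L2 mu D g ->
  mu.-integrable D (EFin \o (fun x => f x * g x)).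
Proof.
move=> /L2P[mf if2] /L2P[mg ig2].
apply: (@le_integrable _ _ _ mu D mD _
  (EFin \o (fun x => f x ^+ 2 + g x ^+ 2))).
- apply/measurable_EFinP; exact: measurable_funM.
- move=> x _ /=; rewrite lee_fin (ger0_norm (addr_ge0 _ _)) ?sqr_ge0//.
  by rewrite ler_norml; apply/andP; split; nra.
- exact: (integrableD_EFin if2 ig2).
Qed.

Lemma L2Z k f : L2 mu D f -> L2 mu D (fun x => k * f x).
Proof.
move=> /L2P[mf if2]; apply/L2P; split.
  by apply: measurable_funM => //; exact: measurable_cst.
have := integrableZ_EFin (k ^+ 2) if2.
by apply: eq_integrable => // x _ /=; rewrite exprMn.
Qed.

Lemma L2D f g : L2 mu D f -> L2 mu D g -> L2 mu D (fun x => f x + g x).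
Proof.
move=> Lf Lg; have /L2P[mf if2] := Lf; have /L2P[mg ig2] := Lg.
apply/L2P; split; first exact: measurable_funD.
have i3 := integrableD_EFin (integrableD_EFin if2 ig2)
  (integrableZ_EFin 2 (L2M_integrable Lf Lg)).
apply: eq_integrable i3 => // x _ /=.
by congr EFin; ring.
Qed.

Lemma L2_eq f g : {in D, f =1 g} -> L2 mu D f -> L2 mu D g.
Proof.
move=> fg; rewrite /L2; suff -> : f \_ D = g \_ D by [].
by apply/funext => x; rewrite !patchE; case: ifPn => // /fg.
Qed.

Lemma L2N f : L2 mu D f -> L2 mu D (fun x => - f x).
Proof.
by move=> /(L2Z (-1)); apply: L2_eq => x _; rewrite mulN1r.
Qed.

Lemma L2B f g : L2 mu D f -> L2 mu D g -> L2 mu D (fun x => f x - g x).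
Proof. by move=> Lf /L2N; exact: L2D. Qed.

Lemma L20 : L2 mu D (fun=> 0).
Proof.
apply/L2P; split; first exact: measurable_cst.
by apply: eq_integrable (integrable0 mu D) => // x _ /=; rewrite expr0n.
Qed.

(** The quadratic polynomial t |-> [nsq] of f - t g is non-negative. *)
Lemma cauchy_schwarz_L2 f g : L2 mu D f -> L2 mu D g ->
  (\int[mu]_(x in D) (f x * g x)) ^+ 2 <= nsq f * nsq g.
Proof.
move=> Lf Lg; set c := \int[mu]_(x in D) _.
have if2 := L2_sqr_integrable Lf; have ig2 := L2_sqr_integrable Lg.
have ifg := L2M_integrable Lf Lg.
have key t : 0 <= nsq f - 2 * t * c + t ^+ 2 * nsq g.
  suff -> : nsq f - 2 * t * c + t ^+ 2 * nsq g = nsq (fun x => f x + (- t) * g x).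
    exact: nsq_ge0.
  rewrite /nsq /c -!RintegralZl// -RintegralB//; last exact: integrableZ_EFin.
  rewrite -RintegralD//.
  - by apply: eq_Rintegral => x _; ring.
  - exact: (integrableB_EFin if2 (integrableZ_EFin _ ifg)).
  - exact: integrableZ_EFin.
have f0 := nsq_ge0 f; have g0 := nsq_ge0 g.
have [gz|gn] := eqVneq (nsq g) 0.
  rewrite gz mulr0; have [->|cn] := eqVneq c 0; first by rewrite expr0n.
  (* With no quadratic term left, this t gives the polynomial the value -1. *)
  have := key ((nsq f + 1) / (2 * c)); rewrite gz mulr0 addr0.
  have -> : 2 * ((nsq f + 1) / (2 * c)) * c = nsq f + 1 by field.
  lra.
(* The minimum of the polynomial. *)
have := key (c / nsq g).
have -> : nsq f - 2 * (c / nsq g) * c + (c / nsq g) ^+ 2 * nsq g =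
  nsq f - c ^+ 2 / nsq g by field.
by rewrite subr_ge0 ler_pdivrMr// lt0r gn.
Qed.

Lemma nsqZ k f : L2 mu D f -> nsq (fun x => k * f x) = k ^+ 2 * nsq f.
Proof.
move=> /L2_sqr_integrable if2; rewrite /nsq -RintegralZl//.
by apply: eq_Rintegral => x _; rewrite exprMn.
Qed.

(** Norms are kept squared to avoid roots. The triangle inequality then takes this form, which
    follows from (f - g)^2 >= 0; the factor 2 returns in the field [nq_lc]. *)
Lemma nsqD_le f g : L2 mu D f -> L2 mu D g ->
  nsq (fun x => f x + g x) <= 2 * (nsq f + nsq g).
Proof.
move=> Lf Lg; rewrite mulrDr /nsq -!RintegralZl//; try exact: L2_sqr_integrable.
rewrite -RintegralD//; try by apply: integrableZ_EFin => //; exact: L2_sqr_integrable.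
apply: le_Rintegral => //.
- exact: L2_sqr_integrable (L2D Lf Lg).
- by apply: integrableD_EFin => //; apply: integrableZ_EFin => //; exact: L2_sqr_integrable.
- by move=> x _ /=; have := sqr_ge0 (f x - g x); nra.
Qed.

Lemma ae_eq_Rintegral f g : measurable_fun D f -> measurable_fun D g ->
  f = g %[ae mu in D] -> \int[mu]_(x in D) f x = \int[mu]_(x in D) g x.
Proof.
move=> mf mg fg; congr fine; apply: ae_eq_integral => //.
- exact/measurable_EFinP.
- exact/measurable_EFinP.
- by apply: filterS fg => x fgx Dx; rewrite fgx.
Qed.

Lemma nsq_ae f g : measurable_fun D f -> measurable_fun D g ->
  f = g %[ae mu in D] -> nsq f = nsq g.
Proof.
move=> mf mg fg; apply: ae_eq_Rintegral; try exact: measurable_funX.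
by apply: filterS fg => x fgx Dx; rewrite fgx.
Qed.

Lemma nsq_eq0 f : L2 mu D f -> nsq f = 0 -> f = (fun=> 0) %[ae mu in D].
Proof.
move=> Lf f0; have if2 := L2_sqr_integrable Lf.
have mf := L2_measurable Lf.
pose h : T -> \bar R := fun x => (f x ^+ 2)%:E.
have mh : measurable_fun D h by apply/measurable_EFinP; exact: measurable_funX.
have /(ae_eq_integral_abs mu mD mh) : (\int[mu]_(x in D) `|h x| = 0)%E.
  transitivity (\int[mu]_(x in D) h x)%E.
    by apply: eq_integral => x _; rewrite /h /= ger0_norm ?sqr_ge0.
  by rewrite -[LHS]fineK; [rewrite -[fine _]/(nsq f) f0|exact: integrable_fin_num if2].
apply: filterS => x /= hx Dx; have := hx Dx.
by rewrite /h => -[] /eqP; rewrite sqrf_eq0 => /eqP.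
Qed.

(** The common source of the bounds for integral operators: a pointwise bound of a square by an
    integrable function yields membership in L2 and the norm estimate at once. *)
Lemma L2_le_integrable (H h : T -> R) : measurable_fun D H ->
  mu.-integrable D (EFin \o h) ->
  {ae mu, forall x, D x -> (H x) ^+ 2 <= h x} ->
  L2 mu D H /\ nsq H <= \int[mu]_(x in D) h x.
Proof.
move=> mH ih Hh.
have mH2 : measurable_fun D (EFin \o (fun x => H x ^+ 2)).
  by apply/measurable_EFinP; exact: measurable_funX.
have mh := measurable_int _ ih.
have le1 : (\int[mu]_(x in D) (EFin \o (fun x => (H x ^+ 2)%R)) x <=
   \int[mu]_(x in D) `|(EFin \o h) x|)%E.
  apply: ae_ge0_le_integral => //.
  - by move=> x _ /=; rewrite lee_fin sqr_ge0.
  - exact: measurableT_comp.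
  - apply: filterS Hh => x + Dx => /(_ Dx) Hx.
    by rewrite /= lee_fin (le_trans Hx)// ler_norm.
have iH2 : mu.-integrable D (EFin \o (fun x => H x ^+ 2)).
  apply/integrableP; split => //.
  under eq_integral do rewrite /= ger0_norm ?sqr_ge0//.
  by apply: le_lt_trans le1 _; case/integrableP : ih.
split; first by apply/L2P.
rewrite /nsq /Rintegral; apply: fine_le.
- exact: integrable_fin_num iH2.
- exact: integrable_fin_num ih.
- apply: (le_trans le1); rewrite le_eqVlt; apply/orP; left; apply/eqP.
  apply: ae_eq_integral => //; first exact: measurableT_comp.
  apply: filterS Hh => x + Dx => /(_ Dx) Hx /=.
  by rewrite ger0_norm// (le_trans _ Hx)// sqr_ge0.
Qed.

Hypothesis Dfin : (mu D < +oo)%E.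

Lemma integrable_cst_EFin k : itg (fun=> k).
Proof.
apply/integrableP; split; first exact/measurable_EFinP/measurable_cst.
under eq_integral do rewrite /=.
rewrite integral_cst//= lte_mul_pinfty//.
Qed.

Lemma L2_cst k : L2 mu D (fun=> k).
Proof.
apply/L2P; split; first exact: measurable_cst.
exact: integrable_cst_EFin.
Qed.

Lemma L2_integrable f : L2 mu D f -> mu.-integrable D (EFin \o f).
Proof.
move=> Lf; have := L2M_integrable Lf (L2_cst 1).
by apply: eq_integrable => // x _ /=; rewrite mulr1.
Qed.

Lemma L2_norm f : L2 mu D f -> L2 mu D (fun x => `|f x|).
Proof.
move=> /L2P[mf if2]; apply/L2P; split; first exact: measurableT_comp.
by apply: eq_integrable if2 => // x _ /=; rewrite -normrX ger0_norm ?sqr_ge0.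
Qed.

Lemma L2_bounded f M : measurable_fun D f -> (forall x, D x -> `|f x| <= M) ->
  L2 mu D f.
Proof.
move=> mf fM; apply/L2P; split => //.
apply: (@le_integrable _ _ _ mu D mD _ (cst (M ^+ 2)%:E)).
- by apply/measurable_EFinP; exact: measurable_funX.
- move=> x Dx /=; rewrite lee_fin normrX.
  have Mx := fM _ Dx; have M0 := le_trans (normr_ge0 _) Mx.
  rewrite (ger0_norm (sqr_ge0 M)).
  by rewrite ler_sqr ?nnegrE.
- exact: integrable_cst_EFin.
Qed.

Lemma L2M_bounded (h : T -> R) (M : R) f : measurable_fun D h -> (forall x, D x -> `|h x| <= M) ->
  L2 mu D f -> L2 mu D (fun x => h x * f x).
Proof.
move=> mh hM /L2P[mf if2]; apply/L2P; split; first exact: measurable_funM.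
apply: (@le_integrable _ _ _ mu D mD _ (EFin \o (fun x => M ^+ 2 * f x ^+ 2))).
- by apply/measurable_EFinP; apply: measurable_funX; exact: measurable_funM.
- move=> x Dx /=; rewrite lee_fin exprMn !(ger0_norm (mulr_ge0 _ _)) ?sqr_ge0//.
  rewrite ler_wpM2r ?sqr_ge0//.
  have Mx := hM _ Dx; have M0 := le_trans (normr_ge0 _) Mx.
  by rewrite -(real_normK (num_real (h x))) ler_sqr ?nnegrE.
- exact: integrableZ_EFin.
Qed.

Lemma sqr_Rintegral_le f : L2 mu D f ->
  (\int[mu]_(x in D) f x) ^+ 2 <= fine (mu D) * nsq f.
Proof.
move=> Lf; have := cauchy_schwarz_L2 (L2_cst 1) Lf.
rewrite [X in X * _](_ : _ = fine (mu D)); last first.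
  by rewrite /nsq Rintegral_cst// expr1n mul1r.
by under eq_Rintegral do rewrite mul1r.
Qed.

End L2theory.

Lemma ae_forall_ord (dp : measure_display) (T : measurableType dp) (R : realType)
    (mu : {measure set T -> \bar R}) n (P : 'I_n -> T -> Prop) :
  (forall i, {ae mu, forall x, P i x}) -> {ae mu, forall x, forall i, P i x}.
Proof.
move=> hP.
(* Indexing by all natural numbers allows the countable intersection lemma; for m >= n the condition
   is vacuous. *)
have h : forall m : nat, {ae mu, forall x, forall j : 'I_n, nat_of_ord j = m -> P j x}.
  move=> m; have [mn|nm] := ltnP m n; last first.
    by apply: aeW => x j jm; move: (ltn_ord j); rewrite jm ltnNge nm.
  apply: filterS (hP (Ordinal mn)) => x h j jm.
  by have -> : j = Ordinal mn by exact: val_inj.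
by apply: filterS (ae_foralln h) => x hx j; exact: hx.
Qed.

(** * Fubini's theorem on products of measurable sets *)

Section product_integrals.
Context (R : realType) (d1 d2 : measure_display)
  (T1 : measurableType d1) (T2 : measurableType d2).
Variables (m1 : {sigma_finite_measure set T1 -> \bar R})
  (m2 : {sigma_finite_measure set T2 -> \bar R}) (D1 : set T1) (D2 : set T2).
Hypotheses (mD1 : measurable D1) (mD2 : measurable D2).
Implicit Types K : T1 * T2 -> R.

Let D := D1 `*` D2.
Let mD : measurable D. Proof. exact: measurableX. Qed.
Let mm : {measure set (T1 * T2) -> \bar R} := (m1 \x m2)%E.

Lemma patch_section1 K x : D1 x ->
  (fun y => (K \_ D) (x, y)) = (fun y => K (x, y)) \_ D2.
Proof.
move=> D1x; apply/funext => y; rewrite !patchE; congr (if _ then _ else _).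
by apply/idP/idP; rewrite !inE => // -[].
Qed.

Lemma measurable_section1 K x : measurable_fun D K -> D1 x ->
  measurable_fun D2 (fun y => K (x, y)).
Proof.
move=> mK D1x; apply/(measurable_restrictT _ mD2).2.
rewrite -patch_section1//.
have mKD := (measurable_restrictT K mD).1 mK.
exact: (measurableT_comp mKD (pair1_measurable x)).
Qed.

Lemma Rintegral_section1 K x : D1 x ->
  \int[m2]_(y in D2) K (x, y) = \int[m2]_y (K \_ D) (x, y).
Proof. by move=> D1x; rewrite Rintegral_mkcond -patch_section1. Qed.

(** Measurability of the inner integral is needed before any integrability is known. Tonelli,
    applied to the positive and negative parts, gives it for every measurable [K]. *)
Lemma measurable_Rintegral1 K : measurable_fun D K ->
  measurable_fun D1 (fun x => \int[m2]_(y in D2) K (x, y)).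
Proof.
move=> /(measurable_restrictT _ mD) mK.
suff : measurable_fun D1 (fun x => \int[m2]_y (K \_ D) (x, y)).
  apply: eq_measurable_fun => x /[!inE] D1x; by rewrite Rintegral_section1.
apply: measurable_funTS; apply: measurableT_comp => //.
pose Ke : T1 * T2 -> \bar R := fun z => ((K \_ D) z)%:E.
have mKe : measurable_fun [set: T1 * T2] Ke by exact/measurable_EFinP.
have -> : (fun x => (\int[m2]_y ((K \_ D) (x, y))%:E)%E) =
  (fun x => ((\int[m2]_y (Ke^\+ (x, y)))%E - (\int[m2]_y (Ke^\- (x, y)))%E)%E).
  apply/funext => x; rewrite integralE.
  by congr (_ - _)%E; apply: eq_integral => y _; rewrite ?funeposE ?funenegE.
apply: emeasurable_funB.
- apply: (measurable_fun_fubini_tonelli_F (m2 := m2) (Ke^\+)%E) => //.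
  exact: measurable_funepos.
- apply: (measurable_fun_fubini_tonelli_F (m2 := m2) (Ke^\-)%E) => //.
  exact: measurable_funeneg.
Qed.

Lemma fubini_ae_integrable1 K : mm.-integrable D (EFin \o K) ->
  {ae m1, forall x, D1 x -> m2.-integrable D2 (EFin \o (fun y => K (x, y)))}.
Proof.
move=> /(integrable_mkcond _ mD); rewrite restrict_EFin => /ae_integrable1.
apply: filterS => x ix D1x; apply/(integrable_mkcond _ mD2).
by rewrite restrict_EFin -patch_section1.
Qed.

Let KE K x : D1 x -> (\int[m2]_(y in D2) (K (x, y))%:E =
  \int[m2]_y ((K \_ D) (x, y))%:E)%E.
Proof.
move=> D1x; rewrite integral_mkcond; apply: eq_integral => y _.
by rewrite restrict_EFin -patch_section1.
Qed.

(** The real inner integral is [fine] of the extended one. The two agree where the section is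
    integrable, which is almost everywhere; the same remark drives [fubini_Rintegral1]. *)
Lemma fubini_integrable1 K : mm.-integrable D (EFin \o K) ->
  m1.-integrable D1 (EFin \o (fun x => \int[m2]_(y in D2) K (x, y))).
Proof.
move=> iK; have ae1 := fubini_ae_integrable1 iK.
move: iK => /[dup] /measurable_int/measurable_EFinP/measurable_Rintegral1 mF.
move=> /(integrable_mkcond _ mD); rewrite restrict_EFin => /integrable_fubini_F.
move/(integrableS measurableT mD1 (@subsetT _ _)) => /integrableP[mF' iF].
apply/integrableP; split; first exact/measurable_EFinP.
apply: le_lt_trans iF; rewrite le_eqVlt; apply/orP; left; apply/eqP.
apply: ae_eq_integral => //.
- by apply: measurableT_comp => //; exact/measurable_EFinP.
- exact: measurableT_comp.
- apply: filterS ae1 => x h D1x /=.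
  rewrite /fubini_F -(KE K D1x) /Rintegral.
  have : (\int[m2]_(y in D2) (K (x, y))%:E)%E \is a fin_num.
    exact: integrable_fin_num (h D1x).
  by move=> hf; rewrite -{2}(fineK hf).
Qed.

Lemma fubini_Rintegral1 K : mm.-integrable D (EFin \o K) ->
  \int[mm]_(z in D) K z = \int[m1]_(x in D1) \int[m2]_(y in D2) K (x, y).
Proof.
move=> iK; have ae1 := fubini_ae_integrable1 iK.
have := fubini_integrable1 iK => /measurable_int mF.
move: iK => /(integrable_mkcond _ mD); rewrite restrict_EFin => iK.
rewrite Rintegral_mkcond /Rintegral -(integral12_prod_meas1 iK).
congr fine; rewrite [RHS]integral_mkcond; apply: ae_eq_integral => //.
- exact: measurable_fubini_F iK.
- exact/(measurable_restrictT _ _).1.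
- apply: filterS ae1 => x h _; rewrite patchE; case: ifPn => [/[!inE] D1x|].
    rewrite /fubini_F -KE// fineK//; exact: integrable_fin_num (h D1x).
  rewrite notin_setE => D1x; rewrite /fubini_F.
  apply: integral0_eq => y _ /=; rewrite patchE ifF//.
  by apply/negP; rewrite inE => -[].
Qed.

End product_integrals.

Definition swapp (A B : Type) (z : A * B) : B * A := (z.2, z.1).

(** * Exchange of the two variables *)

Section swap_integrals.
Context (R : realType) (d1 d2 : measure_display)
  (T1 : measurableType d1) (T2 : measurableType d2).
Variables (m1 : {sigma_finite_measure set T1 -> \bar R})
  (m2 : {sigma_finite_measure set T2 -> \bar R}) (D1 : set T1) (D2 : set T2).
Hypotheses (mD1 : measurable D1) (mD2 : measurable D2).
Implicit Types K : T1 * T2 -> R.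

Let mD : measurable (D1 `*` D2). Proof. exact: measurableX. Qed.
Let mD' : measurable (D2 `*` D1). Proof. exact: measurableX. Qed.
Let m12 : {measure set (T1 * T2) -> \bar R} := (m1 \x m2)%E.
Let m21 : {measure set (T2 * T1) -> \bar R} := (m2 \x m1)%E.

Lemma patch_swap K : (K \o @swapp T2 T1) \_ (D2 `*` D1) =
  (K \_ (D1 `*` D2)) \o @swapp T2 T1.
Proof.
apply/funext => -[y x] /=; rewrite !patchE /= /swapp /=; congr (if _ then _ else _).
by apply/idP/idP; rewrite !inE => -[].
Qed.

Lemma measurable_swapp : measurable_fun [set: T2 * T1] (@swapp T2 T1).
Proof. exact: measurable_swap. Qed.

Lemma measurable_fun_swap K : measurable_fun (D1 `*` D2) K ->
  measurable_fun (D2 `*` D1) (K \o @swapp T2 T1).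
Proof.
move=> mK; apply: (measurable_restrictT _ mD').2; rewrite patch_swap.
have mKD := (measurable_restrictT K mD).1 mK.
exact: (measurableT_comp mKD measurable_swapp).
Qed.

Lemma integrable_swap K : m12.-integrable (D1 `*` D2) (EFin \o K) ->
  m21.-integrable (D2 `*` D1) (EFin \o (K \o @swapp T2 T1)).
Proof.
move=> /(integrable_mkcond _ mD); rewrite restrict_EFin => iK.
apply/(integrable_mkcond _ mD'); rewrite restrict_EFin patch_swap.
have mK := measurable_int _ iK.
apply: (integrable12ltyP m2 m1 _).2.
  exact: (measurableT_comp mK measurable_swapp).
exact: (integrable21ltyP m1 m2 mK).1 iK.
Qed.

Lemma Rintegral_swap K : m12.-integrable (D1 `*` D2) (EFin \o K) ->
  \int[m21]_(z in D2 `*` D1) K (swapp z) = \int[m12]_(z in D1 `*` D2) K z.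
Proof.
move=> iK; have iK' := integrable_swap iK.
move: iK' => /(integrable_mkcond _ mD'); rewrite restrict_EFin patch_swap => iK'.
move: iK => /(integrable_mkcond _ mD); rewrite restrict_EFin => iK.
rewrite [LHS]Rintegral_mkcond [RHS]Rintegral_mkcond.
rewrite -/(K \o @swapp T2 T1) patch_swap /Rintegral.
by rewrite -(integral12_prod_meas1 iK') -(integral21_prod_meas1 iK).
Qed.

Lemma ae_swap (P : T1 * T2 -> Prop) : {ae m12, forall z, (D1 `*` D2) z -> P z} ->
  {ae m21, forall z, (D2 `*` D1) z -> P (swapp z)}.
Proof.
case=> N [mN N0 PN]; exists (@swapp T2 T1 @^-1` N); split.
- rewrite -[X in measurable X]setTI; exact: measurable_swapp.
- rewrite /m21 /product_measure1.
  (* By uniqueness of the product measure, the measure of N may be computed from its sections in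
     either variable. *)
  transitivity ((m1 \x^ m2)%E N).
    apply: eq_integral => y _ /=.
    rewrite (_ : xsection _ _ = ysection N y)//.
  have <- := @product_measure_unique _ _ _ _ _ m1 m2 (m1 \x^ m2)%E _ N mN => //.
  exact: product_measure2E.
- by move=> -[y x] /= Pyx; apply: PN => /= Pxy; apply: Pyx => -[Dy Dx]; apply: Pxy.
Qed.

End swap_integrals.

(** * Null sets and L2 functions on a product *)

Section product_L2.
Context (R : realType) (d1 d2 : measure_display)
  (T1 : measurableType d1) (T2 : measurableType d2).
Variables (m1 : {sigma_finite_measure set T1 -> \bar R})
  (m2 : {sigma_finite_measure set T2 -> \bar R}) (D1 : set T1) (D2 : set T2).
Hypotheses (mD1 : measurable D1) (mD2 : measurable D2).
Implicit Types K : T1 * T2 -> R.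

Let mD : measurable (D1 `*` D2). Proof. exact: measurableX. Qed.
Let mm : {measure set (T1 * T2) -> \bar R} := (m1 \x m2)%E.

(** The measures of the sections of a null set integrate to zero, so almost all of them vanish. *)
Lemma ae_section1 (P : T1 * T2 -> Prop) :
  {ae mm, forall z, (D1 `*` D2) z -> P z} ->
  {ae m1, forall x, D1 x -> {ae m2, forall y, D2 y -> P (x, y)}}.
Proof.
case=> N [mN N0 PN].
have mf : measurable_fun [set: T1] (fun x => m2 (xsection N x)).
  exact: measurable_fun_xsection.
have : (\int[m1]_x `|m2 (xsection N x)| = 0)%E.
  by rewrite -[RHS]N0; apply: eq_integral => x _ /=; rewrite gee0_abs.
move/(ae_eq_integral_abs m1 measurableT mf).
apply: filterS => x /(_ I) h D1x; exists (xsection N x); split => //.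
  exact: measurable_xsection.
move=> y /= Py; rewrite /xsection /= inE; apply: PN => /= Pz; apply: Py => D2y.
exact: Pz.
Qed.

(** The converse of [ae_section1]. Measurability of f and g makes the exceptional set measurable, so
    that its measure is the integral of the measures of its sections. *)
Lemma ae_of_section1 (f g : T1 * T2 -> R) :
  measurable_fun (D1 `*` D2) f -> measurable_fun (D1 `*` D2) g ->
  {ae m1, forall x, D1 x -> {ae m2, forall y, D2 y -> f (x, y) = g (x, y)}} ->
  f = g %[ae mm in (D1 `*` D2)].
Proof.
move=> mf mg fg.
pose N := (D1 `*` D2) `&` (fun z => f z - g z) @^-1` [set~ 0].
have mN : measurable N.
  by apply: (measurable_funB mf mg) => //; apply: measurableC; exact: measurable_set1.
exists N; split => //.
  rewrite -[RHS](integral0 m1 [set: T1]); apply: ae_eq_integral => //.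
    exact: measurable_fun_xsection.
  apply: filterS fg => x h _ /=; apply/negligibleP; first exact: measurable_xsection.
  have [D1x|nD1x] := pselect (D1 x); last first.
    rewrite (_ : xsection N x = set0); first exact: negligible_set0.
    by apply/seteqP; split => // y; rewrite /xsection /= inE => -[[]].
  apply: negligibleS (h D1x) => y; rewrite /xsection /= inE => -[[_ D2y] fgN] /(_ D2y) fgE.
  by apply: fgN; rewrite /= fgE subrr.
move=> z /= nz; split; first by apply: contrapT => nD; apply: nz.
by move=> /= /eqP; rewrite subr_eq0 => /eqP fgz; apply: nz.
Qed.

Lemma L2_section1 K : L2 mm (D1 `*` D2) K ->
  {ae m1, forall x, D1 x -> L2 m2 D2 (fun y => K (x, y))}.
Proof.
move=> /(L2P _ mD)[mK iK]; have := fubini_ae_integrable1 mD1 mD2 iK.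
apply: filterS => x h D1x; apply/L2P => //; split; last exact: h.
exact: measurable_section1 mK D1x.
Qed.

Lemma nsq_fubini1 K : L2 mm (D1 `*` D2) K ->
  nsq mm (D1 `*` D2) K = \int[m1]_(x in D1) nsq m2 D2 (fun y => K (x, y)).
Proof. by move=> /(L2P _ mD)[mK iK]; rewrite /nsq (fubini_Rintegral1 mD1 mD2 iK). Qed.

Lemma nsq_integrable1 K : L2 mm (D1 `*` D2) K ->
  m1.-integrable D1 (EFin \o (fun x => nsq m2 D2 (fun y => K (x, y)))).
Proof. by move=> /(L2P _ mD)[mK iK]; exact: (fubini_integrable1 mD1 mD2 iK). Qed.

Hypotheses (fD1 : (m1 D1 < +oo)%E) (fD2 : (m2 D2 < +oo)%E).

Lemma product_finite : (mm (D1 `*` D2) < +oo)%E.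
Proof.
by rewrite /mm /= product_measure1E// lte_mul_pinfty// ge0_fin_numE.
Qed.

(** Cauchy-Schwarz against the constant 1 on almost every section, then integration over [D1]. *)
Lemma L2_fubini1 K : L2 mm (D1 `*` D2) K ->
  L2 m1 D1 (fun x => \int[m2]_(y in D2) K (x, y)) /\
  nsq m1 D1 (fun x => \int[m2]_(y in D2) K (x, y)) <=
    fine (m2 D2) * nsq mm (D1 `*` D2) K.
Proof.
move=> LK; rewrite nsq_fubini1// -RintegralZl//; last exact: nsq_integrable1.
apply: (L2_le_integrable mD1).
- exact: measurable_Rintegral1 (L2_measurable mD LK).
- apply: integrableZ_EFin => //; exact: nsq_integrable1.
- apply: filterS (L2_section1 LK) => x h D1x.
  exact: sqr_Rintegral_le (h D1x).
Qed.

Lemma measurable_fun_fst (g : T1 -> R) : measurable_fun D1 g ->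
  measurable_fun (D1 `*` D2) (fun z => g z.1).
Proof.
move=> mg; apply: (measurable_restrictT _ mD).2.
rewrite (_ : _ \_ _ = (fun z : T1 * T2 => (g \_ D1) z.1 * \1_D2 z.2)).
  apply: measurable_funM.
    apply: measurableT_comp => //; exact: (measurable_restrictT _ mD1).1.
  by apply: measurableT_comp.
apply/funext => -[x y]; rewrite !patchE indicE /=.
case: (boolP (x \in D1)) => xD; case: (boolP (y \in D2)) => yD; rewrite ?mulr1 ?mulr0 ?mul0r.
- by rewrite ifT// inE; split; [exact/set_mem|exact/set_mem].
- by rewrite ifF//; apply/negP; rewrite inE => -[_ /mem_set]; rewrite (negbTE yD).
- by rewrite ifF//; apply/negP; rewrite inE => -[/mem_set]; rewrite (negbTE xD).
- by rewrite ifF//; apply/negP; rewrite inE => -[/mem_set]; rewrite (negbTE xD).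
Qed.

Lemma measurable_fun_snd (g : T2 -> R) : measurable_fun D2 g ->
  measurable_fun (D1 `*` D2) (fun z => g z.2).
Proof.
move=> mg; apply: (measurable_restrictT _ mD).2.
rewrite (_ : _ \_ _ = (fun z : T1 * T2 => (g \_ D2) z.2 * \1_D1 z.1)).
  apply: measurable_funM.
    apply: measurableT_comp => //; exact: (measurable_restrictT _ mD2).1.
  by apply: measurableT_comp.
apply/funext => -[x y]; rewrite !patchE indicE /=.
case: (boolP (x \in D1)) => xD; case: (boolP (y \in D2)) => yD; rewrite ?mulr1 ?mulr0 ?mul0r.
- by rewrite ifT// inE; split; [exact/set_mem|exact/set_mem].
- by rewrite ifF//; apply/negP; rewrite inE => -[_ /mem_set]; rewrite (negbTE yD).
- by rewrite ifF//; apply/negP; rewrite inE => -[/mem_set]; rewrite (negbTE xD).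
- by rewrite ifF//; apply/negP; rewrite inE => -[/mem_set]; rewrite (negbTE xD).
Qed.

(** Tonelli's criterion. The inner integral is prescribed as an extended real, because a real-valued
    integral equals 0 when the extended one is infinite. *)
Lemma integrable_ge0_fubini1 (K : T1 * T2 -> R) (h : T1 -> R) :
  measurable_fun (D1 `*` D2) K -> (forall z, (D1 `*` D2) z -> 0 <= K z) ->
  m1.-integrable D1 (EFin \o h) ->
  (forall x, D1 x -> (\int[m2]_(y in D2) (K (x, y))%:E = (h x)%:E)%E) ->
  mm.-integrable (D1 `*` D2) (EFin \o K).
Proof.
move=> mK K0 ih Kh; have mKD := (measurable_restrictT K mD).1 mK.
apply: (integrable_mkcond _ mD).2; rewrite restrict_EFin.
apply: (integrable12ltyP m1 m2 _).2; first exact/measurable_EFinP.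
rewrite -ge0_fin_numE; last by apply: integral_ge0 => x _; exact: integral_ge0.
have := integrable_fin_num mD1 ih.
rewrite (_ : (\int[m1]_(x in D1) _)%E =
  (\int[m1]_x \int[m2]_y `|(EFin \o K \_ (D1 `*` D2)) (x, y)|)%E)//.
rewrite [LHS]integral_mkcond; apply: eq_integral => x _.
rewrite patchE; case: ifPn => [/set_mem D1x|/negP D1x].
  rewrite /= -Kh// [LHS]integral_mkcond; apply: eq_integral => y _ /=.
  rewrite !patchE /=; case: ifPn => [/set_mem D2y|/negP D2y].
    rewrite ifT ?inE//; congr EFin; rewrite ger0_norm//; exact: K0.
  by rewrite ifF ?normr0//; apply/negP => /set_mem[_ /mem_set].
rewrite integral0_eq// => y _ /=.
by rewrite patchE ifF ?normr0//; apply/negP => /set_mem[/mem_set].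
Qed.

Lemma L2_fst (g : T1 -> R) : L2 m1 D1 g ->
  L2 mm (D1 `*` D2) (fun z => g z.1) /\
  nsq mm (D1 `*` D2) (fun z => g z.1) = fine (m2 D2) * nsq m1 D1 g.
Proof.
move=> Lg; have [mg ig] := (L2P _ mD1 _).1 Lg.
have mg2 := measurable_fun_fst mg.
have E x : nsq m2 D2 (fun=> g x) = fine (m2 D2) * g x ^+ 2.
  by rewrite /nsq Rintegral_cst// mulrC.
have L : L2 mm (D1 `*` D2) (fun z => g z.1).
  apply/(L2P _ mD); split => //.
  apply: (@integrable_ge0_fubini1 _ (fun x => fine (m2 D2) * g x ^+ 2)).
  - exact: measurable_funX.
  - by move=> z _; exact: sqr_ge0.
  - exact: integrableZ_EFin.
  - move=> x D1x /=; rewrite integral_cst// muleC.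
    by rewrite [in RHS]EFinM fineK// ge0_fin_numE.
split => //; rewrite nsq_fubini1//= -[in RHS]RintegralZl//.
by apply: eq_Rintegral => x _; rewrite E.
Qed.

(** Cauchy-Schwarz on almost every section of the kernel. *)
Lemma hilbert_schmidt k (f : T2 -> R) : L2 mm (D1 `*` D2) k -> L2 m2 D2 f ->
  L2 m1 D1 (fun x => \int[m2]_(y in D2) (k (x, y) * f y)) /\
  nsq m1 D1 (fun x => \int[m2]_(y in D2) (k (x, y) * f y)) <=
    nsq mm (D1 `*` D2) k * nsq m2 D2 f.
Proof.
move=> Lk Lf; rewrite [X in _ <= X * _]nsq_fubini1// -RintegralZr//; last exact: nsq_integrable1.
apply: (L2_le_integrable mD1).
- apply: (@measurable_Rintegral1 _ _ _ _ _ m2 D1 D2 mD1 mD2 (fun z => k z * f z.2)).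
  apply: measurable_funM; first exact: L2_measurable Lk.
  exact: measurable_fun_snd (L2_measurable mD2 Lf).
- have := integrableZ_EFin mD1 (nsq m2 D2 f) (nsq_integrable1 Lk).
  by apply: eq_integrable => // x _ /=; rewrite mulrC.
- apply: filterS (L2_section1 Lk) => x h D1x.
  exact: cauchy_schwarz_L2 (h D1x) Lf.
Qed.

End product_L2.

Section product_more.
Context (R : realType) (d1 d2 : measure_display)
  (T1 : measurableType d1) (T2 : measurableType d2).
Variables (m1 : {sigma_finite_measure set T1 -> \bar R})
  (m2 : {sigma_finite_measure set T2 -> \bar R}) (D1 : set T1) (D2 : set T2).
Hypotheses (mD1 : measurable D1) (mD2 : measurable D2).

Let mD : measurable (D1 `*` D2). Proof. exact: measurableX. Qed.
Let mD' : measurable (D2 `*` D1). Proof. exact: measurableX. Qed.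
Let m12 : {measure set (T1 * T2) -> \bar R} := (m1 \x m2)%E.
Let m21 : {measure set (T2 * T1) -> \bar R} := (m2 \x m1)%E.

Lemma L2_swap (K : T1 * T2 -> R) : L2 m12 (D1 `*` D2) K ->
  L2 m21 (D2 `*` D1) (K \o @swapp T2 T1) /\
  nsq m21 (D2 `*` D1) (K \o @swapp T2 T1) = nsq m12 (D1 `*` D2) K.
Proof.
move=> /(L2P _ mD)[mK iK]; have iK' := integrable_swap mD1 mD2 iK; split.
  by apply/(L2P _ mD'); split => //; exact: measurable_fun_swap.
by rewrite /nsq -(Rintegral_swap mD1 mD2 iK).
Qed.

Lemma ae_fst (P : T1 -> Prop) : {ae m1, forall x, P x} ->
  {ae m12, forall z, P z.1}.
Proof.
case=> N [mN N0 PN]; exists (N `*` setT); split.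
- exact: measurableX.
- by rewrite /m12 /= product_measure1E//= N0 mul0e.
- by move=> z /= Pz; split => //; exact: PN.
Qed.

Lemma ae_snd (P : T2 -> Prop) : {ae m2, forall y, P y} ->
  {ae m12, forall z, P z.2}.
Proof.
case=> N [mN N0 PN]; exists (setT `*` N); split.
- exact: measurableX.
- by rewrite /m12 /= product_measure1E//= N0 mule0.
- by move=> z /= Pz; split => //; exact: PN.
Qed.

Lemma integrable_fst (g : T1 -> R) : (m2 D2 < +oo)%E ->
  m1.-integrable D1 (EFin \o g) ->
  m12.-integrable (D1 `*` D2) (EFin \o (fun z => g z.1)).
Proof.
move=> fD2 ig; have mg := measurable_fun_fst mD1 mD2 ((measurable_EFinP _ _).1 (measurable_int _ ig)).
suff : m12.-integrable (D1 `*` D2) (EFin \o (fun z => `|g z.1|)).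
  move=> h; apply: (le_integrable mD _ _ h); first exact/measurable_EFinP.
  by move=> z _ /=; rewrite normr_id.
apply: (@integrable_ge0_fubini1 _ _ _ _ _ m1 m2 D1 D2 mD1 mD2 _ (fun x => fine (m2 D2) * `|g x|)).
- exact: measurableT_comp mg.
- by [].
- by apply: integrableZ_EFin => //; exact: integrable_norm.
- move=> x D1x /=; rewrite integral_cst// muleC.
  by rewrite [in RHS]EFinM fineK// ge0_fin_numE.
Qed.

End product_more.

Lemma integrable_snd (R : realType) (d1 d2 : measure_display)
  (T1 : measurableType d1) (T2 : measurableType d2)
  (m1 : {sigma_finite_measure set T1 -> \bar R})
  (m2 : {sigma_finite_measure set T2 -> \bar R}) (D1 : set T1) (D2 : set T2)
  (mD1 : measurable D1) (mD2 : measurable D2) (g : T2 -> R) : (m1 D1 < +oo)%E ->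
  m2.-integrable D2 (EFin \o g) ->
  (m1 \x m2)%E.-integrable (D1 `*` D2) (EFin \o (fun z => g z.2)).
Proof.
by move=> fD1 ig; have := integrable_swap mD2 mD1 (integrable_fst (m2 := m1) mD2 mD1 fD1 ig).
Qed.

#[global] Instance ae_leb1_filter (R : realType) :
  Filter (nbhs (almost_everywhere (leb1 R))).
Proof. exact: ae_filter_ringOfSetsType. Qed.

#[global] Instance ae_leb2_filter (R : realType) :
  Filter (nbhs (almost_everywhere (leb2 R))).
Proof. exact: ae_filter_ringOfSetsType. Qed.

(** * Partial primitives on the rectangle *)

Section rectangle.
Context (R : realType).
Implicit Types a b c d : R.

Definition Ix a (f : R * R -> R) (z : R * R) : R :=
  \int[leb1 R]_(th in `[a, z.1]) f (th, z.2).
Definition Iy c (f : R * R -> R) (z : R * R) : R :=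
  \int[leb1 R]_(v in `[c, z.2]) f (z.1, v).

Lemma leb1_itv_fin a b : (leb1 R `[a, b]%classic < +oo)%E.
Proof. by rewrite /leb1 /= lebesgue_measure_itv /=; case: ifPn => // _; rewrite -EFinB ltry. Qed.

Lemma leb1_itv a b : a <= b -> fine (leb1 R `[a, b]%classic) = b - a.
Proof.
rewrite /leb1 /= lebesgue_measure_itv /= lte_fin le_eqVlt => /predU1P[->|ab].
  by rewrite ltxx subrr.
by rewrite ab.
Qed.

Lemma measurable_cc a b : measurable (`[a, b]%classic : set (measurableTypeR R)).
Proof. exact: measurable_itv. Qed.

Lemma measurable_Om a b c d :
  measurable (Omega a b c d : set (measurableTypeR R * measurableTypeR R)).
Proof. by apply: measurableX; exact: measurable_cc. Qed.

Lemma leb2_Om_fin a b c d : (leb2 R (Omega a b c d) < +oo)%E.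
Proof.
apply: (@product_finite _ _ _ _ _ (@lebesgue_measure R) (@lebesgue_measure R)) => //;
  exact: leb1_itv_fin.
Qed.

Lemma Omswap a b c d (f : R * R -> R) :
  L2 (leb2 R) (Omega a b c d) f ->
  L2 (leb2 R) (Omega c d a b) (f \o @swapp R R) /\
  nsq (leb2 R) (Omega c d a b) (f \o @swapp R R) = nsq (leb2 R) (Omega a b c d) f.
Proof.
by apply: (@L2_swap _ _ _ _ _ (@lebesgue_measure R) (@lebesgue_measure R));
  exact: measurable_cc.
Qed.

Lemma Om_ae_swap a b c d (P : R * R -> Prop) :
  {ae leb2 R, forall z, Omega a b c d z -> P z} ->
  {ae leb2 R, forall z, Omega c d a b z -> P (swapp z)}.
Proof.
exact: (@ae_swap _ _ _ _ _ (@lebesgue_measure R) (@lebesgue_measure R)).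
Qed.

Lemma Om_section1 a b c d (f : R * R -> R) : L2 (leb2 R) (Omega a b c d) f ->
  {ae leb1 R, forall x, `[a, b]%classic x -> L2 (leb1 R) `[c, d] (fun y => f (x, y))}.
Proof.
by apply: (@L2_section1 _ _ _ _ _ (@lebesgue_measure R) (@lebesgue_measure R));
  exact: measurable_cc.
Qed.

Lemma Om_section2 a b c d (f : R * R -> R) : L2 (leb2 R) (Omega a b c d) f ->
  {ae leb1 R, forall y, `[c, d]%classic y -> L2 (leb1 R) `[a, b] (fun x => f (x, y))}.
Proof. by case/Omswap => /Om_section1. Qed.

Lemma Om_ae_section1 a b c d (P : R * R -> Prop) :
  {ae leb2 R, forall z, Omega a b c d z -> P z} ->
  {ae leb1 R, forall x, `[a, b]%classic x ->
     {ae leb1 R, forall y, `[c, d]%classic y -> P (x, y)}}.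
Proof.
exact: (@ae_section1 _ _ _ _ _ (@lebesgue_measure R) (@lebesgue_measure R)).
Qed.

Lemma Om_ae_section2 a b c d (P : R * R -> Prop) :
  {ae leb2 R, forall z, Omega a b c d z -> P z} ->
  {ae leb1 R, forall y, `[c, d]%classic y ->
     {ae leb1 R, forall x, `[a, b]%classic x -> P (x, y)}}.
Proof. by move/Om_ae_swap/Om_ae_section1. Qed.

Lemma Om_ae_fst a b c d (P : R -> Prop) :
  {ae leb1 R, forall x, `[a, b]%classic x -> P x} ->
  {ae leb2 R, forall z, Omega a b c d z -> P z.1}.
Proof.
move/(@ae_fst _ _ _ _ _ (@lebesgue_measure R) (@lebesgue_measure R)).
by apply: filterS => z h [/h].
Qed.

Lemma Om_ae_snd a b c d (P : R -> Prop) :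
  {ae leb1 R, forall x, `[c, d]%classic x -> P x} ->
  {ae leb2 R, forall z, Omega a b c d z -> P z.2}.
Proof.
move/(@ae_snd _ _ _ _ _ (@lebesgue_measure R) (@lebesgue_measure R)).
by apply: filterS => z h [_ /h].
Qed.

Lemma Om_ae_of_section1 a b c d (f g : R * R -> R) :
  measurable_fun (Omega a b c d) f -> measurable_fun (Omega a b c d) g ->
  {ae leb1 R, forall x, `[a, b]%classic x ->
     {ae leb1 R, forall y, `[c, d]%classic y -> f (x, y) = g (x, y)}} ->
  f = g %[ae leb2 R in Omega a b c d].
Proof.
by apply: (@ae_of_section1 _ _ _ _ _ (@lebesgue_measure R) (@lebesgue_measure R));
  exact: measurable_cc.
Qed.

Lemma Om_nsq2 a b c d (f : R * R -> R) : L2 (leb2 R) (Omega a b c d) f ->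
  (leb1 R).-integrable `[c, d]
    (EFin \o (fun y => nsq (leb1 R) `[a, b] (fun x => f (x, y)))) /\
  nsq (leb2 R) (Omega a b c d) f =
  \int[leb1 R]_(y in `[c, d]) nsq (leb1 R) `[a, b] (fun x => f (x, y)).
Proof.
case/Omswap => Lf <-.
split.
  have := @nsq_integrable1 _ _ _ _ _ (@lebesgue_measure R) (@lebesgue_measure R) _ _ _ _ _ Lf.
  by apply; exact: measurable_cc.
rewrite (@nsq_fubini1 _ _ _ _ _ (@lebesgue_measure R) (@lebesgue_measure R) _ _ _ _ _ Lf)//;
  exact: measurable_cc.
Qed.

Lemma itv_setI a b x : x <= b -> `[a, x]%classic = `[a, b]%classic `&` [set th | th <= x] :> set R.
Proof.
move=> xb; apply/seteqP; split => t /=; rewrite !in_itv /=.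
  by move=> /andP[-> tx]; rewrite tx (le_trans tx xb).
by move=> [/andP[-> _] ->].
Qed.

(** A variable upper bound becomes a factor of the integrand. Fubini and the Hilbert-Schmidt bound,
    stated on fixed sets, then apply to primitives and Volterra kernels. *)
Lemma Rintegral_itv_trunc a b x (f : R -> R) : x <= b ->
  \int[leb1 R]_(th in `[a, x]) f th =
  \int[leb1 R]_(th in `[a, b]) ((th <= x)%R%:R * f th).
Proof.
move=> xb; rewrite (itv_setI _ xb) Rintegral_mkcondr; apply: eq_Rintegral => t _.
rewrite patchE; have [tx|tx] := boolP (t <= x)%R; rewrite ?mul1r ?mul0r.
  by rewrite ifT// inE.
by rewrite ifF//; apply/negP; rewrite inE /=; exact/negP.
Qed.

Lemma measurable_Ix a b c d (f : R * R -> R) : measurable_fun (Omega a b c d) f ->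
  measurable_fun (Omega a b c d) (Ix a f).
Proof.
move=> mf; have mfO := (measurable_restrictT f (measurable_Om a b c d)).1 mf.
(* The integrand at ((x, y), th), with th <= x turned into a factor; integrating th out leaves a
   function jointly measurable in (x, y). *)
pose K : (R * R) * R -> R := fun w => (w.2 <= w.1.1)%R%:R * (f \_ (Omega a b c d)) (w.2, w.1.2).
have mK : measurable_fun [set: (measurableTypeR R * measurableTypeR R) * measurableTypeR R] K.
  apply: measurable_funM.
    pose S := [set w : (measurableTypeR R * measurableTypeR R) * measurableTypeR R | w.2 <= w.1.1].
    have mS : measurable S.
      have mle : measurable_fun [set: (measurableTypeR R * measurableTypeR R) * measurableTypeR R]
          (fun w => w.2 <= w.1.1).
        by apply: measurable_fun_ler => //; exact: measurableT_comp.
      have := mle measurableT [set true] I; rewrite setTI.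
      by congr measurable; apply/seteqP; split => w /=.
    have : measurable_fun [set: (measurableTypeR R * measurableTypeR R) * measurableTypeR R]
      (\1_S : _ -> R) by exact: measurable_indic.
    apply: eq_measurable_fun => w _; rewrite indicE; congr (nat_of_bool _)%:R.
    by apply/idP/idP; rewrite inE.
  have : measurable_fun [set: (measurableTypeR R * measurableTypeR R) * measurableTypeR R]
     (fun w : (measurableTypeR R * measurableTypeR R) * measurableTypeR R => (w.2, w.1.2)).
    by apply: measurable_fun_pair => //; exact: measurableT_comp.
  exact: measurableT_comp.
have := @measurable_Rintegral1 _ _ _ _ _ (@lebesgue_measure R) (Omega a b c d) `[a, b] (measurable_Om a b c d) (measurable_cc a b) K (measurable_funTS mK).
apply: eq_measurable_fun => -[x y] /set_mem[/= xab ycd].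
move: (xab); rewrite in_itv /= => /andP[ax xb].
rewrite /Ix /= (Rintegral_itv_trunc _ _ xb); apply: eq_Rintegral => th /set_mem /= thab.
by rewrite /K /= patchE mem_set.
Qed.

Lemma integrable_trunc a b x (f : R -> R) : x <= b ->
  (leb1 R).-integrable `[a, b] (EFin \o f) -> (leb1 R).-integrable `[a, x] (EFin \o f).
Proof.
move=> xb; apply: integrableS; try exact: measurable_cc.
by move=> t; rewrite /= !in_itv /= => /andP[-> tx] /=; exact: le_trans xb.
Qed.

Lemma L2_trunc a b x (f : R -> R) : x <= b ->
  L2 (leb1 R) `[a, b] f -> L2 (leb1 R) `[a, x] f.
Proof.
move=> xb /(L2P _ (measurable_cc a b))[mf if2].
apply/(L2P _ (measurable_cc a x)); split; last exact: integrable_trunc if2.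
apply: measurable_funS mf; first exact: measurable_cc.
by move=> t; rewrite /= !in_itv /= => /andP[-> tx] /=; exact: le_trans xb.
Qed.

Lemma L2_itv_integrable a b (f : R -> R) : L2 (leb1 R) `[a, b] f ->
  (leb1 R).-integrable `[a, b] (EFin \o f).
Proof. apply: L2_integrable; [exact: measurable_cc|exact: leb1_itv_fin]. Qed.

Lemma nsq_trunc a b x (f : R -> R) : x <= b -> L2 (leb1 R) `[a, b] f ->
  nsq (leb1 R) `[a, x] f <= nsq (leb1 R) `[a, b] f.
Proof.
move=> xb /(L2P _ (measurable_cc a b))[mf if2].
rewrite /nsq /Rintegral; apply: fine_le.
- by apply: integrable_fin_num (integrable_trunc xb if2); exact: measurable_cc.
- by apply: integrable_fin_num if2; exact: measurable_cc.
apply: ge0_subset_integral; try exact: measurable_cc.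
- exact: measurable_int if2.
- by move=> t _ /=; rewrite lee_fin sqr_ge0.
- by move=> t; rewrite /= !in_itv /= => /andP[-> tx] /=; exact: le_trans xb.
Qed.

Lemma Ix_sqr_le a b x y (f : R * R -> R) : a <= x <= b ->
  L2 (leb1 R) `[a, b] (fun th => f (th, y)) ->
  (Ix a f (x, y)) ^+ 2 <= (b - a) * nsq (leb1 R) `[a, b] (fun th => f (th, y)).
Proof.
move=> /andP[ax xb] Lf; have Lx := L2_trunc xb Lf.
apply: (le_trans (sqr_Rintegral_le (measurable_cc a x) (leb1_itv_fin a x) Lx)).
rewrite leb1_itv//; apply: ler_pM; rewrite ?subr_ge0 ?lerB ?nsq_ge0//.
exact: nsq_trunc.
Qed.

(** One factor b - a comes from Cauchy-Schwarz on [a, x], the other from integrating over x a bound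
    that depends on y alone. *)
Lemma Ix_L2 a b c d (f : R * R -> R) : a <= b -> L2 (leb2 R) (Omega a b c d) f ->
  L2 (leb2 R) (Omega a b c d) (Ix a f) /\
  nsq (leb2 R) (Omega a b c d) (Ix a f) <= (b - a) ^+ 2 * nsq (leb2 R) (Omega a b c d) f.
Proof.
move=> ab Lf; have [i2 n2] := Om_nsq2 Lf.
pose g y := nsq (leb1 R) `[a, b] (fun x => f (x, y)).
have ig : (leb2 R).-integrable (Omega a b c d) (EFin \o (fun z => (b - a) * g z.2)).
  apply: integrableZ_EFin; first exact: measurable_Om.
  apply: (@integrable_snd _ _ _ _ _ (@lebesgue_measure R) (@lebesgue_measure R)) => //.
  exact: leb1_itv_fin.
have Hae : {ae leb2 R, forall z, Omega a b c d z -> Ix a f z ^+ 2 <= (b - a) * g z.2}.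
  have := Om_ae_snd a b (Om_section2 Lf).
  apply: filterS => z h Oz; rewrite [in Ix _ _ _](surjective_pairing z).
  apply: Ix_sqr_le; last exact: h.
  by case: Oz; rewrite /= in_itv.
have [LI le1] := L2_le_integrable (measurable_Om a b c d)
  (measurable_Ix (L2_measurable (measurable_Om a b c d) Lf)) ig Hae.
split => //; apply: (le_trans le1).
have := @fubini_Rintegral1 _ _ _ _ _ (@lebesgue_measure R) (@lebesgue_measure R)
  _ _ (measurable_cc a b) (measurable_cc c d) _ ig.
rewrite -/(leb2 R) -/(Omega a b c d) => -> /=.
rewrite (Rintegral_cst _ (measurable_cc a b)) (RintegralZl _ (measurable_cc c d) i2).
rewrite -/(leb1 R) leb1_itv// -n2.
by rewrite [leRHS](_ : _ = (b - a) * nsq (leb2 R) (Omega a b c d) f * (b - a))//; ring.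
Qed.

End rectangle.

(** * Identities for partial primitives and integration by parts *)

Section rectangle_integrals.
Context (R : realType).
Implicit Types a b c d x y : R.

Lemma itv_in a b x : a <= x <= b -> `[a, b]%classic x.
Proof. by rewrite /= in_itv. Qed.

Lemma Om_ae_slice2 a b c d (P : R * R -> Prop) :
  {ae leb1 R, forall y, `[c, d]%classic y -> forall x, `[a, b]%classic x -> P (x, y)} ->
  {ae leb2 R, forall z, Omega a b c d z -> P z}.
Proof.
move=> /(Om_ae_snd a b (P := fun y => forall x, `[a, b]%classic x -> P (x, y))).
by apply: filterS => -[x y] h [/= xab ycd]; exact: h.
Qed.

Lemma Om_ae_slice1 a b c d (P : R * R -> Prop) :
  {ae leb1 R, forall x, `[a, b]%classic x -> forall y, `[c, d]%classic y -> P (x, y)} ->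
  {ae leb2 R, forall z, Omega a b c d z -> P z}.
Proof.
move=> /(Om_ae_fst c d (P := fun x => forall y, `[c, d]%classic y -> P (x, y))).
by apply: filterS => -[x y] h [/= xab ycd]; exact: h.
Qed.

Lemma Om_measurable1 a b c d (f : R * R -> R) x :
  measurable_fun (Omega a b c d) f -> `[a, b]%classic x ->
  measurable_fun (`[c, d]%classic : set (measurableTypeR R)) (fun y => f (x, y)).
Proof.
by apply: measurable_section1; exact: measurable_cc.
Qed.

Lemma Om_measurable_swap a b c d (f : R * R -> R) :
  measurable_fun (Omega a b c d) f -> measurable_fun (Omega c d a b) (f \o @swapp R R).
Proof. by apply: measurable_fun_swap; exact: measurable_cc. Qed.

Lemma Om_measurable2 a b c d (f : R * R -> R) y :
  measurable_fun (Omega a b c d) f -> `[c, d]%classic y ->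
  measurable_fun (`[a, b]%classic : set (measurableTypeR R)) (fun x => f (x, y)).
Proof. by move=> /Om_measurable_swap; exact: Om_measurable1. Qed.

Lemma measurable_itv_trunc a b x (f : R -> R) : x <= b ->
  measurable_fun (`[a, b]%classic : set (measurableTypeR R)) f ->
  measurable_fun (`[a, x]%classic : set (measurableTypeR R)) f.
Proof.
move=> xb; apply: measurable_funS; first exact: measurable_cc.
by move=> t; rewrite /= !in_itv /= => /andP[-> tx] /=; exact: le_trans xb.
Qed.

(** Only values of y are discarded: once the slices of f and g at y are integrable, the identity
    holds at every x of [a, b]. *)
Lemma Ix_lin a b c d k (f g : R * R -> R) :
  L2 (leb2 R) (Omega a b c d) f -> L2 (leb2 R) (Omega a b c d) g ->
  {ae leb1 R, forall y, `[c, d]%classic y -> forall x, `[a, b]%classic x ->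
    Ix a (fun z => k * f z + g z) (x, y) = k * Ix a f (x, y) + Ix a g (x, y)}.
Proof.
move=> Lf Lg; apply: filterS2 (Om_section2 Lf) (Om_section2 Lg) => y hf hg ycd x.
rewrite /= in_itv /= => /andP[ax xb]; rewrite /Ix /=.
have jf := L2_itv_integrable (L2_trunc xb (hf ycd)).
have jg := L2_itv_integrable (L2_trunc xb (hg ycd)).
rewrite (RintegralD (measurable_cc a x) (integrableZ_EFin (measurable_cc a x) k jf) jg).
by rewrite (RintegralZl _ (measurable_cc a x) jf).
Qed.

Lemma Ix_cong a b c d (f g : R * R -> R) :
  measurable_fun (Omega a b c d) f -> measurable_fun (Omega a b c d) g ->
  f = g %[ae leb2 R in Omega a b c d] ->
  {ae leb1 R, forall y, `[c, d]%classic y -> forall x, `[a, b]%classic x ->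
    Ix a f (x, y) = Ix a g (x, y)}.
Proof.
move=> mf mg /Om_ae_section2; apply: filterS => y h ycd x.
rewrite /= in_itv /= => /andP[ax xb]; rewrite /Ix /=.
apply: ae_eq_Rintegral; first exact: measurable_cc.
- exact: (measurable_itv_trunc xb (Om_measurable2 mf ycd)).
- exact: (measurable_itv_trunc xb (Om_measurable2 mg ycd)).
apply: filterS (h ycd) => th hth /=; rewrite in_itv/= => /andP[ath thx].
by apply: hth; rewrite /= in_itv /= ath (le_trans thx xb).
Qed.

Lemma Iy_L2 a b c d (f : R * R -> R) : c <= d -> L2 (leb2 R) (Omega a b c d) f ->
  L2 (leb2 R) (Omega a b c d) (Iy c f) /\
  nsq (leb2 R) (Omega a b c d) (Iy c f) <= (d - c) ^+ 2 * nsq (leb2 R) (Omega a b c d) f.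
Proof.
move=> cd /Omswap[Lf <-]; have [L1 le1] := Ix_L2 cd Lf.
have [] := Omswap L1; rewrite (_ : _ \o _ = Iy c f); last by apply/funext => -[].
by move=> L2 ->.
Qed.

Lemma Iy_lin a b c d k (f g : R * R -> R) :
  L2 (leb2 R) (Omega a b c d) f -> L2 (leb2 R) (Omega a b c d) g ->
  {ae leb1 R, forall x, `[a, b]%classic x -> forall y, `[c, d]%classic y ->
    Iy c (fun z => k * f z + g z) (x, y) = k * Iy c f (x, y) + Iy c g (x, y)}.
Proof. by move=> /Omswap[Lf _] /Omswap[Lg _]; exact: (Ix_lin k Lf Lg). Qed.

Lemma Iy_cong a b c d (f g : R * R -> R) :
  measurable_fun (Omega a b c d) f -> measurable_fun (Omega a b c d) g ->
  f = g %[ae leb2 R in Omega a b c d] ->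
  {ae leb1 R, forall x, `[a, b]%classic x -> forall y, `[c, d]%classic y ->
    Iy c f (x, y) = Iy c g (x, y)}.
Proof.
move=> /Om_measurable_swap mf /Om_measurable_swap mg /Om_ae_swap h.
exact: (Ix_cong mf mg h).
Qed.

Lemma L2_Om_integrable a b c d (f : R * R -> R) : L2 (leb2 R) (Omega a b c d) f ->
  (leb2 R).-integrable (Omega a b c d) (EFin \o f).
Proof. apply: L2_integrable; [exact: measurable_Om|exact: leb2_Om_fin]. Qed.

Lemma Om_fubini1 a b c d (f : R * R -> R) :
  (leb2 R).-integrable (Omega a b c d) (EFin \o f) ->
  \int[leb2 R]_(z in Omega a b c d) f z =
  \int[leb1 R]_(x in `[a, b]) \int[leb1 R]_(y in `[c, d]) f (x, y).
Proof.
exact: (@fubini_Rintegral1 _ _ _ _ _ (@lebesgue_measure R) (@lebesgue_measure R)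
  _ _ (measurable_cc a b) (measurable_cc c d)).
Qed.

Lemma Om_fubini2 a b c d (f : R * R -> R) :
  (leb2 R).-integrable (Omega a b c d) (EFin \o f) ->
  \int[leb2 R]_(z in Omega a b c d) f z =
  \int[leb1 R]_(y in `[c, d]) \int[leb1 R]_(x in `[a, b]) f (x, y).
Proof.
move=> jf.
have jf' := @integrable_swap _ _ _ _ _ (@lebesgue_measure R) (@lebesgue_measure R)
  _ _ (measurable_cc a b) (measurable_cc c d) _ jf.
have E := @Rintegral_swap _ _ _ _ _ (@lebesgue_measure R) (@lebesgue_measure R)
  _ _ (measurable_cc a b) (measurable_cc c d) _ jf.
by rewrite -[LHS]E; exact: (Om_fubini1 jf').
Qed.

Lemma integrable_Om_trunc a b c d x y (f : R * R -> R) : Omega a b c d (x, y) ->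
  (leb2 R).-integrable (Omega a b c d) (EFin \o f) ->
  (leb2 R).-integrable (Omega a x c y) (EFin \o f).
Proof.
move=> [/= + +]; rewrite !in_itv /= => /andP[ax xb] /andP[cy yd].
apply: integrableS; try exact: measurable_Om.
move=> -[s t] [/=]; rewrite !in_itv /= => /andP[hs sx] /andP[ht ty].
by split; rewrite /= in_itv /= ?hs ?ht ?(le_trans sx xb) ?(le_trans ty yd).
Qed.

(** Both sides are the integral over [a, x] x [c, y], so the identity holds at every point of the
    rectangle and not just almost everywhere. *)
Lemma IxIy_comm a b c d (f : R * R -> R) z :
  (leb2 R).-integrable (Omega a b c d) (EFin \o f) -> Omega a b c d z ->
  Ix a (Iy c f) z = Iy c (Ix a f) z.
Proof.
case: z => x y jf Oz; have j := integrable_Om_trunc Oz jf.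
by rewrite /Ix /Iy /= -(Om_fubini1 j) (Om_fubini2 j).
Qed.

Lemma Rintegral_itv_truncl a b x (f : R -> R) : a <= x ->
  \int[leb1 R]_(th in `[x, b]) f th =
  \int[leb1 R]_(th in `[a, b]) ((x <= th)%R%:R * f th).
Proof.
move=> ax.
have -> : `[x, b]%classic = `[a, b]%classic `&` [set th | x <= th] :> set R.
  apply/seteqP; split => t /=; rewrite !in_itv /=.
    by move=> /andP[xt ->]; rewrite xt (le_trans ax xt).
  by move=> [/andP[_ ->] ->].
rewrite Rintegral_mkcondr; apply: eq_Rintegral => t _.
rewrite patchE; have [tx|tx] := boolP (x <= t)%R; rewrite ?mul1r ?mul0r.
  by rewrite ifT// inE.
by rewrite ifF//; apply/negP; rewrite inE /=; exact/negP.
Qed.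

Lemma measurable_le_ind a b c d :
  measurable_fun (Omega a b c d) (fun z : measurableTypeR R * measurableTypeR R => (z.2 <= z.1)%R%:R : R).
Proof.
pose S := [set z : measurableTypeR R * measurableTypeR R | z.2 <= z.1].
have mS : measurable S.
  have mle : measurable_fun [set: measurableTypeR R * measurableTypeR R]
      (fun z => z.2 <= z.1) by apply: measurable_fun_ler.
  have := mle measurableT [set true] I; rewrite setTI.
  by congr measurable; apply/seteqP; split => w /=.
apply: measurable_funTS.
have : measurable_fun [set: measurableTypeR R * measurableTypeR R]
  (\1_S : _ -> R) by exact: measurable_indic.
apply: eq_measurable_fun => w _; rewrite indicE; congr (nat_of_bool _)%:R.
by apply/idP/idP; rewrite inE.
Qed.

Lemma integrable_le_ind a b c d (h : R * R -> R) :
  (leb2 R).-integrable (Omega a b c d) (EFin \o h) ->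
  (leb2 R).-integrable (Omega a b c d) (EFin \o (fun z => (z.2 <= z.1)%R%:R * h z)).
Proof.
move=> jh; have /measurable_EFinP mh := measurable_int _ jh.
apply: (le_integrable (measurable_Om a b c d) _ _ jh).
  by apply/measurable_EFinP; apply: measurable_funM => //; exact: measurable_le_ind.
move=> z _ /=; rewrite lee_fin normrM; case: (z.2 <= z.1)%R; rewrite ?mulr1n ?mulr0n.
  by rewrite normr1 mul1r.
by rewrite normr0 mul0r.
Qed.

(** Fubini on the square for h times the indicator of the triangle th <= x. *)
Lemma fubini_triangle a b (h : R * R -> R) :
  (leb2 R).-integrable (Omega a b a b) (EFin \o h) ->
  (leb1 R).-integrable `[a, b]
    (EFin \o (fun x => \int[leb1 R]_(th in `[a, x]) h (x, th))) /\
  \int[leb1 R]_(x in `[a, b]) \int[leb1 R]_(th in `[a, x]) h (x, th) =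
  \int[leb1 R]_(th in `[a, b]) \int[leb1 R]_(x in `[th, b]) h (x, th).
Proof.
move=> /integrable_le_ind jk.
have E x : `[a, b]%classic x -> \int[leb1 R]_(th in `[a, x]) h (x, th) =
    \int[leb1 R]_(th in `[a, b]) ((th <= x)%R%:R * h (x, th)).
  by rewrite /= in_itv /= => /andP[_ xb]; exact: Rintegral_itv_trunc.
split.
  have := @fubini_integrable1 _ _ _ _ _ (@lebesgue_measure R) (@lebesgue_measure R)
    _ _ (measurable_cc a b) (measurable_cc a b) _ jk.
  by apply: eq_integrable; [exact: measurable_cc|move=> x /set_mem /= xab; rewrite /= E].
transitivity (\int[leb2 R]_(z in Omega a b a b) ((z.2 <= z.1)%R%:R * h z)).
  rewrite (Om_fubini1 jk); apply: eq_Rintegral => x /set_mem xab; exact: E.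
rewrite (Om_fubini2 jk); apply: eq_Rintegral => th /set_mem /=.
by rewrite in_itv /= => /andP[ath _]; rewrite -Rintegral_itv_truncl.
Qed.

Lemma C1_FTC a b (psi dpsi : R -> R) : a <= b -> continuous dpsi ->
  (forall x, is_derive x 1 psi (dpsi x)) ->
  \int[leb1 R]_(x in `[a, b]) dpsi x = psi b - psi a.
Proof.
move=> ab cd dp; move: ab; rewrite le_eqVlt => /predU1P[<-|ab].
  by rewrite set_itv1 Rintegral_set1 subrr.
have cpsi : continuous psi.
  by move=> x; apply: differentiable_continuous; apply/derivable1_diffP; have [] := dp x.
rewrite /Rintegral (@continuous_FTC2 R dpsi psi a b ab)//.
- exact: continuous_subspaceT.
- split.
  + by move=> x _; have [] := dp x.
  + by apply: cvg_at_right_filter; exact: cpsi.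
  + by apply: cvg_at_left_filter; exact: cpsi.
- by move=> x _; rewrite derive1E; have [_] := dp x.
Qed.

Lemma continuous_itv_bounded a b (g : R -> R) : continuous g ->
  exists M, forall x, a <= x <= b -> `|g x| <= M.
Proof.
move=> cg; have [ab|ba] := leP a b; last first.
  by exists 0 => x /andP[ax xb]; have := lt_le_trans ba (le_trans ax xb); rewrite ltxx.
have cn : {within `[a, b], continuous (fun x => `|g x|)}.
  apply: continuous_subspaceT => x; apply: continuous_comp; first exact: cg.
  exact: norm_continuous.
have [m mab hm] := EVT_max ab cn; exists `|g m| => x xab.
by apply: hm; rewrite in_itv.
Qed.

(** Write the primitive of f as an integral over th <= x and exchange the order on the triangle; the
    inner integral of [dpsi] over [th, b] is psi b - psi th. Here f need only be integrable. *)
Lemma Rintegral_by_parts a b (f psi dpsi : R -> R) : a <= b ->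
  (leb1 R).-integrable `[a, b] (EFin \o f) ->
  continuous dpsi -> (forall x, is_derive x 1 psi (dpsi x)) ->
  (leb1 R).-integrable `[a, b] (EFin \o (fun x => (\int[leb1 R]_(th in `[a, x]) f th) * dpsi x)) /\
  \int[leb1 R]_(x in `[a, b]) ((\int[leb1 R]_(th in `[a, x]) f th) * dpsi x) =
  \int[leb1 R]_(th in `[a, b]) (f th * (psi b - psi th)).
Proof.
move=> ab jf cd dp; have [M hM] := continuous_itv_bounded a b cd.
have mdp : measurable_fun [set: measurableTypeR R] dpsi by exact: continuous_measurable_fun.
have M0 : 0 <= M by apply: le_trans (hM a _); rewrite ?lexx.
(* Dominated by M |f|, with M a bound of the continuous [dpsi] on [a, b]. *)
have jh : (leb2 R).-integrable (Omega a b a b) (EFin \o (fun z => f z.2 * dpsi z.1)).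
  have j2 := @integrable_snd _ _ _ _ _ (@lebesgue_measure R) (@lebesgue_measure R) `[a, b] `[a, b]
    (measurable_cc a b) (measurable_cc a b) f (leb1_itv_fin a b) jf.
  have j3 := integrableZ_EFin (measurable_Om a b a b) M j2.
  apply: (le_integrable (measurable_Om a b a b) _ _ j3).
    apply/measurable_EFinP; apply: measurable_funM.
      have := measurable_int _ j2; exact: (measurable_EFinP _ _).1.
    by apply: measurable_funTS; exact: measurableT_comp.
  move=> [x y] [/=]; rewrite !in_itv /= => xab yab.
  by rewrite lee_fin mulrC !normrM ler_wpM2r// (le_trans (hM _ xab))// ler_norm.
have [j1 E] := fubini_triangle jh.
have E1 x : `[a, b]%classic x -> \int[leb1 R]_(th in `[a, x]) (f th * dpsi x) =
    (\int[leb1 R]_(th in `[a, x]) f th) * dpsi x.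
  rewrite /= in_itv /= => /andP[ax xb].
  by rewrite (RintegralZr _ (measurable_cc a x) (integrable_trunc xb jf)).
split.
  by apply: eq_integrable j1; [exact: measurable_cc|move=> x /set_mem /E1 /= ->].
transitivity (\int[leb1 R]_(x in `[a, b]) \int[leb1 R]_(th in `[a, x]) (f th * dpsi x)).
  by apply: eq_Rintegral => x /set_mem /E1.
rewrite E; apply: eq_Rintegral => th /set_mem /=; rewrite in_itv /= => /andP[ath thb].
have jd : (leb1 R).-integrable `[th, b] (EFin \o dpsi).
  apply: continuous_compact_integrable; first exact: segment_compact.
  exact: continuous_subspaceT.
by rewrite (RintegralZl _ (measurable_cc th b) jd) (C1_FTC thb cd dp).
Qed.

End rectangle_integrals.

(** * Test functions and weak derivatives *)

Section test_functions.
Context (R : realType).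
Implicit Types a b c d x y : R.

(** Relates the topology of the plane to the product sigma-algebra: an open set is the union of the
    rational boxes that it contains. *)
Lemma open_measurable2 (U : set (R * R)) : open U ->
  measurable (U : set (measurableTypeR R * measurableTypeR R)).
Proof.
move=> oU.
pose F (q : (rat * rat) * (rat * rat)) : set (R * R) :=
  `]ratr q.1.1, ratr q.1.2[ `*` `]ratr q.2.1, ratr q.2.2[.
(* Boxes not contained in U are made empty, so that the union runs over all quadruples of rationals,
   a countable type. *)
pose G q : set (R * R) := if `[< F q `<=` U >] then F q else set0.
have -> : U = \bigcup_q G q.
  apply/seteqP; split => [[x y] Uxy|z [q _]]; last first.
    by rewrite /G; case: asboolP => // + Fqz; exact.
  have [[A B] [/= Ax By] ABU] := oU _ Uxy.
  have [e /= e0 hA] := (nbhs_ballP _ _).1 Ax; have [e' /= e'0 hB] := (nbhs_ballP _ _).1 By.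
  have rat2 (u r : R) : 0 < r -> exists p q : rat,
      [/\ u - r < ratr p, ratr p < u, u < ratr q & ratr q < u + r].
    move=> r0; have [] := @rat_in_itvoo R (u - r) u; first by rewrite ltrBlDr ltrDl.
    move=> p; rewrite in_itv /= => /andP[? ?].
    have [] := @rat_in_itvoo R u (u + r); first by rewrite ltrDl.
    by move=> q; rewrite in_itv /= => /andP[? ?]; exists p, q.
  have [p [q [? ? ? ?]]] := rat2 x e e0; have [r [s [? ? ? ?]]] := rat2 y e' e'0.
  exists ((p, q), (r, s)) => //; rewrite /G; case: asboolP => [_|[]].
    by split; rewrite /= in_itv; apply/andP.
  move=> [s1 s2] [/=]; rewrite !in_itv /= => /andP[? ?] /andP[? ?].
  apply: ABU; split; [apply: hA|apply: hB]; rewrite /ball /= ltr_norml; lra.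
apply: countable_bigcupT_measurable => [|q]; first exact: countableP.
rewrite /G; case: asboolP => // _; apply: measurableX; exact: measurable_itv.
Qed.

Lemma continuous_measurable2 (f : R * R -> R) : continuous f ->
  measurable_fun [set: measurableTypeR R * measurableTypeR R] f.
Proof.
move=> cf; apply: (measurability _ (RGenOpens.measurableE R)).
move=> /= _ [_ [u [v ->]] <-]; rewrite setTI.
apply: open_measurable2.
by move/continuousP : cf; apply; exact: interval_open.
Qed.

Lemma continuous_Om_bounded a b c d (f : R * R -> R) : continuous f ->
  exists M, forall z, Omega a b c d z -> `|f z| <= M.
Proof.
move=> cf.
have cO : compact (Omega a b c d).
  by apply: compact_setX; exact: segment_compact.
have : compact (f @` Omega a b c d).
  apply: continuous_compact => //; exact: continuous_subspaceT.
move=> /compact_bounded [M [_ hM]]; exists (M + 1) => z Oz.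
by apply: (hM (M + 1)); [rewrite ltrDl|exists z].
Qed.

Lemma continuous_Om_L2 a b c d (f : R * R -> R) : continuous f ->
  L2 (leb2 R) (Omega a b c d) f.
Proof.
move=> cf; have [M hM] := continuous_Om_bounded a b c d cf.
apply: (L2_bounded (measurable_Om a b c d) (leb2_Om_fin a b c d) _ hM).
by apply: measurable_funTS; exact: continuous_measurable2.
Qed.

Lemma continuous_pairr (y : R) : continuous (fun x : R => (x, y)).
Proof.
move=> x; apply: (@cvg_pair _ _ _ (nbhs x) (nbhs x) (nbhs y) _ _ _ id (cst y)).
  exact: cvg_id.
exact: cvg_cst.
Qed.

Lemma continuous_swapp : continuous (@swapp R R).
Proof.
move=> [x y]; apply: (@cvg_pair _ _ _ (nbhs (x, y)) (nbhs y) (nbhs x) _ _ _ snd fst).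
  exact: cvg_snd.
exact: cvg_fst.
Qed.

Lemma continuous_comp_swapp (g : R * R -> R) : continuous g -> continuous (g \o @swapp R R).
Proof. by move=> cg z; apply: continuous_comp; [exact: continuous_swapp|exact: cg]. Qed.

(** What integration by parts in x uses of a test function and its x-derivative. Both the functions
    of [test_function] and tensor products of one-variable tests provide it. *)
Definition xtest a b (psi dpsi : R * R -> R) : Prop :=
  [/\ continuous psi, continuous dpsi,
     (forall x y, is_derive x 1 (fun s => psi (s, y)) (dpsi (x, y))) &
     forall y, psi (a, y) = 0 /\ psi (b, y) = 0].

Definition ytest c d (psi dpsi : R * R -> R) : Prop :=
  xtest c d (psi \o @swapp R R) (dpsi \o @swapp R R).

Lemma Om_Rintegral_ae2 a b c d (F G : R * R -> R) :
  (leb2 R).-integrable (Omega a b c d) (EFin \o F) ->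
  (leb2 R).-integrable (Omega a b c d) (EFin \o G) ->
  {ae leb1 R, forall y, `[c, d]%classic y ->
    \int[leb1 R]_(x in `[a, b]) F (x, y) = \int[leb1 R]_(x in `[a, b]) G (x, y)} ->
  \int[leb2 R]_(z in Omega a b c d) F z = \int[leb2 R]_(z in Omega a b c d) G z.
Proof.
move=> iF iG FG; rewrite (Om_fubini2 iF) (Om_fubini2 iG).
have m (H : R * R -> R) : (leb2 R).-integrable (Omega a b c d) (EFin \o H) ->
    measurable_fun (`[c, d]%classic : set (measurableTypeR R))
      (fun y => \int[leb1 R]_(x in `[a, b]) H (x, y)).
  move=> /measurable_int/measurable_EFinP/Om_measurable_swap mH.
  exact: (@measurable_Rintegral1 _ _ _ _ _ (@lebesgue_measure R) _ _
    (measurable_cc c d) (measurable_cc a b) _ mH).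
by apply: (ae_eq_Rintegral (measurable_cc c d)); [exact: m|exact: m|exact: FG].
Qed.

Lemma L2_Om_fst a b c d (g : R -> R) : L2 (leb1 R) `[a, b] g ->
  L2 (leb2 R) (Omega a b c d) (fun z => g z.1) /\
  nsq (leb2 R) (Omega a b c d) (fun z => g z.1) = fine (leb1 R `[c, d]%classic) * nsq (leb1 R) `[a, b] g.
Proof.
exact: (@L2_fst _ _ _ _ _ (@lebesgue_measure R) (@lebesgue_measure R)
  _ _ (measurable_cc a b) (measurable_cc c d) (leb1_itv_fin c d) g).
Qed.

Lemma L2_Om_snd a b c d (g : R -> R) : L2 (leb1 R) `[c, d] g ->
  L2 (leb2 R) (Omega a b c d) (fun z => g z.2) /\
  nsq (leb2 R) (Omega a b c d) (fun z => g z.2) = fine (leb1 R `[a, b]%classic) * nsq (leb1 R) `[c, d] g.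
Proof. by move=> /(L2_Om_fst a b)[/Omswap[L1 E1] <-]. Qed.

(** Integration by parts on almost every line y = const. Since psi vanishes at both ends, the term
    in [al] integrates to zero and psi b - psi th reduces to - psi th. *)
Lemma weak_Ix a b c d (al : R -> R) (f psi dpsi : R * R -> R) : a <= b ->
  L2 (leb1 R) `[c, d] al -> L2 (leb2 R) (Omega a b c d) f -> xtest a b psi dpsi ->
  \int[leb2 R]_(z in Omega a b c d) ((al z.2 + Ix a f z) * dpsi z) =
  - \int[leb2 R]_(z in Omega a b c d) (f z * psi z).
Proof.
move=> ab Lal Lf [cpsi cdpsi dpsiE psi0].
have mO := measurable_Om a b c d.
have LF : L2 (leb2 R) (Omega a b c d) (fun z => al z.2 + Ix a f z).
  apply: (L2D mO); first by case: (L2_Om_snd a b Lal).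
  by case: (Ix_L2 ab Lf).
have iF := L2M_integrable mO LF (continuous_Om_L2 a b c d cdpsi).
have iG := L2M_integrable mO Lf (continuous_Om_L2 a b c d cpsi).
rewrite -[RHS]mulN1r -(RintegralZl _ mO iG).
apply: (Om_Rintegral_ae2 iF (integrableZ_EFin mO (-1) iG)).
apply: filterS (Om_section2 Lf) => y hf ycd.
have jf := L2_itv_integrable (hf ycd).
have sec (g : R * R -> R) : continuous g -> continuous (fun x => g (x, y)).
  by move=> cg x; apply: (@continuous_comp _ _ _ (fun x => (x, y)) g); [exact: continuous_pairr|exact: cg].
have [j1 E1] := Rintegral_by_parts ab jf (sec _ cdpsi) (fun x => dpsiE x y).
have mab := measurable_cc a b.
have jd : (leb1 R).-integrable `[a, b] (EFin \o (fun x => dpsi (x, y))).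
  apply: continuous_compact_integrable; first exact: segment_compact.
  apply: continuous_subspaceT; exact: sec.
transitivity (\int[leb1 R]_(x in `[a, b]) (al y * dpsi (x, y) + Ix a f (x, y) * dpsi (x, y))).
  by apply: eq_Rintegral => x _ /=; rewrite mulrDl.
rewrite (RintegralD mab (integrableZ_EFin mab (al y) jd) j1).
rewrite (RintegralZl _ mab jd) (C1_FTC ab (sec _ cdpsi) (fun x => dpsiE x y)).
have [-> pb] := psi0 y; rewrite pb subr0 mulr0 add0r E1.
by apply: eq_Rintegral => x _ /=; rewrite pb sub0r mulrN mulN1r.
Qed.

Lemma weak_Iy a b c d (be : R -> R) (f psi dpsi : R * R -> R) : c <= d ->
  L2 (leb1 R) `[a, b] be -> L2 (leb2 R) (Omega a b c d) f -> ytest c d psi dpsi ->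
  \int[leb2 R]_(z in Omega a b c d) ((be z.1 + Iy c f z) * dpsi z) =
  - \int[leb2 R]_(z in Omega a b c d) (f z * psi z).
Proof.
move=> cd Lbe Lf t; have mO := measurable_Om a b c d.
have cK (g : R * R -> R) : continuous (g \o @swapp R R) -> continuous g.
  move=> cg; rewrite (_ : g = (g \o @swapp R R) \o @swapp R R); last by apply/funext => -[].
  exact: continuous_comp_swapp.
have LF : L2 (leb2 R) (Omega a b c d) (fun z => be z.1 + Iy c f z).
  apply: (L2D mO); first by case: (L2_Om_fst c d Lbe).
  by case: (Iy_L2 cd Lf).
have [cpsi cdpsi _ _] := t.
have iF := L2M_integrable mO LF (continuous_Om_L2 a b c d (cK _ cdpsi)).
have iG := L2M_integrable mO Lf (continuous_Om_L2 a b c d (cK _ cpsi)).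
have sw (g : R * R -> R) := @Rintegral_swap _ _ _ _ _ (@lebesgue_measure R) (@lebesgue_measure R)
  _ _ (measurable_cc a b) (measurable_cc c d) g.
rewrite -[LHS](sw _ iF) -[X in - X](sw _ iG).
have [Lf' _] := Omswap Lf.
exact: weak_Ix cd Lbe Lf' t.
Qed.

Lemma test_function_derive a b c d (phi : R * R -> R) v :
  test_function a b c d phi -> test_function a b c d ('D_v phi).
Proof.
move=> [sphi [K [cK Kab phi0]]]; split.
  by move=> vs z; have := sphi (rcons vs v) z; rewrite foldr_rcons.
exists K; split => // z Kz.
have cloK : closed K by apply: compact_closed => //; exact: norm_hausdorff.
(* The complement of K is open, so phi vanishes near each of its points and so does the derivative
   there. *)
have : \forall z' \near z, phi z' = cst 0 z'.
  have oK : open (~` K) by exact: closed_openC.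
  by apply: filterS (open_nbhs_nbhs (conj oK Kz)) => z' /phi0.
by move=> /(near_eq_derive v) ->; rewrite derive_cst.
Qed.

Lemma test_function_partial a b c d i j (phi : R * R -> R) :
  test_function a b c d phi -> test_function a b c d (partial_xy i j phi).
Proof.
move=> t; rewrite /partial_xy.
elim: i => [|i ih] /=; last exact: test_function_derive.
by elim: j => [|j ih] //=; exact: test_function_derive.
Qed.

Lemma test_function_continuous a b c d (phi : R * R -> R) :
  test_function a b c d phi -> continuous phi.
Proof. by move=> [sphi _] z; apply: differentiable_continuous; exact: (sphi [::]). Qed.

Lemma test_function_xtest a b c d (phi : R * R -> R) :
  test_function a b c d phi -> xtest a b phi ('D_((1, 0) : R * R) phi).
Proof.
move=> t; split.
- exact: test_function_continuous t.
- exact: test_function_continuous (test_function_derive (1, 0) t).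
- move=> x y; have [sphi _] := t.
  have := @derivableP R _ _ phi (x, y) (1, 0) (diff_derivable (sphi [::] (x, y))).
  have E : (fun h : R => h^-1 *: ((phi \o shift (x, y)) (h *: ((1, 0) : R * R)) - phi (x, y))) =
      (fun h : R => h^-1 *: (((fun s => phi (s, y)) \o shift x) (h *: 1) - phi (x, y))).
    apply/funext => h /=; rewrite /shift /=; congr (_ *: (phi _ - _)).
    by apply: injective_projections => /=; rewrite ?scaler0 ?add0r.
  move=> [dp de]; split.
    by rewrite /derivable -E.
  by rewrite /derive -E.
- have [_ [K [_ Kab phi0]]] := t.
  move=> y; split; apply: phi0 => /Kab[/=]; by rewrite in_itv /= ltxx ?andbF.
Qed.

Lemma test_function_ytest a b c d (phi : R * R -> R) :
  test_function a b c d phi -> ytest c d phi ('D_((0, 1) : R * R) phi).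
Proof.
move=> t.
split.
- apply: continuous_comp_swapp; exact: test_function_continuous t.
- apply: continuous_comp_swapp; exact: test_function_continuous (test_function_derive (0, 1) t).
- move=> y x; have [sphi _] := t.
  have := @derivableP R _ _ phi (x, y) (0, 1) (diff_derivable (sphi [::] (x, y))).
  have E : (fun h : R => h^-1 *: ((phi \o shift (x, y)) (h *: ((0, 1) : R * R)) - phi (x, y))) =
      (fun h : R => h^-1 *: (((fun s => phi (x, s)) \o shift y) (h *: 1) - phi (x, y))).
    apply/funext => h /=; rewrite /shift /=; congr (_ *: (phi _ - _)).
    by apply: injective_projections => /=; rewrite ?scaler0 ?add0r.
  move=> [dp de]; split.
    by rewrite /derivable /= -E.
  by rewrite /derive /= -E.
- have [_ [K [_ Kab phi0]]] := t.
  move=> y; split; apply: phi0 => /Kab[_ /=]; by rewrite in_itv /= ltxx ?andbF.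
Qed.

End test_functions.

(** * Smooth bumps approximating indicators of intervals *)

Section bumps.
Context (R : realType).
Implicit Types (a b c d p q s x y : R) (k n : nat).

(** The classical function exp(- 1 / x), with two parameters: the power k makes the family stable
    under differentiation, and as s tends to 0 the case k = 0 tends to the indicator of x > 0. *)
Definition flat k s x : R := if 0 < x then (x^-1) ^+ k * expR (- (s * x^-1)) else 0.

Lemma powexp_bound n s : 0 < s -> exists M, forall y, 0 <= y ->
  y ^+ n * expR (- (s * y)) <= M.
Proof.
(* For y > 1 the bound comes from u <= exp u at u = s y / (n + 1), raised to the power n + 1; the
   summand 1 covers y <= 1. *)
move=> s0; exists ((n.+1%:R / s) ^+ n.+1 + 1) => y y0.
have n0 : 0 < n.+1%:R :> R by [].
have h : (s * y / n.+1%:R) ^+ n.+1 <= expR (s * y).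
  have -> : expR (s * y) = expR (s * y / n.+1%:R) ^+ n.+1.
    by rewrite -expRM_natl; congr expR; field; rewrite gt_eqF.
  rewrite lerXn2r ?nnegrE ?expR_ge0//.
    by rewrite divr_ge0// mulr_ge0// ltW.
  by apply: le_trans (expR_ge1Dx _); rewrite lerDr.
have e0 := expR_gt0 (s * y).
rewrite expRN ler_pdivrMr//.
have [y1|y1] := leP y 1.
  have yn : y ^+ n <= 1 by rewrite exprn_ile1.
  have e1 : 1 <= expR (s * y).
    by apply: le_trans (expR_ge1Dx _); rewrite lerDl mulr_ge0// ltW.
  apply: (le_trans yn); apply: (le_trans e1); rewrite ler_peMl ?expR_ge0//.
  by rewrite lerDr exprn_ge0// divr_ge0// ltW.
have yn : y ^+ n <= y ^+ n.+1 by rewrite exprS ler_peMl ?exprn_ge0// ltW.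
apply: (le_trans yn).
have -> : y ^+ n.+1 = (n.+1%:R / s) ^+ n.+1 * (s * y / n.+1%:R) ^+ n.+1.
  by rewrite -exprMn; congr (_ ^+ _); field; rewrite !gt_eqF.
apply: (@le_trans _ _ ((n.+1%:R / s) ^+ n.+1 * expR (s * y))).
  by rewrite ler_wpM2l// exprn_ge0// divr_ge0// ltW.
by rewrite ler_wpM2r ?expR_ge0// lerDl.
Qed.

Lemma flat_le0 k s x : x <= 0 -> flat k s x = 0.
Proof. by move=> x0; rewrite /flat ltNge x0. Qed.

Lemma flat_derive k s x : 0 < s ->
  is_derive x 1 (flat k s) (- (k%:R * flat k.+1 s x) + s * flat k.+2 s x).
Proof.
move=> s0; have [x0|x0|x0] := ltgtP x 0.
- apply: (@near_eq_is_derive _ _ _ (cst 0)).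
    near=> z; rewrite flat_le0// ltW//.
    by near: z; exact: lt_nbhsl.
  rewrite !flat_le0 ?(ltW x0)// !mulr0 oppr0 addr0; exact: is_derive_cst.
- apply: (@near_eq_is_derive R R R (fun z : R => (z^-1) ^+ k * expR (- (s * z^-1)))).
    near=> z; rewrite /flat ifT//.
    by near: z; exact: lt_nbhsr.
  have xn0 : x != 0 by rewrite gt_eqF.
  have d1 : is_derive x 1 (fun z : R => z^-1) (- (x^-1 ^+ 2)).
    have := is_deriveV xn0 (is_derive_id x (1 : R)).
    by move/is_derive_eq; apply; rewrite /GRing.scale /= mulr1 exprVn.
  have d2 : is_derive x 1 (fun z : R => z^-1 ^+ k) (- (k%:R * x^-1 ^+ k.+1)).
    rewrite (_ : (fun z : R => z^-1 ^+ k) = (fun z : R => z^-1) ^+ k); last first.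
      by apply/funext => z; rewrite exprfctE.
    have /is_derive_eq := is_deriveX k d1; apply.
    rewrite /GRing.scale /= mulrN -mulrA; congr (- _).
    by case: k => [|k]; rewrite ?mul0r// -exprD addn2.
  have d3 : is_derive x 1 (fun z : R => - (s * z^-1)) (s * x^-1 ^+ 2).
    have /is_derive_eq := is_deriveN (is_deriveZ s d1); apply.
    by rewrite /GRing.scale /= mulrN opprK.
  have d4 := @is_derive1_comp R expR (fun z : R => - (s * z^-1)) x _ _ (is_derive_expR _) d3.
  have /is_derive_eq := is_deriveM d2 d4; apply.
  rewrite /flat x0 /GRing.scale /=; rewrite !exprS expr0; ring.
- rewrite x0 /flat !ltxx !mulr0 oppr0 addr0.
  (* For h > 0 the difference quotient at 0 is h times y^(k + 2) exp(- s y) with y = 1 / h, and the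
     second factor is bounded by [powexp_bound]. *)
  have [M hM] := powexp_bound k.+2 s0.
  have key : (fun h : R => h^-1 *: ((flat k s \o shift 0) (h *: 1) - flat k s 0)) @ 0^' --> (0 : R).
    apply/cvgr0Pnorm_lt => e e0.
    have M1 : 0 < `|M| + 1 by rewrite ltr_wpDl.
    near=> h.
    have hn0 : h != 0 by near: h; exact: nbhs_dnbhs_neq.
    rewrite /= /shift /= addr0 /GRing.scale /= mulr1 /flat ltxx subr0.
    case: ifPn => h0; last by rewrite mulr0 normr0.
    have := hM h^-1; rewrite invr_ge0 ltW// => /(_ isT) hb.
    have b0 : 0 <= h^-1 ^+ k * expR (- (s * h^-1)) by rewrite mulr_ge0 ?expR_ge0 ?exprn_ge0 ?invr_ge0// ltW.
    rewrite ger0_norm; last by rewrite mulr_ge0 ?invr_ge0// ltW.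
    have -> : h^-1 * (h^-1 ^+ k * expR (- (s * h^-1))) = h * (h^-1 ^+ k.+2 * expR (- (s * h^-1))).
      by rewrite !exprS; field.
    apply: (@le_lt_trans _ _ (h * (`|M| + 1))).
      rewrite ler_wpM2l ?(ltW h0)// (le_trans hb)// (le_trans (ler_norm _))//.
      by rewrite lerDl.
    rewrite -ltr_pdivlMr// -(gtr0_norm h0).
    by near: h; apply: dnbhs0_lt; rewrite divr_gt0.
  split; first by apply/cvg_ex; exists 0.
  exact: cvg_lim key.
Unshelve. all: by end_near. Qed.

Lemma flat_ge0 k s x : 0 <= flat k s x.
Proof.
rewrite /flat; case: ifPn => // x0.
by rewrite mulr_ge0 ?expR_ge0 ?exprn_ge0 ?invr_ge0// ltW.
Qed.

Lemma flat0_le1 s x : 0 < s -> flat 0 s x <= 1.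
Proof.
move=> s0; rewrite /flat; case: ifPn => // x0.
by rewrite expr0 mul1r -expR0 ler_expR oppr_le0 mulr_ge0 ?invr_ge0// ltW.
Qed.

(** A class containing the bumps and stable under differentiation, as [smooth1] asks; sums and
    constants enter through the derivative formulas. *)
Inductive flat_algebra : (R -> R) -> Prop :=
| FlatGen k s (sg p : R) : 0 < s -> flat_algebra (fun x => flat k s (sg * x + p))
| FlatCst c : flat_algebra (fun=> c)
| FlatAdd f g : flat_algebra f -> flat_algebra g -> flat_algebra (fun x => f x + g x)
| FlatMul f g : flat_algebra f -> flat_algebra g -> flat_algebra (fun x => f x * g x).

Definition derivative_of (f f' : R -> R) := forall x, is_derive x 1 f (f' x).

(** Smoothness as membership in some class stable under differentiation. No induction on the order
    of the derivative is then needed: a proof exhibits a class. *)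
Definition smooth1 (f : R -> R) := exists C : set (R -> R),
  C f /\ forall g, C g -> exists2 g', C g' & derivative_of g g'.

Lemma flat_algebra_derive f : flat_algebra f ->
  exists2 f', flat_algebra f' & derivative_of f f'.
Proof.
elim=> [k s sg p s0|c|{}f g Af [f' Af' df] Ag [g' Ag' dg]|{}f g Af [f' Af' df] Ag [g' Ag' dg]].
- exists (fun x => (- k%:R * flat k.+1 s (sg * x + p) + s * flat k.+2 s (sg * x + p)) * sg).
    by do ?[apply: FlatAdd|apply: FlatMul|exact: FlatGen|exact: FlatCst].
  move=> x.
  have d1 : is_derive x 1 (fun z : R => sg * z + p) sg.
    have /is_derive_eq := is_deriveD (is_deriveZ sg (is_derive_id x 1)) (is_derive_cst p x 1).
    by apply; rewrite addr0 /GRing.scale /= mulr1.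
  have /is_derive_eq := @is_derive1_comp R (flat k s) (fun z : R => sg * z + p) x _ _ (flat_derive k _ s0) d1.
  by apply; rewrite mulNr.
- by exists (fun=> 0); [exact: FlatCst|move=> x; exact: is_derive_cst].
- by exists (fun x => f' x + g' x); [exact: FlatAdd|move=> x; exact: is_deriveD].
- exists (fun x => f x * g' x + g x * f' x).
    by do ?[apply: FlatAdd|apply: FlatMul].
  by move=> x; exact: is_deriveM.
Qed.

Lemma flat_algebra_smooth f : flat_algebra f -> smooth1 f.
Proof. by move=> Af; exists flat_algebra; split => //; exact: flat_algebra_derive. Qed.

Definition test1 a b (f : R -> R) := smooth1 f /\
  exists p q, [/\ a < p, q < b & forall x, ~ (p <= x <= q) -> f x = 0].

Definition smooth_bump p q n x : R :=
  flat 0 n.+1%:R^-1 (1 * x - p) * flat 0 n.+1%:R^-1 (-1 * x + q).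

Lemma bump_test1 a b p q n : a < p -> q < b -> test1 a b (smooth_bump p q n).
Proof.
move=> ap qb; have n0 : 0 < n.+1%:R^-1 :> R by rewrite invr_gt0.
split.
  by apply: flat_algebra_smooth; apply: FlatMul; exact: FlatGen.
exists p, q; split => // x /negP; rewrite negb_and -!ltNge /smooth_bump.
move=> /orP[xp|qx].
  by rewrite flat_le0 ?mul0r// mul1r subr_le0 ltW.
by rewrite [X in _ * X]flat_le0 ?mulr0// mulN1r addrC subr_le0 ltW.
Qed.

Lemma bump_ge0 p q n x : 0 <= smooth_bump p q n x.
Proof. by rewrite mulr_ge0// flat_ge0. Qed.

Lemma bump_le1 p q n x : smooth_bump p q n x <= 1.
Proof.
have n0 : 0 < n.+1%:R^-1 :> R by rewrite invr_gt0.
by rewrite /smooth_bump -[leRHS]mulr1 ler_pM ?flat_ge0 ?flat0_le1.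
Qed.

(** Each of the two factors tends to the indicator of its half-line because s = 1 / (n + 1) tends to
    0. *)
Lemma bump_cvg p q x : smooth_bump p q n x @[n --> \oo] --> ((p < x < q)%R%:R : R).
Proof.
have key y : flat 0 n.+1%:R^-1 y @[n --> \oo] --> ((0 < y)%R%:R : R).
  have [y0|y0] := ltP 0 y; last first.
    by under eq_fun do rewrite flat_le0//; exact: cvg_cst.
  rewrite (_ : (fun n : nat => _) = (fun n : nat => expR (- (n.+1%:R^-1 * y^-1)))); last first.
    by apply/funext => n; rewrite /flat y0 expr0 mul1r.
  rewrite (_ : true%:R = expR (- (0 * y^-1)) :> R); last by rewrite mul0r oppr0 expR0.
  apply: (@continuous_cvg _ _ _ _ _ (fun n : nat => - (n.+1%:R^-1 * y^-1)) expR).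
    exact: continuous_expR.
  apply: cvgN; apply: cvgM; last exact: cvg_cst.
  exact: cvg_harmonic.
have -> : ((p < x < q)%R%:R : R) = (0 < 1 * x - p)%R%:R * (0 < -1 * x + q)%R%:R.
  rewrite mul1r (_ : -1 * x + q = q - x) ?subr_gt0; last by ring.
  by case: (p < x); case: (x < q); rewrite ?mul1r ?mul0r.
exact: cvgM (key _) (key _).
Qed.

End bumps.

(** * The fundamental lemma of the calculus of variations *)

Section fundamental_lemma.
Context (R : realType).
Implicit Types (a b c d p q x y : R) (n k : nat).

Lemma derivative_continuous (f f' : R -> R) : derivative_of f f' -> continuous f.
Proof.
move=> df x; apply: differentiable_continuous; apply/derivable1_diffP.
by have [] := df x.
Qed.

Lemma test1_continuous a b (f : R -> R) : test1 a b f -> continuous f.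
Proof. by move=> [[C [Cf /(_ _ Cf) [f' _ df]]] _]; exact: derivative_continuous df. Qed.

Lemma test1_0 a b : a < b -> test1 a b (fun=> 0).
Proof.
move=> ab; split; first exact/flat_algebra_smooth/FlatCst.
by exists ((a + b) / 2), ((a + b) / 2); split => //; lra.
Qed.

(** Rational bumps, enumerated. Countability is what lets [fundamental_lemma2] collect one
    exceptional null set for all tests in y. Codes of no admissible bump give the zero function. *)
Definition bump_seq c d k : R -> R :=
  if (unpickle k : option (rat * rat * nat)) is Some (r, s, n) then
    if ((c < ratr r) && (ratr s < d))%R then smooth_bump (ratr r) (ratr s) n else fun=> 0
  else fun=> 0.

Lemma bump_seq_test1 c d k : c < d -> test1 c d (bump_seq c d k).
Proof.
move=> cd; rewrite /bump_seq; case: unpickle => [[[r s] n]|]; last exact: test1_0.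
by case: ifPn => [/andP[? ?]|_]; [exact: bump_test1|exact: test1_0].
Qed.

Lemma rat_dense_itv x y : x < y -> exists r : rat, x < ratr r < y.
Proof. by move=> /rat_in_itvoo[r]; rewrite in_itv /= => ?; exists r. Qed.

(** Dominated convergence with bound |g|, as bumps take values in [0, 1]. *)
Lemma bump_Rintegral_eq0 c d p q (g : R -> R) : c < p -> q < d ->
  (leb1 R).-integrable `[c, d] (EFin \o g) ->
  (forall n, \int[leb1 R]_(x in `[c, d]) (g x * smooth_bump p q n x) = 0) ->
  \int[leb1 R]_(x in `[c, d]) (g x * (p < x < q)%R%:R) = 0.
Proof.
move=> cp qd jg g0; have mcd := measurable_cc c d.
have /measurable_EFinP mg := measurable_int _ jg.
have cb n : continuous (smooth_bump p q n : R -> R) by exact: test1_continuous (bump_test1 n cp qd).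
have mb n : measurable_fun (`[c, d]%classic : set (measurableTypeR R)) (fun x => g x * smooth_bump p q n x).
  apply: measurable_funM => //; apply: measurable_funTS.
  exact: continuous_measurable_fun (cb n).
have mb' : measurable_fun (`[c, d]%classic : set (measurableTypeR R)) (fun x => g x * (p < x < q)%R%:R).
  apply: measurable_funM => //; apply: measurable_funTS.
  have : measurable_fun [set: measurableTypeR R] (\1_(`]p, q[%classic) : R -> R).
    by apply: measurable_indic; exact: measurable_itv.
  apply: eq_measurable_fun => x _; rewrite indicE; congr (nat_of_bool _)%:R.
  by apply/idP/idP; rewrite inE /= in_itv.
have h1 : {ae leb1 R, forall x, `[c, d]%classic x ->
    (fun n => (g x * smooth_bump p q n x)%:E) @ \oo --> (g x * (p < x < q)%R%:R)%:E}.
  apply: aeW => x _; apply: cvg_EFin; first by apply: nearW.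
  by apply: cvgM; [exact: cvg_cst|exact: bump_cvg].
have h2 : (leb1 R).-integrable `[c, d] (fun x => (`|g x|)%:E) by exact: integrable_norm jg.
have h3 : {ae leb1 R, forall x n, `[c, d]%classic x -> (`|(g x * smooth_bump p q n x)%:E| <= (`|g x|)%:E)%E}.
  apply: aeW => x n _ /=; rewrite lee_fin normrM -[leRHS]mulr1 ler_wpM2l//.
  by rewrite ger0_norm ?bump_ge0 ?bump_le1.
have [_ _ cv] := @dominated_convergence _ _ _ (leb1 R) `[c, d]%classic mcd
  (fun n x => (g x * smooth_bump p q n x)%:E) (fun x => (g x * (p < x < q)%R%:R)%:E)
  (fun x => (`|g x|)%:E) (fun n => (measurable_EFinP _ _).2 (mb n)) ((measurable_EFinP _ _).2 mb')
  h1 h2 h3.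
have jb' : (leb1 R).-integrable `[c, d] (fun x => (g x * (p < x < q)%R%:R)%:E).
  apply: (le_integrable mcd _ _ h2); first exact/measurable_EFinP.
  move=> x _ /=; rewrite lee_fin normr_id normrM -[leRHS]mulr1 ler_wpM2l//.
  by case: (p < x < q); rewrite ?normr1 ?normr0.
have E n : (\int[leb1 R]_(x in `[c, d]) (g x * smooth_bump p q n x)%:E = 0)%E.
  rewrite -[LHS]fineK; last first.
    apply: (integrable_fin_num mcd); apply: (le_integrable mcd _ _ h2).
      exact/measurable_EFinP.
    move=> x _ /=; rewrite lee_fin normr_id normrM -[leRHS]mulr1 ler_wpM2l//.
    by rewrite ger0_norm ?bump_ge0 ?bump_le1.
  by rewrite -[fine _]/(\int[leb1 R]_(x in `[c, d]) (g x * smooth_bump p q n x)) g0.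
move: cv; under eq_fun do rewrite E.
move=> /(cvg_lim (@ereal_hausdorff _)).
rewrite lim_cst; last exact: ereal_hausdorff.
by rewrite /Rintegral => <-.
Qed.

Lemma Rintegral_ind_itv c d p q (g : R -> R) : c <= p -> p <= q -> q <= d ->
  (leb1 R).-integrable `[c, d] (EFin \o g) ->
  \int[leb1 R]_(x in `[c, d]) (g x * (p < x < q)%R%:R) =
  \int[leb1 R]_(x in `[c, q]) g x - \int[leb1 R]_(x in `[c, p]) g x.
Proof.
move=> cp pq qd jg; rewrite Rintegral_itvB; last 3 first.
- exact: integrable_trunc jg.
- by rewrite bnd_simp.
- by rewrite bnd_simp.
rewrite -[RHS]Rintegral_itv_bndo_bndc; last first.
  apply: (integrableS (measurable_cc c d) (measurable_itv _) _ jg).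
  move=> t /=; rewrite !in_itv /= => /andP[pt tq].
  by rewrite (le_trans cp (ltW pt)) (le_trans (ltW tq) qd).
have -> : `]p, q[%classic = `[c, d]%classic `&` `]p, q[%classic :> set R.
  apply/seteqP; split => [t|t []//]; rewrite /= !in_itv /= => /andP[pt tq]; split.
    by rewrite (le_trans cp (ltW pt)) (le_trans (ltW tq) qd).
  by rewrite pt.
rewrite Rintegral_mkcondr; apply: eq_Rintegral => t _; rewrite patchE.
case: (boolP (p < t < q)) => ptq; rewrite ?mulr1 ?mulr0.
  by rewrite ifT// inE /= in_itv.
by rewrite ifF//; apply/negP; rewrite inE /= in_itv; exact/negP.
Qed.

(** The primitive F of g takes a single value at the rationals of ]c, d[, hence is constant there by
    continuity, and Lebesgue differentiation gives g = 0 almost everywhere. *)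
Lemma fundamental_lemma1 c d (g : R -> R) : c < d ->
  (leb1 R).-integrable `[c, d] (EFin \o g) ->
  (forall k, \int[leb1 R]_(x in `[c, d]) (g x * bump_seq c d k x) = 0) ->
  g = (fun=> 0) %[ae leb1 R in `[c, d]%classic].
Proof.
move=> cd jg g0; pose F x := \int[leb1 R]_(t in `[c, x]) g t.
have Frat (r s : rat) : c < ratr r -> ratr r < ratr s :> R -> ratr s < d -> F (ratr s) = F (ratr r).
  move=> cr rs sd; apply/eqP; rewrite -subr_eq0; apply/eqP.
  rewrite -(@Rintegral_ind_itv c d) ?ltW//.
  apply: bump_Rintegral_eq0 => // n.
  have := g0 (pickle (r, s, n)).
  by rewrite /bump_seq pickleK cr sd.
have [cF _ _] := (continuous_within_itvP _ cd).1 (parameterized_integral_continuous (ltW cd) jg).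
have [r0 /andP[cr0 r0d]] := rat_dense_itv cd.
pose K := F (ratr r0).
have Frat0 (r : rat) : c < ratr r -> ratr r < d -> F (ratr r) = K.
  move=> cr rd; have [rr|rr|->//] := ltgtP (ratr r : R) (ratr r0); last exact: Frat.
  by rewrite /K -(Frat r r0).
have FK x : x \in `]c, d[ -> F x = K.
  move=> xcd; apply/eqP/negPn/negP => FxK.
  have e0 : 0 < `|F x - K| by rewrite normr_gt0 subr_eq0.
  have := (cF x xcd); move/cvgrPdist_lt => /(_ _ e0) /nbhs_ballP[e /= ep he].
  move: (xcd); rewrite in_itv /= => /andP[cx xd].
  have [r /andP[xr re]] : exists r : rat, x < ratr r < Num.min d (x + e).
    by apply: rat_dense_itv; rewrite lt_min xd ltrDl.
  move: re; rewrite lt_min => /andP[rd rxe].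
  have hb : ball x e (ratr r : R).
    by rewrite /ball /= distrC gtr0_norm ?subr_gt0//; lra.
  have : `|F x - F (ratr r)| < `|F x - K| := he _ hb.
  by rewrite Frat0 ?ltxx//; exact: lt_trans xr.
(* The differentiation theorem is applied to g extended by zero to the whole line; the endpoints c
   and d are then discarded as null sets. *)
pose gp : R -> R := g \_ `[c, d]%classic.
have jgp : (leb1 R).-integrable [set: R] (EFin \o gp).
  by rewrite /gp -restrict_EFin; apply: (integrable_mkcond _ (measurable_cc c d)).1.
have lgp : locally_integrable [set: R] gp.
  by apply: integrable_locally => //; exact: openT.
have := @FTC1 R gp (BLeft c) (fun y => integrableS measurableT (measurable_cc c y) (@subsetT _ _) jgp) lgp.
have nc : {ae leb1 R, forall x, x != c}.
  exists [set c]; split; [exact: measurable_set1|exact: lebesgue_measure_set1|].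
  by move=> x /= /negP; rewrite negbK => /eqP.
have nd : {ae leb1 R, forall x, x != d}.
  exists [set d]; split; [exact: measurable_set1|exact: lebesgue_measure_set1|].
  by move=> x /= /negP; rewrite negbK => /eqP.
move=> hF; apply: filterS3 hF nc nd => x h xc xd /= xcd; move: (xcd); rewrite in_itv /= => /andP[cx dx].
have {}cx : c < x by rewrite lt_neqAle eq_sym xc.
have {}xd : x < d by rewrite lt_neqAle xd.
have [_] := h cx.
rewrite {2}/gp patchE mem_set// => <-.
rewrite derive1E (@near_eq_derive _ _ _ _ (cst K)) ?derive_cst//.
near=> z.
have zcd : z \in `]c, d[ by near: z; apply: near_in_itvoo; rewrite in_itv /= cx xd.
rewrite -(FK z zcd); apply: eq_Rintegral => t /set_mem /=; rewrite in_itv /= => /andP[ct tz].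
rewrite /gp patchE mem_set//= in_itv /= ct (le_trans tz)//.
by move: zcd; rewrite in_itv /= => /andP[_ /ltW].
Unshelve. all: by end_near. Qed.

Lemma L2_Om_integrable_test a b c d (g h : R * R -> R) :
  (leb2 R).-integrable (Omega a b c d) (EFin \o g) -> continuous h ->
  (leb2 R).-integrable (Omega a b c d) (EFin \o (fun z => g z * h z)).
Proof.
move=> jg ch; have [M hM] := continuous_Om_bounded a b c d ch.
have mO := measurable_Om a b c d.
have /measurable_EFinP mg := measurable_int _ jg.
apply: (le_integrable mO _ _ (integrableZ_EFin mO M (integrable_norm jg))).
  apply/measurable_EFinP; apply: measurable_funM => //; apply: measurable_funTS.
  exact: continuous_measurable2.
move=> z Oz /=; rewrite lee_fin mulrC !normrM normr_id ler_wpM2r// (le_trans (hM z Oz))//.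
exact: ler_norm.
Qed.

Definition tens (f g : R -> R) (z : R * R) : R := f z.1 * g z.2.

Lemma tens_continuous f g : continuous f -> continuous g -> continuous (tens f g).
Proof.
move=> cf cg z; apply: cvgM.
  by apply: (@continuous_comp _ _ _ fst f); [exact: cvg_fst|exact: cf].
by apply: (@continuous_comp _ _ _ snd g); [exact: cvg_snd|exact: cg].
Qed.

(** For a fixed test in y, the one-variable lemma in x kills the partial integral for almost every
    x. Over the countable family [bump_seq] the exceptional sets merge into one, and the
    one-variable lemma in y finishes. *)
Lemma fundamental_lemma2 a b c d (g : R * R -> R) : a < b -> c < d ->
  (leb2 R).-integrable (Omega a b c d) (EFin \o g) ->
  (forall f h, test1 a b f -> test1 c d h ->
    \int[leb2 R]_(z in Omega a b c d) (g z * tens f h z) = 0) ->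
  g = (fun=> 0) %[ae leb2 R in Omega a b c d].
Proof.
move=> ab cd jg g0.
have mO := measurable_Om a b c d.
have ctens k l : continuous (tens (bump_seq a b k) (bump_seq c d l)).
  by apply: tens_continuous; apply: test1_continuous; exact: bump_seq_test1.
have ch l : continuous (fun z : R * R => bump_seq c d l z.2).
  move=> z; apply: (@continuous_comp _ _ _ snd (bump_seq c d l)); first exact: cvg_snd.
  exact: (test1_continuous (bump_seq_test1 l cd)).
have step l : {ae leb1 R, forall x, `[a, b]%classic x ->
    \int[leb1 R]_(y in `[c, d]) (g (x, y) * bump_seq c d l y) = 0}.
  apply: (fundamental_lemma1 ab).
    exact: (@fubini_integrable1 _ _ _ _ _ (@lebesgue_measure R) (@lebesgue_measure R)
      _ _ (measurable_cc a b) (measurable_cc c d) _ (L2_Om_integrable_test jg (ch l))).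
  move=> k.
  have j1 := L2_Om_integrable_test jg (ctens k l).
  rewrite -(g0 _ _ (bump_seq_test1 k ab) (bump_seq_test1 l cd)) (Om_fubini1 j1).
  apply: ae_eq_Rintegral; first exact: measurable_cc.
  - apply: measurable_funM.
      have := @fubini_integrable1 _ _ _ _ _ (@lebesgue_measure R) (@lebesgue_measure R)
        _ _ (measurable_cc a b) (measurable_cc c d) _ (L2_Om_integrable_test jg (ch l)).
      by move=> /measurable_int /measurable_EFinP.
    apply: measurable_funTS; apply: continuous_measurable_fun.
    exact: (test1_continuous (bump_seq_test1 k ab)).
  - have := @fubini_integrable1 _ _ _ _ _ (@lebesgue_measure R) (@lebesgue_measure R)
        _ _ (measurable_cc a b) (measurable_cc c d) _ j1.
    by move=> /measurable_int /measurable_EFinP.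
  have := @fubini_ae_integrable1 _ _ _ _ _ (@lebesgue_measure R) (@lebesgue_measure R)
        _ _ (measurable_cc a b) (measurable_cc c d) _ (L2_Om_integrable_test jg (ch l)).
  apply: filterS => x jx xab; rewrite -(RintegralZr _ (measurable_cc c d) (jx xab)).
  by apply: eq_Rintegral => y _; rewrite /tens /=; ring.
have /measurable_EFinP mg := measurable_int _ jg.
have m0 : measurable_fun (Omega a b c d) (fun=> 0 : R) by exact: measurable_cst.
apply: (Om_ae_of_section1 mg m0).
have := @fubini_ae_integrable1 _ _ _ _ _ (@lebesgue_measure R) (@lebesgue_measure R)
        _ _ (measurable_cc a b) (measurable_cc c d) _ jg.
have := ae_foralln step.
apply: filterS2 => x h jx xab; apply: (fundamental_lemma1 cd (jx xab)) => l.
exact: h.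
Qed.

End fundamental_lemma.

(** * Tensor products of one-variable test functions *)

Section tensor_tests.
Context (R : realType).
Implicit Types (a b c d p q x y : R).

(** [smooth] quantifies over all sequences of directional derivatives. A derivative of a tensor
    product in an oblique direction is a combination of two, so the invariant has to be the span. *)
Inductive tens_span (C1 C2 : set (R -> R)) : (R * R -> R) -> Prop :=
| TensMul k f g : C1 f -> C2 g -> tens_span C1 C2 (fun z => k * tens f g z)
| TensAdd F G : tens_span C1 C2 F -> tens_span C1 C2 G ->
    tens_span C1 C2 (fun z => F z + G z).

Lemma derivative_of_derive (f f' : R -> R) x v : derivative_of f f' ->
  derivable f x v /\ 'D_v f x = v * f' x.
Proof.
move=> df; have [dx Dx] := df x.
have dfx : differentiable f x by apply/derivable1_diffP.
split; first exact: diff_derivable.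
by rewrite deriveE// diff1E//= derive1E Dx.
Qed.

Lemma is_derive_fst (f f' : R -> R) (z v : R * R) : derivative_of f f' ->
  is_derive z v (fun z => f z.1) (v.1 * f' z.1).
Proof.
move=> df; have [dz Dz] := derivative_of_derive z.1 v.1 df.
by split; [exact: dz|exact: Dz].
Qed.

Lemma is_derive_snd (f f' : R -> R) (z v : R * R) : derivative_of f f' ->
  is_derive z v (fun z => f z.2) (v.2 * f' z.2).
Proof.
move=> df; have [dz Dz] := derivative_of_derive z.2 v.2 df.
by split; [exact: dz|exact: Dz].
Qed.

Lemma is_derive_tens k (f f' g g' : R -> R) (z v : R * R) :
  derivative_of f f' -> derivative_of g g' ->
  is_derive z v (fun z => k * tens f g z)
    ((k * v.2) * tens f g' z + (k * v.1) * tens f' g z).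
Proof.
move=> df dg.
have /is_derive_eq := is_deriveZ k (is_deriveM (is_derive_fst z v df) (is_derive_snd z v dg)).
by apply; rewrite /tens /GRing.scale /=; ring.
Qed.

Lemma differentiable_tens k (f f' g g' : R -> R) (z : R * R) :
  derivative_of f f' -> derivative_of g g' ->
  differentiable (fun z => k * tens f g z) z.
Proof.
move=> df dg.
have d1 : differentiable (fun z : R * R => f z.1) z.
  apply: (@differentiable_comp _ _ _ _ fst f).
    by apply: linear_differentiable => w; exact: cvg_fst.
  by apply/derivable1_diffP; have [] := df z.1.
have d2 : differentiable (fun z : R * R => g z.2) z.
  apply: (@differentiable_comp _ _ _ _ snd g).
    by apply: linear_differentiable => w; exact: cvg_snd.
  by apply/derivable1_diffP; have [] := dg z.2.
exact: (@differentiableZ _ _ _ _ k _ (differentiableM d1 d2)).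
Qed.

Definition derivative_closed (C : set (R -> R)) :=
  forall g, C g -> exists2 g', C g' & derivative_of g g'.

Lemma tens_span_derive C1 C2 (F : R * R -> R) : derivative_closed C1 -> derivative_closed C2 ->
  tens_span C1 C2 F ->
  (forall z, differentiable F z) /\ (forall v, tens_span C1 C2 ('D_v F)).
Proof.
move=> c1 c2; elim=> [k f g Cf Cg|{}F G sF [dF DF] sG [dG DG]].
  have [f' Cf' df] := c1 _ Cf; have [g' Cg' dg] := c2 _ Cg; split=> [z|v].
    exact: differentiable_tens df dg.
  have -> : 'D_v (fun z => k * tens f g z) =
      (fun z => (k * v.2) * tens f g' z + (k * v.1) * tens f' g z).
    by apply/funext => z; have [] := is_derive_tens k z v df dg.
  by apply: TensAdd; exact: TensMul.
split=> [z|v]; first exact: differentiableD.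
have -> : 'D_v (fun z => F z + G z) = (fun z => 'D_v F z + 'D_v G z).
  apply/funext => z; apply: (@deriveD _ _ _ F G); exact: diff_derivable.
exact: TensAdd.
Qed.

Lemma test1_derive a b (f : R -> R) : test1 a b f ->
  test1 a b (derive1 f) /\ derivative_of f (derive1 f).
Proof.
move=> [[C [Cf cC]] [p [q [ap qb f0]]]]; have [f' Cf' df] := cC _ Cf.
have E : (derive1 f) = f' by apply/funext => x; rewrite derive1E; have [] := df x.
rewrite E; split => //; split; first by exists C.
exists p, q; split => // x /negP; rewrite negb_and -!ltNge => hx.
have [_ <-] := df x; rewrite (@near_eq_derive _ _ _ _ (cst 0)) ?derive_cst//.
case/orP: hx => hx.
  near=> z; apply: f0; apply/negP; rewrite negb_and -!ltNge; apply/orP; left.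
  by near: z; exact: lt_nbhsl.
near=> z; apply: f0; apply/negP; rewrite negb_and -!ltNge; apply/orP; right.
by near: z; exact: lt_nbhsr.
Unshelve. all: by end_near. Qed.

Lemma tens_test_function a b c d (f g : R -> R) : test1 a b f -> test1 c d g ->
  test_function a b c d (tens f g).
Proof.
move=> [[C1 [C1f c1]] [p [q [ap qb f0]]]] [[C2 [C2g c2]] [r [s [cr sd g0]]]]; split.
  move=> vs; suff h : tens_span C1 C2 (foldr (fun v f0 => 'D_v f0) (tens f g) vs).
    by move=> z; have [] := tens_span_derive c1 c2 h.
  elim: vs => [|v vs ih] /=; last by have [_] := tens_span_derive c1 c2 ih.
  rewrite (_ : tens f g = (fun z => 1 * tens f g z)); first exact: TensMul.
  by apply/funext => z; rewrite mul1r.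
exists (`[p, q] `*` `[r, s]); split.
- by apply: compact_setX; exact: segment_compact.
- move=> [x y] [/=]; rewrite !in_itv /= => /andP[px xq] /andP[ry ys].
  by rewrite (lt_le_trans ap px) (le_lt_trans xq qb) (lt_le_trans cr ry) (le_lt_trans ys sd).
- move=> [x y] /= nK; rewrite /tens /=.
  have [xpq|/f0->] := pselect (p <= x <= q); last by rewrite mul0r.
  have [yrs|/g0->] := pselect (r <= y <= s); last by rewrite mulr0.
  by exfalso; apply: nK; split; rewrite /= in_itv.
Qed.

Lemma derive_tens1 a b c d (f g : R -> R) : test1 a b f -> test1 c d g ->
  'D_((1, 0) : R * R) (tens f g) = tens (derive1 f) g.
Proof.
move=> /test1_derive[_ df] /test1_derive[_ dg]; apply/funext => z.
have := is_derive_tens 1 z (1, 0) df dg.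
rewrite (_ : (fun z => 1 * tens f g z) = tens f g); last by apply/funext => ?; rewrite mul1r.
by case=> _ ->; rewrite /= mulr0 mul0r add0r !mul1r.
Qed.

Lemma derive_tens2 a b c d (f g : R -> R) : test1 a b f -> test1 c d g ->
  'D_((0, 1) : R * R) (tens f g) = tens f (derive1 g).
Proof.
move=> /test1_derive[_ df] /test1_derive[_ dg]; apply/funext => z.
have := is_derive_tens 1 z (0, 1) df dg.
rewrite (_ : (fun z => 1 * tens f g z) = tens f g); last by apply/funext => ?; rewrite mul1r.
by case=> _ ->; rewrite /= mulr0 mul0r addr0 !mul1r.
Qed.

Lemma test1_iter a b (f : R -> R) n : test1 a b f -> test1 a b (iter n (fun g => (derive1 g)) f).
Proof. by move=> tf; elim: n => //= n /test1_derive[]. Qed.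

Lemma partial_tens a b c d (f g : R -> R) i j : test1 a b f -> test1 c d g ->
  partial_xy i j (tens f g) =
  tens (iter i (fun g => (derive1 g)) f) (iter j (fun g => (derive1 g)) g).
Proof.
move=> tf tg; rewrite /partial_xy.
have -> : iter j (fun f : R * R -> R => 'D_((0, 1) : R * R) f) (tens f g) =
    tens f (iter j (fun g => (derive1 g)) g).
  elim: j => //= j ->; exact: derive_tens2 tf (test1_iter j tg).
elim: i => //= i ->; exact: derive_tens1 (test1_iter i tf) (test1_iter j tg).
Qed.

(** The primitive from a vanishes before the support of f and is constant after it; the constant is
    the total integral, which is zero. *)
Lemma test1_antiderivative a b (f : R -> R) : a < b -> test1 a b f ->
  \int[leb1 R]_(x in `[a, b]) f x = 0 ->
  exists2 F, test1 a b F & (derive1 F) = f.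
Proof.
move=> ab tf int0; have cf := test1_continuous tf.
have [[C [Cf cC]] [p [q [ap qb f0]]]] := tf.
pose F x := \int[leb1 R]_(t in `[a, x]) f t.
have jf u v : (leb1 R).-integrable `[u, v] (EFin \o f).
  apply: continuous_compact_integrable; first exact: segment_compact.
  exact: continuous_subspaceT.
have Fl x : x < p -> F x = 0.
  move=> xp; rewrite /F (@eq_Rintegral _ _ _ _ _ (fun=> 0)) ?Rintegral_cst ?mul0r//.
  move=> t /set_mem /=; rewrite in_itv /= => /andP[_ tx]; apply: f0.
  by apply/negP; rewrite negb_and -ltNge (le_lt_trans tx xp).
have Fq x : q <= x -> F x = F q.
  move=> qx; rewrite /F (Rintegral_itv_trunc _ _ qx); apply: eq_Rintegral => t _.
  have [tq|qt] := leP t q; first by rewrite mul1r.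
  by rewrite mul0r f0//; apply/negP; rewrite negb_and -!ltNge qt orbT.
have Fr x : q < x -> F x = 0.
  by move=> qx; rewrite Fq ?ltW// -(Fq b) ?ltW.
have dF : derivative_of F f.
  (* To the right of a this is the fundamental theorem; at and to the left of a, both F and f vanish
     near x, as a < p. *)
  move=> x; have [ax|xa] := ltP a x.
    have cx : {for x, continuous f} by exact: cf.
    have x1 : x < x + 1 by rewrite ltrDl.
    have [dx ex] := continuous_FTC1_closed x1 (jf a (x + 1)) ax cx.
    by apply: DeriveDef; [exact: dx|rewrite -derive1E; exact: ex].
  have xp := le_lt_trans xa ap.
  apply: (@near_eq_is_derive _ _ _ (cst 0)).
    near=> z; rewrite Fl//.
    by near: z; exact: lt_nbhsl.
  rewrite f0; first exact: is_derive_cst.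
  by apply/negP; rewrite negb_and -ltNge xp.
exists F; last by apply/funext => x; rewrite derive1E; have [] := dF x.
split.
  exists (C `|` [set F]); split; first by right.
  move=> g [Cg|->]; last by exists f => //; left.
  by have [g' Cg' dg] := cC _ Cg; exists g' => //; left.
exists p, q; split => // x /negP; rewrite negb_and -!ltNge => /orP[/Fl|/Fr]//.
Unshelve. all: by end_near. Qed.

(** Used to pick a good slice: a non-degenerate interval has positive measure. *)
Lemma ae_itv_exists a b (P : R -> Prop) : a < b ->
  {ae leb1 R, forall x, `[a, b]%classic x -> P x} -> exists2 x, `[a, b]%classic x & P x.
Proof.
move=> ab [N [mN N0 PN]]; apply: contrapT => nP.
have : leb1 R `[a, b]%classic = 0%E.
  apply: (subset_measure0 (measurable_cc a b) mN _ N0) => x xab.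
  by apply: PN => /= h; apply: nP; exists x => //; exact: h.
rewrite /leb1 /= lebesgue_measure_itv /= lte_fin ab -EFinB => -[] /eqP.
by rewrite subr_eq0 gt_eqF.
Qed.

(** Some rational bump has non-zero integral: otherwise the fundamental lemma, applied to the
    constant 1, would give 1 = 0 at some point. *)
Lemma test1_normalized a b : a < b -> exists2 r : R -> R, test1 a b r &
  \int[leb1 R]_(x in `[a, b]) r x = 1.
Proof.
move=> ab.
have cb k : continuous (bump_seq a b k) := test1_continuous (bump_seq_test1 k ab).
have jb k : (leb1 R).-integrable `[a, b] (EFin \o bump_seq a b k).
  apply: continuous_compact_integrable; first exact: segment_compact.
  exact: continuous_subspaceT.
have [k kn0] : exists k, \int[leb1 R]_(x in `[a, b]) bump_seq a b k x != 0.
  apply/not_existsP => h.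
  have j1 : (leb1 R).-integrable `[a, b] (EFin \o (fun=> 1 : R)).
    exact: (integrable_cst_EFin (measurable_cc a b) (leb1_itv_fin a b)).
  have [] := ae_itv_exists ab (fundamental_lemma1 ab j1 _).
    move=> k; under eq_Rintegral do rewrite mul1r.
    by apply/eqP; have /negP := h k; rewrite negbK.
  by move=> x _ /eqP; rewrite oner_eq0.
pose c := (\int[leb1 R]_(x in `[a, b]) bump_seq a b k x)^-1.
exists (fun x => c * bump_seq a b k x).
  have [[C [Cf cC]] [p [q [ap qb f0]]]] := bump_seq_test1 k ab.
  split; last by exists p, q; split => // x /f0 ->; rewrite mulr0.
  exists [set f | exists2 g, C g & f = (fun x => c * g x)]; split.
    by exists (bump_seq a b k).
  move=> _ [g Cg ->]; have [g' Cg' dg] := cC _ Cg.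
  exists (fun x => c * g' x); first by exists g'.
  by move=> x; exact: is_deriveZ.
by rewrite (RintegralZl _ (measurable_cc a b) (jb k)) mulVf.
Qed.

Lemma test1_sub a b k (f g : R -> R) : test1 a b f -> test1 a b g ->
  test1 a b (fun x => f x - k * g x).
Proof.
move=> [[C [Cf cC]] [p [q [ap qb f0]]]] [[C' [Cg cC']] [r [s [ar sb g0]]]]; split.
  (* The combinations of members of two stable classes form a stable class. *)
  exists [set h | exists u v, [/\ C u, C' v & h = (fun x => u x - k * v x)]]; split.
    by exists f, g.
  move=> _ [u [v [Cu Cv ->]]]; have [u' Cu' du] := cC _ Cu; have [v' Cv' dv] := cC' _ Cv.
  exists (fun x => u' x - k * v' x); first by exists u', v'.
  by move=> x; apply: is_deriveB; [exact: du|exact: (is_deriveZ k (dv x))].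
exists (Num.min p r), (Num.max q s); split; rewrite ?lt_min ?ap ?gt_max ?qb//.
move=> x /negP; rewrite negb_and -!ltNge lt_min gt_max.
move=> /orP[] /andP[h1 h2]; rewrite f0 ?g0 ?mulr0 ?subr0//;
  by apply/negP; rewrite negb_and -!ltNge ?h1 ?h2 ?orbT.
Qed.

End tensor_tests.

(** * Weak derivatives and functions with vanishing derivative *)

Section weak_derivatives.
Context (R : realType) (a b c d : R).
Hypotheses (ab : a < b) (cd : c < d).
Implicit Types (f g p q r : R * R -> R).

Local Notation Om := (Omega a b c d).
Local Notation L2Om := (L2 (leb2 R) Om).
Let mO := measurable_Om a b c d.

Let sign_neq0 n : (-1) ^+ n != 0 :> R. Proof. by rewrite signr_eq0. Qed.

Lemma Rint_ae f g h : L2Om f -> L2Om g -> continuous h ->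
  f = g %[ae leb2 R in Om] ->
  \int[leb2 R]_(z in Om) (f z * h z) = \int[leb2 R]_(z in Om) (g z * h z).
Proof.
move=> Lf Lg ch fg.
have mh : measurable_fun Om h by apply: measurable_funTS; exact: continuous_measurable2.
apply: (ae_eq_Rintegral mO).
- by apply: measurable_funM => //; exact: L2_measurable Lf.
- by apply: measurable_funM => //; exact: L2_measurable Lg.
- by apply: filterS fg => z fgz Oz; rewrite fgz.
Qed.

Lemma Rint_lin k f g h : L2Om f -> L2Om g -> continuous h ->
  \int[leb2 R]_(z in Om) ((f z + k * g z) * h z) =
  \int[leb2 R]_(z in Om) (f z * h z) + k * \int[leb2 R]_(z in Om) (g z * h z).
Proof.
move=> Lf Lg ch; have Lh := continuous_Om_L2 a b c d ch.
have jf := L2M_integrable mO Lf Lh; have jg := L2M_integrable mO Lg Lh.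
rewrite -(RintegralZl _ mO jg) -(RintegralD mO jf (integrableZ_EFin mO k jg)).
by apply: eq_Rintegral => z _; ring.
Qed.

Lemma wderiv_unique i j f g1 g2 : L2Om g1 -> L2Om g2 ->
  is_wderiv a b c d i j f g1 -> is_wderiv a b c d i j f g2 ->
  g1 = g2 %[ae leb2 R in Om].
Proof.
move=> L1 L2 w1 w2.
have L3 : L2Om (fun z => g1 z + (-1) * g2 z) by apply: (L2D mO) => //; exact: L2Z.
have : (fun z => g1 z + (-1) * g2 z) = (fun=> 0) %[ae leb2 R in Om].
  apply: (fundamental_lemma2 ab cd (L2_Om_integrable L3)) => u v tu tv.
  have tt := tens_test_function tu tv.
  rewrite (Rint_lin (-1) L1 L2 (test_function_continuous tt)).
  have := w1 _ tt; rewrite (w2 _ tt).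
  move=> /(mulfI (sign_neq0 _)) ->; ring.
apply: filterS => z h Oz; have := h Oz => /eqP.
by rewrite mulN1r subr_eq0 => /eqP.
Qed.

Lemma is_wderiv_ae i j f f' g : L2Om f -> L2Om f' -> f = f' %[ae leb2 R in Om] ->
  is_wderiv a b c d i j f g -> is_wderiv a b c d i j f' g.
Proof.
move=> Lf Lf' ff' w phi tphi; rewrite -w//; apply/esym; apply: Rint_ae => //.
exact: test_function_continuous (test_function_partial i j tphi).
Qed.

(** An equality of functions and not just almost everywhere: the candidates are the same set, from
    which [xget] makes the same choice. *)
Lemma wderiv_ae i j f f' : L2Om f -> L2Om f' -> f = f' %[ae leb2 R in Om] ->
  wderiv a b c d i j f = wderiv a b c d i j f'.
Proof.
move=> Lf Lf' ff'; rewrite /wderiv; congr xget; apply/seteqP; split => g [Lg w].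
  by split => //; exact: is_wderiv_ae w.
by split => //; apply: is_wderiv_ae w => //; exact: ae_eq_sym.
Qed.

Lemma wderivP i j f g : L2Om g -> is_wderiv a b c d i j f g ->
  L2Om (wderiv a b c d i j f) /\ is_wderiv a b c d i j f (wderiv a b c d i j f).
Proof.
move=> Lg w; rewrite /wderiv; case: xgetP => [h _ []//|/(_ g) []].
by split.
Qed.

Lemma wderiv_eq i j f g : L2Om g -> is_wderiv a b c d i j f g ->
  L2Om (wderiv a b c d i j f) /\ wderiv a b c d i j f = g %[ae leb2 R in Om].
Proof.
by move=> Lg w; have [L w'] := wderivP Lg w; split => //; exact: wderiv_unique w' w.
Qed.

(* Weak partial derivatives, tested against tensor products only. *)
Definition wdx f p := forall u v, test1 a b u -> test1 c d v ->
  \int[leb2 R]_(z in Om) (f z * tens (derive1 u) v z) =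
  - \int[leb2 R]_(z in Om) (p z * tens u v z).

Definition wdy f p := forall u v, test1 a b u -> test1 c d v ->
  \int[leb2 R]_(z in Om) (f z * tens u (derive1 v) z) =
  - \int[leb2 R]_(z in Om) (p z * tens u v z).

(** Test p on u (x) v and q on u' (x) v: both have the same integral of f on the left, and the signs
    differ by one factor -1. *)
Lemma is_wderiv_wdx i j f p q : is_wderiv a b c d i.+1 j f p ->
  is_wderiv a b c d i j f q -> wdx q p.
Proof.
move=> wp wq u v tu tv.
have := wp _ (tens_test_function tu tv).
have [tu' _] := test1_derive tu.
have := wq _ (tens_test_function tu' tv).
rewrite (partial_tens _ _ tu tv) (partial_tens _ _ tu' tv) -iterSr => ->.
rewrite addSn exprS mulN1r mulNr -mulrN.
exact: (mulfI (sign_neq0 _)).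
Qed.

Lemma is_wderiv_wdy i j f p q : is_wderiv a b c d i j.+1 f p ->
  is_wderiv a b c d i j f q -> wdy q p.
Proof.
move=> wp wq u v tu tv.
have := wp _ (tens_test_function tu tv).
have [tv' _] := test1_derive tv.
have := wq _ (tens_test_function tu tv').
rewrite (partial_tens _ _ tu tv) (partial_tens _ _ tu tv') -iterSr => ->.
rewrite addnS exprS mulN1r mulNr -mulrN.
exact: (mulfI (sign_neq0 _)).
Qed.

Lemma test1_tens_continuous u v : test1 a b u -> test1 c d v -> continuous (tens u v).
Proof. by move=> tu tv; apply: tens_continuous; [exact: test1_continuous tu|exact: test1_continuous tv]. Qed.

Lemma xtest_tens u v : test1 a b u -> test1 c d v -> xtest a b (tens u v) (tens (derive1 u) v).
Proof.
move=> tu tv; rewrite -(derive_tens1 tu tv).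
exact: test_function_xtest (tens_test_function tu tv).
Qed.

Lemma ytest_tens u v : test1 a b u -> test1 c d v -> ytest c d (tens u v) (tens u (derive1 v)).
Proof.
move=> tu tv; rewrite -(derive_tens2 tu tv).
exact: test_function_ytest (tens_test_function tu tv).
Qed.

(** The lemma of du Bois-Reymond with a parameter: [al] averages w in x against a test function of
    integral one. *)
Lemma wdx0_const w : L2Om w -> wdx w (fun=> 0) ->
  exists2 al, L2 (leb1 R) `[c, d] al & w = (fun z => al z.2) %[ae leb2 R in Om].
Proof.
move=> Lw w0; have [rho trho int_rho] := test1_normalized ab.
have crho := test1_continuous trho.
have mab := measurable_cc a b; have mcd := measurable_cc c d.
have jt (u : R -> R) : test1 a b u -> (leb1 R).-integrable `[a, b] (EFin \o u).
  move=> tu; apply: continuous_compact_integrable; first exact: segment_compact.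
  apply: continuous_subspaceT; exact: test1_continuous tu.
pose al y := \int[leb1 R]_(x in `[a, b]) (w (x, y) * rho x).
have crho1 : continuous (fun z : R * R => rho z.1).
  by move=> z; apply: (@continuous_comp _ _ _ fst rho); [exact: cvg_fst|exact: crho].
have Lwr : L2Om (fun z => w z * rho z.1).
  have [M hM] := continuous_Om_bounded a b c d crho1.
  have mr : measurable_fun Om (fun z => rho z.1) by apply: measurable_funTS; exact: continuous_measurable2.
  by apply: (L2_eq _ (L2M_bounded mO mr hM Lw)) => z _; rewrite mulrC.
have Lal : L2 (leb1 R) `[c, d] al.
  have [L1 _] := Omswap Lwr.
  have [] := @L2_fubini1 _ _ _ _ _ (@lebesgue_measure R) (@lebesgue_measure R) _ _ mcd mab
    (leb1_itv_fin a b) _ L1.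
  by [].
exists al => //.
have [Lal2 _] := L2_Om_snd a b Lal.
have Lg : L2Om (fun z => w z + (-1) * al z.2) by apply: (L2D mO) => //; exact: L2Z.
have : (fun z => w z + (-1) * al z.2) = (fun=> 0) %[ae leb2 R in Om].
  apply: (fundamental_lemma2 ab cd (L2_Om_integrable Lg)) => u v tu tv.
  set k := \int[leb1 R]_(x in `[a, b]) u x.
  have ct := test1_tens_continuous tu tv.
  rewrite (Rint_lin (-1) Lw Lal2 ct).
  have ctr := test1_tens_continuous trho tv.
  have E : \int[leb2 R]_(z in Om) (al z.2 * tens u v z) =
      k * \int[leb2 R]_(z in Om) (w z * tens rho v z).
    have j1 := L2M_integrable mO Lal2 (continuous_Om_L2 a b c d ct).
    have j2 := L2M_integrable mO Lw (continuous_Om_L2 a b c d ctr).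
    rewrite -(RintegralZl _ mO j2); apply: (Om_Rintegral_ae2 j1 (integrableZ_EFin mO k j2)).
    apply: filterS (Om_section2 Lwr) => y Lwy ycd.
    have jwy := L2_itv_integrable (Lwy ycd).
    transitivity (\int[leb1 R]_(x in `[a, b]) ((al y * v y) * u x)).
      by apply: eq_Rintegral => x _; rewrite /tens /=; ring.
    rewrite (RintegralZl _ mab (jt _ tu)) -/k.
    transitivity (\int[leb1 R]_(x in `[a, b]) ((k * v y) * (w (x, y) * rho x))); last first.
      by apply: eq_Rintegral => x _; rewrite /tens /=; ring.
    by rewrite (RintegralZl _ mab jwy) -/(al y); ring.
  rewrite E.
  (* The function u - k rho has integral zero, hence is the derivative of a test function, against
     which w vanishes. *)
  have tu' := test1_sub k tu trho.
  have [|F tF F'] := test1_antiderivative ab tu'.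
    rewrite (RintegralB mab (jt _ tu) (integrableZ_EFin mab k (jt _ trho))).
    by rewrite (RintegralZl _ mab (jt _ trho)) int_rho mulr1 subrr.
  have := w0 _ _ tF tv; rewrite F'.
  under [in RHS]eq_Rintegral do rewrite mul0r.
  rewrite (Rintegral_cst _ mO) mul0r oppr0 => <-.
  have j2 := L2M_integrable mO Lw (continuous_Om_L2 a b c d ctr).
  have j3 := L2M_integrable mO Lw (continuous_Om_L2 a b c d ct).
  rewrite mulrA mulN1r -(RintegralZl _ mO j2) -(RintegralD mO j3 (integrableZ_EFin mO (- k) j2)).
  by apply: eq_Rintegral => z _; rewrite /tens; ring.
apply: filterS => z h Oz; have := h Oz => /eqP.
by rewrite mulN1r subr_eq0 => /eqP.
Qed.

(** By [weak_Ix], f minus the primitive of p has vanishing weak x-derivative. *)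
Lemma wdx_Ix f p : L2Om f -> L2Om p -> wdx f p ->
  exists2 al, L2 (leb1 R) `[c, d] al &
    f = (fun z => al z.2 + Ix a p z) %[ae leb2 R in Om].
Proof.
move=> Lf Lp w; have [LI _] := Ix_L2 (ltW ab) Lp.
have Lw : L2Om (fun z => f z + (-1) * Ix a p z) by apply: (L2D mO) => //; exact: L2Z.
have L0 : L2 (leb1 R) `[c, d] (fun=> 0) by exact: (L20 _ (measurable_cc c d)).
have [|al Lal E] := wdx0_const Lw.
  move=> u v tu tv.
  have [tu' _] := test1_derive tu.
  rewrite (Rint_lin (-1) Lf LI (test1_tens_continuous tu' tv)) w//.
  have := weak_Ix (ltW ab) L0 Lp (xtest_tens tu tv).
  under eq_Rintegral do rewrite add0r.
  move=> ->; rewrite mulN1r opprK addNr.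
  under eq_Rintegral do rewrite mul0r.
  by rewrite (Rintegral_cst _ mO) mul0r oppr0.
exists al => //; apply: filterS E => z h Oz; rewrite -(h Oz); ring.
Qed.

End weak_derivatives.

(** * Functions recovered from corner, edge and mixed derivative data *)

Section weak_derivatives2.
Context (R : realType) (a b c d : R).
Hypotheses (ab : a < b) (cd : c < d).
Implicit Types (f g p q r : R * R -> R).

Local Notation Om := (Omega a b c d).
Local Notation L2Om := (L2 (leb2 R) Om).
Let mO := measurable_Om a b c d.

Lemma wdy_swap f p : L2Om f -> L2Om p -> wdy a b c d f p ->
  wdx c d a b (f \o @swapp R R) (p \o @swapp R R).
Proof.
move=> Lf Lp w u v tu tv.
have [tu' _] := test1_derive tu.
have sw (g : R * R -> R) := @Rintegral_swap _ _ _ _ _ (@lebesgue_measure R) (@lebesgue_measure R)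
  _ _ (measurable_cc a b) (measurable_cc c d) g.
have j1 := L2M_integrable mO Lf (continuous_Om_L2 a b c d (test1_tens_continuous tv tu')).
have j2 := L2M_integrable mO Lp (continuous_Om_L2 a b c d (test1_tens_continuous tv tu)).
have E1 := sw _ j1; have E2 := sw _ j2; have := w _ _ tv tu.
rewrite -E1 -E2 => E.
transitivity (\int[leb2 R]_(z in Omega c d a b) (f (swapp z) * tens v (derive1 u) (swapp z))).
  by apply: eq_Rintegral => z _; congr (_ * _); exact: mulrC.
rewrite [LHS]E; congr (- _).
by apply: eq_Rintegral => z _; congr (_ * _); exact: mulrC.
Qed.

Lemma wdy_Iy f p : L2Om f -> L2Om p -> wdy a b c d f p ->
  exists2 be, L2 (leb1 R) `[a, b] be &
    f = (fun z => be z.1 + Iy c p z) %[ae leb2 R in Om].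
Proof.
move=> Lf Lp w; have [Lf' _] := Omswap Lf; have [Lp' _] := Omswap Lp.
have [be Lbe E] := wdx_Ix cd ab Lf' Lp' (wdy_swap Lf Lp w).
exists be => //; have := Om_ae_swap E.
by apply: filterS => -[x y] h Oz; exact: h.
Qed.

(** The function with value k at (a, c), x-derivative [be] on y = c, y-derivative [al] on x = a and
    mixed derivative r. *)
Definition Qf (k : R) (be al : R -> R) r (z : R * R) : R :=
  k + Ix a (fun z => be z.1) z + Iy c (fun z => al z.2) z + Ix a (Iy c r) z.

Section Qf_theory.
Variables (k : R) (be al : R -> R) (r : R * R -> R).
Hypotheses (Lbe : L2 (leb1 R) `[a, b] be) (Lal : L2 (leb1 R) `[c, d] al) (Lr : L2Om r).

Let Lbe2 : L2Om (fun z => be z.1). Proof. by case: (L2_Om_fst c d Lbe). Qed.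
Let Lal2 : L2Om (fun z => al z.2). Proof. by case: (L2_Om_snd a b Lal). Qed.
Let LIyr : L2Om (Iy c r). Proof. by case: (Iy_L2 (ltW cd) Lr). Qed.
Let LIxr : L2Om (Ix a r). Proof. by case: (Ix_L2 (ltW ab) Lr). Qed.
Let LO k' : L2Om (fun=> k'). Proof. exact: (L2_cst mO (leb2_Om_fin a b c d)). Qed.

Lemma Qf_L2 : L2Om (Qf k be al r).
Proof.
apply: (L2D mO); last by case: (Ix_L2 (ltW ab) LIyr).
apply: (L2D mO); last by case: (Iy_L2 (ltW cd) Lal2).
by apply: (L2D mO) => //; case: (Ix_L2 (ltW ab) Lbe2).
Qed.

(** The one-variable fact is read off a slice of [Iy_L2], applied to a function of y alone. *)
Lemma Iy_snd_L2 : L2 (leb1 R) `[c, d] (fun y => \int[leb1 R]_(v in `[c, y]) al v).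
Proof.
have [LI _] := Iy_L2 (ltW cd) Lal2.
have [x _ h] := ae_itv_exists ab (Om_section1 LI).
by [].
Qed.

Lemma Ix_fst_L2 : L2 (leb1 R) `[a, b] (fun x => \int[leb1 R]_(v in `[a, x]) be v).
Proof.
have [LI _] := Ix_L2 (ltW ab) Lbe2.
have [x _ h] := ae_itv_exists cd (Om_section2 LI).
by [].
Qed.

(** Puts [Qf] in the shape required by [weak_Ix]: a function of y plus the x-primitive of what is
    thereby its weak x-derivative. *)
Lemma Qf_slice2 : Qf k be al r =
  (fun z => (k + \int[leb1 R]_(v in `[c, z.2]) al v) + Ix a (fun z => be z.1 + Iy c r z) z)
  %[ae leb2 R in Om].
Proof.
have := Om_ae_slice2 (P := fun z => Ix a (fun z => 1 * be z.1 + Iy c r z) z = 1 * Ix a (fun z => be z.1) z + Ix a (Iy c r) z)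
  (Ix_lin 1 Lbe2 LIyr).
apply: filterS => z h Oz; have := h Oz.
have -> : (fun z => 1 * be z.1 + Iy c r z) = (fun z => be z.1 + Iy c r z).
  by apply/funext => ?; rewrite mul1r.
move=> ->; rewrite /Qf mul1r /Iy /=; ring.
Qed.

Lemma Qf_slice1 : Qf k be al r =
  (fun z => (k + \int[leb1 R]_(v in `[a, z.1]) be v) + Iy c (fun z => al z.2 + Ix a r z) z)
  %[ae leb2 R in Om].
Proof.
have := Om_ae_slice1 (P := fun z => Iy c (fun z => 1 * al z.2 + Ix a r z) z = 1 * Iy c (fun z => al z.2) z + Iy c (Ix a r) z)
  (Iy_lin 1 Lal2 LIxr).
apply: filterS => z h Oz; have := h Oz.
have -> : (fun z => 1 * al z.2 + Ix a r z) = (fun z => al z.2 + Ix a r z).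
  by apply/funext => ?; rewrite mul1r.
move=> ->; rewrite /Qf mul1r (IxIy_comm (L2_Om_integrable Lr) Oz) /Ix /=; ring.
Qed.

Lemma Qf_weak_x psi dpsi : xtest a b psi dpsi ->
  \int[leb2 R]_(z in Om) (Qf k be al r z * dpsi z) =
  - \int[leb2 R]_(z in Om) ((be z.1 + Iy c r z) * psi z).
Proof.
move=> t; have [_ cdpsi _ _] := t.
have LB : L2Om (fun z => be z.1 + Iy c r z) by exact: (L2D mO).
have Lk : L2 (leb1 R) `[c, d] (fun y => k + \int[leb1 R]_(v in `[c, y]) al v).
  apply: (L2D (measurable_cc c d)); last exact: Iy_snd_L2.
  exact: (L2_cst (measurable_cc c d) (leb1_itv_fin c d)).
rewrite (Rint_ae Qf_L2 _ cdpsi Qf_slice2); first exact: (weak_Ix (ltW ab) Lk LB t).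
apply: (L2D mO); first by case: (L2_Om_snd a b Lk).
by case: (Ix_L2 (ltW ab) LB).
Qed.

Lemma Qf_weak_y psi dpsi : ytest c d psi dpsi -> continuous dpsi ->
  \int[leb2 R]_(z in Om) (Qf k be al r z * dpsi z) =
  - \int[leb2 R]_(z in Om) ((al z.2 + Ix a r z) * psi z).
Proof.
move=> t cdpsi.
have LB : L2Om (fun z => al z.2 + Ix a r z) by exact: (L2D mO).
have Lk : L2 (leb1 R) `[a, b] (fun x => k + \int[leb1 R]_(v in `[a, x]) be v).
  apply: (L2D (measurable_cc a b)); last exact: Ix_fst_L2.
  exact: (L2_cst (measurable_cc a b) (leb1_itv_fin a b)).
rewrite (Rint_ae Qf_L2 _ cdpsi Qf_slice1); first exact: (weak_Iy (ltW cd) Lk LB t).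
apply: (L2D mO); first by case: (L2_Om_fst c d Lk).
by case: (Iy_L2 (ltW cd) LB).
Qed.

End Qf_theory.

(** The edge data come from p and q. Then f minus the function with these data and corner value 0
    has two vanishing weak derivatives: it depends on y alone and on x alone, so it is a constant
    k. *)
Lemma wd_Qf f p q r : L2Om f -> L2Om p -> L2Om q -> L2Om r ->
  wdx a b c d f p -> wdy a b c d f q -> wdy a b c d p r -> wdx a b c d q r ->
  exists k be al, [/\ L2 (leb1 R) `[a, b] be, L2 (leb1 R) `[c, d] al,
    p = (fun z => be z.1 + Iy c r z) %[ae leb2 R in Om],
    q = (fun z => al z.2 + Ix a r z) %[ae leb2 R in Om] &
    f = Qf k be al r %[ae leb2 R in Om]].
Proof.
move=> Lf Lp Lq Lr wfp wfq wpr wqr.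
have [be Lbe Ep] := wdy_Iy Lp Lr wpr; have [al Lal Eq] := wdx_Ix ab cd Lq Lr wqr.
have LB : L2Om (fun z => be z.1 + Iy c r z).
  by apply: (L2D mO); [case: (L2_Om_fst c d Lbe)|case: (Iy_L2 (ltW cd) Lr)].
have LA : L2Om (fun z => al z.2 + Ix a r z).
  by apply: (L2D mO); [case: (L2_Om_snd a b Lal)|case: (Ix_L2 (ltW ab) Lr)].
have LQ := Qf_L2 0 Lbe Lal Lr.
pose h z := f z + (-1) * Qf 0 be al r z.
have Lh : L2Om h by apply: (L2D mO) => //; exact: L2Z.
have [A LAA hA] : exists2 A, L2 (leb1 R) `[c, d] A & h = (fun z => A z.2) %[ae leb2 R in Om].
  apply: (wdx0_const ab cd Lh) => u v tu tv.
  have [tu' _] := test1_derive tu.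
  rewrite (Rint_lin (-1) Lf LQ (test1_tens_continuous tu' tv)) wfp//.
  rewrite (Qf_weak_x 0 Lbe Lal Lr (xtest_tens tu tv)).
  rewrite (Rint_ae Lp LB (test1_tens_continuous tu tv) Ep) mulN1r opprK addNr.
  under eq_Rintegral do rewrite mul0r.
  by rewrite (Rintegral_cst _ mO) mul0r oppr0.
have [B LBB hB] : exists2 B, L2 (leb1 R) `[a, b] B & h = (fun z => B z.1) %[ae leb2 R in Om].
  have L0 : L2Om (fun=> 0) by exact: (L20 _ mO).
  have [|B LBB hB] := wdy_Iy Lh L0.
    move=> u v tu tv.
    have [tv' _] := test1_derive tv.
    rewrite (Rint_lin (-1) Lf LQ (test1_tens_continuous tu tv')) wfq//.
    rewrite (Qf_weak_y 0 Lbe Lal Lr (ytest_tens tu tv) (test1_tens_continuous tu tv')).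
    rewrite (Rint_ae Lq LA (test1_tens_continuous tu tv) Eq) mulN1r opprK addNr.
    under eq_Rintegral do rewrite mul0r.
    by rewrite (Rintegral_cst _ mO) mul0r oppr0.
  exists B => //; apply: filterS hB => z hz Oz; rewrite (hz Oz) /Iy /=.
  by rewrite (Rintegral_cst _ (measurable_cc _ _)) mul0r addr0.
have hAB : {ae leb2 R, forall z, Om z -> A z.2 = B z.1}.
  by apply: filterS2 hA hB => z h1 h2 Oz; rewrite -h1// h2.
(* A good x0 makes A(y) = B(x0) for almost every y; this value is the constant. *)
have [x0 x0ab hx0] := ae_itv_exists ab (Om_ae_section1 hAB).
exists (B x0), be, al; split => //.
have := Om_ae_snd a b (P := fun y => A y = B x0) hx0.
apply: filterS2 hA => z h1 h2 Oz.
have := h1 Oz; rewrite (h2 Oz) /h /Qf => E.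
have -> : f z = B x0 + Qf 0 be al r z by rewrite -E /h /Qf; ring.
rewrite /Qf; ring.
Qed.

End weak_derivatives2.

(** * Functions in H_1 and H_2 *)

Section forms.
Context (R : realType) (a b c d : R).
Hypotheses (ab : a < b) (cd : c < d).
Implicit Types (f g p q r : R * R -> R) (be al : R -> R).

Local Notation Om := (Omega a b c d).
Local Notation L2Om := (L2 (leb2 R) Om).
Local Notation L2x := (L2 (leb1 R) `[a, b]).
Local Notation L2y := (L2 (leb1 R) `[c, d]).
Local Notation Q := (Qf a c).
Let mO := measurable_Om a b c d.

Definition prim (l k : R) (h : R -> R) (x : R) : R := k + \int[leb1 R]_(t in `[l, x]) h t.

Definition edgex be r (z : R * R) : R := be z.1 + Iy c r z.
Definition edgey al r (z : R * R) : R := al z.2 + Ix a r z.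

Lemma edgex_L2 be r : L2x be -> L2Om r -> L2Om (edgex be r).
Proof.
move=> Lbe Lr; apply: (L2D mO); first by case: (L2_Om_fst c d Lbe).
by case: (Iy_L2 (ltW cd) Lr).
Qed.

Lemma edgey_L2 al r : L2y al -> L2Om r -> L2Om (edgey al r).
Proof.
move=> Lal Lr; apply: (L2D mO); first by case: (L2_Om_snd a b Lal).
by case: (Ix_L2 (ltW ab) Lr).
Qed.

Lemma primx_L2 k be : L2x be -> L2x (prim a k be).
Proof.
move=> Lbe; apply: (L2D (measurable_cc a b)); last exact: (Ix_fst_L2 ab cd Lbe).
exact: (L2_cst (measurable_cc a b) (leb1_itv_fin a b)).
Qed.

Lemma primy_L2 k al : L2y al -> L2y (prim c k al).
Proof.
move=> Lal; apply: (L2D (measurable_cc c d)); last exact: (Iy_snd_L2 ab cd Lal).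
exact: (L2_cst (measurable_cc c d) (leb1_itv_fin c d)).
Qed.

Lemma Ix_ae f g : L2Om f -> L2Om g -> f = g %[ae leb2 R in Om] ->
  Ix a f = Ix a g %[ae leb2 R in Om].
Proof.
move=> Lf Lg fg; apply: (Om_ae_slice2 (P := fun z => Ix a f z = Ix a g z)).
exact: Ix_cong (L2_measurable mO Lf) (L2_measurable mO Lg) fg.
Qed.

Lemma Iy_ae f g : L2Om f -> L2Om g -> f = g %[ae leb2 R in Om] ->
  Iy c f = Iy c g %[ae leb2 R in Om].
Proof.
move=> Lf Lg fg; apply: (Om_ae_slice1 (P := fun z => Iy c f z = Iy c g z)).
exact: Iy_cong (L2_measurable mO Lf) (L2_measurable mO Lg) fg.
Qed.

Lemma Qf_ae k be be' al al' r r' : L2x be -> L2x be' -> L2y al -> L2y al' ->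
  L2Om r -> L2Om r' ->
  (fun z : R * R => be z.1) = (fun z => be' z.1) %[ae leb2 R in Om] ->
  (fun z : R * R => al z.2) = (fun z => al' z.2) %[ae leb2 R in Om] ->
  r = r' %[ae leb2 R in Om] ->
  Q k be al r = Q k be' al' r' %[ae leb2 R in Om].
Proof.
move=> /(L2_Om_fst c d)[L1 _] /(L2_Om_fst c d)[L2 _] /(L2_Om_snd a b)[L3 _] /(L2_Om_snd a b)[L4 _] L5 L6 E1 E2 E3.
have [L7 _] := Iy_L2 (ltW cd) L5; have [L8 _] := Iy_L2 (ltW cd) L6.
have H1 := Ix_ae L1 L2 E1; have H2 := Iy_ae L3 L4 E2.
have H3 := Ix_ae L7 L8 (Iy_ae L5 L6 E3).
by apply: filterS3 H1 H2 H3 => z h1 h2 h3 Oz; rewrite /Qf (h1 Oz) (h2 Oz) (h3 Oz).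
Qed.

Lemma Om_ae_trans f g h : f = g %[ae leb2 R in Om] -> g = h %[ae leb2 R in Om] ->
  f = h %[ae leb2 R in Om].
Proof. exact: ae_eq_trans. Qed.

Lemma Om_ae_sym f g : f = g %[ae leb2 R in Om] -> g = f %[ae leb2 R in Om].
Proof. exact: ae_eq_sym. Qed.

(** First order weak derivatives, now against all test functions; the derivatives demanded by
    [is_wderiv] are chains of these. *)
Definition WX f g := forall phi, test_function a b c d phi ->
  \int[leb2 R]_(z in Om) (f z * 'D_((1, 0) : R * R) phi z) =
  - \int[leb2 R]_(z in Om) (g z * phi z).

Definition WY f g := forall phi, test_function a b c d phi ->
  \int[leb2 R]_(z in Om) (f z * 'D_((0, 1) : R * R) phi z) =
  - \int[leb2 R]_(z in Om) (g z * phi z).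

Lemma WX_ae f g g' : L2Om g -> L2Om g' -> g = g' %[ae leb2 R in Om] -> WX f g -> WX f g'.
Proof.
move=> Lg Lg' gg' w phi tphi.
by rewrite w// (Rint_ae Lg Lg' (test_function_continuous tphi) gg').
Qed.

Lemma WY_ae f g g' : L2Om g -> L2Om g' -> g = g' %[ae leb2 R in Om] -> WY f g -> WY f g'.
Proof.
move=> Lg Lg' gg' w phi tphi.
by rewrite w// (Rint_ae Lg Lg' (test_function_continuous tphi) gg').
Qed.

Lemma is_wderiv00 f : is_wderiv a b c d 0 0 f f.
Proof. by move=> phi _; rewrite expr0 mul1r. Qed.

Lemma is_wderivSx i j f g h : WX f g -> is_wderiv a b c d i j g h ->
  is_wderiv a b c d i.+1 j f h.
Proof.
move=> w wh phi tphi; rewrite [LHS]w; last exact: test_function_partial.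
by rewrite wh// addSn exprS mulN1r mulNr.
Qed.

(** Stated for order 0 in x, where the y-derivative is outermost in [partial_xy]. The chains below
    therefore take all x-steps before the y-steps, and partial derivatives of test functions are
    never commuted. *)
Lemma is_wderivSy j f g h : WY f g -> is_wderiv a b c d 0 j g h ->
  is_wderiv a b c d 0 j.+1 f h.
Proof.
move=> w wh phi tphi; rewrite [LHS]w; last exact: (test_function_partial 0 j).
by rewrite -[X in - X]/(\int[leb2 R]_(z in Om) (g z * partial_xy 0 j phi z)) wh// !add0n exprS mulN1r mulNr.
Qed.

Lemma Qf_WX k be al r : L2x be -> L2y al -> L2Om r -> WX (Q k be al r) (edgex be r).
Proof.
move=> L1 L2 L3 phi tphi.
exact: (Qf_weak_x ab cd k L1 L2 L3 (test_function_xtest tphi)).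
Qed.

Lemma Qf_WY k be al r : L2x be -> L2y al -> L2Om r -> WY (Q k be al r) (edgey al r).
Proof.
move=> L1 L2 L3 phi tphi.
apply: (Qf_weak_y ab cd k L1 L2 L3 (test_function_ytest tphi)).
exact: test_function_continuous (test_function_derive _ tphi).
Qed.

Lemma edgex_WY be r : L2x be -> L2Om r -> WY (edgex be r) r.
Proof.
by move=> L1 L2 phi tphi; exact: (weak_Iy (ltW cd) L1 L2 (test_function_ytest tphi)).
Qed.

(** The same function seen from the edge x = a: its trace there is the primitive of [al], its
    x-derivative is [edgex be r]. *)
Lemma Qf_edgey k be al r : L2x be -> L2y al -> L2Om r ->
  Q k be al r = edgey (prim c k al) (edgex be r) %[ae leb2 R in Om].
Proof. by move=> L1 _ L3; exact: (Qf_slice2 cd k al L1 L3). Qed.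

Lemma Qf_edgex k be al r : L2x be -> L2y al -> L2Om r ->
  Q k be al r = edgex (prim a k be) (edgey al r) %[ae leb2 R in Om].
Proof. by move=> L1 L2 L3; exact: (Qf_slice1 ab k be L2 L3). Qed.

Lemma edgex_ae be r r' : L2Om r -> L2Om r' -> r = r' %[ae leb2 R in Om] ->
  edgex be r = edgex be r' %[ae leb2 R in Om].
Proof.
by move=> L1 L2 /(Iy_ae L1 L2); apply: filterS => z h Oz; rewrite /edgex (h Oz).
Qed.

Lemma edgey_ae al r r' : L2Om r -> L2Om r' -> r = r' %[ae leb2 R in Om] ->
  edgey al r = edgey al r' %[ae leb2 R in Om].
Proof.
by move=> L1 L2 /(Ix_ae L1 L2); apply: filterS => z h Oz; rewrite /edgey (h Oz).
Qed.

(* The weak derivatives of a function in H_1 with traces k, be, al and mixed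
   derivative v. *)
Definition form1 k be al v (i j : nat) : R * R -> R :=
  match i, j with
  | 0, 0 => Q k be al v
  | 1, 0 => edgex be v
  | 0, 1 => edgey al v
  | _, _ => v
  end.

Lemma form1_L2 k be al v i j : L2x be -> L2y al -> L2Om v -> L2Om (form1 k be al v i j).
Proof.
move=> L1 L2 L3; case: i => [|[|i]]; case: j => [|[|j]] //=.
- exact: Qf_L2.
- exact: edgey_L2.
- exact: edgex_L2.
Qed.

Lemma form1_wderiv k be al v i j : (i <= 1)%N -> (j <= 1)%N ->
  L2x be -> L2y al -> L2Om v ->
  is_wderiv a b c d i j (form1 k be al v 0 0) (form1 k be al v i j).
Proof.
move=> i1 j1 L1 L2 L3.
case: i i1 => [|[|//]] _; case: j j1 => [|[|//]] _ /=.
- exact: is_wderiv00.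
- exact: is_wderivSy (Qf_WY k L1 L2 L3) (@is_wderiv00 _).
- exact: is_wderivSx (Qf_WX k L1 L2 L3) (@is_wderiv00 _).
- apply: is_wderivSx (Qf_WX k L1 L2 L3) _.
  exact: is_wderivSy (edgex_WY L1 L3) (@is_wderiv00 _).
Qed.

(* The same for a function in H_2; k00, k10, k01, k11 are the values at (a, c) of
   its derivatives of order at most one in each variable, be0 and be1 the traces
   on y = c of d_x^2 and d_x^2 d_y, al0 and al1 those on x = a of d_y^2 and
   d_x d_y^2. *)
Definition form2 k00 k10 k01 k11 be0 be1 al0 al1 v (i j : nat) : R * R -> R :=
  match i, j with
  | 1, 1 => Q k11 be1 al1 v
  | 2, 1 => edgex be1 v
  | 1, 2 => edgey al1 v
  | 1, 0 => Q k10 be0 (prim c k11 al1) (edgex be1 v)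
  | 0, 1 => Q k01 (prim a k11 be1) al0 (edgey al1 v)
  | 2, 0 => edgex be0 (edgex be1 v)
  | 0, 2 => edgey al0 (edgey al1 v)
  | 0, 0 => Q k00 (prim a k10 be0) (prim c k01 al0) (Q k11 be1 al1 v)
  | _, _ => v
  end.

Section form2_theory.
Variables (k00 k10 k01 k11 : R) (be0 be1 al0 al1 : R -> R) (v : R * R -> R).
Hypotheses (Lb0 : L2x be0) (Lb1 : L2x be1) (La0 : L2y al0) (La1 : L2y al1) (Lv : L2Om v).

Let F := form2 k00 k10 k01 k11 be0 be1 al0 al1 v.

Lemma form2_L2 i j : L2Om (F i j).
Proof.
have h1 := edgex_L2 Lb1 Lv; have h2 := edgey_L2 La1 Lv.
have p1 := primx_L2 k11 Lb1; have p2 := primx_L2 k10 Lb0.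
have p3 := primy_L2 k11 La1; have p4 := primy_L2 k01 La0.
case: i => [|[|[|i]]]; case: j => [|[|[|j]]]; try exact: Lv.
- exact: (Qf_L2 ab cd k00 p2 p4 (Qf_L2 ab cd k11 Lb1 La1 Lv)).
- exact: (Qf_L2 ab cd k01 p1 La0 h2).
- exact: (edgey_L2 La0 h2).
- exact: (Qf_L2 ab cd k10 Lb0 p3 h1).
- exact: (Qf_L2 ab cd k11 Lb1 La1 Lv).
- exact: h2.
- exact: (edgex_L2 Lb0 h1).
- exact: h1.
Qed.

Let L21 : L2Om (edgex be1 v). Proof. exact: (form2_L2 2 1). Qed.
Let L12 : L2Om (edgey al1 v). Proof. exact: (form2_L2 1 2). Qed.
Let L11 : L2Om (Q k11 be1 al1 v). Proof. exact: (form2_L2 1 1). Qed.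

(** The outer [Qf] of [F 0 0] yields its x-derivative as the left-hand side, whereas [F 1 0] is
    written so that it can be differentiated in x again. They are two orders of integration of the
    same data. *)
Lemma form2_x00 : edgex (prim a k10 be0) (F 1 1) = F 1 0 %[ae leb2 R in Om].
Proof.
have E1 := Qf_edgex k10 Lb0 (primy_L2 k11 La1) L21.
have E2 := Qf_edgey k11 Lb1 La1 Lv.
have E3 := edgex_ae (prim a k10 be0) L11 (edgey_L2 (primy_L2 k11 La1) L21) E2.
exact: Om_ae_trans E3 (Om_ae_sym E1).
Qed.

Lemma form2_y00 : edgey (prim c k01 al0) (F 1 1) = F 0 1 %[ae leb2 R in Om].
Proof.
have E1 := Qf_edgey k01 (primx_L2 k11 Lb1) La0 L12.
have E2 := Qf_edgex k11 Lb1 La1 Lv.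
have E3 := edgey_ae (prim c k01 al0) L11 (edgex_L2 (primx_L2 k11 Lb1) L12) E2.
exact: Om_ae_trans E3 (Om_ae_sym E1).
Qed.

Lemma form2_wderiv i j : (i <= 2)%N -> (j <= 2)%N ->
  is_wderiv a b c d i j (F 0 0) (F i j).
Proof.
have x00 : WX (F 0 0) (F 1 0).
  exact: (WX_ae (edgex_L2 (primx_L2 k10 Lb0) L11) (form2_L2 1 0) form2_x00
    (Qf_WX k00 (primx_L2 k10 Lb0) (primy_L2 k01 La0) L11)).
have y00 : WY (F 0 0) (F 0 1).
  exact: (WY_ae (edgey_L2 (primy_L2 k01 La0) L11) (form2_L2 0 1) form2_y00
    (Qf_WY k00 (primx_L2 k10 Lb0) (primy_L2 k01 La0) L11)).
have x10 : WX (F 1 0) (F 2 0) := Qf_WX k10 Lb0 (primy_L2 k11 La1) L21.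
have y10 : WY (F 1 0) (F 1 1).
  exact: (WY_ae (edgey_L2 (primy_L2 k11 La1) L21) (form2_L2 1 1)
    (ae_eq_sym (Qf_edgey k11 Lb1 La1 Lv)) (Qf_WY k10 Lb0 (primy_L2 k11 La1) L21)).
have y01 : WY (F 0 1) (F 0 2) := Qf_WY k01 (primx_L2 k11 Lb1) La0 L12.
have y11 : WY (F 1 1) (F 1 2) := Qf_WY k11 Lb1 La1 Lv.
have y20 : WY (F 2 0) (F 2 1) := edgex_WY Lb0 L21.
have y21 : WY (F 2 1) (F 2 2) := edgex_WY Lb1 Lv.
case: i => [|[|[|//]]] _; case: j => [|[|[|//]]] _.
- exact: is_wderiv00.
- exact: is_wderivSy y00 (@is_wderiv00 _).
- exact: is_wderivSy y00 (is_wderivSy y01 (@is_wderiv00 _)).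
- exact: is_wderivSx x00 (@is_wderiv00 _).
- exact: is_wderivSx x00 (is_wderivSy y10 (@is_wderiv00 _)).
- exact: is_wderivSx x00 (is_wderivSy y10 (is_wderivSy y11 (@is_wderiv00 _))).
- exact: is_wderivSx x00 (is_wderivSx x10 (@is_wderiv00 _)).
- exact: is_wderivSx x00 (is_wderivSx x10 (is_wderivSy y20 (@is_wderiv00 _))).
- exact: is_wderivSx x00 (is_wderivSx x10 (is_wderivSy y20 (is_wderivSy y21 (@is_wderiv00 _)))).
Qed.

End form2_theory.

Lemma in_H_wderiv k f i j : in_H a b c d k f -> (i <= k)%N -> (j <= k)%N ->
  L2Om (wderiv a b c d i j f) /\ is_wderiv a b c d i j f (wderiv a b c d i j f).
Proof. by move=> [_ h] ik jk; have [g [Lg w]] := h _ _ ik jk; exact: wderivP w. Qed.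

Lemma in_H_form1 k be al v : L2x be -> L2y al -> L2Om v ->
  in_H a b c d 1 (form1 k be al v 0 0).
Proof.
move=> L1 L2 L3; split; first exact: form1_L2.
by move=> i j i1 j1; exists (form1 k be al v i j); split; [exact: form1_L2|exact: form1_wderiv].
Qed.

Lemma in_H_form2 k00 k10 k01 k11 be0 be1 al0 al1 v :
  L2x be0 -> L2x be1 -> L2y al0 -> L2y al1 -> L2Om v ->
  in_H a b c d 2 (form2 k00 k10 k01 k11 be0 be1 al0 al1 v 0 0).
Proof.
move=> L1 L2 L3 L4 L5; split; first exact: form2_L2.
move=> i j i1 j1; exists (form2 k00 k10 k01 k11 be0 be1 al0 al1 v i j).
by split; [exact: form2_L2|exact: form2_wderiv].
Qed.

Lemma in_H1_form f : in_H a b c d 1 f -> exists k be al, [/\ L2x be, L2y al &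
  f = form1 k be al (wderiv a b c d 1 1 f) 0 0 %[ae leb2 R in Om]].
Proof.
move=> Hf; have [Lf _] := Hf.
have [L10 w10] := @in_H_wderiv _ _ 1 0 Hf isT isT.
have [L01 w01] := @in_H_wderiv _ _ 0 1 Hf isT isT.
have [L11 w11] := @in_H_wderiv _ _ 1 1 Hf isT isT.
have w00 := @is_wderiv00 f.
have [k [be [al [Lbe Lal _ _ E]]]] := wd_Qf ab cd Lf L10 L01 L11
  (is_wderiv_wdx w10 w00) (is_wderiv_wdy w01 w00) (is_wderiv_wdy w11 w10) (is_wderiv_wdx w11 w01).
by exists k, be, al.
Qed.

(** [wd_Qf] is applied to the mixed derivative, to both first derivatives and to f. Each application
    produces its own edge functions; those that are not free data are identified with primitives of
    the others. *)
Lemma in_H2_form f : in_H a b c d 2 f ->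
  exists k00 k10 k01 k11 be0 be1 al0 al1, [/\ L2x be0, L2x be1, L2y al0, L2y al1 &
  f = form2 k00 k10 k01 k11 be0 be1 al0 al1 (wderiv a b c d 2 2 f) 0 0 %[ae leb2 R in Om]].
Proof.
move=> Hf; have [Lf _] := Hf; have w00 := @is_wderiv00 f.
have [L10 w10] := @in_H_wderiv _ _ 1 0 Hf isT isT.
have [L01 w01] := @in_H_wderiv _ _ 0 1 Hf isT isT.
have [L11 w11] := @in_H_wderiv _ _ 1 1 Hf isT isT.
have [L20 w20] := @in_H_wderiv _ _ 2 0 Hf isT isT.
have [L02 w02] := @in_H_wderiv _ _ 0 2 Hf isT isT.
have [L21 w21] := @in_H_wderiv _ _ 2 1 Hf isT isT.
have [L12 w12] := @in_H_wderiv _ _ 1 2 Hf isT isT.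
have [L22 w22] := @in_H_wderiv _ _ 2 2 Hf isT isT.
have [k11 [be1 [al1 [Lb1 La1 E21 E12 E11]]]] := wd_Qf ab cd L11 L21 L12 L22
  (is_wderiv_wdx w21 w11) (is_wderiv_wdy w12 w11) (is_wderiv_wdy w22 w21) (is_wderiv_wdx w22 w12).
have [k10 [be0 [A' [Lb0 LA' E20 E11' E10]]]] := wd_Qf ab cd L10 L20 L11 L21
  (is_wderiv_wdx w20 w10) (is_wderiv_wdy w11 w10) (is_wderiv_wdy w21 w20) (is_wderiv_wdx w21 w11).
have [k01 [B' [al0 [LB' La0 E11'' E02 E01]]]] := wd_Qf ab cd L01 L11 L02 L12
  (is_wderiv_wdx w11 w01) (is_wderiv_wdy w02 w01) (is_wderiv_wdy w12 w11) (is_wderiv_wdx w12 w02).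
have [k00 [B'' [A'' [LB'' LA'' E10' E01' E00]]]] := wd_Qf ab cd Lf L10 L01 L11
  (is_wderiv_wdx w10 w00) (is_wderiv_wdy w01 w00) (is_wderiv_wdy w11 w10) (is_wderiv_wdx w11 w01).
exists k00, k10, k01, k11, be0, be1, al0, al1; split; [exact: Lb0|exact: Lb1|exact: La0|exact: La1|].
set v := wderiv a b c d 2 2 f in E21 E12 E11 L22 w22 *.
pose F := form2 k00 k10 k01 k11 be0 be1 al0 al1 v.
have LF i j : L2Om (F i j) by exact: form2_L2.
(* The mixed derivative has two expressions as an edge function plus an x-primitive; the primitives
   agree, hence so do the edge functions. The next three identifications follow this pattern. *)
have EA : (fun z : R * R => A' z.2) = (fun z => prim c k11 al1 z.2) %[ae leb2 R in Om].
  have H1 := Qf_edgey k11 Lb1 La1 L22.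
  have H2 := Ix_ae L21 (LF 2 1) E21.
  have H3 : {ae leb2 R, forall z, Om z -> edgey A' (wderiv a b c d 2 1 f) z = F 1 1 z}.
    exact: Om_ae_trans (Om_ae_sym E11') E11.
  apply: filterS3 H1 H2 H3 => z h1 h2 h3 Oz.
  have := etrans (h3 Oz) (h1 Oz); rewrite /edgey (h2 Oz); exact: addIr.
have EB : (fun z : R * R => B' z.1) = (fun z => prim a k11 be1 z.1) %[ae leb2 R in Om].
  have H1 := Qf_edgex k11 Lb1 La1 L22.
  have H2 := Iy_ae L12 (LF 1 2) E12.
  have H3 : {ae leb2 R, forall z, Om z -> edgex B' (wderiv a b c d 1 2 f) z = F 1 1 z}.
    exact: Om_ae_trans (Om_ae_sym E11'') E11.
  apply: filterS3 H1 H2 H3 => z h1 h2 h3 Oz.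
  have := etrans (h3 Oz) (h1 Oz); rewrite /edgex (h2 Oz); exact: addIr.
have F10 : wderiv a b c d 1 0 f = F 1 0 %[ae leb2 R in Om].
  have H := Qf_ae k10 Lb0 Lb0 LA' (primy_L2 k11 La1) L21 (LF 2 1) (@ae_eq_refl _ _ _ _ _ _ _) EA E21.
  exact: Om_ae_trans E10 H.
have F01 : wderiv a b c d 0 1 f = F 0 1 %[ae leb2 R in Om].
  have H := Qf_ae k01 LB' (primx_L2 k11 Lb1) La0 La0 L12 (LF 1 2) EB (@ae_eq_refl _ _ _ _ _ _ _) E12.
  exact: Om_ae_trans E01 H.
have EB'' : (fun z : R * R => B'' z.1) = (fun z => prim a k10 be0 z.1) %[ae leb2 R in Om].
  have H1 := form2_x00 k00 k10 k01 k11 Lb0 Lb1 La0 La1 L22.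
  have H2 := Iy_ae L11 (LF 1 1) E11.
  have H3 : {ae leb2 R, forall z, Om z -> edgex B'' (wderiv a b c d 1 1 f) z = F 1 0 z}.
    exact: Om_ae_trans (Om_ae_sym E10') F10.
  apply: filterS3 H1 H2 H3 => z h1 h2 h3 Oz.
  have := etrans (h3 Oz) (esym (h1 Oz)); rewrite /edgex (h2 Oz); exact: addIr.
have EA'' : (fun z : R * R => A'' z.2) = (fun z => prim c k01 al0 z.2) %[ae leb2 R in Om].
  have H1 := form2_y00 k00 k10 k01 k11 Lb0 Lb1 La0 La1 L22.
  have H2 := Ix_ae L11 (LF 1 1) E11.
  have H3 : {ae leb2 R, forall z, Om z -> edgey A'' (wderiv a b c d 1 1 f) z = F 0 1 z}.
    exact: Om_ae_trans (Om_ae_sym E01') F01.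
  apply: filterS3 H1 H2 H3 => z h1 h2 h3 Oz.
  have := etrans (h3 Oz) (esym (h1 Oz)); rewrite /edgey (h2 Oz); exact: addIr.
have H := Qf_ae k00 LB'' (primx_L2 k10 Lb0) LA'' (primy_L2 k01 La0) L11 (LF 1 1) EB'' EA'' E11.
exact: Om_ae_trans E00 H.
Qed.

End forms.

(** * Traces *)

Section traces.
Context (R : realType).
Implicit Types (a b c d x y : R) (f g r : R * R -> R).

(** The point may be an endpoint, so the small interval is taken to the right of x0 when x0 < b and
    to its left otherwise. Having positive length, it meets every set of full measure. *)
Lemma subitv a b x0 e : a < b -> a <= x0 <= b -> 0 < e ->
  exists a' b', a' < b' /\ forall t, a' <= t <= b' -> a <= t <= b /\ `|x0 - t| < e.
Proof.
move=> ab /andP[ax xb] e0.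
have [xlb|blx] := ltP x0 b.
  exists x0, (Num.min b (x0 + e / 2)); split; first by rewrite lt_min xlb ltrDl divr_gt0.
  move=> t /andP[xt]; rewrite le_min => /andP[tb te].
  rewrite (le_trans ax xt) tb; split => //.
  by rewrite distrC ger0_norm ?subr_ge0//; lra.
exists (Num.max a (x0 - e / 2)), x0; split.
  by rewrite gt_max (lt_le_trans ab blx)/=; lra.
move=> t /andP[]; rewrite ge_max => /andP[at_ te] tx.
rewrite at_ (le_trans tx xb); split => //.
by rewrite ger0_norm ?subr_ge0//; lra.
Qed.

Lemma continuous_ae0_itv a b (F : R -> R) x0 : a < b ->
  {within `[a, b], continuous F} -> F = (fun=> 0) %[ae leb1 R in `[a, b]%classic] ->
  a <= x0 <= b -> F x0 = 0.
Proof.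
move=> ab cF F0 xab; apply/eqP/negPn/negP => Fx.
have e0 : 0 < `|F x0| by rewrite normr_gt0.
have := ((subspace_continuousP _ _).1 cF) x0 (itv_in xab).
move=> /cvgrPdist_lt/(_ _ e0)/nbhs_ballP[e /= ep he].
have [a' [b' [ab' sub]]] := subitv ab xab ep.
have [t tab Ft] : exists2 t, `[a', b']%classic t & F t = 0.
  apply: (ae_itv_exists ab'); apply: filterS F0 => t h.
  by rewrite /= in_itv /= => /sub[tab _]; apply: h; rewrite /= in_itv.
move: tab; rewrite /= in_itv /= => /sub[tab xt].
have : `|F x0 - F t| < `|F x0| := he t xt (itv_in tab).
by rewrite Ft subr0 ltxx.
Qed.

Lemma continuous_ae0_Om a b c d (F : R * R -> R) z0 : a < b -> c < d ->
  {within Omega a b c d, continuous F} -> F = (fun=> 0) %[ae leb2 R in Omega a b c d] ->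
  Omega a b c d z0 -> F z0 = 0.
Proof.
case: z0 => x0 y0 ab cd cF F0 Oz; apply/eqP/negPn/negP => Fx.
have e0 : 0 < `|F (x0, y0)| by rewrite normr_gt0.
have := ((subspace_continuousP _ _).1 cF) (x0, y0) Oz.
move=> /cvgrPdist_lt/(_ _ e0)/nbhs_ballP[e /= ep he].
case: (Oz) => /=; rewrite !in_itv /= => xab ycd.
have [a' [b' [ab' subx]]] := subitv ab xab ep.
have [c' [d' [cd' suby]]] := subitv cd ycd ep.
have F0' : {ae leb2 R, forall z, Omega a' b' c' d' z -> F z = 0}.
  apply: filterS F0 => -[s t] h [] /=; rewrite !in_itv /= => /subx[sab _] /suby[tcd _].
  by apply: h; split; rewrite /= in_itv.
have [x xab' hx] := ae_itv_exists ab' (Om_ae_section1 F0').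
have [y ycd' Fxy] := ae_itv_exists cd' hx.
move: xab' ycd'; rewrite /= !in_itv /= => /subx[xab1 xt] /suby[ycd1 yt].
have Oxy : Omega a b c d (x, y) by split; rewrite /= in_itv.
have hb : ball (x0, y0) e (x, y) by split.
have : `|F (x0, y0) - F (x, y)| < `|F (x0, y0)| := he _ hb Oxy.
by rewrite Fxy subr0 ltxx.
Qed.

Lemma within_Om_fst a b c d (P : R -> R) : {within `[a, b], continuous P} ->
  {within Omega a b c d, continuous (fun z => P z.1)}.
Proof.
move=> /subspace_continuousP cP; apply/subspace_continuousP => -[x y] [/= xab ycd].
apply: (@cvg_comp _ _ _ (fun z : R * R => z.1) P _ (within `[a, b]%classic (nbhs x))); last exact: cP.
move=> A /= hA; rewrite /within /=.
have hz : \forall z \near (x, y), `[a, b]%classic z.1 -> A z.1.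
  exact: (@cvg_fst _ _ (nbhs x) (nbhs y) _ _ hA).
by apply: filterS hz => z h Oz; apply: h; case: Oz.
Qed.

Lemma within_Om_snd a b c d (P : R -> R) : {within `[c, d], continuous P} ->
  {within Omega a b c d, continuous (fun z => P z.2)}.
Proof.
move=> /subspace_continuousP cP; apply/subspace_continuousP => -[x y] [/= xab ycd].
apply: (@cvg_comp _ _ _ (fun z : R * R => z.2) P _ (within `[c, d]%classic (nbhs y))); last exact: cP.
move=> A /= hA; rewrite /within /=.
have hz : \forall z \near (x, y), `[c, d]%classic z.2 -> A z.2.
  exact: (@cvg_snd _ _ (nbhs x) (nbhs y) _ _ hA).
by apply: filterS hz => z h Oz; apply: h; case: Oz.
Qed.

Lemma prim_continuous a b (f : R -> R) : a <= b -> L2 (leb1 R) `[a, b] f ->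
  {within `[a, b], continuous (fun x => \int[leb1 R]_(t in `[a, x]) f t)}.
Proof. by move=> ab Lf; exact: (parameterized_integral_continuous ab (L2_itv_integrable Lf)). Qed.

(** A modulus of continuity in x that is uniform in y: enlarge [c, y] to [c, d] under the absolute
    value. With its mirror image this gives joint continuity. *)
Lemma IxIy_dist_x a b c d r x x' y : a < b -> c < d ->
  L2 (leb2 R) (Omega a b c d) r -> a <= x' -> x' <= x -> x <= b -> c <= y <= d ->
  `|Ix a (Iy c r) (x, y) - Ix a (Iy c r) (x', y)| <=
  (\int[leb1 R]_(t in `[a, x]) \int[leb1 R]_(v in `[c, d]) `|r (t, v)|) -
  (\int[leb1 R]_(t in `[a, x']) \int[leb1 R]_(v in `[c, d]) `|r (t, v)|).
Proof.
move=> ab cd Lr ax x'x xb /andP[cy yd].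
pose V t := \int[leb1 R]_(v in `[c, d]) `|r (t, v)|.
pose I t := \int[leb1 R]_(v in `[c, y]) r (t, v).
have jr := L2_Om_integrable Lr.
have mab := measurable_cc a b; have mcd := measurable_cc c d; have mcy := measurable_cc c y.
have fub (u w : R) (g : R * R -> R) := @fubini_integrable1 _ _ _ _ _ (@lebesgue_measure R)
  (@lebesgue_measure R) _ _ mab (measurable_cc u w) g.
have jV : (leb1 R).-integrable `[a, b] (EFin \o V).
  exact: (fub _ _ (fun z => `|r z|) (integrable_norm jr)).
have Oby : Omega a b c d (b, y) by split; rewrite /= in_itv /= ?lexx ?(ltW ab) ?cy ?yd.
have jI : (leb1 R).-integrable `[a, b] (EFin \o I).
  exact: (fub _ _ r (integrable_Om_trunc Oby jr)).
have E (f : R -> R) : (leb1 R).-integrable `[a, b] (EFin \o f) ->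
    \int[leb1 R]_(t in `[a, x]) f t - \int[leb1 R]_(t in `[a, x']) f t =
    \int[leb1 R]_(t in `]x', x]) f t.
  by move=> jf; rewrite Rintegral_itvB ?bnd_simp//; exact: integrable_trunc jf.
have EI : Ix a (Iy c r) (x, y) - Ix a (Iy c r) (x', y) = \int[leb1 R]_(t in `]x', x]) I t.
  exact: E jI.
rewrite EI (E V jV).
have moc : measurable (`]x', x]%classic : set (measurableTypeR R)) by exact: measurable_itv.
have sub : `]x', x]%classic `<=` `[a, b]%classic.
  by move=> t /=; rewrite !in_itv /= => /andP[xt tx]; rewrite (le_trans ax (ltW xt)) (le_trans tx xb).
have jI' := integrableS mab moc sub jI; have jV' := integrableS mab moc sub jV.
apply: (le_trans (le_normr_Rintegral moc jI')).
rewrite /Rintegral; apply: fine_le.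
- exact: integrable_fin_num (integrable_norm jI').
- exact: integrable_fin_num jV'.
have /measurable_EFinP mI := measurable_int _ jI'.
apply: ae_ge0_le_integral => //.
- by apply/measurable_EFinP; exact: measurableT_comp mI.
- by move=> t _; rewrite lee_fin; apply: Rintegral_ge0.
- exact: measurable_int jV'.
have ae1 := @fubini_ae_integrable1 _ _ _ _ _ (@lebesgue_measure R)
  (@lebesgue_measure R) _ _ mab mcd _ jr.
apply: filterS ae1 => t h xt; have jt := h (sub _ xt); rewrite lee_fin.
apply: (le_trans (le_normr_Rintegral mcy (integrable_trunc yd jt))).
rewrite /Rintegral; apply: fine_le.
- exact: integrable_fin_num (integrable_norm (integrable_trunc yd jt)).
- exact: integrable_fin_num (integrable_norm jt).
apply: ge0_subset_integral => //.
- exact: measurable_int (integrable_norm jt).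
- by move=> v /=; rewrite !in_itv /= => /andP[-> vy]; rewrite (le_trans vy yd).
Qed.

(** One goes from (x, y) to z through (z.1, y), with half of e for each leg. *)
Lemma Om_dist_continuous a b c d (F : R * R -> R) (P P' : R -> R) :
  {within `[a, b], continuous P} -> {within `[c, d], continuous P'} ->
  (forall x x' y, a <= x' -> x' <= x -> x <= b -> c <= y <= d ->
    `|F (x, y) - F (x', y)| <= P x - P x') ->
  (forall x y y', c <= y' -> y' <= y -> y <= d -> a <= x <= b ->
    `|F (x, y) - F (x, y')| <= P' y - P' y') ->
  {within Omega a b c d, continuous F}.
Proof.
move=> cP cP' FP FP'.
have FPx x x' y : a <= x <= b -> a <= x' <= b -> c <= y <= d ->
    `|F (x, y) - F (x', y)| <= `|P x - P x'|.
  move=> /andP[ax xb] /andP[ax' xb'] hy; have [h|h] := leP x x'.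
    by rewrite distrC [leRHS]distrC (le_trans (FP _ _ _ ax h xb' hy))// ler_norm.
  by rewrite (le_trans (FP _ _ _ ax' (ltW h) xb hy))// ler_norm.
have FPy x y y' : a <= x <= b -> c <= y <= d -> c <= y' <= d ->
    `|F (x, y) - F (x, y')| <= `|P' y - P' y'|.
  move=> hx /andP[ay yb] /andP[ay' yb']; have [h|h] := leP y y'.
    by rewrite distrC [leRHS]distrC (le_trans (FP' _ _ _ ay h yb' hx))// ler_norm.
  by rewrite (le_trans (FP' _ _ _ ay' (ltW h) yb hx))// ler_norm.
apply/subspace_continuousP => -[x y] Oz; apply/cvgrPdist_lt => e e0.
have e2 : 0 < e / 2 by rewrite divr_gt0.
have h1 := ((subspace_continuousP _ _).1 (@within_Om_fst a b c d P cP)) _ Oz.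
have h2 := ((subspace_continuousP _ _).1 (@within_Om_snd a b c d P' cP')) _ Oz.
have {}h1 := ((cvgrPdist_lt _ _).1 h1) _ e2; have {}h2 := ((cvgrPdist_lt _ _).1 h2) _ e2.
case: Oz => /=; rewrite !in_itv /= => xab ycd.
have h3 : \forall z \near within (Omega a b c d) (nbhs (x, y)), Omega a b c d z.
  exact: withinT.
near=> z.
have a1 : `|P x - P z.1| < e / 2 by near: z; exact: h1.
have a2 : `|P' y - P' z.2| < e / 2 by near: z; exact: h2.
have a3 : Omega a b c d z by near: z; exact: h3.
case: (a3) => /=; rewrite !in_itv /= => xab' ycd'.
have -> : F (x, y) - F z = (F (x, y) - F (z.1, y)) + (F (z.1, y) - F (z.1, z.2)).
  by rewrite -surjective_pairing; ring.
apply: (le_lt_trans (ler_normD _ _)).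
have := FPx _ _ _ xab xab' ycd; have := FPy _ _ _ xab' ycd ycd'; lra.
Unshelve. all: by end_near. Qed.

Section edge_traces.
Variables (a b c d : R).
Hypotheses (ab : a < b) (cd : c < d).
Local Notation Om := (Omega a b c d).

Lemma Qf_continuous k (be al : R -> R) r :
  L2 (leb1 R) `[a, b] be -> L2 (leb1 R) `[c, d] al -> L2 (leb2 R) Om r ->
  {within Om, continuous (Qf a c k be al r)}.
Proof.
move=> Lb La Lr.
have c1 : {within Om, continuous (fun z => Ix a (fun z => be z.1) z)}.
  exact: (@within_Om_fst a b c d _ (prim_continuous (ltW ab) Lb)).
have c2 : {within Om, continuous (fun z => Iy c (fun z => al z.2) z)}.
  exact: (@within_Om_snd a b c d _ (prim_continuous (ltW cd) La)).
have Lr' := L2_norm (measurable_Om a b c d) Lr.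
have Lx : L2 (leb1 R) `[a, b] (fun t => \int[leb1 R]_(v in `[c, d]) `|r (t, v)|).
  by case: (@L2_fubini1 _ _ _ _ _ (@lebesgue_measure R) (@lebesgue_measure R) _ _
    (measurable_cc a b) (measurable_cc c d) (leb1_itv_fin c d) _ Lr').
have [Lrs _] := Omswap Lr.
have [Lrs' _] := Omswap Lr'.
have Ly : L2 (leb1 R) `[c, d] (fun v => \int[leb1 R]_(t in `[a, b]) `|r (t, v)|).
  by case: (@L2_fubini1 _ _ _ _ _ (@lebesgue_measure R) (@lebesgue_measure R) _ _
    (measurable_cc c d) (measurable_cc a b) (leb1_itv_fin a b) _ Lrs').
have c3 : {within Om, continuous (Ix a (Iy c r))}.
  apply: (Om_dist_continuous (prim_continuous (ltW ab) Lx) (prim_continuous (ltW cd) Ly)).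
    by move=> x x' y h1 h2 h3 h4; exact: IxIy_dist_x ab cd Lr h1 h2 h3 h4.
  move=> x y y' h1 h2 h3 h4.
  have jr := L2_Om_integrable Lr.
  have O1 : Om (x, y) by split; rewrite /= in_itv //= h3 (le_trans h1 h2).
  have O2 : Om (x, y') by split; rewrite /= in_itv //= h1 (le_trans h2 h3).
  (* After exchanging the integrals, the estimate in y is the estimate in x for the swapped
     function. *)
  rewrite (IxIy_comm jr O1) (IxIy_comm jr O2).
  exact: (IxIy_dist_x cd ab Lrs h1 h2 h3 h4).
apply/subspace_continuousP => z Oz; rewrite /Qf.
apply: cvgD; last exact: ((subspace_continuousP _ _).1 c3).
apply: cvgD; last exact: ((subspace_continuousP _ _).1 c2).
by apply: cvgD; [exact: cvg_cst|exact: ((subspace_continuousP _ _).1 c1)].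
Qed.

Lemma trace_corner_eq f F z0 : Om z0 -> {within Om, continuous F} ->
  F = f %[ae leb2 R in Om] ->
  xget 0 (is_trace_corner a b c d f z0) = F z0.
Proof.
move=> Oz cF Ff; case: xgetP => [r _ [G [Gf cG Gz]]|/(_ (F z0)) []]; last first.
  by exists F.
rewrite -Gz; apply/eqP; rewrite -subr_eq0; apply/eqP.
apply: (@continuous_ae0_Om a b c d (fun z => G z - F z)) => //.
  apply/subspace_continuousP => z Oz'.
  by apply: cvgB; [exact: ((subspace_continuousP _ _).1 cG)|exact: ((subspace_continuousP _ _).1 cF)].
by apply: filterS2 Gf Ff => z h1 h2 Oz'; rewrite (h1 Oz') (h2 Oz') subrr.
Qed.

(** On almost every vertical line two such representatives agree almost everywhere, hence everywhere
    by continuity, in particular at y0. *)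
Lemma is_trace_y_unique f y0 (g g' : R -> R) : c <= y0 <= d ->
  is_trace_y a b c d f y0 g -> is_trace_y a b c d f y0 g' ->
  g = g' %[ae leb1 R in `[a, b]%classic].
Proof.
move=> ycd [_ [F [Ff hF]]] [_ [F' [Ff' hF']]].
have FF' : {ae leb2 R, forall z, Om z -> F z = F' z}.
  by apply: filterS2 Ff Ff' => z h1 h2 Oz; rewrite (h1 Oz) (h2 Oz).
apply: filterS3 (Om_ae_section1 FF') hF hF' => x h1 h2 h3 xab.
have [c1 e1] := h2 xab; have [c2 e2] := h3 xab.
rewrite -e1 -e2; apply/eqP; rewrite -subr_eq0; apply/eqP.
apply: (@continuous_ae0_itv c d (fun y => F (x, y) - F' (x, y))) => //.
  apply/subspace_continuousP => y yin.
  by apply: cvgB; [exact: ((subspace_continuousP _ _).1 c1)|exact: ((subspace_continuousP _ _).1 c2)].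
by apply: filterS (h1 xab) => y h yin; rewrite (h yin) subrr.
Qed.

Lemma Iy_slice_L2 r y0 : c <= y0 <= d -> L2 (leb2 R) Om r ->
  L2 (leb1 R) `[a, b] (fun x => Iy c r (x, y0)).
Proof.
move=> /andP[cy yd] Lr.
have Lr' : L2 (leb2 R) (Omega a b c y0) r.
  have /(L2P _ (measurable_Om a b c d))[mr jr] := Lr.
  have Ob : Omega a b c d (b, y0) by split; rewrite /= in_itv /= ?lexx ?(ltW ab) ?cy ?yd.
  apply/(L2P _ (measurable_Om a b c y0)); split; last exact: integrable_Om_trunc Ob jr.
  apply: measurable_funS mr; first exact: measurable_Om.
  move=> [s t] [/=]; rewrite !in_itv /= => hs /andP[h1 h2].
  by split; rewrite /= in_itv /= ?hs ?h1 ?(le_trans h2 yd).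
by case: (@L2_fubini1 _ _ _ _ _ (@lebesgue_measure R) (@lebesgue_measure R) _ _
    (measurable_cc a b) (measurable_cc c y0) (leb1_itv_fin c y0) _ Lr').
Qed.

(** [edgex] is itself the representative that the definition of the trace asks for: a primitive in y
    is continuous on every integrable slice. *)
Lemma edgex_trace f (be : R -> R) r y0 : c <= y0 <= d ->
  L2 (leb1 R) `[a, b] be -> L2 (leb2 R) Om r ->
  edgex c be r = f %[ae leb2 R in Om] ->
  is_trace_y a b c d f y0 (fun x => be x + Iy c r (x, y0)).
Proof.
move=> ycd Lb Lr E; split.
  exact: (L2D (measurable_cc a b) Lb (Iy_slice_L2 ycd Lr)).
exists (edgex c be r); split => //.
apply: filterS (Om_section1 Lr) => x Lx xab; split => //.
apply/subspace_continuousP => y yin.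
apply: (@cvgD _ _ _ _ _ (fun=> be x) (fun y => \int[leb1 R]_(t in `[c, y]) r (x, t))).
  exact: cvg_cst.
have := prim_continuous (ltW cd) (Lx xab).
by move/subspace_continuousP => /(_ _ yin).
Qed.

Lemma trace_y_eq f (be : R -> R) r y0 : c <= y0 <= d ->
  L2 (leb1 R) `[a, b] be -> L2 (leb2 R) Om r ->
  edgex c be r = f %[ae leb2 R in Om] ->
  L2 (leb1 R) `[a, b] (xget (fun=> 0) (is_trace_y a b c d f y0)) /\
  xget (fun=> 0) (is_trace_y a b c d f y0) = (fun x => be x + Iy c r (x, y0))
    %[ae leb1 R in `[a, b]%classic].
Proof.
move=> ycd Lb Lr E; have t := edgex_trace ycd Lb Lr E.
case: xgetP => [g _ tg|/(_ _) h]; last by have := h _ t.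
by split; [case: tg|exact: is_trace_y_unique ycd tg t].
Qed.

End edge_traces.

Lemma is_trace_x_swap a b c d f x0 (g : R -> R) :
  is_trace_x a b c d f x0 g <-> is_trace_y c d a b (f \o @swapp R R) x0 g.
Proof.
split=> [[Lg [F [Ff hF]]]|[Lg [F [Ff hF]]]]; split => //; exists (F \o @swapp R R).
  split; last exact: hF.
  exact: (Om_ae_swap Ff).
split; last exact: hF.
have := Om_ae_swap Ff; apply: filterS => -[x y] h Oz; exact: h.
Qed.

Lemma trace_x_eq a b c d f (al : R -> R) r x0 : a < b -> c < d -> a <= x0 <= b ->
  L2 (leb1 R) `[c, d] al -> L2 (leb2 R) (Omega a b c d) r ->
  edgey a al r = f %[ae leb2 R in Omega a b c d] ->
  L2 (leb1 R) `[c, d] (xget (fun=> 0) (is_trace_x a b c d f x0)) /\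
  xget (fun=> 0) (is_trace_x a b c d f x0) = (fun y => al y + Ix a r (x0, y))
    %[ae leb1 R in `[c, d]%classic].
Proof.
move=> ab cd xab La Lr E.
have -> : is_trace_x a b c d f x0 = is_trace_y c d a b (f \o @swapp R R) x0.
  by apply/funext => g; apply/propext; exact: is_trace_x_swap.
have [Lrs _] := Omswap Lr.
exact: (trace_y_eq cd ab xab La Lrs (Om_ae_swap E)).
Qed.

End traces.

(** * Bounded linear operators between spaces of representatives *)

(* A vector space of representatives: [lc k x y] stands for k x + y, [ok] for
   membership, [eqv] for equality almost everywhere, [nq] for the squared norm. *)
Record l2space (R : realType) := L2Space {
  car :> Type;
  lc : R -> car -> car -> car;
  ok : car -> Prop;
  eqv : car -> car -> Prop;
  nq : car -> R;
  eqv_refl : forall x, eqv x x;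
  eqv_sym : forall x y, eqv x y -> eqv y x;
  eqv_trans : forall x y z, eqv x y -> eqv y z -> eqv x z;
  ok_lc : forall k x y, ok x -> ok y -> ok (lc k x y);
  eqv_lc : forall k x x' y y', eqv x x' -> eqv y y' -> eqv (lc k x y) (lc k x' y');
  nq_ge0 : forall x, 0 <= nq x;
  nq_lc : forall k x y, ok x -> ok y -> nq (lc k x y) <= 2 * (k ^+ 2 * nq x + nq y);
  nq_eqv : forall x y, ok x -> ok y -> eqv x y -> nq x = nq y;
  nq_sub0 : forall x y, ok x -> ok y -> (eqv x y <-> nq (lc (-1) y x) = 0) }.

Arguments lc {R l} _ _ _.
Arguments ok {R l} _.
Arguments eqv {R l} _ _.
Arguments nq {R l} _.

Section good_operators.
Context (R : realType).
Implicit Types S : l2space R.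

(** Bounded linear operators on representatives. The constant bounds squared norms, so it is the
    square of an operator bound. *)
Definition good S S' (F : S -> S') : Prop :=
  [/\ forall x, ok x -> ok (F x),
      forall k x y, ok x -> ok y -> eqv (F (lc k x y)) (lc k (F x) (F y)) &
      exists2 C, 0 <= C & forall x, ok x -> nq (F x) <= C * nq x].

(** Respecting [eqv] is a consequence of boundedness: a difference of zero norm has an image of zero
    norm. *)
Lemma good_cong S S' (F : S -> S') x y : good F -> ok x -> ok y -> eqv x y ->
  eqv (F x) (F y).
Proof.
move=> [okF lin [C C0 bd]] ox oy /(nq_sub0 ox oy) n0.
have oF := okF _ ox; have oF' := okF _ oy.
apply/(nq_sub0 oF oF'); apply/eqP; rewrite eq_le nq_ge0 andbT.
rewrite -(nq_eqv _ _ (lin (-1) _ _ oy ox)); first last.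
- exact: ok_lc.
- by apply: okF; exact: ok_lc.
by apply: (le_trans (bd _ (ok_lc _ oy ox))); rewrite n0 mulr0.
Qed.

Lemma good_lin S S' (F : S -> S') k x y z : good F -> ok x -> ok y -> ok z ->
  eqv z (lc k x y) -> eqv (F z) (lc k (F x) (F y)).
Proof.
move=> gF ox oy oz e; have [_ lin _] := gF.
exact: eqv_trans (good_cong gF oz (ok_lc k ox oy) e) (lin _ _ _ ox oy).
Qed.

Lemma good_comp S S' S'' (F : S -> S') (G : S' -> S'') : good F -> good G ->
  good (fun x => G (F x)).
Proof.
move=> gF gG; have [oF lF [C C0 bF]] := gF; have [oG lG [C' C'0 bG]] := gG; split.
- by move=> x ox; apply: oG; exact: oF.
- move=> k x y ox oy.
  exact: (good_lin gG (oF _ ox) (oF _ oy) (oF _ (ok_lc _ ox oy)) (lF k _ _ ox oy)).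
- exists (C' * C); first exact: mulr_ge0.
  move=> x ox; rewrite -mulrA; apply: (le_trans (bG _ (oF _ ox))).
  by rewrite ler_wpM2l// bF.
Qed.

Lemma good_id S : good (fun x : S => x).
Proof.
split=> //; first by move=> *; exact: eqv_refl.
by exists 1 => // x _; rewrite mul1r.
Qed.

(** [ok] has to be supplied for F: for Borel functions, measurability does not pass to functions
    equal almost everywhere. *)
Lemma good_ae S S' (F G : S -> S') : good G -> (forall x, ok x -> ok (F x)) ->
  (forall x, ok x -> eqv (F x) (G x)) -> good F.
Proof.
move=> [oG lG [C C0 bG]] oF FG; split => //.
- move=> k x y ox oy; apply: eqv_trans (FG _ (ok_lc _ ox oy)) _.
  apply: eqv_trans (lG _ _ _ ox oy) _.
  by apply: eqv_lc; apply: eqv_sym; exact: FG.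
- exists C => // x ox; rewrite (nq_eqv _ _ (FG _ ox)); [exact: bG|exact: oF|exact: oG].
Qed.

Program Definition Rspace : l2space R := @L2Space R R (fun k x y => k * x + y)
  (fun=> True) eq (fun x => x ^+ 2) _ _ _ _ _ _ _ _ _.
Next Obligation. by []. Qed.
Next Obligation. by move=> x y ->. Qed.
Next Obligation. by move=> x y z -> ->. Qed.
Next Obligation. by []. Qed.
Next Obligation. by move=> k x x' y y' -> ->. Qed.
Next Obligation. by move=> x /=; exact: sqr_ge0. Qed.
Next Obligation. by move=> k x y _ _ /=; have := sqr_ge0 (k * x - y); nra. Qed.
Next Obligation. by move=> x y _ _ ->. Qed.
Next Obligation.
move=> x y _ _ /=; split=> [->|]; first by rewrite mulN1r addNr expr0n.
by move/eqP; rewrite sqrf_eq0 mulN1r addrC subr_eq0 => /eqP.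
Qed.

Section Fspace.
Context (dp : measure_display) (T : measurableType dp) (mu : {measure set T -> \bar R})
  (D : set T) (mD : measurable D).

Lemma ae_eq_sub0 (f g : T -> R) : L2 mu D f -> L2 mu D g ->
  f = g %[ae mu in D] <-> nsq mu D (fun z => -1 * g z + f z) = 0.
Proof.
move=> Lf Lg; have Ls := L2D mD (L2Z mD (-1) Lg) Lf; split=> [fg|/(nsq_eq0 mD Ls)].
  rewrite (nsq_ae mD (g := fun=> 0)) ?/nsq.
  - under eq_Rintegral do rewrite expr0n.
    by rewrite (Rintegral_cst _ mD) mul0r.
  - exact: L2_measurable Ls.
  - exact: measurable_cst.
  - by apply: filterS fg => z h Dz; rewrite (h Dz) mulN1r addNr.
apply: filterS => z h Dz; have /eqP := h Dz.
by rewrite mulN1r addrC subr_eq0 => /eqP.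
Qed.

Program Definition Fspace : l2space R := @L2Space R (T -> R)
  (fun k f g z => k * f z + g z) (L2 mu D) (fun f g => f = g %[ae mu in D])
  (nsq mu D) _ _ _ _ _ _ _ _ _.
Next Obligation. by move=> f; exact: ae_eq_refl. Qed.
Next Obligation. by move=> f g; exact: ae_eq_sym. Qed.
Next Obligation. by move=> f g h; exact: ae_eq_trans. Qed.
Next Obligation. by move=> k f g Lf Lg; apply: (L2D mD) => //; exact: L2Z. Qed.
Next Obligation.
move=> k f f' g g' ff' gg' /=; apply: filterS2 ff' gg' => z h1 h2 Dz.
by rewrite (h1 Dz) (h2 Dz).
Qed.
Next Obligation. by move=> f; exact: nsq_ge0. Qed.
Next Obligation.
move=> k f g Lf Lg /=; rewrite -(nsqZ mD)//; apply: (nsqD_le mD) => //; exact: L2Z.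
Qed.
Next Obligation. by move=> f g Lf Lg; exact: (nsq_ae mD (L2_measurable mD Lf) (L2_measurable mD Lg)). Qed.
Next Obligation. by move=> f g Lf Lg; exact: ae_eq_sub0. Qed.

(** The bound doubles because [nsqD_le] does. *)
Lemma good_addF S (F G : S -> Fspace) : good F -> good G ->
  good (fun s => (fun z => F s z + G s z) : Fspace).
Proof.
move=> [oF lF [C C0 bF]] [oG lG [C' C'0 bG]]; split.
- by move=> x ox; apply: (L2D mD); [exact: oF|exact: oG].
- move=> k x y ox oy; apply: filterS2 (lF k _ _ ox oy) (lG k _ _ ox oy) => z h1 h2 Dz /=.
  by rewrite (h1 Dz) (h2 Dz) /=; ring.
- exists (2 * (C + C')); first by rewrite mulr_ge0// addr_ge0.
  move=> x ox; apply: (le_trans (nsqD_le mD (oF _ ox) (oG _ ox))).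
  by rewrite -mulrA ler_wpM2l// mulrDl lerD ?bF ?bG.
Qed.

Lemma good_sumF S (I : Type) (s : seq I) (F : I -> S -> Fspace) :
  (forall i, good (F i)) -> good (fun x => (fun z => \sum_(i <- s) F i x z) : Fspace).
Proof.
move=> gF; elim: s => [|i s ih].
  split.
  - by move=> x _; apply: (L2_eq _ (L20 _ mD)) => z _; rewrite big_nil.
  - by move=> k x y _ _; apply: aeW => z _ /=; rewrite !big_nil mulr0 addr0.
  - exists 0 => // x _ /=; rewrite mul0r /nsq.
    under eq_Rintegral do rewrite big_nil expr0n.
    by rewrite (Rintegral_cst _ mD) mul0r.
apply: good_ae (good_addF (gF i) ih) _ _ => x ox; last first.
  by apply: aeW => z _ /=; rewrite big_cons.
have [oF _ _] := good_addF (gF i) ih.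
by apply: (L2_eq _ (oF _ ox)) => z _; rewrite big_cons.
Qed.

Lemma good_mulF (h : T -> R) (M : R) : measurable_fun D h -> (forall z, D z -> `|h z| <= M) ->
  good (fun f : Fspace => (fun z => h z * f z) : Fspace).
Proof.
move=> mh hM; split.
- by move=> f Lf; exact: (L2M_bounded mD mh hM).
- by move=> k f g _ _; apply: aeW => z _ /=; ring.
- exists (M ^+ 2); first exact: sqr_ge0.
  move=> f Lf /=; rewrite -(nsqZ mD)//; apply: le_Rintegral => //.
  + exact: L2_sqr_integrable (L2M_bounded mD mh hM Lf).
  + exact: L2_sqr_integrable (L2Z mD M Lf).
  + move=> z Dz; rewrite !exprMn ler_wpM2r ?sqr_ge0//.
    have Mx := hM _ Dz; have M0 := le_trans (normr_ge0 _) Mx.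
    by rewrite -(real_normK (num_real (h z))) ler_sqr ?nnegrE.
Qed.

Lemma good_scaleF (k : R) : good (fun f : Fspace => (fun z => k * f z) : Fspace).
Proof.
by apply: (@good_mulF (fun=> k) `|k|) => //; exact: measurable_cst.
Qed.

Lemma good_rank1 (g : T -> R) : L2 mu D g -> good (fun c : Rspace => (fun z => g z * c) : Fspace).
Proof.
move=> Lg; split.
- by move=> c _; apply: (L2_eq _ (L2Z mD c Lg)) => z _; rewrite mulrC.
- by move=> k x y _ _; apply: aeW => z _ /=; ring.
- exists (nsq mu D g); first exact: nsq_ge0.
  move=> x _ /=; rewrite mulrC -(nsqZ mD)// le_eqVlt; apply/orP; left; apply/eqP.
  by apply: eq_Rintegral => z _; rewrite mulrC.
Qed.

Lemma good_dual (g : T -> R) : L2 mu D g ->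
  good (fun f : Fspace => (\int[mu]_(z in D) (g z * f z)) : Rspace).
Proof.
move=> Lg; split => //.
- move=> k f h Lf Lh /=.
  have j1 := L2M_integrable mD Lg Lf; have j2 := L2M_integrable mD Lg Lh.
  rewrite -(RintegralZl _ mD j1) -(RintegralD mD (integrableZ_EFin mD k j1) j2).
  by apply: eq_Rintegral => z _; ring.
- exists (nsq mu D g); first exact: nsq_ge0.
  by move=> f Lf; exact: cauchy_schwarz_L2.
Qed.

End Fspace.

Lemma good_addR S (F G : S -> Rspace) : good F -> good G ->
  good (fun s => (F s + G s) : Rspace).
Proof.
move=> [oF lF [C C0 bF]] [oG lG [C' C'0 bG]]; split => //.
- by move=> k x y ox oy /=; rewrite (lF k _ _ ox oy) (lG k _ _ ox oy) /=; ring.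
- exists (2 * (C + C')); first by rewrite mulr_ge0// addr_ge0.
  move=> x ox; apply: (@le_trans _ _ (2 * (F x ^+ 2 + G x ^+ 2))).
    by rewrite /=; have := sqr_ge0 (F x - G x); nra.
  by rewrite -mulrA ler_wpM2l// mulrDl lerD ?bF ?bG.
Qed.

Lemma good_scaleR (k : R) : good (fun c : Rspace => (k * c) : Rspace).
Proof.
split=> //; first by move=> l x y _ _ /=; ring.
by exists (k ^+ 2) => [|x _ /=]; rewrite ?sqr_ge0// exprMn.
Qed.

Lemma good_0R S : good (fun _ : S => 0 : Rspace).
Proof.
split=> //; first by move=> k x y _ _ /=; rewrite mulr0 addr0.
by exists 0 => // x _; rewrite /= expr0n mul0r.
Qed.

Lemma good_sumR S (I : Type) (s : seq I) (F : I -> S -> Rspace) :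
  (forall i, good (F i)) -> good (fun x => (\sum_(i <- s) F i x) : Rspace).
Proof.
move=> gF; elim: s => [|i s ih].
  rewrite (_ : (fun x => _) = fun=> 0); first exact: good_0R.
  by apply/funext => x; rewrite big_nil.
rewrite (_ : (fun x => _) = (fun x => F i x + \sum_(j <- s) F j x)); first exact: good_addR.
by apply/funext => x; rewrite big_cons.
Qed.

End good_operators.

(** * Integral operators on the rectangle *)

Section good_rectangle.
Context (R : realType) (a b c d : R).
Hypotheses (ab : a < b) (cd : c < d).

Definition FOm : l2space R := Fspace (leb2 R) (measurable_Om a b c d).
Definition Fx : l2space R := Fspace (leb1 R) (measurable_cc a b).
Definition Fy : l2space R := Fspace (leb1 R) (measurable_cc c d).

Lemma good_Ix : good (fun f : FOm => Ix a f : FOm).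
Proof.
split.
- by move=> f Lf; case: (Ix_L2 (ltW ab) Lf).
- move=> k f g Lf Lg.
  apply: (Om_ae_slice2 (P := fun z => Ix a (fun z => k * f z + g z) z = k * Ix a f z + Ix a g z)).
  exact: Ix_lin.
- exists ((b - a) ^+ 2); first exact: sqr_ge0.
  by move=> f Lf; case: (Ix_L2 (ltW ab) Lf).
Qed.

Lemma good_Iy : good (fun f : FOm => Iy c f : FOm).
Proof.
split.
- by move=> f Lf; case: (Iy_L2 (ltW cd) Lf).
- move=> k f g Lf Lg.
  apply: (Om_ae_slice1 (P := fun z => Iy c (fun z => k * f z + g z) z = k * Iy c f z + Iy c g z)).
  exact: Iy_lin.
- exists ((d - c) ^+ 2); first exact: sqr_ge0.
  by move=> f Lf; case: (Iy_L2 (ltW cd) Lf).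
Qed.

Lemma good_fst : good (fun f : Fx => (fun z => f z.1) : FOm).
Proof.
split.
- by move=> f /(L2_Om_fst c d)[].
- by move=> k f g _ _; apply: aeW => z _ /=.
- exists (fine (leb1 R `[c, d]%classic)); first by rewrite fine_ge0.
  by move=> f /(L2_Om_fst c d)[_ /= ->].
Qed.

Lemma good_snd : good (fun f : Fy => (fun z => f z.2) : FOm).
Proof.
split.
- by move=> f /(L2_Om_snd a b)[].
- by move=> k f g _ _; apply: aeW => z _ /=.
- exists (fine (leb1 R `[a, b]%classic)); first by rewrite fine_ge0.
  by move=> f /(L2_Om_snd a b)[_ /= ->].
Qed.

Lemma good_cstOm : good (fun k : Rspace R => (fun=> k) : FOm).
Proof.
have L1 : L2 (leb2 R) (Omega a b c d) (fun=> 1).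
  exact: (L2_cst (measurable_Om a b c d) (leb2_Om_fin a b c d)).
have := good_rank1 (measurable_Om a b c d) L1.
rewrite (_ : (fun k : Rspace R => _) = (fun k : Rspace R => (fun=> k) : FOm))//.
by apply/funext => k; apply/funext => z; rewrite mul1r.
Qed.

Lemma good_inty : good (fun f : FOm => (fun x => \int[leb1 R]_(y in `[c, d]) f (x, y)) : Fx).
Proof.
have F1 (f : FOm) : ok f -> _ := fun Lf : ok f => @L2_fubini1 _ _ _ _ _ (@lebesgue_measure R) (@lebesgue_measure R) _ _
    (measurable_cc a b) (measurable_cc c d) (leb1_itv_fin c d) _ Lf.
split.
- by move=> f /F1[].
- move=> k f g Lf Lg; apply: filterS2 (Om_section1 Lf) (Om_section1 Lg) => x hf hg xab /=.
  have jf := L2_itv_integrable (hf xab); have jg := L2_itv_integrable (hg xab).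
  have mcd := measurable_cc c d.
  by rewrite (RintegralD mcd (integrableZ_EFin mcd k jf) jg) (RintegralZl _ mcd jf).
- exists (fine (leb1 R `[c, d]%classic)); first by rewrite fine_ge0.
  by move=> f /F1[].
Qed.

End good_rectangle.

Lemma good_swap (R : realType) (a b c d : R) :
  good (fun f : FOm a b c d => (f \o @swapp R R) : FOm c d a b).
Proof.
split.
- by move=> f /Omswap[].
- by move=> k f g _ _; apply: aeW => z _ /=.
- by exists 1 => // f /Omswap[_ /= ->]; rewrite mul1r.
Qed.

Lemma good_intx (R : realType) (a b c d : R) :
  good (fun f : FOm a b c d => (fun y => \int[leb1 R]_(x in `[a, b]) f (x, y)) : Fy c d).
Proof. exact: (good_comp (good_swap a b c d) (@good_inty R c d a b)). Qed.

(** * Multipliers of L2 and 011-PI operators *)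

Section multiplier.
Context (R : realType) (dp : measure_display) (T : measurableType dp)
  (mu : {measure set T -> \bar R}) (D : set T).
Hypothesis mD : measurable D.

Lemma L2_ae (f g : T -> R) : measurable_fun D g -> L2 mu D f ->
  f = g %[ae mu in D] -> L2 mu D g.
Proof.
move=> mg /(L2P _ mD)[mf /integrableP[_ jf]] fg; apply/(L2P _ mD); split => //.
apply/integrableP; split; first by apply/measurable_EFinP; exact: measurable_funX.
apply: le_lt_trans jf; rewrite le_eqVlt; apply/orP; left; apply/eqP.
apply: ae_eq_integral => //.
- by apply: measurableT_comp => //; apply/measurable_EFinP; exact: measurable_funX.
- by apply: measurableT_comp => //; apply/measurable_EFinP; exact: measurable_funX.
- by apply: filterS fg => z h Dz /=; rewrite (h Dz).
Qed.

(* A multiplier of L2 into L2 is bounded: otherwise a weighted sum of squares of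
   normalized functions on which it is larger and larger gives an L2 function
   sent outside L2. *)
Lemma multiplier_bounded (m : T -> R) : measurable_fun D m ->
  (forall f, L2 mu D f -> L2 mu D (fun z => m z * f z)) ->
  exists2 C, 0 <= C & forall f, L2 mu D f ->
    nsq mu D (fun z => m z * f z) <= C * nsq mu D f.
Proof.
move=> mm mL; apply: contrapT => noC.
(* Gain 4^(n + 1) against weight 2^-(n + 1) leaves 2^(n + 1), which is unbounded, while the weights
   remain summable. *)
have ex n : exists f, L2 mu D f /\ (4 ^ n.+1)%:R * nsq mu D f < nsq mu D (fun z => m z * f z).
  apply: contrapT => h; apply: noC; exists (4 ^ n.+1)%:R => // f Lf.
  by rewrite leNgt; apply/negP => hf; apply: h; exists f.
have {ex} [f_ f_P] := choice ex.
have Lf n : L2 mu D (f_ n) by case: (f_P n).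
have fn n : (4 ^ n.+1)%:R * nsq mu D (f_ n) < nsq mu D (fun z => m z * f_ n z) by case: (f_P n).
have f0 n : 0 < nsq mu D (f_ n).
  rewrite lt0r nsq_ge0 andbT; apply/negP => /eqP n0.
  have := fn n; rewrite n0 mulr0 (nsq_ae mD (g := fun=> 0)); last first.
  - by apply: filterS (nsq_eq0 mD (Lf n) n0) => z h Dz; rewrite (h Dz) mulr0.
  - exact: measurable_cst.
  - exact: L2_measurable (mL _ (Lf n)).
  rewrite /nsq; under eq_Rintegral do rewrite expr0n.
  by rewrite (Rintegral_cst _ mD) mul0r ltxx.
pose w n : R := 1 / (2 ^ n.+1)%:R.
have w0 n : 0 < w n by rewrite divr_gt0// ltr0n expn_gt0.
pose g n z : R := w n / nsq mu D (f_ n) * f_ n z ^+ 2.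
have g0 n z : 0 <= g n z by rewrite mulr_ge0 ?sqr_ge0// divr_ge0// ltW.
have mf n := L2_measurable mD (Lf n).
have mg n : measurable_fun D (g n).
  by apply: measurable_funM; [exact: measurable_cst|exact: measurable_funX].
have ig n : (\int[mu]_(z in D) (g n z)%:E = (w n)%:E)%E.
  have jf := L2_sqr_integrable mD (Lf n).
  rewrite -[LHS]fineK; last exact: (integrable_fin_num mD (integrableZ_EFin mD (w n / nsq mu D (f_ n)) jf)).
  congr EFin; rewrite -[LHS]/(\int[mu]_(z in D) (w n / nsq mu D (f_ n) * f_ n z ^+ 2)).
  by rewrite (RintegralZl _ mD jf) -/(nsq mu D (f_ n)) divfK// gt_eqF.
pose s z := (\sum_(n <oo) (g n z)%:E)%E.
have s0 z : (0 <= s z)%E by apply: nneseries_ge0 => n _ _; rewrite lee_fin.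
have is1 : (\int[mu]_(z in D) s z < +oo)%E.
  rewrite /s integral_nneseries//; last 2 first.
  - by move=> n; exact/measurable_EFinP.
  - by move=> n z _; rewrite lee_fin.
  apply: (@le_lt_trans _ _ 1%E); last exact: ltry.
  apply: le_trans (@epsilon_trick0 R 1 xpredT ler01).
  by apply: lee_nneseries => n _ //; rewrite ig// lee_fin ltW.
have ms : measurable_fun D s.
  apply: ge0_emeasurable_sum; first by move=> n z _ _; rewrite lee_fin.
  by move=> n _; exact/measurable_EFinP.
have js : mu.-integrable D s.
  apply/integrableP; split => //; apply: le_lt_trans is1.
  by apply: ge0_le_integral => //; [exact: measurableT_comp|move=> z _; rewrite gee0_abs].
have sfin := integrable_ae mD js.
(* The series s is finite almost everywhere because its integral is at most the sum of the weights;
   [fine] only matters on the remaining null set. *)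
pose F z := Num.sqrt (fine (s z)).
have F2 z : F z ^+ 2 = fine (s z) by rewrite sqr_sqrtr// fine_ge0.
have mF : measurable_fun D F.
  have mq : measurable_fun [set: R] (Num.sqrt : R -> R).
    by apply: continuous_measurable_fun; exact: sqrt_continuous.
  have mfs : measurable_fun D (fun z => fine (s z)) by exact: measurableT_comp.
  exact: (measurableT_comp mq mfs).
have LF : L2 mu D F.
  apply/(L2P _ mD); split => //; apply/integrableP; split.
    by apply/measurable_EFinP; exact: measurable_funX.
  apply: le_lt_trans is1; apply: ae_ge0_le_integral => //.
  - by apply: measurableT_comp => //; apply/measurable_EFinP; exact: measurable_funX.
  - apply: filterS sfin => z h Dz /=; rewrite F2 ger0_norm ?fine_ge0//.
    by rewrite fineK ?lexx// h.
have LmF := mL _ LF.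
(* The square of F dominates each term of the series, so the image of F is at least as large as the
   image of the n-th term. *)
have bound n : (2 ^ n.+1)%:R <= nsq mu D (fun z => m z * F z).
  have LmG := mL _ (Lf n).
  have jmG := L2_sqr_integrable mD LmG.
  have le1 : w n / nsq mu D (f_ n) * nsq mu D (fun z => m z * f_ n z) <= nsq mu D (fun z => m z * F z).
    rewrite -(RintegralZl _ mD jmG) /nsq /Rintegral; apply: fine_le.
    - exact: (integrable_fin_num mD (integrableZ_EFin mD (w n / nsq mu D (f_ n)) jmG)).
    - exact: integrable_fin_num (L2_sqr_integrable mD LmF).
    apply: ae_ge0_le_integral => //.
    - move=> z _; rewrite lee_fin mulr_ge0 ?sqr_ge0//.
      exact: divr_ge0 (ltW (w0 n)) (ltW (f0 n)).
    - apply/measurable_EFinP; apply: measurable_funM; first exact: measurable_cst.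
      by apply: measurable_funX; exact: (L2_measurable mD LmG).
    - by move=> z _; rewrite lee_fin sqr_ge0.
    - by apply/measurable_EFinP; apply: measurable_funX; exact: (L2_measurable mD LmF).
    - apply: filterS sfin => z h Dz; rewrite lee_fin !exprMn F2 mulrCA ler_wpM2l ?sqr_ge0//.
      rewrite -lee_fin fineK ?h// -/(g n z).
      apply: le_trans (@nneseries_lim_ge R (fun n => (g n z)%:E) xpredT 0%N n.+1 _); last first.
        by move=> k _; rewrite lee_fin.
      rewrite big_nat_recr//= leeDr// sume_ge0// => k _; rewrite lee_fin//.
  apply: le_trans le1; rewrite mulrAC ler_pdivlMr//.
  apply: (@le_trans _ _ (w n * ((4 ^ n.+1)%:R * nsq mu D (f_ n)))).
    rewrite mulrA ler_wpM2r ?nsq_ge0// /w div1r mulrC.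
    by rewrite ler_pdivlMr ?ltr0n ?expn_gt0// -natrM -expnMn.
  by rewrite ler_wpM2l ?ltW.
have [n hn] : exists n : nat, nsq mu D (fun z => m z * F z) < n%:R.
  exists (Num.truncn (nsq mu D (fun z => m z * F z))).+1.
  by rewrite truncnS_gt.
have := bound n; rewrite leNgt => /negP; apply; apply: (lt_le_trans hn).
by rewrite ler_nat (leq_trans _ (ltnW (ltn_expl _ _)))// ltnW// ltn_expl.
Qed.

Lemma good_multiplier (m : T -> R) : measurable_fun D m ->
  (forall f, L2 mu D f -> L2 mu D (fun z => m z * f z)) ->
  good (fun f : Fspace mu mD => (fun z => m z * f z) : Fspace mu mD).
Proof.
move=> mm mL; split => //; last exact: multiplier_bounded.
by move=> k f g _ _; apply: aeW => z _ /=; ring.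
Qed.

(** Agreement everywhere on D also carries membership over, since [L2] looks only at the restriction
    to D; compare [good_ae]. *)
Lemma good_eqD (S : l2space R) (F G : S -> Fspace mu mD) : good G ->
  (forall s, ok s -> {in D, F s =1 G s}) -> good F.
Proof.
move=> gG FG; have [oG _ _] := gG; apply: (good_ae gG) => s os.
  by apply: (L2_eq _ (oG _ os)) => z Dz; rewrite (FG _ os).
by apply: aeW => z Dz; apply: (FG _ os); exact: mem_set.
Qed.

End multiplier.

(** * Hilbert-Schmidt and Volterra operators *)

Section kernel_operators.
Context (R : realType).
Implicit Types (a b c d : R) (S : l2space R).

Lemma good_mono S a b (F G : S -> Fx a b) : good G ->
  (forall s x, ok s -> a <= x <= b -> F s x = G s x) -> good F.
Proof.
move=> gG FG; apply: (good_eqD gG) => s os x /set_mem /=; rewrite in_itv /=.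
exact: FG.
Qed.

Lemma good_hs1 a b c d (k : R * R -> R) : L2 (leb2 R) (Omega a b c d) k ->
  good (fun f : Fx c d => (fun x => \int[leb1 R]_(y in `[c, d]) (k (x, y) * f y)) : Fx a b).
Proof.
move=> Lk; have mcd := measurable_cc c d.
have hs (f : R -> R) Lf := @hilbert_schmidt _ _ _ _ _ (@lebesgue_measure R) (@lebesgue_measure R)
  _ _ (measurable_cc a b) mcd k f Lk Lf.
split.
- by move=> f /hs[].
- move=> l f g Lf Lg; apply: filterS (Om_section1 Lk) => x hk xab /=.
  have j1 := L2M_integrable mcd (hk xab) Lf; have j2 := L2M_integrable mcd (hk xab) Lg.
  rewrite -(RintegralZl _ mcd j1) -(RintegralD mcd (integrableZ_EFin mcd l j1) j2).
  by apply: eq_Rintegral => y _; ring.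
- exists (nsq (leb2 R) (Omega a b c d) k); first exact: nsq_ge0.
  by move=> f /hs[].
Qed.

(** The sum stays inside the integral, as in a matrix-vector product under the integral sign. Moving
    it outside is valid for almost every x, where all sections of the kernels are in L2;
    measurability of the original is proved separately. *)
Lemma good_hs a b c d S n (k : 'I_n -> R * R -> R) (F : 'I_n -> S -> Fx c d) :
  (forall j, L2 (leb2 R) (Omega a b c d) (k j)) -> (forall j, good (F j)) ->
  good (fun s => (fun x => \int[leb1 R]_(y in `[c, d]) (\sum_j k j (x, y) * F j s y)) : Fx a b).
Proof.
move=> Lk gF; have mcd := measurable_cc c d; have mO := measurable_Om a b c d.
have gG := good_sumF (mD := measurable_cc a b) (index_enum 'I_n) (fun j => good_comp (gF j) (good_hs1 (Lk j))).
have oF j s (os : ok s) : L2 (leb1 R) `[c, d] (F j s) by have [+ _ _] := gF j; apply.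
have E s : ok s -> (fun x => \sum_j \int[leb1 R]_(y in `[c, d]) (k j (x, y) * F j s y)) =
    (fun x => \int[leb1 R]_(y in `[c, d]) (\sum_j k j (x, y) * F j s y)) %[ae leb1 R in `[a, b]%classic].
  move=> os; have Hk := ae_forall_ord (fun j => Om_section1 (Lk j)).
  apply: filterS Hk => x hk xab; rewrite (Rintegral_sum_EFin mcd)// => j.
  by have := L2M_integrable mcd (hk j xab) (oF j _ os); exact.
apply: (good_ae gG) => s os; last exact: ae_eq_sym (E s os).
apply: (L2_ae (measurable_cc a b) _ _ (E s os)).
  have mK : measurable_fun (Omega a b c d) (fun z => \sum_j k j z * F j s z.2).
    apply: measurable_sum => j; apply: measurable_funM; first by have := L2_measurable mO (Lk j); exact.
    apply: (@measurable_fun_snd _ _ _ _ _ `[a, b]%classic `[c, d]%classic) => //.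
    by have := L2_measurable mcd (oF j _ os); exact.
  exact: (@measurable_Rintegral1 _ _ _ _ _ (@lebesgue_measure R) _ _ (measurable_cc a b) mcd _ mK).
by have [+ _ _] := gG; apply.
Qed.

Lemma good_hsT a b c d S n (k : 'I_n -> R * R -> R) (F : 'I_n -> S -> Fx a b) :
  (forall j, L2 (leb2 R) (Omega a b c d) (k j)) -> (forall j, good (F j)) ->
  good (fun s => (fun y => \int[leb1 R]_(x in `[a, b]) (\sum_j k j (x, y) * F j s x)) : Fx c d).
Proof.
move=> Lk gF.
exact: (@good_hs c d a b S n (fun j => k j \o @swapp R R) F (fun j => (Omswap (Lk j)).1) gF).
Qed.

Lemma L2_le_kernel a b c d (k : R * R -> R) : L2 (leb2 R) (Omega a b c d) k ->
  L2 (leb2 R) (Omega a b c d) (fun z => (z.2 <= z.1)%R%:R * k z).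
Proof.
move=> Lk; apply: (L2M_bounded (measurable_Om a b c d) (M := 1)) => //.
  exact: measurable_le_ind.
by move=> z _; case: (z.2 <= z.1)%R; rewrite /= ?normr1 ?normr0 ?ler01.
Qed.

(** A Volterra operator is a Hilbert-Schmidt one whose kernel is cut off above the diagonal. *)
Lemma good_hs_low a b S n (k : 'I_n -> R * R -> R) (F : 'I_n -> S -> Fx a b) :
  (forall j, L2 (leb2 R) (Omega a b a b) (k j)) -> (forall j, good (F j)) ->
  good (fun s => (fun x => \int[leb1 R]_(t in `[a, x]) (\sum_j k j (x, t) * F j s t)) : Fx a b).
Proof.
move=> Lk gF; apply: (good_mono (good_hs (fun j => L2_le_kernel (Lk j)) gF)).
move=> s x _ /andP[ax xb]; rewrite (Rintegral_itv_trunc _ _ xb).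
by apply: eq_Rintegral => t _; rewrite mulr_sumr; apply: eq_bigr => j _; rewrite mulrA.
Qed.

Lemma good_hs_up a b S n (k : 'I_n -> R * R -> R) (F : 'I_n -> S -> Fx a b) :
  (forall j, L2 (leb2 R) (Omega a b a b) (k j)) -> (forall j, good (F j)) ->
  good (fun s => (fun x => \int[leb1 R]_(t in `[x, b]) (\sum_j k j (x, t) * F j s t)) : Fx a b).
Proof.
move=> Lk gF.
have Lk' j : L2 (leb2 R) (Omega a b a b) (fun z => (z.1 <= z.2)%R%:R * k j z).
  have [L1 _] := Omswap (Lk j); have [L2 _] := Omswap (L2_le_kernel L1).
  by apply: (L2_eq _ L2) => -[x y] _.
apply: (good_mono (good_hs Lk' gF)).
move=> s x _ /andP[ax xb]; rewrite (Rintegral_itv_truncl _ _ ax).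
by apply: eq_Rintegral => t _; rewrite mulr_sumr; apply: eq_bigr => j _; rewrite mulrA.
Qed.

Lemma good_dual_sum a b S n (g : 'I_n -> R -> R) (F : 'I_n -> S -> Fx a b) :
  (forall j, L2 (leb1 R) `[a, b] (g j)) -> (forall j, good (F j)) ->
  good (fun s => (\int[leb1 R]_(x in `[a, b]) (\sum_j g j x * F j s x)) : Rspace R).
Proof.
move=> Lg gF; have mab := measurable_cc a b.
apply: (good_ae (good_sumR (index_enum 'I_n) (fun j => good_comp (gF j) (good_dual mab (Lg j))))) => //.
move=> s os /=; rewrite (Rintegral_sum_EFin mab)// => j.
have [oF _ _] := gF j; by have := L2M_integrable mab (Lg j) (oF _ os); exact.
Qed.

Lemma good_rank1_sum a b S n (g : 'I_n -> R -> R) (F : 'I_n -> S -> Rspace R) :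
  (forall j, L2 (leb1 R) `[a, b] (g j)) -> (forall j, good (F j)) ->
  good (fun s => (fun x => \sum_j g j x * F j s) : Fx a b).
Proof.
move=> Lg gF; have mab := measurable_cc a b.
exact: (good_sumF (mD := mab) (index_enum 'I_n) (fun j => good_comp (gF j) (good_rank1 mab (Lg j)))).
Qed.

End kernel_operators.

(** * Product spaces and boundedness of 011-PI operators *)

Section coordinate_space.
Context (R : realType) (I : finType) (S : I -> l2space R) (X : Type)
  (lcX : R -> X -> X -> X) (p : forall i, X -> S i).
Hypothesis p_lc : forall k x y i, p i (lcX k x y) = lc k (p i x) (p i y).

(** A product of spaces carried by an arbitrary type X through its coordinate maps. The triples of
    [Ztype] and the vector-valued states thus keep their own types. *)
Program Definition coordinate_space : l2space R := @L2Space R X lcX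
  (fun x => forall i, ok (p i x)) (fun x y => forall i, eqv (p i x) (p i y))
  (fun x => \sum_i nq (p i x)) _ _ _ _ _ _ _ _ _.
Next Obligation. by move=> x i; exact: eqv_refl. Qed.
Next Obligation. by move=> x y h i; apply: eqv_sym; exact: h. Qed.
Next Obligation. by move=> x y z h1 h2 i; apply: eqv_trans (h1 i) (h2 i). Qed.
Next Obligation. by move=> k x y ox oy i; rewrite p_lc; exact: ok_lc. Qed.
Next Obligation. by move=> k x x' y y' h1 h2 i; rewrite !p_lc; exact: eqv_lc. Qed.
Next Obligation. by move=> x; apply: sumr_ge0 => i _; exact: nq_ge0. Qed.
Next Obligation.
move=> k x y ox oy /=; rewrite (mulr_sumr _ _ _ (k ^+ 2)) -big_split /= mulr_sumr.
by apply: ler_sum => i _; rewrite p_lc; exact: nq_lc.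
Qed.
Next Obligation. by move=> x y ox oy h /=; apply: eq_bigr => i _; exact: nq_eqv. Qed.
Next Obligation.
move=> x y ox oy /=; split=> [h|/eqP].
  by apply: big1 => i _; rewrite p_lc; apply/nq_sub0.
rewrite psumr_eq0; last by move=> i _; exact: nq_ge0.
move=> /allP h i; apply/nq_sub0 => //; apply/eqP.
by have := h i (mem_index_enum i); rewrite p_lc.
Qed.

Lemma good_coordinate i : good (p i : coordinate_space -> S i).
Proof.
split.
- by move=> x ox; exact: ox.
- by move=> k x y _ _; rewrite -p_lc; exact: eqv_refl.
- exists 1 => // x _ /=; rewrite mul1r (bigD1 i)//= lerDl.
  by apply: sumr_ge0 => j _; exact: nq_ge0.
Qed.

Lemma good_coordinates (S0 : l2space R) (F : S0 -> coordinate_space) :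
  (forall i, good (fun s => p i (F s))) -> good F.
Proof.
move=> gF; split.
- by move=> x ox i; have [oF _ _] := gF i; exact: oF.
- by move=> k x y ox oy i; rewrite p_lc; have [_ lF _] := gF i; exact: lF.
- have /choice[C hC] : forall i, exists C, 0 <= C /\ forall x, ok x -> nq (p i (F x)) <= C * nq x.
    by move=> i; have [_ _ [C C0 bF]] := gF i; exists C.
  exists (\sum_i C i); first by apply: sumr_ge0 => i _; case: (hC i).
  move=> x ox /=; rewrite mulr_suml; apply: ler_sum => i _.
  by have [_ bF] := hC i; exact: bF.
Qed.

End coordinate_space.

Section PI_good.
Context (R : realType) (a b c d : R).
Hypotheses (ab : a < b) (cd : c < d).

Section Zspace.
Variables (m0 m1 m2 : nat).

Definition Zlc (k : R) (v w : Ztype R m0 m1 m2) : Ztype R m0 m1 m2 :=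
  (k *: v.1.1 + w.1.1, fun x => k *: v.1.2 x + w.1.2 x, fun y => k *: v.2 y + w.2 y).

Definition Zcoord_space (i : 'I_m0 + 'I_m1 + 'I_m2) : l2space R :=
  match i with
  | inl (inl _) => Rspace R
  | inl (inr _) => Fx a b
  | inr _ => Fx c d
  end.

Definition Zcoord (i : 'I_m0 + 'I_m1 + 'I_m2) (w : Ztype R m0 m1 m2) : Zcoord_space i :=
  match i return Zcoord_space i with
  | inl (inl i) => w.1.1 i 0
  | inl (inr i) => fun x => w.1.2 x i 0
  | inr i => fun y => w.2 y i 0
  end.

Lemma Zcoord_lc k v w i : Zcoord i (Zlc k v w) = lc k (Zcoord i v) (Zcoord i w).
Proof.
case: i => [[i|i]|i] /=; first by rewrite !mxE.
  by apply/funext => x; rewrite !mxE.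
by apply/funext => x; rewrite !mxE.
Qed.

Definition Zspace : l2space R := coordinate_space Zcoord_lc.

Lemma ok_Zspace (w : Ztype R m0 m1 m2) : in_Z a b c d w <-> ok (w : Zspace).
Proof.
split=> [[h1 h2]|h].
  by case=> [[i|i]|i] //; [exact: h1|exact: h2].
by split=> i j; rewrite ord1; [exact: (h (inl (inr i)))|exact: (h (inr i))].
Qed.

Lemma eqv_Zspace (v w : Ztype R m0 m1 m2) : eqZ a b c d v w <-> eqv (v : Zspace) (w : Zspace).
Proof.
split=> [[h0 h1 h2] [[i|i]|i] /=|h].
- by rewrite h0.
- by apply: filterS h1 => x hx xab; rewrite (hx xab).
- by apply: filterS h2 => x hx xab; rewrite (hx xab).
split.
- by apply/colP => i; exact: (h (inl (inl i))).
- have := ae_forall_ord (fun i => h (inl (inr i))); apply: filterS => x hx xab.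
  by apply/colP => i; exact: hx.
- have := ae_forall_ord (fun i => h (inr i)); apply: filterS => x hx xab.
  by apply/colP => i; exact: hx.
Qed.

(** Boundedness entry by entry, the form in which PI operators, given by matrices, are estimated;
    [goodZP] returns to [good]. *)
Definition goodZ (S : l2space R) (W : S -> Ztype R m0 m1 m2) :=
  [/\ forall i, good (fun s => (W s).1.1 i 0 : Rspace R),
      forall i, good (fun s => (fun x => (W s).1.2 x i 0) : Fx a b) &
      forall i, good (fun s => (fun y => (W s).2 y i 0) : Fx c d)].

Lemma goodZP (S : l2space R) (W : S -> Ztype R m0 m1 m2) : goodZ W <-> good (W : S -> Zspace).
Proof.
split=> [[h0 h1 h2]|gW].
  by apply: good_coordinates => -[[i|i]|i]; [exact: h0|exact: h1|exact: h2].
split=> i.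
- exact: good_comp gW (good_coordinate Zcoord_lc (inl (inl i))).
- exact: good_comp gW (good_coordinate Zcoord_lc (inl (inr i))).
- exact: good_comp gW (good_coordinate Zcoord_lc (inr i)).
Qed.

End Zspace.

Section PI.
Variables (m0 m1 m2 q0 q1 q2 : nat) (B : params011 R m0 m1 m2 q0 q1 q2).
Hypotheses (hB : N011 a b c d B) (hmaps : maps_Z a b c d (PI011 a b c d B)).

Section source.
Variables (S : l2space R) (W : S -> Ztype R q0 q1 q2).
Hypothesis gW : goodZ W.

Lemma PI_good0 i : good (fun s => (PI011 a b c d B (W s)).1.1 i 0 : Rspace R).
Proof.
have [[L01 L02 _ _] _] := hB; have [g0 g1 g2] := gW.
rewrite (_ : (fun s => _) = (fun s => (\sum_j B00 B i j * (W s).1.1 j 0 +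
   \int[leb1 R]_(x in `[a, b]) (\sum_j B01 B x i j * (W s).1.2 x j 0)) +
   \int[leb1 R]_(y in `[c, d]) (\sum_j B02 B y i j * (W s).2 y j 0))); last first.
  apply/funext => s; case: (W s) => [[w0 w1] w2] /=; rewrite !mxE; congr (_ + _ + _);
    by apply: eq_Rintegral => z _; rewrite mxE.
apply: good_addR; first apply: good_addR.
- by apply: good_sumR => j; exact: good_comp (g0 j) (good_scaleR (B00 B i j)).
- exact: (good_dual_sum (g := fun j x => B01 B x i j) (fun j => L01 i j) g1).
- exact: (good_dual_sum (g := fun j x => B02 B x i j) (fun j => L02 i j) g2).
Qed.

(** All terms except multiplication by [B11_0]: they are of rank one or have L2 kernels, hence are
    bounded by membership in [N011]. *)
Let rest1 i s x := \sum_j B10 B x i j * (W s).1.1 j 0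
   + \int[leb1 R]_(t in `[a, x]) (\sum_j B11_1 B (x, t) i j * (W s).1.2 t j 0)
   + \int[leb1 R]_(t in `[x, b]) (\sum_j B11_2 B (x, t) i j * (W s).1.2 t j 0)
   + \int[leb1 R]_(y in `[c, d]) (\sum_j B12 B (x, y) i j * (W s).2 y j 0).

Lemma PI_rest1_good i : good (fun s => rest1 i s : Fx a b).
Proof.
have [[_ _ L10 _] [[_ L111 L112] [_ [L12 _]]]] := hB; have [g0 g1 g2] := gW.
have mab := measurable_cc a b.
apply: (good_addF (mD := mab)); first apply: (good_addF (mD := mab)); first apply: (good_addF (mD := mab)).
- exact: (good_rank1_sum (g := fun j x => B10 B x i j) (fun j => L10 i j) g0).
- exact: (good_hs_low (k := fun j z => B11_1 B z i j) (fun j => L111 i j) g1).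
- exact: (good_hs_up (k := fun j z => B11_2 B z i j) (fun j => L112 i j) g1).
- exact: (good_hs (k := fun j z => B12 B z i j) (fun j => L12 i j) g2).
Qed.

Lemma PI_split1 i s x : (PI011 a b c d B (W s)).1.2 x i 0 =
  \sum_j B11_0 B x i j * (W s).1.2 x j 0 + rest1 i s x.
Proof.
rewrite /rest1; case: (W s) => [[w0 w1] w2] /=; rewrite !mxE.
have E (D : set R) k l (M : R -> 'M[R]_(k, l)) (w : R -> 'cV[R]_l) e :
    \int[leb1 R]_(z in D) (M z *m w z) e 0 = \int[leb1 R]_(z in D) (\sum_j M z e j * w z j 0).
  by apply: eq_Rintegral => z _; rewrite mxE.
by rewrite !E; ring.
Qed.

Let rest2 i s y := \sum_j B20 B y i j * (W s).1.1 j 0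
   + \int[leb1 R]_(x in `[a, b]) (\sum_j B21 B (x, y) i j * (W s).1.2 x j 0)
   + \int[leb1 R]_(t in `[c, y]) (\sum_j B22_1 B (y, t) i j * (W s).2 t j 0)
   + \int[leb1 R]_(t in `[y, d]) (\sum_j B22_2 B (y, t) i j * (W s).2 t j 0).

Lemma PI_rest2_good i : good (fun s => rest2 i s : Fx c d).
Proof.
have [[_ _ _ L20] [_ [[_ L221 L222] [_ L21]]]] := hB; have [g0 g1 g2] := gW.
have mcd := measurable_cc c d.
apply: (good_addF (mD := mcd)); first apply: (good_addF (mD := mcd)); first apply: (good_addF (mD := mcd)).
- exact: (good_rank1_sum (g := fun j x => B20 B x i j) (fun j => L20 i j) g0).
- exact: (good_hsT (k := fun j z => B21 B z i j) (fun j => L21 i j) g1).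
- exact: (good_hs_low (k := fun j z => B22_1 B z i j) (fun j => L221 i j) g2).
- exact: (good_hs_up (k := fun j z => B22_2 B z i j) (fun j => L222 i j) g2).
Qed.

Lemma PI_split2 i s y : (PI011 a b c d B (W s)).2 y i 0 =
  \sum_j B22_0 B y i j * (W s).2 y j 0 + rest2 i s y.
Proof.
rewrite /rest2; case: (W s) => [[w0 w1] w2] /=; rewrite !mxE.
have E (D : set R) k l (M : R -> 'M[R]_(k, l)) (w : R -> 'cV[R]_l) e :
    \int[leb1 R]_(z in D) (M z *m w z) e 0 = \int[leb1 R]_(z in D) (\sum_j M z e j * w z j 0).
  by apply: eq_Rintegral => z _; rewrite mxE.
by rewrite !E; ring.
Qed.

End source.

Lemma sum_delta n (m : 'I_n -> R) (f : R) j :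
  \sum_k m k * ((f *: delta_mx j 0) : 'cV[R]_n) k 0 = m j * f.
Proof.
rewrite (bigD1 j)//= big1 ?addr0; first by rewrite !mxE !eqxx mulr1.
by move=> k kj; rewrite !mxE (negbTE kj) mulr0 mulr0.
Qed.

Lemma good_0F (S : l2space R) (u v : R) : good (fun _ : S => (fun=> 0) : Fx u v).
Proof.
have := good_comp (good_0R S) (good_rank1 (measurable_cc u v)
  (L2_cst (measurable_cc u v) (leb1_itv_fin u v) 1)).
rewrite (_ : (fun x : S => _) = (fun _ : S => (fun=> 0) : Fx u v))//.
by apply/funext => s; apply/funext => x; rewrite mulr0.
Qed.

(** An L2 entry need not multiply L2 into L2. This comes from [hmaps]: feed the operator with f in
    the j-th edge component and zero elsewhere, then subtract the bounded remainder [rest1]. *)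
Lemma PI_multiplier1 i j : good (fun f : Fx a b => (fun x => B11_0 B x i j * f x) : Fx a b).
Proof.
have mab := measurable_cc a b.
have [_ [[L110 _ _] _]] := hB.
have gm := good_multiplier mab (L2_measurable mab (L110 i j)); apply: gm => f Lf.
pose W (f : Fx a b) : Ztype R q0 q1 q2 := (0, fun x => f x *: delta_mx j 0, fun=> 0).
have gW : goodZ W.
  split=> k /=.
  - by under eq_fun do rewrite mxE; exact: good_0R.
  - have gs := good_scaleF (leb1 R) mab ((k == j)%:R).
    apply: (good_mono gs) => s x _ _; rewrite !mxE eqxx andbT; exact: mulrC.
  - by under eq_fun do under eq_fun do rewrite mxE; exact: good_0F.
have [og _ _] := PI_rest1_good gW i.
have oW : in_Z a b c d (W f).
  have [+ _ _] := (goodZP W).1 gW; move=> /(_ f Lf) oWf; exact/ok_Zspace.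
have [LP _] := hmaps oW.
have := L2B mab (LP i 0) (og _ Lf).
apply: L2_eq => x _; rewrite (PI_split1 W i f x) addrK.
exact: sum_delta.
Qed.

Lemma PI_multiplier2 i j : good (fun f : Fx c d => (fun x => B22_0 B x i j * f x) : Fx c d).
Proof.
have mcd := measurable_cc c d.
have [_ [_ [[L220 _ _] _]]] := hB.
have gm := good_multiplier mcd (L2_measurable mcd (L220 i j)); apply: gm => f Lf.
pose W (f : Fx c d) : Ztype R q0 q1 q2 := (0, fun=> 0, fun x => f x *: delta_mx j 0).
have gW : goodZ W.
  split=> k /=.
  - by under eq_fun do rewrite mxE; exact: good_0R.
  - by under eq_fun do under eq_fun do rewrite mxE; exact: good_0F.
  - have gs := good_scaleF (leb1 R) mcd ((k == j)%:R).
    apply: (good_mono gs) => s x _ _; rewrite !mxE eqxx andbT; exact: mulrC.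
have [og _ _] := PI_rest2_good gW i.
have oW : in_Z a b c d (W f).
  have [+ _ _] := (goodZP W).1 gW; move=> /(_ f Lf) oWf; exact/ok_Zspace.
have [_ LP] := hmaps oW.
have := L2B mcd (LP i 0) (og _ Lf).
apply: L2_eq => x _; rewrite (PI_split2 W i f x) addrK.
exact: sum_delta.
Qed.

Lemma PI_good (S : l2space R) (W : S -> Ztype R q0 q1 q2) : goodZ W ->
  goodZ (fun s => PI011 a b c d B (W s)).
Proof.
move=> gW; have [g0 g1 g2] := gW; have mab := measurable_cc a b; have mcd := measurable_cc c d.
split=> i.
- exact: PI_good0.
- have gs := good_sumF (mD := mab) (index_enum 'I_q1) (fun j => good_comp (g1 j) (PI_multiplier1 i j)).
  apply: (good_mono (good_addF (mD := mab) gs (PI_rest1_good gW i))) => s x _ _.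
  exact: PI_split1.
- have gs := good_sumF (mD := mcd) (index_enum 'I_q2) (fun j => good_comp (g2 j) (PI_multiplier2 i j)).
  apply: (good_mono (good_addF (mD := mcd) gs (PI_rest2_good gW i))) => s x _ _.
  exact: PI_split2.
Qed.

End PI.

End PI_good.

(** * Iterated primitives *)

Section iterated_primitives.
Context (R : realType).
Implicit Types (a b c d x y : R) (f g : R -> R) (v : R * R -> R).

(** Also true for infinite or undefined integrals, by inspection of [fine]; so [opK1_opp] can be an
    identity at every point for every w. *)
Lemma RintegralN_total (dp : measure_display) (T : measurableType dp)
    (mu : {measure set T -> \bar R}) (D : set T) (f : T -> R) :
  \int[mu]_(x in D) (- f x) = - \int[mu]_(x in D) f x.
Proof.
rewrite -[LHS]/(fine (\int[mu]_(x in D) (\- (EFin \o f))%E x)) /Rintegral.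
rewrite integralE [in RHS]integralE funeposN funenegN.
move: (\int[_]_(_ in _) _)%E (\int[_]_(_ in _) _)%E => [r| |] [s| |] //=; rewrite ?oppr0//.
by rewrite opprB.
Qed.

Lemma Rintegral_itv1 a f : \int[leb1 R]_(t in `[a, a]) f t = 0.
Proof. by rewrite set_itv1 Rintegral_set1. Qed.

Lemma L2_mul_continuous a b (h f : R -> R) : continuous h ->
  L2 (leb1 R) `[a, b] f -> L2 (leb1 R) `[a, b] (fun t => h t * f t).
Proof.
move=> ch Lf; have [M hM] := continuous_itv_bounded a b ch.
apply: (L2M_bounded (measurable_cc a b) (M := M)) Lf.
  by apply: measurable_funTS; exact: continuous_measurable_fun.
by move=> x /=; rewrite in_itv /=; exact: hM.
Qed.

Lemma L2_mul_continuous2 a b c d (h v : R * R -> R) : continuous h ->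
  L2 (leb2 R) (Omega a b c d) v -> L2 (leb2 R) (Omega a b c d) (fun z => h z * v z).
Proof.
move=> ch Lf; have [M hM] := continuous_Om_bounded a b c d ch.
apply: (L2M_bounded (measurable_Om a b c d) (M := M)) Lf => //.
by apply: measurable_funTS; exact: continuous_measurable2.
Qed.

(** Cauchy's formula for repeated integration: integration by parts with psi = [id]. It is the
    origin of the kernels x - theta and y - nu. *)
Lemma iterated_primitive a x f : a <= x -> (leb1 R).-integrable `[a, x] (EFin \o f) ->
  \int[leb1 R]_(s in `[a, x]) (\int[leb1 R]_(t in `[a, s]) f t) =
  \int[leb1 R]_(t in `[a, x]) ((x - t) * f t).
Proof.
move=> ax jf.
have c1 : continuous (fun _ : R => 1 : R) by move=> t; exact: cvg_cst.
have d1 (t : R) : is_derive t 1 id (1 : R) by exact: is_derive_id.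
have [_ E] := @Rintegral_by_parts R a x f id (fun=> 1) ax jf c1 d1.
transitivity (\int[leb1 R]_(t in `[a, x]) (f t * (x - t))).
  by rewrite -E; apply: eq_Rintegral => s _; rewrite mulr1.
by apply: eq_Rintegral => t _; rewrite mulrC.
Qed.

Lemma Rintegral_lin a b k f g : L2 (leb1 R) `[a, b] f -> L2 (leb1 R) `[a, b] g ->
  \int[leb1 R]_(t in `[a, b]) (f t + k * g t) =
  \int[leb1 R]_(t in `[a, b]) f t + k * \int[leb1 R]_(t in `[a, b]) g t.
Proof.
move=> /L2_itv_integrable jf /L2_itv_integrable jg; have m := measurable_cc a b.
by rewrite (RintegralD m jf (integrableZ_EFin m k jg)) (RintegralZl _ m jg).
Qed.

Section rectangle.
Variables (a b c d : R).
Hypotheses (ab : a < b) (cd : c < d).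
Local Notation Om := (Omega a b c d).
Local Notation L2Om := (L2 (leb2 R) Om).
Local Notation L2x := (L2 (leb1 R) `[a, b]).
Local Notation L2y := (L2 (leb1 R) `[c, d]).

Lemma L2x_trunc f x : a <= x <= b -> L2x f -> L2 (leb1 R) `[a, x] f.
Proof. by move=> /andP[_ xb]; exact: L2_trunc. Qed.

Lemma L2y_trunc f y : c <= y <= d -> L2y f -> L2 (leb1 R) `[c, y] f.
Proof. by move=> /andP[_ xb]; exact: L2_trunc. Qed.

Lemma IxIyE v z : L2Om v -> Om z ->
  Ix a (Iy c v) z = \int[leb2 R]_(w in Omega a z.1 c z.2) v w.
Proof.
case: z => x y Lv Oz; rewrite (Om_fubini1 (integrable_Om_trunc Oz (L2_Om_integrable Lv))).
by [].
Qed.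

Lemma IxIyD v w z : L2Om v -> L2Om w -> Om z ->
  Ix a (Iy c (fun z => v z + w z)) z = Ix a (Iy c v) z + Ix a (Iy c w) z.
Proof.
case: z => x y Lv Lw Oz.
have Ls := L2D (measurable_Om a b c d) Lv Lw.
rewrite (IxIyE Lv Oz) (IxIyE Lw Oz) (IxIyE Ls Oz).
have jv := integrable_Om_trunc Oz (L2_Om_integrable Lv).
have jw := integrable_Om_trunc Oz (L2_Om_integrable Lw).
exact: (RintegralD (measurable_Om a x c y) jv jw).
Qed.

Lemma IxIy_fst f x y : c <= y ->
  Ix a (Iy c (fun z => f z.1)) (x, y) = \int[leb1 R]_(t in `[a, x]) ((y - c) * f t).
Proof.
move=> cy; apply: eq_Rintegral => t _; rewrite /Iy /=.
by rewrite (Rintegral_cst _ (measurable_cc c y)) (leb1_itv cy) mulrC.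
Qed.

Lemma IxIy_snd f x y : a <= x ->
  Ix a (Iy c (fun z => f z.2)) (x, y) = (x - a) * \int[leb1 R]_(t in `[c, y]) f t.
Proof.
move=> ax; rewrite /Ix /Iy /=.
by rewrite (Rintegral_cst _ (measurable_cc a x)) (leb1_itv ax) mulrC.
Qed.

Lemma Ix_prim f x y : c <= y <= d -> a <= x <= b -> L2x f ->
  Ix a (Iy c (Ix a (fun z => f z.1))) (x, y) =
  (y - c) * \int[leb1 R]_(t in `[a, x]) ((x - t) * f t).
Proof.
move=> /andP[cy _] xab Lf; case/andP: (xab) => ax xb.
rewrite (IxIy_fst (fun s => \int[leb1 R]_(t in `[a, s]) f t) _ cy).
have LI := L2x_trunc xab (Ix_fst_L2 ab cd Lf).
rewrite (RintegralZl _ (measurable_cc a x) (L2_itv_integrable LI)).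
by rewrite (iterated_primitive ax (L2_itv_integrable (L2x_trunc xab Lf))).
Qed.

Lemma Iy_prim f x y : a <= x <= b -> c <= y <= d -> L2y f ->
  Ix a (Iy c (Iy c (fun z => f z.2))) (x, y) =
  (x - a) * \int[leb1 R]_(t in `[c, y]) ((y - t) * f t).
Proof.
move=> /andP[ax _] ycd Lf; case/andP: (ycd) => cy yd.
rewrite (IxIy_snd (fun s => \int[leb1 R]_(t in `[c, s]) f t) _ ax).
by rewrite (iterated_primitive cy (L2_itv_integrable (L2y_trunc ycd Lf))).
Qed.

Lemma continuous_sub_fst x : continuous (fun z : R * R => x - z.1).
Proof. by move=> z; apply: cvgB; [exact: cvg_cst|exact: cvg_fst]. Qed.

Lemma continuous_sub_snd y : continuous (fun z : R * R => y - z.2).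
Proof. by move=> z; apply: cvgB; [exact: cvg_cst|exact: cvg_snd]. Qed.

Lemma Iy_kernel_L2 v y : L2Om v -> L2Om (fun z => (y - z.2) * v z).
Proof. by apply: L2_mul_continuous2; exact: continuous_sub_snd. Qed.

Lemma Ix_kernel_L2 v x : L2Om v -> L2Om (fun z => (x - z.1) * v z).
Proof. by apply: L2_mul_continuous2; exact: continuous_sub_fst. Qed.

Lemma ae_Iy_Iy v : L2Om v -> {ae leb1 R, forall x, `[a, b]%classic x ->
  forall y, `[c, d]%classic y ->
  Iy c (Iy c v) (x, y) = Iy c (fun z => (y - z.2) * v z) (x, y)}.
Proof.
move=> Lv; apply: filterS (Om_section1 Lv) => x hx xab y; rewrite /= in_itv /= => ycd.
case/andP: (ycd) => cy _.
exact: (iterated_primitive cy (L2_itv_integrable (L2y_trunc ycd (hx xab)))).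
Qed.

Lemma ae_Ix_Ix v : L2Om v -> {ae leb1 R, forall y, `[c, d]%classic y ->
  forall x, `[a, b]%classic x ->
  Ix a (Ix a v) (x, y) = Ix a (fun z => (x - z.1) * v z) (x, y)}.
Proof.
move=> Lv; apply: filterS (Om_section2 Lv) => y hy ycd x; rewrite /= in_itv /= => xab.
case/andP: (xab) => ax _.
exact: (iterated_primitive ax (L2_itv_integrable (L2x_trunc xab (hy ycd)))).
Qed.

Lemma ae_Iy_scale (h : R -> R) v : L2Om v -> {ae leb1 R, forall x, `[a, b]%classic x ->
  forall y, `[c, d]%classic y ->
  Iy c (fun z => h z.1 * v z) (x, y) = h x * Iy c v (x, y)}.
Proof.
move=> Lv; apply: filterS (Om_section1 Lv) => x hx xab y; rewrite /= in_itv /= => ycd.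
by rewrite /Iy /= (RintegralZl _ (measurable_cc c y) (L2_itv_integrable (L2y_trunc ycd (hx xab)))).
Qed.

Lemma eq_ae_Ix v w x y : a <= x <= b -> c <= y <= d ->
  L2 (leb1 R) `[a, b] (fun t => v (t, y)) -> L2 (leb1 R) `[a, b] (fun t => w (t, y)) ->
  {ae leb1 R, forall x, `[a, b]%classic x -> v (x, y) = w (x, y)} ->
  Ix a v (x, y) = Ix a w (x, y).
Proof.
move=> xab ycd Lv Lw E; have m := measurable_cc a x.
apply: (ae_eq_Rintegral m (L2_measurable m (L2x_trunc xab Lv)) (L2_measurable m (L2x_trunc xab Lw))).
apply: filterS E => t h; rewrite /= in_itv /= => /andP[at_ tx]; apply: h.
by rewrite /= in_itv /= at_ (le_trans tx)//; case/andP: xab.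
Qed.

(** The inner identity holds for almost every abscissa and all y; the outer integral absorbs the
    exceptional set, so the result holds at every point, corners included. *)
Lemma IxIyIy v x y : L2Om v -> Om (x, y) ->
  Ix a (Iy c (Iy c v)) (x, y) = Ix a (Iy c (fun z => (y - z.2) * v z)) (x, y).
Proof.
move=> Lv [/=]; rewrite !in_itv /= => xab ycd.
have [LI _] := Iy_L2 (ltW cd) Lv.
apply: eq_ae_Ix => //.
- exact: (Iy_slice_L2 ab ycd LI).
- exact: (Iy_slice_L2 ab ycd (Iy_kernel_L2 y Lv)).
- by apply: filterS (ae_Iy_Iy Lv) => t h tab; apply: h => //; rewrite /= in_itv.
Qed.

Lemma eq_ae_Iy v w x y : a <= x <= b -> c <= y <= d ->
  L2 (leb1 R) `[c, d] (fun t => v (x, t)) -> L2 (leb1 R) `[c, d] (fun t => w (x, t)) ->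
  {ae leb1 R, forall y, `[c, d]%classic y -> v (x, y) = w (x, y)} ->
  Iy c v (x, y) = Iy c w (x, y).
Proof.
move=> xab ycd Lv Lw E; have m := measurable_cc c y.
apply: (ae_eq_Rintegral m (L2_measurable m (L2y_trunc ycd Lv)) (L2_measurable m (L2y_trunc ycd Lw))).
apply: filterS E => t h; rewrite /= in_itv /= => /andP[at_ tx]; apply: h.
by rewrite /= in_itv /= at_ (le_trans tx)//; case/andP: ycd.
Qed.

Lemma Ix_slice_L2 r x0 : a <= x0 <= b -> L2Om r ->
  L2 (leb1 R) `[c, d] (fun y => Ix a r (x0, y)).
Proof.
by move=> xab Lr; have [Lrs _] := Omswap Lr; exact: (Iy_slice_L2 cd xab Lrs).
Qed.

Lemma IxIyIx v x y : L2Om v -> Om (x, y) ->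
  Ix a (Iy c (Ix a v)) (x, y) = Ix a (Iy c (fun z => (x - z.1) * v z)) (x, y).
Proof.
move=> Lv Oz; have [/=] := Oz; rewrite !in_itv /= => xab ycd.
have [LI _] := Ix_L2 (ltW ab) Lv; have Lk := Ix_kernel_L2 x Lv.
rewrite (IxIy_comm (L2_Om_integrable LI) Oz) (IxIy_comm (L2_Om_integrable Lk) Oz).
apply: eq_ae_Iy => //.
- exact: (Ix_slice_L2 xab LI).
- exact: (Ix_slice_L2 xab Lk).
- by apply: filterS (ae_Ix_Ix Lv) => t h tab; apply: h => //; rewrite /= in_itv.
Qed.

Lemma IxIy_ae v w z : L2Om v -> L2Om w -> v = w %[ae leb2 R in Om] -> Om z ->
  Ix a (Iy c v) z = Ix a (Iy c w) z.
Proof.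
case: z => x y Lv Lw E Oz; rewrite (IxIyE Lv Oz) (IxIyE Lw Oz).
have sub : Omega a x c y `<=` Om.
  move=> [s t]; case: Oz => /=; rewrite !in_itv /= => /andP[_ xb] /andP[_ yd] [/=].
  rewrite !in_itv /= => /andP[h1 h2] /andP[h3 h4].
  by split; rewrite /= in_itv /= ?h1 ?h3 ?(le_trans h2)// (le_trans h4).
have mO := measurable_Om a b c d; have mxy := measurable_Om a x c y.
apply: (ae_eq_Rintegral mxy (measurable_funS mO sub (L2_measurable mO Lv))
  (measurable_funS mO sub (L2_measurable mO Lw))).
by apply: filterS E => t h /sub; exact: h.
Qed.

Lemma IxIyIxIy v x y : L2Om v -> Om (x, y) ->
  Ix a (Iy c (Ix a (Iy c v))) (x, y) =
  Ix a (Iy c (fun z => (x - z.1) * (y - z.2) * v z)) (x, y).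
Proof.
move=> Lv Oz; have [LI _] := Iy_L2 (ltW cd) Lv.
have Lw := Ix_kernel_L2 x Lv; have [LIw _] := Iy_L2 (ltW cd) Lw.
rewrite (IxIyIx LI Oz).
(* On almost every vertical slice, x - z.1 is constant and enters the y-integral. *)
rewrite (IxIy_ae (Ix_kernel_L2 x LI) LIw _ Oz); last first.
  apply: (Om_ae_slice1 (P := fun z => (x - z.1) * Iy c v z = Iy c (fun z => (x - z.1) * v z) z)).
  by apply: filterS (ae_Iy_scale (fun t => x - t) Lv) => t h tab s scd; rewrite (h tab s scd).
have -> : (fun z : R * R => (x - z.1) * (y - z.2) * v z) = (fun z => (y - z.2) * ((x - z.1) * v z)).
  by apply/funext => z; ring.
exact: (IxIyIy Lw Oz).
Qed.

Lemma prim_valx k f x : a <= x <= b -> L2x f ->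
  \int[leb1 R]_(t in `[a, x]) prim a k f t =
  (x - a) * k + \int[leb1 R]_(t in `[a, x]) ((x - t) * f t).
Proof.
move=> xab Lf; case/andP: (xab) => ax xb; have m := measurable_cc a x.
have L1 := L2_cst m (leb1_itv_fin a x) k.
have LI := L2x_trunc xab (Ix_fst_L2 ab cd Lf).
rewrite /prim (RintegralD m (L2_itv_integrable L1) (L2_itv_integrable LI)).
rewrite (iterated_primitive ax (L2_itv_integrable (L2x_trunc xab Lf))).
by rewrite (Rintegral_cst _ m) (leb1_itv ax) mulrC.
Qed.

Lemma prim_valy k f y : c <= y <= d -> L2y f ->
  \int[leb1 R]_(t in `[c, y]) prim c k f t =
  (y - c) * k + \int[leb1 R]_(t in `[c, y]) ((y - t) * f t).
Proof.
move=> ycd Lf; case/andP: (ycd) => cy yd; have m := measurable_cc c y.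
have L1 := L2_cst m (leb1_itv_fin c y) k.
have LI := L2y_trunc ycd (Iy_snd_L2 ab cd Lf).
rewrite /prim (RintegralD m (L2_itv_integrable L1) (L2_itv_integrable LI)).
rewrite (iterated_primitive cy (L2_itv_integrable (L2y_trunc ycd Lf))).
by rewrite (Rintegral_cst _ m) (leb1_itv cy) mulrC.
Qed.

Lemma L2_kernel1 u w x f : L2 (leb1 R) `[u, w] f -> L2 (leb1 R) `[u, w] (fun t => (x - t) * f t).
Proof.
by apply: L2_mul_continuous => t; apply: cvgB; [exact: cvg_cst|exact: cvg_id].
Qed.

Section values.
Variables (k00 k10 k01 k11 : R) (be0 be1 al0 al1 : R -> R) (v : R * R -> R).
Hypotheses (Lb0 : L2x be0) (Lb1 : L2x be1) (La0 : L2y al0) (La1 : L2y al1) (Lv : L2Om v).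
Local Notation F := (form2 a c k00 k10 k01 k11 be0 be1 al0 al1 v).
Variables (x y : R).
Hypotheses (xab : a <= x <= b) (ycd : c <= y <= d).

Let ax : a <= x. Proof. by case/andP: xab. Qed.
Let cy : c <= y. Proof. by case/andP: ycd. Qed.
Let Oxy : Om (x, y). Proof. by split; rewrite /= in_itv. Qed.

(** This and the next two expand nested primitives into single integrals with polynomial kernels,
    the shape of K1, K2, H1 and H2. They hold at every point of the rectangle, as corner values
    require. *)
Lemma form2_val10 : F 1 0 (x, y) = k10 + (y - c) * k11
  + \int[leb1 R]_(t in `[a, x]) (be0 t + (y - c) * be1 t)
  + \int[leb1 R]_(t in `[c, y]) ((y - t) * al1 t)
  + Ix a (Iy c (fun z => (y - z.2) * v z)) (x, y).
Proof.
have [L1 _] := L2_Om_fst c d Lb1; have [L2 _] := Iy_L2 (ltW cd) Lv.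
rewrite -[LHS]/(k10 + \int[leb1 R]_(t in `[a, x]) be0 t
  + \int[leb1 R]_(t in `[c, y]) prim c k11 al1 t
  + Ix a (Iy c (fun z => be1 z.1 + Iy c v z)) (x, y)).
rewrite (IxIyD L1 L2 Oxy) (IxIyIy Lv Oxy) (IxIy_fst _ _ cy) (prim_valy _ ycd La1).
rewrite (Rintegral_lin _ (L2x_trunc xab Lb0) (L2x_trunc xab Lb1)).
rewrite (RintegralZl _ (measurable_cc a x) (L2_itv_integrable (L2x_trunc xab Lb1))).
by ring.
Qed.

Lemma form2_val01 : F 0 1 (x, y) = k01 + (x - a) * k11
  + \int[leb1 R]_(t in `[a, x]) ((x - t) * be1 t)
  + \int[leb1 R]_(t in `[c, y]) (al0 t + (x - a) * al1 t)
  + Ix a (Iy c (fun z => (x - z.1) * v z)) (x, y).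
Proof.
have [L1 _] := L2_Om_snd a b La1; have [L2 _] := Ix_L2 (ltW ab) Lv.
rewrite -[LHS]/(k01 + \int[leb1 R]_(t in `[a, x]) prim a k11 be1 t
  + \int[leb1 R]_(t in `[c, y]) al0 t
  + Ix a (Iy c (fun z => al1 z.2 + Ix a v z)) (x, y)).
rewrite (IxIyD L1 L2 Oxy) (IxIyIx Lv Oxy) (IxIy_snd _ _ ax) (prim_valx _ xab Lb1).
rewrite (Rintegral_lin _ (L2y_trunc ycd La0) (L2y_trunc ycd La1)).
by ring.
Qed.

Lemma form2_val00 : F 0 0 (x, y) = k00 + (x - a) * k10 + (y - c) * k01
  + (y - c) * (x - a) * k11
  + \int[leb1 R]_(t in `[a, x]) ((x - t) * be0 t + (y - c) * ((x - t) * be1 t))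
  + \int[leb1 R]_(t in `[c, y]) ((y - t) * al0 t + (x - a) * ((y - t) * al1 t))
  + Ix a (Iy c (fun z => (x - z.1) * (y - z.2) * v z)) (x, y).
Proof.
have [L1 _] := L2_Om_fst c d Lb1; have [L2 _] := Iy_L2 (ltW cd) Lv.
have [L3 _] := L2_Om_snd a b La1; have [L4 _] := Ix_L2 (ltW ab) L1.
have [L5 _] := Iy_L2 (ltW cd) L3; have [L6 _] := Ix_L2 (ltW ab) L2.
have mO := measurable_Om a b c d.
have L0 := L2_cst mO (leb2_Om_fin a b c d) k11.
rewrite -[LHS]/(k00 + \int[leb1 R]_(t in `[a, x]) prim a k10 be0 t
  + \int[leb1 R]_(t in `[c, y]) prim c k01 al0 t
  + Ix a (Iy c (fun z => k11 + Ix a (fun z => be1 z.1) z + Iy c (fun z => al1 z.2) z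
      + Ix a (Iy c v) z)) (x, y)).
have L7 := L2D mO L0 L4; have L8 := L2D mO L7 L5.
rewrite (IxIyD L8 L6 Oxy) (IxIyD L7 L5 Oxy) (IxIyD L0 L4 Oxy).
rewrite (IxIyIxIy Lv Oxy).
rewrite (IxIy_snd (fun=> k11) _ ax) (Rintegral_cst _ (measurable_cc c y)) (leb1_itv cy).
rewrite (Ix_prim ycd xab Lb1) (Iy_prim xab ycd La1) (prim_valx _ xab Lb0) (prim_valy _ ycd La0).
rewrite (Rintegral_lin _ (L2_kernel1 x (L2x_trunc xab Lb0)) (L2_kernel1 x (L2x_trunc xab Lb1))).
rewrite (Rintegral_lin _ (L2_kernel1 y (L2y_trunc ycd La0)) (L2_kernel1 y (L2y_trunc ycd La1))).
by ring.
Qed.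

End values.

(** Valid for almost every x and every y: it is evaluated at y = c and y = d to obtain edge
    traces. *)
Lemma ae_Iy_edgex be v : L2x be -> L2Om v ->
  {ae leb1 R, forall x, `[a, b]%classic x -> forall y, `[c, d]%classic y ->
    Iy c (edgex c be v) (x, y) = (y - c) * be x + Iy c (fun z => (y - z.2) * v z) (x, y)}.
Proof.
move=> Lb Lv; have [LI _] := Iy_L2 (ltW cd) Lv.
apply: filterS2 (Om_section1 LI) (ae_Iy_Iy Lv) => x h1 h2 xab y ycd.
rewrite -(h2 xab _ ycd); move: ycd; rewrite /= in_itv /= => ycd; case/andP: (ycd) => cy yd.
have m := measurable_cc c y; have L1 := L2_cst m (leb1_itv_fin c y) (be x).
rewrite -[LHS]/(\int[leb1 R]_(t in `[c, y]) (be x + Iy c v (x, t))).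
rewrite (RintegralD m (L2_itv_integrable L1) (L2_itv_integrable (L2y_trunc ycd (h1 xab)))).
by rewrite (Rintegral_cst _ m) (leb1_itv cy) [be x * _]mulrC.
Qed.

Lemma ae_Ix_edgey al v : L2y al -> L2Om v ->
  {ae leb1 R, forall y, `[c, d]%classic y -> forall x, `[a, b]%classic x ->
    Ix a (edgey a al v) (x, y) = (x - a) * al y + Ix a (fun z => (x - z.1) * v z) (x, y)}.
Proof.
move=> Lb Lv; have [LI _] := Ix_L2 (ltW ab) Lv.
apply: filterS2 (Om_section2 LI) (ae_Ix_Ix Lv) => y h1 h2 ycd x xab.
rewrite -(h2 ycd _ xab); move: xab; rewrite /= in_itv /= => xab; case/andP: (xab) => ax xb.
have m := measurable_cc a x; have L1 := L2_cst m (leb1_itv_fin a x) (al y).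
rewrite -[LHS]/(\int[leb1 R]_(t in `[a, x]) (al y + Ix a v (t, y))).
rewrite (RintegralD m (L2_itv_integrable L1) (L2_itv_integrable (L2x_trunc xab (h1 ycd)))).
by rewrite (Rintegral_cst _ m) (leb1_itv ax) [al y * _]mulrC.
Qed.

Section good_forms.
Variable S : l2space R.
Implicit Types (k : S -> Rspace R) (be : S -> Fx a b) (al : S -> Fx c d) (r : S -> FOm a b c d).

Lemma good_const u w k : good k -> good (fun s => (fun=> k s) : Fx u w).
Proof.
move=> gk; have L1 := L2_cst (measurable_cc u w) (leb1_itv_fin u w) 1.
have := good_comp gk (good_rank1 (measurable_cc u w) L1).
rewrite (_ : (fun s : S => _) = (fun s => (fun=> k s) : Fx u w))//.
by apply/funext => s; apply/funext => z; rewrite mul1r.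
Qed.

Lemma good_prim u w k (g : S -> Fx u w) : good k -> good g ->
  good (fun s => prim u (k s) (g s) : Fx u w).
Proof.
move=> gk gf; apply: (good_addF (mD := measurable_cc u w) (good_const u w gk)).
have L1 := L2_cst (measurable_Om u w u w) (leb2_Om_fin u w u w) 1.
(* A primitive is the Volterra operator with kernel 1, seen as a sum of one term. *)
apply: (good_mono (good_hs_low (n := 1) (k := fun _ _ => 1) (fun=> L1) (fun=> gf))).
move=> s x _ _; apply: eq_Rintegral => t _.
by rewrite big_ord1 mul1r.
Qed.

Lemma good_edgex be r : good be -> good r -> good (fun s => edgex c (be s) (r s) : FOm a b c d).
Proof.
move=> gb gv; apply: (good_addF (mD := measurable_Om a b c d)).
- exact: (good_comp gb (good_fst a b c d)).
- exact: (good_comp gv (good_Iy a b cd)).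
Qed.

Lemma good_edgey al r : good al -> good r -> good (fun s => edgey a (al s) (r s) : FOm a b c d).
Proof.
move=> ga gv; apply: (good_addF (mD := measurable_Om a b c d)).
- exact: (good_comp ga (good_snd a b c d)).
- exact: (good_comp gv (good_Ix c d ab)).
Qed.

Lemma good_Qf k be al r : good k -> good be -> good al -> good r ->
  good (fun s => Qf a c (k s) (be s) (al s) (r s) : FOm a b c d).
Proof.
move=> gk gb ga gv; have mO := measurable_Om a b c d.
apply: (good_addF (mD := mO)); first apply: (good_addF (mD := mO)); first apply: (good_addF (mD := mO)).
- exact: (good_comp gk (good_cstOm a b c d)).
- exact: (good_comp (good_comp gb (good_fst a b c d)) (good_Ix c d ab)).
- exact: (good_comp (good_comp ga (good_snd a b c d)) (good_Iy a b cd)).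
- exact: (good_comp (good_comp gv (good_Iy a b cd)) (good_Ix c d ab)).
Qed.

Lemma good_form1 k be al r i j : good k -> good be -> good al -> good r ->
  good (fun s => form1 a c (k s) (be s) (al s) (r s) i j : FOm a b c d).
Proof.
move=> gk gb ga gv; case: i => [|[|i]]; case: j => [|[|j]] //=.
- exact: good_Qf.
- exact: good_edgey.
- exact: good_edgex.
Qed.

Lemma good_form2 (k00 k10 k01 k11 : S -> Rspace R) be0 be1 al0 al1 r i j :
  good k00 -> good k10 -> good k01 -> good k11 ->
  good be0 -> good be1 -> good al0 -> good al1 -> good r ->
  good (fun s => form2 a c (k00 s) (k10 s) (k01 s) (k11 s) (be0 s) (be1 s) (al0 s) (al1 s)
    (r s) i j : FOm a b c d).
Proof.
move=> g00 g10 g01 g11 gb0 gb1 ga0 ga1 gv.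
have h1 := good_edgex gb1 gv; have h2 := good_edgey ga1 gv.
have h3 := good_Qf g11 gb1 ga1 gv.
case: i => [|[|[|i]]]; last exact: gv.
- case: j => [|[|[|j]]]; last exact: gv.
  + exact: (good_Qf g00 (good_prim g10 gb0) (good_prim g01 ga0) h3).
  + exact: (good_Qf g01 (good_prim g11 gb1) ga0 h2).
  + exact: (good_edgey ga0 h2).
- case: j => [|[|[|j]]]; last exact: gv.
  + exact: (good_Qf g10 gb0 (good_prim g11 ga1) h1).
  + exact: h3.
  + exact: h2.
- case: j => [|[|[|j]]]; last exact: gv.
  + exact: (good_edgex gb0 h1).
  + exact: h1.
  + exact: gv.
Qed.

End good_forms.

End rectangle.

End iterated_primitives.

(** * The blocks of H1, H2, K1 and K2 *)

Section block_indices.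
Context (R : realType).

(** The first bit refers to x and the second to y. The same order serves the corners (a, c), (b, c),
    (a, d), (b, d) of Lambda_1 and the derivatives 1, d_x, d_y, d_x d_y of [Lambda_bf]. *)
Definition sel4 (T : Type) (p : bool * bool) (A B C D : T) : T :=
  if p.1 then if p.2 then D else B else if p.2 then C else A.

Lemma sel4E (T : Type) (A B C D : T) :
  (sel4 (false, false) A B C D = A) * (sel4 (true, false) A B C D = B) *
  (sel4 (false, true) A B C D = C) * (sel4 (true, true) A B C D = D).
Proof. by []. Qed.

Definition idx4 n (p : bool * bool) (k : 'I_n) : 'I_(four n) :=
  sel4 p (lshift (n + (n + n)) k) (rshift n (lshift (n + n) k))
    (rshift n (rshift n (lshift n k))) (rshift n (rshift n (rshift n k))).

Definition idx2 n (q : bool) (k : 'I_n) : 'I_(two n) :=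
  if q then rshift n k else lshift n k.

Lemma idx4P n (i : 'I_(four n)) : exists p k, i = idx4 p k.
Proof.
case: (split_ordP i) => k ->; first by exists (false, false), k.
case: (split_ordP k) => {}k ->; first by exists (true, false), k.
by case: (split_ordP k) => {}k ->; [exists (false, true), k|exists (true, true), k].
Qed.

Lemma idx2P n (i : 'I_(two n)) : exists q k, i = idx2 q k.
Proof. by case: (split_ordP i) => k ->; [exists false, k|exists true, k]. Qed.

Lemma col4E m n (A B C D : 'M[R]_(m, n)) p k j :
  col4 A B C D (idx4 p k) j = sel4 p A B C D k j.
Proof. by case: p => -[] []; rewrite /idx4 /sel4 /col4 /= ?(col_mxEd, col_mxEu). Qed.

Lemma col2E m n (A B : 'M[R]_(m, n)) q k j :
  col_mx A B (idx2 q k) j = (if q then B else A) k j.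
Proof. by case: q; rewrite /idx2 ?(col_mxEd, col_mxEu). Qed.

Definition sub4 n (p : bool * bool) (u : 'cV[R]_(four n)) : 'cV[R]_n := \col_k u (idx4 p k) 0.

Definition sub2 n (q : bool) (u : 'cV[R]_(two n)) : 'cV[R]_n := \col_k u (idx2 q k) 0.

Lemma row4_mul m n (A B C D : 'M[R]_(m, n)) (u : 'cV[R]_(four n)) :
  row4 A B C D *m u = A *m sub4 (false, false) u + (B *m sub4 (true, false) u +
    (C *m sub4 (false, true) u + D *m sub4 (true, true) u)).
Proof.
have {1}-> : u = col4 (sub4 (false, false) u) (sub4 (true, false) u) (sub4 (false, true) u)
    (sub4 (true, true) u).
  apply/colP => i; have [p [k ->]] := idx4P i; rewrite col4E.
  by case: p => -[] []; rewrite mxE.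
by rewrite /row4 /col4 !mul_row_col.
Qed.

Lemma row2_mul m n (A B : 'M[R]_(m, n)) (u : 'cV[R]_(two n)) :
  row_mx A B *m u = A *m sub2 false u + B *m sub2 true u.
Proof.
have {1}-> : u = col_mx (sub2 false u) (sub2 true u).
  apply/colP => i; have [p [k ->]] := idx2P i; rewrite col2E.
  by case: p; rewrite mxE.
by rewrite mul_row_col.
Qed.

Lemma mul_col4 m n p (A B C D : 'M[R]_(m, n)) (u : 'M[R]_(n, p)) :
  col4 A B C D *m u = col4 (A *m u) (B *m u) (C *m u) (D *m u).
Proof. by rewrite /col4 !mul_col_mx. Qed.

Lemma kron4_mul n v0 v1 v2 v3 (u : 'cV[R]_n) p k :
  (kron4 n v0 v1 v2 v3 *m u) (idx4 p k) 0 = sel4 p v0 v1 v2 v3 * u k 0.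
Proof.
rewrite /kron4 mul_col4 !mul_scalar_mx col4E.
by case: p => -[] []; rewrite mxE.
Qed.

Lemma kron2_mul n v0 v1 (u : 'cV[R]_n) q k :
  (kron2 n v0 v1 *m u) (idx2 q k) 0 = (if q then v1 else v0) * u k 0.
Proof.
rewrite /kron2 !mul_col_mx !mul_scalar_mx col2E.
by case: q; rewrite mxE.
Qed.

Lemma blockdiag_mul m n p q (A : 'M[R]_(m, p)) (D : 'M[R]_(n, q)) (u : 'cV[R]_(p + q)) :
  block_mx A 0 0 D *m u = col_mx (A *m usubmx u) (D *m dsubmx u).
Proof. by rewrite -{1}[u]vsubmxK mul_block_col !mul0mx addr0 add0r. Qed.

Lemma sub4_dsubmx n1 n2 p (u : 'cV[R]_(n1 + four n2)) k :
  sub4 p (dsubmx u) k 0 = u (rshift n1 (idx4 p k)) 0.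
Proof. by rewrite !mxE. Qed.

Lemma sub2_dsubmx n1 n2 q (u : 'cV[R]_(n1 + two n2)) k :
  sub2 q (dsubmx u) k 0 = u (rshift n1 (idx2 q k)) 0.
Proof. by rewrite !mxE. Qed.

End block_indices.

(** * Entries of the boundary matrices *)

Section H_entries.
Context (R : realType) (a b c d : R) (n0 n1 n2 : nat).

Definition xat (s : bool) : R := if s then b else a.
Definition yat (s : bool) : R := if s then d else c.

Local Notation row1 q k := (lshift (four (four n2)) (idx4 q k)).
Local Notation row2 r q k := (rshift (four n1) (idx4 r (idx4 q k))).
Local Notation erow1 q k := (lshift (two (two n2)) (idx2 q k)).
Local Notation erow2 r q k := (rshift (two n1) (idx2 r (idx2 q k))).

Lemma H00_row1 (u : 'cV[R]_(n1 + four n2)) q k :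
  (H00 a b c d n1 n2 *m u) (row1 q k) 0 = u (lshift _ k) 0.
Proof.
rewrite /H00 blockdiag_mul col_mxEu kron4_mul mxE.
by case: q => -[] []; rewrite /sel4 /= mul1r.
Qed.

(** In these rows r is the derivative and q the corner: the value at q of the r-th derivative of the
    polynomial K00 + (x - a) K10 + (y - c) K01 + (x - a)(y - c) K11. *)
Lemma H00_row2 (u : 'cV[R]_(n1 + four n2)) r q k :
  let K j := u (rshift n1 (idx4 j k)) 0 in
  (H00 a b c d n1 n2 *m u) (row2 r q k) 0 = sel4 r
    (K (false, false) + (xat q.1 - a) * K (true, false) + (yat q.2 - c) * K (false, true)
       + (yat q.2 - c) * (xat q.1 - a) * K (true, true))
    (K (true, false) + (yat q.2 - c) * K (true, true))
    (K (false, true) + (xat q.1 - a) * K (true, true))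
    (K (true, true)).
Proof.
move=> K; rewrite /H00 blockdiag_mul col_mxEd mul_col4 col4E.
have mxD (A B : 'cV[R]_(four n2)) i : (A + B) i 0 = A i 0 + B i 0 by rewrite mxE.
have mx0 i : (0 : 'cV[R]_(four n2)) i 0 = 0 by rewrite mxE.
case: r => -[] []; rewrite /sel4 /= row4_mul ?mul0mx !mxD ?mx0 !kron4_mul !sub4_dsubmx -!/(K _);
  by case: q => -[] []; rewrite /sel4 /xat /yat /=; ring.
Qed.

Lemma H01_row1 x (u : 'cV[R]_(n1 + two n2)) q k :
  (H01 b c d n1 n2 x *m u) (row1 q k) 0 = (q.1)%:R * u (lshift _ k) 0.
Proof.
rewrite /H01 blockdiag_mul col_mxEu kron4_mul mxE.
by case: q => -[] []; rewrite /sel4 /= ?mul1r ?mul0r.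
Qed.

(** Integrals over the edge y = c contribute at corners with x = b only, hence the factor [q.1]. *)
Lemma H01_row2 x (u : 'cV[R]_(n1 + two n2)) r q k :
  let K j := u (rshift n1 (idx2 j k)) 0 in
  (H01 b c d n1 n2 x *m u) (row2 r q k) 0 = (q.1)%:R * sel4 r
    ((b - x) * K false + (yat q.2 - c) * ((b - x) * K true))
    (K false + (yat q.2 - c) * K true)
    ((b - x) * K true)
    (K true).
Proof.
move=> K; rewrite /H01 blockdiag_mul col_mxEd mul_col4 col4E.
have mxD (A B : 'cV[R]_(four n2)) i : (A + B) i 0 = A i 0 + B i 0 by rewrite mxE.
have mxZ e (A : 'cV[R]_(four n2)) i : (e *: A) i 0 = e * A i 0 by rewrite mxE.
have mx0 i : (0 : 'cV[R]_(four n2)) i 0 = 0 by rewrite mxE.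
case: r => -[] []; rewrite /sel4 /= row2_mul ?mul0mx -?scalemxAl !mxD ?mxZ ?mx0 !kron4_mul !sub2_dsubmx -!/(K _);
  by case: q => -[] []; rewrite /sel4 /xat /yat /=; ring.
Qed.

Lemma H02_row1 y (u : 'cV[R]_(n1 + two n2)) q k :
  (H02 a b d n1 n2 y *m u) (row1 q k) 0 = (q.2)%:R * u (lshift _ k) 0.
Proof.
rewrite /H02 blockdiag_mul col_mxEu kron4_mul mxE.
by case: q => -[] []; rewrite /sel4 /= ?mul1r ?mul0r.
Qed.

Lemma H02_row2 y (u : 'cV[R]_(n1 + two n2)) r q k :
  let K j := u (rshift n1 (idx2 j k)) 0 in
  (H02 a b d n1 n2 y *m u) (row2 r q k) 0 = (q.2)%:R * sel4 r
    ((d - y) * K false + (xat q.1 - a) * ((d - y) * K true))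
    ((d - y) * K true)
    (K false + (xat q.1 - a) * K true)
    (K true).
Proof.
move=> K; rewrite /H02 blockdiag_mul col_mxEd mul_col4 col4E.
have mxD (A B : 'cV[R]_(four n2)) i : (A + B) i 0 = A i 0 + B i 0 by rewrite mxE.
have mxZ e (A : 'cV[R]_(four n2)) i : (e *: A) i 0 = e * A i 0 by rewrite mxE.
have mx0 i : (0 : 'cV[R]_(four n2)) i 0 = 0 by rewrite mxE.
case: r => -[] []; rewrite /sel4 /= row2_mul ?mul0mx -?scalemxAl !mxD ?mxZ ?mx0 !kron4_mul !sub2_dsubmx -!/(K _);
  by case: q => -[] []; rewrite /sel4 /xat /yat /=; ring.
Qed.

Definition st1 (k : 'I_n1) : 'I_(n0 + (n1 + n2)) := rshift n0 (lshift n2 k).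
Definition st2 (k : 'I_n2) : 'I_(n0 + (n1 + n2)) := rshift n0 (rshift n1 k).

Lemma row0_mul m n (A : 'M[R]_(m, n)) (u : 'cV[R]_(n0 + n)) :
  row_mx 0 A *m u = A *m dsubmx u.
Proof. by rewrite -{1}[u]vsubmxK mul_row_col mul0mx add0r. Qed.

Lemma H03_row1 z (u : 'cV[R]_(n0 + (n1 + n2))) q k :
  (H03 b d n0 n1 n2 z *m u) (row1 q k) 0 = (q.1 && q.2)%:R * u (st1 k) 0.
Proof.
case: z => x y; rewrite /H03 row0_mul blockdiag_mul col_mxEu kron4_mul !mxE.
by case: q => -[] []; rewrite /sel4 /= ?mul1r ?mul0r.
Qed.

Lemma H03_row2 z (u : 'cV[R]_(n0 + (n1 + n2))) r q k :
  (H03 b d n0 n1 n2 z *m u) (row2 r q k) 0 = (q.1 && q.2)%:R * sel4 r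
    ((b - z.1) * (d - z.2) * u (st2 k) 0) ((d - z.2) * u (st2 k) 0)
    ((b - z.1) * u (st2 k) 0) (u (st2 k) 0).
Proof.
case: z => x y; rewrite /H03 row0_mul blockdiag_mul col_mxEd mul_col4 col4E.
have mxZ e (A : 'cV[R]_(four n2)) i : (e *: A) i 0 = e * A i 0 by rewrite mxE.
case: r => -[] []; rewrite /sel4 /= -?scalemxAl ?mxZ !kron4_mul !mxE -/(st2 k);
  by case: q => -[] []; rewrite /sel4 /=; ring.
Qed.

Lemma H11_row1 (u : 'cV[R]_(n1 + two n2)) q k :
  (H11 c d n1 n2 *m u) (erow1 q k) 0 = u (lshift _ k) 0.
Proof.
rewrite /H11 blockdiag_mul col_mxEu kron2_mul mxE.
by case: q; rewrite /= mul1r.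
Qed.

Lemma H11_row2 (u : 'cV[R]_(n1 + two n2)) r q k :
  let K j := u (rshift n1 (idx2 j k)) 0 in
  (H11 c d n1 n2 *m u) (erow2 r q k) 0 =
    if r then K true else K false + (yat q - c) * K true.
Proof.
move=> K; rewrite /H11 blockdiag_mul col_mxEd.
have mxD (A B : 'cV[R]_(two n2)) i : (A + B) i 0 = A i 0 + B i 0 by rewrite mxE.
have mxZ e (A : 'cV[R]_(two n2)) i : (e *: A) i 0 = e * A i 0 by rewrite mxE.
have mx0 i : (0 : 'cV[R]_(two n2)) i 0 = 0 by rewrite mxE.
rewrite -[block_mx _ _ _ _]/(col_mx _ _) mul_col_mx col2E.
case: r; rewrite row2_mul ?mul0mx -?scalemxAl !mxD ?mxZ ?mx0 !kron2_mul !sub2_dsubmx -!/(K _);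
  by case: q; rewrite /yat /=; ring.
Qed.

Lemma H22_row1 (u : 'cV[R]_(n1 + two n2)) q k :
  (H22 a b n1 n2 *m u) (erow1 q k) 0 = u (lshift _ k) 0.
Proof.
rewrite /H22 blockdiag_mul col_mxEu kron2_mul mxE.
by case: q; rewrite /= mul1r.
Qed.

Lemma H22_row2 (u : 'cV[R]_(n1 + two n2)) r q k :
  let K j := u (rshift n1 (idx2 j k)) 0 in
  (H22 a b n1 n2 *m u) (erow2 r q k) 0 =
    if r then K true else K false + (xat q - a) * K true.
Proof.
move=> K; rewrite /H22 blockdiag_mul col_mxEd.
have mxD (A B : 'cV[R]_(two n2)) i : (A + B) i 0 = A i 0 + B i 0 by rewrite mxE.
have mxZ e (A : 'cV[R]_(two n2)) i : (e *: A) i 0 = e * A i 0 by rewrite mxE.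
have mx0 i : (0 : 'cV[R]_(two n2)) i 0 = 0 by rewrite mxE.
rewrite -[block_mx _ _ _ _]/(col_mx _ _) mul_col_mx col2E.
case: r; rewrite row2_mul ?mul0mx -?scalemxAl !mxD ?mxZ ?mx0 !kron2_mul !sub2_dsubmx -!/(K _);
  by case: q; rewrite /xat /=; ring.
Qed.

Lemma H13_row1 y (u : 'cV[R]_(n0 + (n1 + n2))) q k :
  (H13 d n0 n1 n2 y *m u) (erow1 q k) 0 = q%:R * u (st1 k) 0.
Proof.
rewrite /H13 row0_mul blockdiag_mul col_mxEu kron2_mul !mxE.
by case: q; rewrite /= ?mul1r ?mul0r.
Qed.

Lemma H13_row2 y (u : 'cV[R]_(n0 + (n1 + n2))) r q k :
  (H13 d n0 n1 n2 y *m u) (erow2 r q k) 0 =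
    q%:R * if r then u (st2 k) 0 else (d - y) * u (st2 k) 0.
Proof.
have mxZ e (A : 'cV[R]_(two n2)) i : (e *: A) i 0 = e * A i 0 by rewrite mxE.
rewrite /H13 row0_mul blockdiag_mul col_mxEd mul_col_mx col2E.
case: r; rewrite -?scalemxAl ?mxZ !kron2_mul !mxE -/(st2 k);
  by case: q => /=; ring.
Qed.

Lemma H23_row1 x (u : 'cV[R]_(n0 + (n1 + n2))) q k :
  (H23 b n0 n1 n2 x *m u) (erow1 q k) 0 = q%:R * u (st1 k) 0.
Proof.
rewrite /H23 row0_mul blockdiag_mul col_mxEu kron2_mul !mxE.
by case: q; rewrite /= ?mul1r ?mul0r.
Qed.

Lemma H23_row2 x (u : 'cV[R]_(n0 + (n1 + n2))) r q k :
  (H23 b n0 n1 n2 x *m u) (erow2 r q k) 0 =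
    q%:R * if r then u (st2 k) 0 else (b - x) * u (st2 k) 0.
Proof.
have mxZ e (A : 'cV[R]_(two n2)) i : (e *: A) i 0 = e * A i 0 by rewrite mxE.
rewrite /H23 row0_mul blockdiag_mul col_mxEd mul_col_mx col2E.
case: r; rewrite -?scalemxAl ?mxZ !kron2_mul !mxE -/(st2 k);
  by case: q => /=; ring.
Qed.

End H_entries.

Section prod_space.
Context (R : realType) (S1 S2 : l2space R).

Definition prod_lc (k : R) (x y : S1 * S2) : S1 * S2 := (lc k x.1 y.1, lc k x.2 y.2).

Definition prod_factor (i : bool) : l2space R := if i then S1 else S2.

Definition prod_proj (i : bool) (x : S1 * S2) : prod_factor i :=
  match i return prod_factor i with true => x.1 | false => x.2 end.

Lemma prod_proj_lc k x y i : prod_proj i (prod_lc k x y) = lc k (prod_proj i x) (prod_proj i y).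
Proof. by case: i. Qed.

(** Jets depend on a pair (w, v). Viewing them as operators on this product is what allows w to be
    replaced by an equivalent w. *)
Definition prod_space : l2space R := coordinate_space prod_proj_lc.

Lemma good_prod1 : good (fun x : prod_space => x.1 : S1).
Proof. exact: (good_coordinate prod_proj_lc true). Qed.

Lemma good_prod2 : good (fun x : prod_space => x.2 : S2).
Proof. exact: (good_coordinate prod_proj_lc false). Qed.

End prod_space.

Section continuous_matrices.
Context (R : realType) (T : topologicalType).

Definition continuous_mx m n (F : T -> 'M[R]_(m, n)) :=
  forall i j, continuous (fun t => F t i j).

Lemma continuous_mx_cst m n (A : 'M[R]_(m, n)) : continuous_mx (fun=> A).
Proof. by move=> i j t; exact: cvg_cst. Qed.

Lemma continuous_mx_col m n p (F : T -> 'M[R]_(m, p)) (G : T -> 'M[R]_(n, p)) :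
  continuous_mx F -> continuous_mx G -> continuous_mx (fun t => col_mx (F t) (G t)).
Proof.
move=> cF cG i j; case: (split_ordP i) => k ->.
  by under eq_fun do rewrite col_mxEu; exact: cF.
by under eq_fun do rewrite col_mxEd; exact: cG.
Qed.

Lemma continuous_mx_row m n p (F : T -> 'M[R]_(p, m)) (G : T -> 'M[R]_(p, n)) :
  continuous_mx F -> continuous_mx G -> continuous_mx (fun t => row_mx (F t) (G t)).
Proof.
move=> cF cG i j; case: (split_ordP j) => k ->.
  by under eq_fun do rewrite row_mxEl; exact: cF.
by under eq_fun do rewrite row_mxEr; exact: cG.
Qed.

Lemma continuous_mx_diag m n p q (A : 'M[R]_(m, p)) (F : T -> 'M[R]_(n, q)) :
  continuous_mx F -> continuous_mx (fun t => block_mx A 0 0 (F t)).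
Proof.
move=> cF; apply: continuous_mx_col; apply: continuous_mx_row => //;
  exact: continuous_mx_cst.
Qed.

Lemma continuous_mx_scale m n (f : T -> R) (A : 'M[R]_(m, n)) :
  continuous f -> continuous_mx (fun t => f t *: A).
Proof.
move=> cf i j; under eq_fun do rewrite mxE.
by move=> t; apply: cvgM; [exact: cf|exact: cvg_cst].
Qed.

End continuous_matrices.

(** * Boundedness of H1 and H2 *)

Section boundary_operators.
Context (R : realType) (a b c d : R) (n0 n1 n2 : nat).
Hypotheses (ab : a < b) (cd : c < d).
Local Notation ns := (n0 + (n1 + n2))%N.
Local Notation state := (R * R -> 'cV[R]_(n0 + (n1 + n2))).
Local Notation Om := (Omega a b c d).

Definition state_lc (k : R) (u v : state) : state := fun z => k *: u z + v z.

Definition state_coord (i : 'I_ns) (u : state) : FOm a b c d := fun z => u z i 0.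

Lemma state_coord_lc k u v i :
  state_coord i (state_lc k u v) = lc k (state_coord i u) (state_coord i v).
Proof. by apply/funext => z; rewrite /state_coord !mxE. Qed.

Definition Xspace : l2space R := coordinate_space state_coord_lc.

Lemma ok_Xspace (u : state) : L2mx (leb2 R) Om u <-> ok (u : Xspace).
Proof. by split=> [h i|h i j]; [exact: h|rewrite ord1; exact: h]. Qed.

Lemma eqv_Xspace (u v : state) : u = v %[ae leb2 R in Om] <-> eqv (u : Xspace) (v : Xspace).
Proof.
split=> [h i|h]; first by apply: filterS h => z hz Oz; rewrite /state_coord (hz Oz).
have := ae_forall_ord h; apply: filterS => z hz Oz.
by apply/colP => i; exact: hz.
Qed.

Lemma L2normsq_coord n (F : R * R -> 'cV[R]_n) :
  L2normsq (leb2 R) Om F = \sum_i nsq (leb2 R) Om (fun z => F z i 0).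
Proof. by apply: eq_bigr => i _; rewrite big_ord1. Qed.

Lemma nq_Xspace (u : state) : L2normsq (leb2 R) Om u = nq (u : Xspace).
Proof. exact: L2normsq_coord. Qed.

Definition goodX (S : l2space R) (V : S -> state) :=
  forall i, good (fun s => (fun z => V s z i 0) : FOm a b c d).

Lemma goodXP (S : l2space R) (V : S -> state) : goodX V <-> good (V : S -> Xspace).
Proof.
split=> [h|h i]; first exact: good_coordinates.
exact: good_comp h (good_coordinate state_coord_lc i).
Qed.

Lemma good_mul_continuous2 (h : R * R -> R) : continuous h ->
  good (fun f : FOm a b c d => (fun z => h z * f z) : FOm a b c d).
Proof.
move=> ch; have [M hM] := continuous_Om_bounded a b c d ch.
apply: (good_mulF (leb2 R) (measurable_Om a b c d) (M := M)); last exact: hM.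
by apply: measurable_funTS; exact: continuous_measurable2.
Qed.

Lemma good_mulmx (S : l2space R) (V : S -> state) m (F : R * R -> 'M[R]_(m, ns)) i :
  goodX V -> continuous_mx F ->
  good (fun s => (fun z => (F z *m V s z) i 0) : FOm a b c d).
Proof.
move=> gV cF; have mO := measurable_Om a b c d.
have gs := good_sumF (mD := mO) (index_enum 'I_ns)
  (fun j => good_comp (gV j) (good_mul_continuous2 (cF i j))).
apply: (good_eqD gs) => s _ z _.
by rewrite mxE.
Qed.

Lemma continuous_sub1 (e : R) : continuous (fun x : R => e - x).
Proof. by move=> t; apply: cvgB; [exact: cvg_cst|exact: cvg_id]. Qed.

Lemma H01_continuous : continuous_mx (H01 b c d n1 n2).
Proof.
apply: continuous_mx_diag; apply: continuous_mx_col.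
  by apply: continuous_mx_row; apply: continuous_mx_scale; exact: continuous_sub1.
apply: continuous_mx_col; first exact: continuous_mx_cst.
apply: continuous_mx_col; last exact: continuous_mx_cst.
apply: continuous_mx_row; first exact: continuous_mx_cst.
by apply: continuous_mx_scale; exact: continuous_sub1.
Qed.

Lemma H02_continuous : continuous_mx (H02 a b d n1 n2).
Proof.
apply: continuous_mx_diag; apply: continuous_mx_col.
  by apply: continuous_mx_row; apply: continuous_mx_scale; exact: continuous_sub1.
apply: continuous_mx_col; last exact: continuous_mx_cst.
apply: continuous_mx_row; first exact: continuous_mx_cst.
by apply: continuous_mx_scale; exact: continuous_sub1.
Qed.

Lemma H03_continuous : continuous_mx (H03 b d n0 n1 n2).
Proof.
(* The matrix with projections in place of the pattern matching of [H03], so that continuity can be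
   read off its blocks. *)
pose F (z : R * R) := let h := kron4 n2 0 0 0 (1 : R) in
  row_mx 0 (block_mx (kron4 n1 0 0 0 1) 0
    0 (col4 (((d - z.2) * (b - z.1)) *: h) ((d - z.2) *: h) ((b - z.1) *: h) h))
  : 'M[R]_(four n1 + four (four n2), ns).
have -> : H03 b d n0 n1 n2 = F by apply/funext => -[].
have c1 := @continuous_sub_fst R b; have c2 := @continuous_sub_snd R d.
apply: continuous_mx_row; first exact: continuous_mx_cst.
apply: continuous_mx_diag; apply: continuous_mx_col.
  by apply: continuous_mx_scale => z; apply: cvgM; [exact: c2|exact: c1].
apply: continuous_mx_col; first exact: continuous_mx_scale.
by apply: continuous_mx_col; [exact: continuous_mx_scale|exact: continuous_mx_cst].
Qed.

Lemma H13_continuous : continuous_mx (fun z : R * R => H13 d n0 n1 n2 z.2).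
Proof.
apply: continuous_mx_row; first exact: continuous_mx_cst.
apply: continuous_mx_diag; apply: continuous_mx_col; last exact: continuous_mx_cst.
by apply: continuous_mx_scale; exact: continuous_sub_snd.
Qed.

Lemma H23_continuous : continuous_mx (fun z : R * R => H23 b n0 n1 n2 z.1).
Proof.
apply: continuous_mx_row; first exact: continuous_mx_cst.
apply: continuous_mx_diag; apply: continuous_mx_col; last exact: continuous_mx_cst.
by apply: continuous_mx_scale; exact: continuous_sub_fst.
Qed.

Lemma continuous_L2 u w (h : R -> R) : continuous h -> L2 (leb1 R) `[u, w] h.
Proof.
move=> ch; have L1 := L2_cst (measurable_cc u w) (leb1_itv_fin u w) 1.
by apply: (L2_eq _ (L2_mul_continuous ch L1)) => x _; rewrite mulr1.
Qed.

Lemma goodZ_H1 (S : l2space R) (W : S -> ZBC R n1 n2) : goodZ a b c d W ->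
  goodZ a b c d (fun s => opH1 a b c d (W s)).
Proof.
move=> [g0 g1 g2]; split=> i.
- rewrite (_ : (fun s => _) = (fun s => (\sum_j H00 a b c d n1 n2 i j * (W s).1.1 j 0 +
    \int[leb1 R]_(x in `[a, b]) (\sum_j H01 b c d n1 n2 x i j * (W s).1.2 x j 0)) +
    \int[leb1 R]_(y in `[c, d]) (\sum_j H02 a b d n1 n2 y i j * (W s).2 y j 0))); last first.
    apply/funext => s; case: (W s) => [[w0 w1] w2] /=; rewrite !mxE; congr (_ + _ + _);
      by apply: eq_Rintegral => z _; rewrite mxE.
  apply: good_addR; first apply: good_addR.
  + by apply: good_sumR => j; exact: good_comp (g0 j) (good_scaleR (H00 a b c d n1 n2 i j)).
  + have h := good_dual_sum (g := fun j x => H01 b c d n1 n2 x i j)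
      (fun j => continuous_L2 a b (@H01_continuous i j)) g1.
    exact: h.
  + have h := good_dual_sum (g := fun j x => H02 a b d n1 n2 x i j)
      (fun j => continuous_L2 c d (@H02_continuous i j)) g2.
    exact: h.
- have mab := measurable_cc a b.
  have gs := good_sumF (mD := mab) (index_enum 'I__) (fun j => good_comp (g1 j)
    (good_scaleF (leb1 R) mab (H11 c d n1 n2 i j))).
  by apply: (good_mono gs) => s x _ _; case: (W s) => [[w0 w1] w2] /=; rewrite mxE.
- have mcd := measurable_cc c d.
  have gs := good_sumF (mD := mcd) (index_enum 'I__) (fun j => good_comp (g2 j)
    (good_scaleF (leb1 R) mcd (H22 a b n1 n2 i j))).
  by apply: (good_mono gs) => s x _ _; case: (W s) => [[w0 w1] w2] /=; rewrite mxE.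
Qed.

Lemma good_Rintegral u w : good (fun f : Fx u w => (\int[leb1 R]_(x in `[u, w]) f x) : Rspace R).
Proof.
have L1 := L2_cst (measurable_cc u w) (leb1_itv_fin u w) 1.
have := good_dual (measurable_cc u w) L1.
rewrite (_ : (fun f : Fspace _ _ => _) = (fun f : Fx u w => (\int[leb1 R]_(x in `[u, w]) f x) : Rspace R))//.
by apply/funext => f; apply: eq_Rintegral => x _; rewrite mul1r.
Qed.

Lemma goodZ_H2 (S : l2space R) (V : S -> state) : goodX V ->
  goodZ a b c d (fun s => opH2 a b c d (V s)).
Proof.
move=> gV; split=> i.
- have gs := good_comp (good_comp (good_mulmx i gV H03_continuous) (good_inty a b c d)) (good_Rintegral a b).
  rewrite (_ : (fun s => _) = (fun s => \int[leb1 R]_(x in `[a, b]) \int[leb1 R]_(y in `[c, d])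
    (H03 b d n0 n1 n2 (x, y) *m V s (x, y)) i 0))//.
  by apply/funext => s /=; rewrite mxE; apply: eq_Rintegral => x _; rewrite mxE.
- have gs := good_comp (good_mulmx i gV H13_continuous) (good_inty a b c d).
  by apply: (good_mono gs) => s x _ _; rewrite /= mxE.
- have gs := good_comp (good_mulmx i gV H23_continuous) (good_intx a b c d).
  by apply: (good_mono gs) => s x _ _; rewrite /= mxE.
Qed.

End boundary_operators.

(** * K1 w + K2 v and its derivatives *)

Section jets.
Context (R : realType) (a b c d : R) (n0 n1 n2 : nat).
Hypotheses (ab : a < b) (cd : c < d).
Local Notation ns := (n0 + (n1 + n2))%N.
Local Notation state := (R * R -> 'cV[R]_(n0 + (n1 + n2))).
Local Notation Om := (Omega a b c d).
Local Notation L2Om := (L2 (leb2 R) Om).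
Local Notation st1 := (@st1 n0 n1 n2).
Local Notation st2 := (@st2 n0 n1 n2).
Local Notation Zbc := (ZBC R n1 n2).

(* The weak derivatives of the components of [K1 w + K2 v]. *)
Definition jet1 (w : Zbc) (v : state) (k : 'I_n1) (i j : nat) : R * R -> R :=
  form1 a c (w.1.1 (lshift _ k) 0) (fun t => w.1.2 t (lshift _ k) 0)
    (fun t => w.2 t (lshift _ k) 0) (fun z => v z (st1 k) 0) i j.

Definition jet2 (w : Zbc) (v : state) (k : 'I_n2) (i j : nat) : R * R -> R :=
  form2 a c (w.1.1 (rshift n1 (idx4 (false, false) k)) 0)
    (w.1.1 (rshift n1 (idx4 (true, false) k)) 0)
    (w.1.1 (rshift n1 (idx4 (false, true) k)) 0)
    (w.1.1 (rshift n1 (idx4 (true, true) k)) 0)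
    (fun t => w.1.2 t (rshift n1 (idx2 false k)) 0)
    (fun t => w.1.2 t (rshift n1 (idx2 true k)) 0)
    (fun t => w.2 t (rshift n1 (idx2 false k)) 0)
    (fun t => w.2 t (rshift n1 (idx2 true k)) 0)
    (fun z => v z (st2 k) 0) i j.

Lemma good_jet1 (S : l2space R) (W : S -> Zbc) (V : S -> state) k i j :
  goodZ a b c d W -> goodX a b c d V -> good (fun s => jet1 (W s) (V s) k i j : FOm a b c d).
Proof. by move=> [g0 g1 g2] gV; apply: good_form1. Qed.

Lemma good_jet2 (S : l2space R) (W : S -> Zbc) (V : S -> state) k i j :
  goodZ a b c d W -> goodX a b c d V -> good (fun s => jet2 (W s) (V s) k i j : FOm a b c d).
Proof. by move=> [g0 g1 g2] gV; apply: good_form2. Qed.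

Let mxD m (A B : 'cV[R]_m) i : (A + B) i 0 = A i 0 + B i 0. Proof. by rewrite mxE. Qed.
Let mxZ m e (A : 'cV[R]_m) i : (e *: A) i 0 = e * A i 0. Proof. by rewrite mxE. Qed.
Let mx0 m i : (0 : 'cV[R]_m) i 0 = 0. Proof. by rewrite mxE. Qed.

Lemma intmxE m n (D : set R) (F : R -> 'M[R]_(m, n)) i j :
  intmx (leb1 R) D F i j = \int[leb1 R]_(t in D) F t i j.
Proof. by rewrite mxE. Qed.

Lemma K30_st0 z (u : 'cV[R]_(n1 + four n2)) (k : 'I_n0) : (K30 a c n0 n1 n2 z *m u) (lshift _ k) 0 = 0.
Proof. by case: z => x y; rewrite /K30 mul_col_mx col_mxEu mul0mx mx0. Qed.

Lemma K30_st1 z (u : 'cV[R]_(n1 + four n2)) (k : 'I_n1) : (K30 a c n0 n1 n2 z *m u) (st1 k) 0 = u (lshift _ k) 0.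
Proof.
case: z => x y; rewrite /K30 mul_col_mx col_mxEd blockdiag_mul col_mxEu mul1mx.
by rewrite mxE.
Qed.

Lemma K30_st2 z (u : 'cV[R]_(n1 + four n2)) k : let K p := u (rshift n1 (idx4 p k)) 0 in
  (K30 a c n0 n1 n2 z *m u) (st2 k) 0 =
  K (false, false) + (z.1 - a) * K (true, false) + (z.2 - c) * K (false, true)
    + (z.2 - c) * (z.1 - a) * K (true, true).
Proof.
move=> K; case: z => x y; rewrite /K30 mul_col_mx col_mxEd blockdiag_mul col_mxEd.
rewrite row4_mul mul1mx !mul_scalar_mx !mxD !mxZ !sub4_dsubmx -!/(K _) /=.
by ring.
Qed.

Lemma K31_st0 z t (u : 'cV[R]_(n1 + two n2)) (k : 'I_n0) : (K31 c n0 n1 n2 z t *m u) (lshift _ k) 0 = 0.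
Proof. by case: z => x y; rewrite /K31 mul_col_mx col_mxEu mul0mx mx0. Qed.

Lemma K31_st1 z t (u : 'cV[R]_(n1 + two n2)) (k : 'I_n1) : (K31 c n0 n1 n2 z t *m u) (st1 k) 0 = u (lshift _ k) 0.
Proof.
case: z => x y; rewrite /K31 mul_col_mx col_mxEd blockdiag_mul col_mxEu mul1mx.
by rewrite mxE.
Qed.

Lemma K31_st2 z t (u : 'cV[R]_(n1 + two n2)) k : let K p := u (rshift n1 (idx2 p k)) 0 in
  (K31 c n0 n1 n2 z t *m u) (st2 k) 0 =
  (z.1 - t) * K false + (z.2 - c) * ((z.1 - t) * K true).
Proof.
move=> K; case: z => x y; rewrite /K31 mul_col_mx col_mxEd blockdiag_mul col_mxEd.
rewrite row2_mul !mul_scalar_mx !mxD !mxZ !sub2_dsubmx -!/(K _) /=.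
by ring.
Qed.

Lemma K32_st0 z t (u : 'cV[R]_(n1 + two n2)) (k : 'I_n0) : (K32 a n0 n1 n2 z t *m u) (lshift _ k) 0 = 0.
Proof. by case: z => x y; rewrite /K32 mul_col_mx col_mxEu mul0mx mx0. Qed.

Lemma K32_st1 z t (u : 'cV[R]_(n1 + two n2)) (k : 'I_n1) : (K32 a n0 n1 n2 z t *m u) (st1 k) 0 = u (lshift _ k) 0.
Proof.
case: z => x y; rewrite /K32 mul_col_mx col_mxEd blockdiag_mul col_mxEu mul1mx.
by rewrite mxE.
Qed.

Lemma K32_st2 z t (u : 'cV[R]_(n1 + two n2)) k : let K p := u (rshift n1 (idx2 p k)) 0 in
  (K32 a n0 n1 n2 z t *m u) (st2 k) 0 =
  (z.2 - t) * K false + (z.1 - a) * ((z.2 - t) * K true).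
Proof.
move=> K; case: z => x y; rewrite /K32 mul_col_mx col_mxEd blockdiag_mul col_mxEd.
rewrite row2_mul !mul_scalar_mx !mxD !mxZ !sub2_dsubmx -!/(K _) /=.
by ring.
Qed.

Lemma K33_st0 z s t (u : 'cV[R]_ns) (k : 'I_n0) : (K33 n0 n1 n2 z s t *m u) (lshift _ k) 0 = 0.
Proof. by case: z => x y; rewrite /K33 blockdiag_mul col_mxEu mul0mx mx0. Qed.

Lemma K33_st1 z s t (u : 'cV[R]_ns) (k : 'I_n1) : (K33 n0 n1 n2 z s t *m u) (st1 k) 0 = u (st1 k) 0.
Proof.
case: z => x y; rewrite /K33 blockdiag_mul col_mxEd blockdiag_mul col_mxEu mul1mx.
by rewrite !mxE.
Qed.

Lemma K33_st2 z s t (u : 'cV[R]_ns) k :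
  (K33 n0 n1 n2 z s t *m u) (st2 k) 0 = (z.1 - s) * (z.2 - t) * u (st2 k) 0.
Proof.
case: z => x y; rewrite /K33 blockdiag_mul col_mxEd blockdiag_mul col_mxEd mul_scalar_mx mxZ.
by rewrite !mxE.
Qed.

Let zero_itv l h : \int[leb1 R]_(t in `[l, h]) (0 : R) = 0.
Proof. by rewrite (Rintegral_cst _ (measurable_cc l h)) mul0r. Qed.

Lemma opK1E (w : Zbc) z i : opK1 a c n0 w z i 0 = (K30 a c n0 n1 n2 z *m w.1.1) i 0
  + \int[leb1 R]_(t in `[a, z.1]) (K31 c n0 n1 n2 z t *m w.1.2 t) i 0
  + \int[leb1 R]_(t in `[c, z.2]) (K32 a n0 n1 n2 z t *m w.2 t) i 0.
Proof. by case: w => [[w0 w1] w2]; rewrite /opK1 !mxD !intmxE. Qed.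

Lemma opK2E (v : state) z i : opK2 a c v z i 0 = (block_mx 1%:M 0 0 0 *m v z) i 0
  + \int[leb1 R]_(s in `[a, z.1]) \int[leb1 R]_(t in `[c, z.2])
      (K33 n0 n1 n2 z s t *m v (s, t)) i 0.
Proof.
rewrite /opK2 !mxD intmxE; congr (_ + _).
by apply: eq_Rintegral => s _; rewrite intmxE.
Qed.

Section source.
Variables (w : Zbc) (v : state).
Hypotheses (ow : in_Z a b c d w) (Lv : L2mx (leb2 R) Om v).

Let Lx i : L2 (leb1 R) `[a, b] (fun t => w.1.2 t i 0). Proof. by case: ow => h _; exact: h. Qed.
Let Ly i : L2 (leb1 R) `[c, d] (fun t => w.2 t i 0). Proof. by case: ow => _ h; exact: h. Qed.
Let Lv1 i : L2Om (fun z => v z i 0). Proof. exact: Lv. Qed.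

Lemma jet1_L2 k i j : L2Om (jet1 w v k i j).
Proof. exact: form1_L2. Qed.

Lemma jet2_L2 k i j : L2Om (jet2 w v k i j).
Proof. exact: form2_L2. Qed.

Let K p k := w.1.1 (rshift n1 (@idx4 n2 p k)) 0.
Let X q k t := w.1.2 t (rshift n1 (@idx2 n2 q k)) 0.
Let Y q k t := w.2 t (rshift n1 (@idx2 n2 q k)) 0.

Section values.
Variables (k : 'I_n2) (x y : R).
Hypotheses (xab : a <= x <= b) (ycd : c <= y <= d).

Lemma jet2_val00 : jet2 w v k 0 0 (x, y) = K (false, false) k
  + (x - a) * K (true, false) k + (y - c) * K (false, true) k
  + (y - c) * (x - a) * K (true, true) k
  + \int[leb1 R]_(t in `[a, x]) ((x - t) * X false k t + (y - c) * ((x - t) * X true k t))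
  + \int[leb1 R]_(t in `[c, y]) ((y - t) * Y false k t + (x - a) * ((y - t) * Y true k t))
  + Ix a (Iy c (fun z => (x - z.1) * (y - z.2) * v z (st2 k) 0)) (x, y).
Proof. exact: (form2_val00 ab cd _ _ _ _ (Lx _) (Lx _) (Ly _) (Ly _) (Lv1 _) xab ycd). Qed.

Lemma jet2_val10 : jet2 w v k 1 0 (x, y) = K (true, false) k + (y - c) * K (true, true) k
  + \int[leb1 R]_(t in `[a, x]) (X false k t + (y - c) * X true k t)
  + \int[leb1 R]_(t in `[c, y]) ((y - t) * Y true k t)
  + Ix a (Iy c (fun z => (y - z.2) * v z (st2 k) 0)) (x, y).
Proof. exact: (form2_val10 ab cd _ _ _ _ _ (Lx _) (Lx _) (Ly _) (Lv1 _) xab ycd). Qed.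

Lemma jet2_val01 : jet2 w v k 0 1 (x, y) = K (false, true) k + (x - a) * K (true, true) k
  + \int[leb1 R]_(t in `[a, x]) ((x - t) * X true k t)
  + \int[leb1 R]_(t in `[c, y]) (Y false k t + (x - a) * Y true k t)
  + Ix a (Iy c (fun z => (x - z.1) * v z (st2 k) 0)) (x, y).
Proof. exact: (form2_val01 ab cd _ _ _ _ _ (Lx _) (Ly _) (Ly _) (Lv1 _) xab ycd). Qed.

End values.

Lemma opK_st0 z (k : 'I_n0) : (opK2 a c v z + opK1 a c n0 w z) (lshift _ k) 0 = v z (lshift _ k) 0.
Proof.
rewrite mxD opK1E opK2E blockdiag_mul col_mxEu mul1mx mxE K30_st0.
under eq_Rintegral do under eq_Rintegral do rewrite K33_st0.
under eq_Rintegral do rewrite zero_itv.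
under [X in _ + (_ + X + _)]eq_Rintegral do rewrite K31_st0.
under [X in _ + (_ + _ + X)]eq_Rintegral do rewrite K32_st0.
by rewrite !zero_itv !addr0.
Qed.

(** For these components all kernels are 0 or 1, and the sum is [Qf] term by term, at every z. *)
Lemma opK_st1 z k : (opK2 a c v z + opK1 a c n0 w z) (st1 k) 0 = jet1 w v k 0 0 z.
Proof.
rewrite mxD opK1E opK2E blockdiag_mul col_mxEd mul0mx mx0 add0r K30_st1.
under eq_Rintegral do under eq_Rintegral do rewrite K33_st1.
under [X in _ + (_ + X + _)]eq_Rintegral do rewrite K31_st1.
under [X in _ + (_ + _ + X)]eq_Rintegral do rewrite K32_st1.
by rewrite addrC; case: z.
Qed.

(** The polynomial kernels are those produced by [form2_val00], which holds inside the rectangle. *)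
Lemma opK_st2 z k : Om z -> (opK2 a c v z + opK1 a c n0 w z) (st2 k) 0 = jet2 w v k 0 0 z.
Proof.
case: z => x y [xin yin].
have xab : a <= x <= b by move: xin; rewrite /= in_itv.
have ycd : c <= y <= d by move: yin; rewrite /= in_itv.
rewrite mxD opK1E opK2E blockdiag_mul col_mxEd mul0mx mx0 add0r K30_st2.
under eq_Rintegral do under eq_Rintegral do rewrite K33_st2.
under [X in _ + (_ + X + _)]eq_Rintegral do rewrite K31_st2.
under [X in _ + (_ + _ + X)]eq_Rintegral do rewrite K32_st2.
by rewrite (jet2_val00 _ xab ycd) addrC.
Qed.

Lemma jet1_continuous k : {within Om, continuous (jet1 w v k 0 0)}.
Proof. exact: Qf_continuous. Qed.

(** The bits of r are coerced to orders of differentiation. The four derivatives of order at most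
    one in each variable are exactly the [Qf] forms, and they are the ones evaluated at corners. *)
Lemma jet2_continuous k (r : bool * bool) : {within Om, continuous (jet2 w v k r.1 r.2)}.
Proof.
case: r => -[] [].
- exact: (Qf_continuous ab cd (Lx _) (Ly _) (Lv1 _)).
- exact: (Qf_continuous ab cd (Lx _) (primy_L2 ab cd _ (Ly _)) (jet2_L2 k 2 1)).
- exact: (Qf_continuous ab cd (primx_L2 ab cd _ (Lx _)) (Ly _) (jet2_L2 k 1 2)).
- exact: (Qf_continuous ab cd (primx_L2 ab cd _ (Lx _)) (primy_L2 ab cd _ (Ly _)) (jet2_L2 k 1 1)).
Qed.

Lemma wderiv_jet1 f k i j : L2Om f -> f = jet1 w v k 0 0 %[ae leb2 R in Om] ->
  (i <= 1)%N -> (j <= 1)%N ->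
  L2Om (wderiv a b c d i j f) /\ wderiv a b c d i j f = jet1 w v k i j %[ae leb2 R in Om].
Proof.
move=> Lf E i1 j1; apply: (wderiv_eq ab cd (jet1_L2 k i j)).
apply: (is_wderiv_ae (jet1_L2 k 0 0) Lf (ae_eq_sym E)).
exact: form1_wderiv.
Qed.

Lemma wderiv_jet2 f k i j : L2Om f -> f = jet2 w v k 0 0 %[ae leb2 R in Om] ->
  (i <= 2)%N -> (j <= 2)%N ->
  L2Om (wderiv a b c d i j f) /\ wderiv a b c d i j f = jet2 w v k i j %[ae leb2 R in Om].
Proof.
move=> Lf E i1 j1; apply: (wderiv_eq ab cd (jet2_L2 k i j)).
apply: (is_wderiv_ae (jet2_L2 k 0 0) Lf (ae_eq_sym E)).
exact: form2_wderiv.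
Qed.

(** At a corner an integral up to x runs over all of [a, b] or over the single point a. The bit s as
    a factor expresses both cases over the fixed interval of H1 and H2. *)
Lemma Rintegral_xat (f : R -> R -> R) s :
  \int[leb1 R]_(t in `[a, xat a b s]) f (xat a b s) t =
  \int[leb1 R]_(t in `[a, b]) (s%:R * f b t).
Proof.
case: s; rewrite /xat; first by apply: eq_Rintegral => t _; rewrite mul1r.
rewrite Rintegral_itv1; under eq_Rintegral do rewrite mul0r.
by rewrite zero_itv.
Qed.

Lemma Rintegral_yat (f : R -> R -> R) s :
  \int[leb1 R]_(t in `[c, yat c d s]) f (yat c d s) t =
  \int[leb1 R]_(t in `[c, d]) (s%:R * f d t).
Proof.
case: s; rewrite /yat; first by apply: eq_Rintegral => t _; rewrite mul1r.
rewrite Rintegral_itv1; under eq_Rintegral do rewrite mul0r.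
by rewrite zero_itv.
Qed.

Lemma IxIy_at (f : R -> R -> R * R -> R) s t : let x := xat a b s in let y := yat c d t in
  Ix a (Iy c (f x y)) (x, y) =
  \int[leb1 R]_(x in `[a, b]) \int[leb1 R]_(y in `[c, d]) ((s && t)%:R * f b d (x, y)).
Proof.
case: s; case: t; rewrite /Ix /Iy /xat /yat /= ?Rintegral_itv1.
- by do 2![apply: eq_Rintegral => ? _]; rewrite mul1r.
- apply: eq_Rintegral => x _; rewrite Rintegral_itv1.
  by under eq_Rintegral do rewrite mul0r; rewrite zero_itv.
- under eq_Rintegral do under eq_Rintegral do rewrite mul0r.
  by under eq_Rintegral do rewrite zero_itv; rewrite zero_itv.
- under eq_Rintegral do under eq_Rintegral do rewrite mul0r.
  by under eq_Rintegral do rewrite zero_itv; rewrite zero_itv.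
Qed.

Local Notation Hwv := (Zlc 1 (opH1 a b c d w) (opH2 a b c d v)).

Lemma Hwv_corner i : Hwv.1.1 i 0 = (H00 a b c d n1 n2 *m w.1.1) i 0
  + \int[leb1 R]_(x in `[a, b]) (H01 b c d n1 n2 x *m w.1.2 x) i 0
  + \int[leb1 R]_(y in `[c, d]) (H02 a b d n1 n2 y *m w.2 y) i 0
  + \int[leb1 R]_(x in `[a, b]) \int[leb1 R]_(y in `[c, d])
      (H03 b d n0 n1 n2 (x, y) *m v (x, y)) i 0.
Proof.
rewrite /Zlc mxD mxZ mul1r /opH1 /opH2; case: (w) => [[w0 w1] w2] /=.
rewrite !mxD !intmxE; congr (_ + _).
by apply: eq_Rintegral => s _; rewrite intmxE.
Qed.

Lemma Hwv_edgex x i : Hwv.1.2 x i 0 = (H11 c d n1 n2 *m w.1.2 x) i 0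
  + \int[leb1 R]_(y in `[c, d]) (H13 d n0 n1 n2 y *m v (x, y)) i 0.
Proof.
by rewrite /Zlc mxD mxZ mul1r /opH1 /opH2; case: (w) => [[w0 w1] w2] /=; rewrite intmxE.
Qed.

Lemma Hwv_edgey y i : Hwv.2 y i 0 = (H22 a b n1 n2 *m w.2 y) i 0
  + \int[leb1 R]_(x in `[a, b]) (H23 b n0 n1 n2 x *m v (x, y)) i 0.
Proof.
by rewrite /Zlc mxD mxZ mul1r /opH1 /opH2; case: (w) => [[w0 w1] w2] /=; rewrite intmxE.
Qed.

Let xat_in s : a <= xat a b s <= b.
Proof. by case: s; rewrite /= lexx (ltW ab). Qed.

Let yat_in s : c <= yat c d s <= d.
Proof. by case: s; rewrite /= lexx (ltW cd). Qed.

Lemma jet1_corner k (q : bool * bool) :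
  jet1 w v k 0 0 (xat a b q.1, yat c d q.2) = Hwv.1.1 (lshift _ (idx4 q k)) 0.
Proof.
rewrite Hwv_corner H00_row1.
under eq_Rintegral do rewrite H01_row1.
under [X in _ + X + _]eq_Rintegral do rewrite H02_row1.
under [X in _ + X]eq_Rintegral do under eq_Rintegral do rewrite H03_row1.
rewrite -(Rintegral_xat (fun _ t => w.1.2 t _ 0)) -(Rintegral_yat (fun _ t => w.2 t _ 0)).
by rewrite -(IxIy_at (fun _ _ z => v z _ 0)).
Qed.

Lemma jet2_corner k (r q : bool * bool) :
  jet2 w v k r.1 r.2 (xat a b q.1, yat c d q.2) = Hwv.1.1 (rshift _ (idx4 r (idx4 q k))) 0.
Proof.
rewrite Hwv_corner H00_row2.
under eq_Rintegral do rewrite H01_row2.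
under [X in _ + X + _]eq_Rintegral do rewrite H02_row2.
under [X in _ + X]eq_Rintegral do under eq_Rintegral do rewrite H03_row2.
have xab := xat_in q.1; have ycd := yat_in q.2.
case: r => -[] []; rewrite !sel4E.
(* The mixed derivative is a plain [Qf], so no expansion precedes; the other three cases start from
   [form2_val10], [form2_val01] and [form2_val00]. *)
- rewrite -(Rintegral_xat (fun _ t => X true k t)) -(Rintegral_yat (fun _ t => Y true k t)).
  by rewrite -(IxIy_at (fun _ _ z => v z (st2 k) 0)).
- rewrite (jet2_val10 _ xab ycd).
  rewrite -(Rintegral_xat (fun _ t => X false k t + (yat c d q.2 - c) * X true k t)).
  rewrite -(Rintegral_yat (fun y t => (y - t) * Y true k t)).
  by rewrite -(IxIy_at (fun _ y z => (y - z.2) * v z (st2 k) 0)).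
- rewrite (jet2_val01 _ xab ycd).
  rewrite -(Rintegral_xat (fun x t => (x - t) * X true k t)).
  rewrite -(Rintegral_yat (fun _ t => Y false k t + (xat a b q.1 - a) * Y true k t)).
  by rewrite -(IxIy_at (fun x _ z => (x - z.1) * v z (st2 k) 0)).
- rewrite (jet2_val00 _ xab ycd).
  rewrite -(Rintegral_xat (fun x t => (x - t) * X false k t + (yat c d q.2 - c) * ((x - t) * X true k t))).
  rewrite -(Rintegral_yat (fun y t => (y - t) * Y false k t + (xat a b q.1 - a) * ((y - t) * Y true k t))).
  by rewrite -(IxIy_at (fun x y z => (x - z.1) * (y - z.2) * v z (st2 k) 0)).
Qed.

End source.

End jets.

(** * Boundary values of K1 w + K2 v *)

Section boundary_values.
Context (R : realType) (a b c d : R) (n0 n1 n2 : nat).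
Hypotheses (ab : a < b) (cd : c < d).
Local Notation ns := (n0 + (n1 + n2))%N.
Local Notation state := (R * R -> 'cV[R]_(n0 + (n1 + n2))).
Local Notation Om := (Omega a b c d).
Local Notation L2Om := (L2 (leb2 R) Om).
Local Notation Zbc := (ZBC R n1 n2).
Local Notation Lam := (Lambda_bf a b c d).
Local Notation wd := (wderiv a b c d).

Section entries.
Variable u : state.
Local Notation f1 k := (fun z => state1 u z k 0).
Local Notation f2 k := (fun z => state2 u z k 0).

Lemma wderivmxE n (f : R * R -> 'cV[R]_n) i j k :
  (fun z => wderivmx a b c d i j f z k 0) = wd i j (fun z => f z k 0).
Proof. by apply/funext => z; rewrite mxE. Qed.

Lemma Lambda_corner1 (q : bool * bool) k : (Lam u).1.1 (lshift _ (idx4 q k)) 0 =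
  xget 0 (is_trace_corner a b c d (f1 k) (xat a b q.1, yat c d q.2)).
Proof. by rewrite /Lambda_bf col_mxEu col4E; case: q => -[] []; rewrite sel4E mxE. Qed.

Lemma Lambda_corner2 (r q : bool * bool) k : (Lam u).1.1 (rshift _ (idx4 r (idx4 q k))) 0 =
  xget 0 (is_trace_corner a b c d
    (sel4 r (f2 k) (wd 1 0 (f2 k)) (wd 0 1 (f2 k)) (wd 1 1 (f2 k)))
    (xat a b q.1, yat c d q.2)).
Proof.
rewrite /Lambda_bf col_mxEd col4E.
by case: r => -[] []; rewrite !sel4E col4E; case: q => -[] []; rewrite sel4E mxE ?wderivmxE.
Qed.

Lemma Lambda_edgex1 (q : bool) k : (fun x => (Lam u).1.2 x (lshift _ (idx2 q k)) 0) =
  xget (fun=> 0) (is_trace_y a b c d (wd 1 0 (f1 k)) (yat c d q)).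
Proof.
apply/funext => x; rewrite /Lambda_bf col_mxEu col2E.
by case: q; rewrite mxE wderivmxE.
Qed.

Lemma Lambda_edgex2 (r q : bool) k : (fun x => (Lam u).1.2 x (rshift _ (idx2 r (idx2 q k))) 0) =
  xget (fun=> 0) (is_trace_y a b c d (wd 2 r (f2 k)) (yat c d q)).
Proof.
apply/funext => x; rewrite /Lambda_bf col_mxEd col2E.
by case: r; rewrite col2E; case: q; rewrite mxE wderivmxE.
Qed.

Lemma Lambda_edgey1 (q : bool) k : (fun x => (Lam u).2 x (lshift _ (idx2 q k)) 0) =
  xget (fun=> 0) (is_trace_x a b c d (wd 0 1 (f1 k)) (xat a b q)).
Proof.
apply/funext => x; rewrite /Lambda_bf col_mxEu col2E.
by case: q; rewrite mxE wderivmxE.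
Qed.

Lemma Lambda_edgey2 (r q : bool) k : (fun x => (Lam u).2 x (rshift _ (idx2 r (idx2 q k))) 0) =
  xget (fun=> 0) (is_trace_x a b c d (wd r 2 (f2 k)) (xat a b q)).
Proof.
apply/funext => x; rewrite /Lambda_bf col_mxEd col2E.
by case: r; rewrite col2E; case: q; rewrite mxE wderivmxE.
Qed.

End entries.

Section source.
Variables (w : Zbc) (v u : state).
Hypotheses (ow : in_Z a b c d w) (Lv : L2mx (leb2 R) Om v).
Local Notation f1 k := (fun z => state1 u z k 0).
Local Notation f2 k := (fun z => state2 u z k 0).
Hypotheses (Lf1 : forall k, L2Om (f1 k)) (Lf2 : forall k, L2Om (f2 k)).
Hypotheses (E1 : forall k, f1 k = jet1 a c w v k 0 0 %[ae leb2 R in Om])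
  (E2 : forall k, f2 k = jet2 a c w v k 0 0 %[ae leb2 R in Om]).
Local Notation Hwv := (Zlc 1 (opH1 a b c d w) (opH2 a b c d v)).

Let Lx i : L2 (leb1 R) `[a, b] (fun t => w.1.2 t i 0). Proof. by case: ow => h _; exact: h. Qed.
Let Ly i : L2 (leb1 R) `[c, d] (fun t => w.2 t i 0). Proof. by case: ow => _ h; exact: h. Qed.
Let Lv1 i : L2Om (fun z => v z i 0). Proof. exact: Lv. Qed.

Let xat_in s : a <= xat a b s <= b.
Proof. by case: s; rewrite /= lexx (ltW ab). Qed.

Let yat_in s : c <= yat c d s <= d.
Proof. by case: s; rewrite /= lexx (ltW cd). Qed.

Let corner_in q : Om (xat a b q.1, yat c d q.2).
Proof. by split; rewrite /= in_itv /=. Qed.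

Let w1 k i j := wderiv_jet1 ab cd ow Lv (Lf1 k) (E1 k) (i := i) (j := j).
Let w2 k i j := wderiv_jet2 ab cd ow Lv (Lf2 k) (E2 k) (i := i) (j := j).

Lemma Lambda_corner1_jet q k : (Lam u).1.1 (lshift _ (idx4 q k)) 0 = Hwv.1.1 (lshift _ (idx4 q k)) 0.
Proof.
rewrite Lambda_corner1 -jet1_corner.
exact: (trace_corner_eq ab cd (corner_in q) (@jet1_continuous _ _ _ _ _ _ _ _ ab cd _ _ ow Lv k) (ae_eq_sym (E1 k))).
Qed.

Lemma Lambda_corner2_jet r q k :
  (Lam u).1.1 (rshift _ (idx4 r (idx4 q k))) 0 = Hwv.1.1 (rshift _ (idx4 r (idx4 q k))) 0.
Proof.
rewrite Lambda_corner2 -(jet2_corner ab cd ow Lv).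
apply: (trace_corner_eq ab cd (corner_in q) (@jet2_continuous _ _ _ _ _ _ _ _ ab cd _ _ ow Lv k r)).
apply: ae_eq_sym; case: r => -[] []; rewrite sel4E.
- by case: (@w2 k 1 1).
- by case: (@w2 k 1 0).
- by case: (@w2 k 0 1).
- exact: E2.
Qed.

Lemma Lambda_edgex1_jet q k :
  L2 (leb1 R) `[a, b] (fun x => (Lam u).1.2 x (lshift _ (idx2 q k)) 0) /\
  (fun x => (Lam u).1.2 x (lshift _ (idx2 q k)) 0) =
  (fun x => Hwv.1.2 x (lshift _ (idx2 q k)) 0) %[ae leb1 R in `[a, b]%classic].
Proof.
rewrite Lambda_edgex1; have [_ E] := @w1 k 1 0 isT isT.
have [L t] := trace_y_eq ab cd (yat_in q) (Lx _) (Lv1 _) (ae_eq_sym E).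
split; first exact: L.
apply: ae_eq_trans t _; apply: aeW => x _.
rewrite Hwv_edgex H11_row1; congr (_ + _).
under eq_Rintegral do rewrite H13_row1.
exact: (Rintegral_yat c d (fun _ t => v (x, t) _ 0)).
Qed.

Lemma Lambda_edgex2_jet r q k :
  L2 (leb1 R) `[a, b] (fun x => (Lam u).1.2 x (rshift _ (idx2 r (idx2 q k))) 0) /\
  (fun x => (Lam u).1.2 x (rshift _ (idx2 r (idx2 q k))) 0) =
  (fun x => Hwv.1.2 x (rshift _ (idx2 r (idx2 q k))) 0) %[ae leb1 R in `[a, b]%classic].
Proof.
rewrite Lambda_edgex2.
have H x : Hwv.1.2 x (rshift _ (idx2 r (idx2 q k))) 0 =
    (if r then w.1.2 x (rshift n1 (idx2 true k)) 0 else
      w.1.2 x (rshift n1 (idx2 false k)) 0 + (yat c d q - c) * w.1.2 x (rshift n1 (idx2 true k)) 0)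
    + \int[leb1 R]_(y in `[c, d])
      (q%:R * if r then v (x, y) (st2 n0 n1 k) 0 else (d - y) * v (x, y) (st2 n0 n1 k) 0).
  rewrite Hwv_edgex H11_row2; congr (_ + _).
  by apply: eq_Rintegral => y _; rewrite H13_row2.
case: r H => H.
  have [_ E] := @w2 k 2 1 isT isT.
  have [L t] := trace_y_eq ab cd (yat_in q) (Lx _) (Lv1 _) (ae_eq_sym E).
  split; first exact: L.
  apply: ae_eq_trans t _; apply: aeW => x _; rewrite H; congr (_ + _).
  exact: (Rintegral_yat c d (fun _ t => v (x, t) _ 0)).
have [_ E] := @w2 k 2 0 isT isT.
(* Here d_x^2 is an edge form whose inner function is itself an edge form; the trace contains a
   double primitive in y, which [ae_Iy_edgex] unfolds. *)
have [L t] := trace_y_eq ab cd (yat_in q) (Lx _) (edgex_L2 cd (Lx _) (Lv1 _)) (ae_eq_sym E).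
split; first exact: L.
apply: ae_eq_trans t _.
apply: filterS (ae_Iy_edgex cd (Lx (rshift n1 (idx2 true k))) (Lv1 (st2 n0 n1 k))) => x h xin.
have yin : `[c, d]%classic (yat c d q) by rewrite /= in_itv; exact: yat_in.
rewrite (h xin _ yin) H addrA; congr (_ + _).
exact: (Rintegral_yat c d (fun y t => (y - t) * v (x, t) _ 0)).
Qed.

Lemma Lambda_edgey1_jet q k :
  L2 (leb1 R) `[c, d] (fun y => (Lam u).2 y (lshift _ (idx2 q k)) 0) /\
  (fun y => (Lam u).2 y (lshift _ (idx2 q k)) 0) =
  (fun y => Hwv.2 y (lshift _ (idx2 q k)) 0) %[ae leb1 R in `[c, d]%classic].
Proof.
rewrite Lambda_edgey1; have [_ E] := @w1 k 0 1 isT isT.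
have [L t] := trace_x_eq ab cd (xat_in q) (Ly _) (Lv1 _) (ae_eq_sym E).
split; first exact: L.
apply: ae_eq_trans t _; apply: aeW => y _.
rewrite Hwv_edgey H22_row1; congr (_ + _).
under eq_Rintegral do rewrite H23_row1.
exact: (Rintegral_xat a b (fun _ t => v (t, y) _ 0)).
Qed.

Lemma Lambda_edgey2_jet r q k :
  L2 (leb1 R) `[c, d] (fun y => (Lam u).2 y (rshift _ (idx2 r (idx2 q k))) 0) /\
  (fun y => (Lam u).2 y (rshift _ (idx2 r (idx2 q k))) 0) =
  (fun y => Hwv.2 y (rshift _ (idx2 r (idx2 q k))) 0) %[ae leb1 R in `[c, d]%classic].
Proof.
rewrite Lambda_edgey2.
have H y : Hwv.2 y (rshift _ (idx2 r (idx2 q k))) 0 =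
    (if r then w.2 y (rshift n1 (idx2 true k)) 0 else
      w.2 y (rshift n1 (idx2 false k)) 0 + (xat a b q - a) * w.2 y (rshift n1 (idx2 true k)) 0)
    + \int[leb1 R]_(x in `[a, b])
      (q%:R * if r then v (x, y) (st2 n0 n1 k) 0 else (b - x) * v (x, y) (st2 n0 n1 k) 0).
  rewrite Hwv_edgey H22_row2; congr (_ + _).
  by apply: eq_Rintegral => x _; rewrite H23_row2.
case: r H => H.
  have [_ E] := @w2 k 1 2 isT isT.
  have [L t] := trace_x_eq ab cd (xat_in q) (Ly _) (Lv1 _) (ae_eq_sym E).
  split; first exact: L.
  apply: ae_eq_trans t _; apply: aeW => y _; rewrite H; congr (_ + _).
  exact: (Rintegral_xat a b (fun _ t => v (t, y) _ 0)).
have [_ E] := @w2 k 0 2 isT isT.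
have [L t] := trace_x_eq ab cd (xat_in q) (Ly _) (edgey_L2 ab (Ly _) (Lv1 _)) (ae_eq_sym E).
split; first exact: L.
apply: ae_eq_trans t _.
apply: filterS (ae_Ix_edgey ab (Ly (rshift n1 (idx2 true k))) (Lv1 (st2 n0 n1 k))) => y h yin.
have xin : `[a, b]%classic (xat a b q) by rewrite /= in_itv; exact: xat_in.
rewrite (h yin _ xin) H addrA; congr (_ + _).
exact: (Rintegral_xat a b (fun x t => (x - t) * v (t, y) _ 0)).
Qed.

(** Not a consequence of [Lambda_jet], since equality almost everywhere does not transport
    measurability; the L2 clause in the definition of the traces provides it. *)
Lemma Lambda_in_Z : in_Z a b c d (Lam u).
Proof.
split=> i j; rewrite ord1.
  case: (split_ordP i) => k ->; have [q [l ->]] := idx2P k; first exact: (Lambda_edgex1_jet q l).1.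
  by have [s [l' ->]] := idx2P l; exact: (Lambda_edgex2_jet q s l').1.
case: (split_ordP i) => k ->; have [q [l ->]] := idx2P k; first exact: (Lambda_edgey1_jet q l).1.
by have [s [l' ->]] := idx2P l; exact: (Lambda_edgey2_jet q s l').1.
Qed.

Lemma Lambda_jet : eqZ a b c d (Lam u) Hwv.
Proof.
apply: (eqv_Zspace a b c d _ _).2 => -[[i|i]|i].
- case: (split_ordP i) => k ->; have [q [l ->]] := idx4P k; first exact: Lambda_corner1_jet.
  by have [s [l' ->]] := idx4P l; exact: Lambda_corner2_jet.
- case: (split_ordP i) => k ->; have [q [l ->]] := idx2P k; first exact: (Lambda_edgex1_jet q l).2.
  by have [s [l' ->]] := idx2P l; exact: (Lambda_edgex2_jet q s l').2.
- case: (split_ordP i) => k ->; have [q [l ->]] := idx2P k; first exact: (Lambda_edgey1_jet q l).2.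
  by have [s [l' ->]] := idx2P l; exact: (Lambda_edgey2_jet q s l').2.
Qed.

End source.

End boundary_values.

(** * The operator T *)

Section bounded_forms.
Context (R : realType) (S : l2space R).

(** The norm of X(B) is not that of one of the spaces above, so its bound is stated for real-valued
    functionals and assembled by sums. *)
Definition nq_bounded (g : S -> R) : Prop :=
  exists2 C, 0 <= C & forall x, ok x -> g x <= C * nq x.

Lemma nq_boundedD g h : nq_bounded g -> nq_bounded h -> nq_bounded (fun x => g x + h x).
Proof.
move=> [C C0 hC] [C' C'0 hC']; exists (C + C'); first exact: addr_ge0.
by move=> x ox; rewrite mulrDl lerD// ?hC ?hC'.
Qed.

Lemma nq_bounded_sum (I : Type) (r : seq I) (g : I -> S -> R) :
  (forall i, nq_bounded (g i)) -> nq_bounded (fun x => \sum_(i <- r) g i x).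
Proof.
move=> hg; elim: r => [|i r ih].
  by exists 0 => // x _; rewrite big_nil mul0r.
have [C C0 hC] := nq_boundedD (hg i) ih.
by exists C => // x ox; rewrite big_cons; exact: hC.
Qed.

Lemma good_nq_bounded (S' : l2space R) (F : S -> S') : good F -> nq_bounded (fun x => nq (F x)).
Proof. by case. Qed.

Lemma nq_bounded_eq g h : nq_bounded h -> (forall x, ok x -> g x = h x) -> nq_bounded g.
Proof. by move=> [C C0 hC] E; exists C => // x ox; rewrite E//; exact: hC. Qed.

End bounded_forms.

Section PI_operator_T.
Context (R : realType) (a b c d : R) (n0 n1 n2 : nat).
Hypotheses (ab : a < b) (cd : c < d).
Local Notation ns := (n0 + (n1 + n2))%N.
Local Notation state := (R * R -> 'cV[R]_(n0 + (n1 + n2))).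
Local Notation Om := (Omega a b c d).
Local Notation L2Om := (L2 (leb2 R) Om).
Local Notation L2X := (L2mx (leb2 R) Om).
Local Notation wd := (wderiv a b c d).
Local Notation XS := (Xspace a b c d n0 n1 n2).
Local Notation ZS m0 m1 m2 := (Zspace a b c d m0 m1 m2).

Lemma Zlc_self m0 m1 m2 (w : Ztype R m0 m1 m2) : Zlc (-1) w w = zeroZ R m0 m1 m2.
Proof.
rewrite /Zlc /zeroZ; congr (_, _, _).
- by rewrite scaleN1r addNr.
- by apply/funext => x; rewrite scaleN1r addNr.
- by apply/funext => x; rewrite scaleN1r addNr.
Qed.

Lemma zeroZ_in_Z m0 m1 m2 : in_Z a b c d (zeroZ R m0 m1 m2).
Proof.
by split=> i j; [apply: (L2_eq _ (L20 _ (measurable_cc a b)))|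
  apply: (L2_eq _ (L20 _ (measurable_cc c d)))] => x _; rewrite mxE.
Qed.

(** An [l2space] has no distinguished zero; here zero is -1 times itself plus itself, and linearity
    applies. *)
Lemma good_zeroZ m0 m1 m2 q0 q1 q2 (F : ZS m0 m1 m2 -> ZS q0 q1 q2) : good F ->
  eqv (F (zeroZ R m0 m1 m2)) (zeroZ R q0 q1 q2 : ZS q0 q1 q2).
Proof.
move=> [_ lin _]; have o := (ok_Zspace a b c d _).1 (@zeroZ_in_Z m0 m1 m2).
by have := lin (-1) _ _ o o; rewrite /= !Zlc_self.
Qed.

Lemma goodZ_opp (S : l2space R) m0 m1 m2 (W : S -> Ztype R m0 m1 m2) : goodZ a b c d W ->
  goodZ a b c d (fun s => Zlc (-1) (W s) (zeroZ R m0 m1 m2)).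
Proof.
move=> [g0 g1 g2]; have mab := measurable_cc a b; have mcd := measurable_cc c d; split=> i.
- rewrite (_ : (fun s => _) = (fun s => -1 * (W s).1.1 i 0)).
    exact: good_comp (g0 i) (good_scaleR (-1)).
  by apply/funext => s; rewrite /= !mxE addr0.
- apply: (good_mono (good_comp (g1 i) (good_scaleF (leb1 R) mab (-1)))) => s x _ _.
  by rewrite /= !mxE addr0.
- apply: (good_mono (good_comp (g2 i) (good_scaleF (leb1 R) mcd (-1)))) => s x _ _.
  by rewrite /= !mxE addr0.
Qed.

Lemma opK1_opp (w : ZBC R n1 n2) z : opK1 a c n0 (Zlc (-1) w (zeroZ R _ _ _)) z = - opK1 a c n0 w z.
Proof.
apply/colP => i; rewrite [RHS]mxE !opK1E /= !opprD.
have N m (A : 'M[R]_(m, _)) (x : 'cV[R]_(n1 + four n2)) l : (A *m (-1 *: x + 0)) l 0 = - (A *m x) l 0.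
  by rewrite addr0 scaleN1r mulmxN mxE.
have N' m (A : 'M[R]_(m, _)) (x : 'cV[R]_(n1 + two n2)) l : (A *m (-1 *: x + 0)) l 0 = - (A *m x) l 0.
  by rewrite addr0 scaleN1r mulmxN mxE.
rewrite N; congr (_ + _ + _); rewrite -RintegralN_total;
  by apply: eq_Rintegral => t _; rewrite N'.
Qed.

Section fixed_parameters.
Variables (B : BCparams R n1 n2) (E : BCinvparams R n1 n2).
Hypotheses (hB : N011 a b c d B) (hBmaps : maps_Z a b c d (PI011 a b c d B)).
Hypotheses (hE : N011 a b c d E) (hwp : well_posed_bc a b c d B E).

Let T := @opT R a b c d n0 n1 n2 B E.
Let PB := PI011 a b c d B.
Let PE := PI011 a b c d E.

Definition bc_data (v : state) : ZBC R n1 n2 :=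
  Zlc (-1) (PE (PB (opH2 a b c d v))) (zeroZ R _ _ _).

Lemma opT_bc_data v z : T v z = opK2 a c v z + opK1 a c n0 (bc_data v) z.
Proof. by rewrite /T /opT /bc_data opK1_opp. Qed.

Let hEmaps : maps_Z a b c d PE. Proof. by case: hwp. Qed.

Lemma goodZ_PBH2 (S : l2space R) (V : S -> state) : goodX a b c d V ->
  goodZ a b c d (fun s => PB (opH2 a b c d (V s))).
Proof. by move=> gV; exact: (PI_good hB hBmaps (goodZ_H2 gV)). Qed.

Lemma goodZ_bc_data (S : l2space R) (V : S -> state) : goodX a b c d V ->
  goodZ a b c d (fun s => bc_data (V s)).
Proof. by move=> gV; apply: goodZ_opp; exact: (PI_good hE hEmaps (goodZ_PBH2 gV)). Qed.

Let gid : goodX a b c d (fun v : XS => v).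
Proof. by apply: (goodXP a b c d _).2; exact: good_id. Qed.

Lemma bc_data_in_Z (v : state) : L2X v -> in_Z a b c d (bc_data v).
Proof.
move=> Lv; have [h _ _] := (goodZP a b c d _).1 (goodZ_bc_data gid).
exact: (ok_Zspace a b c d _).2 (h _ ((ok_Xspace a b c d v).1 Lv)).
Qed.

Lemma PBH2_in_Z (v : state) : L2X v -> in_Z a b c d (PB (opH2 a b c d v)).
Proof.
move=> Lv; have [h _ _] := (goodZP a b c d _).1 (goodZ_PBH2 gid).
exact: (ok_Zspace a b c d _).2 (h _ ((ok_Xspace a b c d v).1 Lv)).
Qed.

Lemma H2_in_Z (v : state) : L2X v -> in_Z a b c d (opH2 a b c d v).
Proof.
move=> Lv; have [h _ _] := (goodZP a b c d _).1 (goodZ_H2 gid).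
exact: (ok_Zspace a b c d _).2 (h _ ((ok_Xspace a b c d v).1 Lv)).
Qed.

Let gZid m0 m1 m2 : goodZ a b c d (fun w : ZS m0 m1 m2 => w).
Proof. by apply: (goodZP a b c d _).2; exact: good_id. Qed.

Lemma good_PB : good (PB : ZS _ _ _ -> ZS _ _ _).
Proof. exact: (goodZP a b c d _).1 (PI_good hB hBmaps (@gZid _ _ _)). Qed.

Lemma good_PE : good (PE : ZS _ _ _ -> ZS _ _ _).
Proof. exact: (goodZP a b c d _).1 (PI_good hE hEmaps (@gZid _ _ _)). Qed.

Lemma good_H1 : good (@opH1 R a b c d n1 n2 : ZS (n1 + four n2) (n1 + two n2) (n1 + two n2) -> ZS _ _ _).
Proof. exact: (goodZP a b c d _).1 (goodZ_H1 (@gZid _ _ _)). Qed.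

Lemma opT_st0 (v : state) z k : T v z (lshift _ k) 0 = v z (lshift _ k) 0.
Proof. by rewrite opT_bc_data; exact: opK_st0. Qed.

Lemma opT_st1 (v : state) z k : T v z (st1 n0 n2 k) 0 = jet1 a c (bc_data v) v k 0 0 z.
Proof. by rewrite opT_bc_data; exact: opK_st1. Qed.

Lemma opT_st2 (v : state) z k : L2X v -> Om z ->
  T v z (st2 n0 n1 k) 0 = jet2 a c (bc_data v) v k 0 0 z.
Proof. by move=> Lv Oz; rewrite opT_bc_data; exact: (opK_st2 ab cd (bc_data_in_Z Lv) Lv). Qed.

Lemma st_case (i : 'I_ns) (P : 'I_ns -> Prop) : (forall k, P (lshift _ k)) ->
  (forall k, P (st1 n0 n2 k)) -> (forall k, P (st2 n0 n1 k)) -> P i.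
Proof.
move=> h0 h1 h2; case: (split_ordP i) => k ->; first exact: h0.
by case: (split_ordP k) => l ->; [exact: h1|exact: h2].
Qed.

(** Each component of T v is a component of v or a jet of order (0, 0) of v and its boundary data,
    all of which are bounded operators. *)
Lemma goodX_T : goodX a b c d (fun v : XS => T v).
Proof.
move=> i; elim/st_case: i => k.
- apply: (good_eqD (gid (lshift _ k))) => v _ z _; exact: opT_st0.
- apply: (good_eqD (good_jet1 ab cd k 0 0 (goodZ_bc_data gid) gid)) => v _ z _; exact: opT_st1.
- apply: (good_eqD (good_jet2 ab cd k 0 0 (goodZ_bc_data gid) gid)) => v ov z /set_mem Oz.
  by apply: opT_st2 => //; exact: (ok_Xspace a b c d v).2.
Qed.

Lemma good_T : good (T : XS -> XS).
Proof. exact: (goodXP a b c d _).1 goodX_T. Qed.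

Lemma opT_L2 (v : state) : L2X v -> L2X (T v).
Proof.
move=> Lv; have [h _ _] := good_T.
exact: (ok_Xspace a b c d _).2 (h _ ((ok_Xspace a b c d v).1 Lv)).
Qed.

Lemma in_H_eq k (f g : R * R -> R) : (forall z, Om z -> f z = g z) -> in_H a b c d k f -> in_H a b c d k g.
Proof.
move=> fg [Lf hf]; have Lg : L2Om g by apply: (L2_eq _ Lf) => z /set_mem Oz; exact: fg.
split; first exact: Lg.
move=> i j ik jk; have [h [Lh wh]] := hf i j ik jk; exists h; split; first exact: Lh.
apply: (is_wderiv_ae Lf Lg _ wh); exact: aeW.
Qed.

Lemma zeroZ_eqv_sub m0 m1 m2 (x q : Ztype R m0 m1 m2) :
  eqZ a b c d (Zlc 1 x q) (zeroZ R _ _ _) ->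
  eqZ a b c d x (Zlc (-1) q (zeroZ R _ _ _)).
Proof.
move=> h; apply: (eqv_Zspace a b c d _ _).2.
have {1}-> : x = Zlc (-1) q (Zlc 1 x q).
  case: x {h} => [[x0 x1] x2]; rewrite /Zlc /=; congr (_, _, _).
  - by rewrite scaleN1r scale1r addrC addrK.
  - by apply/funext => t; rewrite scaleN1r scale1r addrC addrK.
  - by apply/funext => t; rewrite scaleN1r scale1r addrC addrK.
apply: (@eqv_lc _ (ZS m0 m1 m2)); first exact: eqv_refl.
exact: (eqv_Zspace a b c d _ _).1.
Qed.

Lemma Zlc_opp_add m0 m1 m2 (q : Ztype R m0 m1 m2) :
  Zlc 1 (Zlc (-1) q (zeroZ R _ _ _)) q = zeroZ R _ _ _.
Proof.
rewrite /Zlc /zeroZ /=; congr (_, _, _).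
- by rewrite addr0 scale1r scaleN1r addNr.
- by apply/funext => t; rewrite addr0 scale1r scaleN1r addNr.
- by apply/funext => t; rewrite addr0 scale1r scaleN1r addNr.
Qed.

(** With L = H1 w + H2 v, the condition reads B H1 w = - B H2 v; apply the inverse in one direction
    and B H1 in the other. L is kept apart because boundary traces equal H1 w + H2 v only up to
    [eqZ]. *)
Lemma bc_iff w (v : state) (L : ZBF R n1 n2) : in_Z a b c d w -> L2X v -> in_Z a b c d L ->
  eqZ a b c d L (Zlc 1 (opH1 a b c d w) (opH2 a b c d v)) ->
  (eqZ a b c d (PB L) (zeroZ R _ _ _) <-> eqZ a b c d w (bc_data v)).
Proof.
move=> ow Lv oL EL.
have oH1 : ok (opH1 a b c d w : ZS _ _ _).
  by have [h _ _] := good_H1; apply: h; exact: (ok_Zspace a b c d _).1.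
have oH2 := (ok_Zspace a b c d _).1 (H2_in_Z Lv).
have oq := (ok_Zspace a b c d _).1 (PBH2_in_Z Lv).
have ow' := (ok_Zspace a b c d _).1 ow.
have oz := (ok_Zspace a b c d _).1 (@zeroZ_in_Z (n1 + four n2) (n1 + two n2) (n1 + two n2)).
set q := PB (opH2 a b c d v) in oq.
have gBH := good_comp good_H1 good_PB.
have oEq : ok (PE q : ZS _ _ _) by have [h _ _] := good_PE; exact: h.
have EB : eqv (PB L : ZS _ _ _) (lc 1 (PB (opH1 a b c d w) : ZS _ _ _) q).
  exact: (good_lin good_PB oH1 oH2 ((ok_Zspace a b c d _).1 oL) ((eqv_Zspace a b c d _ _).1 EL)).
have [_ hinv] := hwp.
split=> [E0|Ew].
- have E1 : eqv (PB (opH1 a b c d w) : ZS _ _ _) (lc (-1) (q : ZS _ _ _) (zeroZ R _ _ _)).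
    apply: (eqv_Zspace a b c d _ _).1; apply: zeroZ_eqv_sub; apply: (eqv_Zspace a b c d _ _).2.
    exact: eqv_trans (eqv_sym EB) ((eqv_Zspace a b c d _ _).1 E0).
  have [EPw _] := hinv _ ow.
  have oBw : ok (PB (opH1 a b c d w) : ZS _ _ _) by have [h _ _] := gBH; exact: h.
  have E2 := good_lin good_PE oq oz oBw E1.
  apply: (eqv_Zspace a b c d _ _).2.
  apply: eqv_trans (eqv_sym ((eqv_Zspace a b c d _ _).1 EPw)) _.
  apply: eqv_trans E2 _; apply: (@eqv_lc _ (ZS _ _ _)); first exact: eqv_refl.
  exact: good_zeroZ good_PE.
- have [_ EBE] := hinv _ ((ok_Zspace a b c d _).2 oq).
  have E1 := good_lin gBH oEq oz ow' ((eqv_Zspace a b c d _ _).1 Ew).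
  apply: (eqv_Zspace a b c d _ _).2; apply: eqv_trans EB _.
  rewrite -(Zlc_opp_add q); apply: (@eqv_lc _ (ZS _ _ _)); last exact: eqv_refl.
  apply: eqv_trans E1 _; apply: (@eqv_lc _ (ZS _ _ _)).
    exact: (eqv_Zspace a b c d _ _).1 EBE.
  exact: good_zeroZ gBH.
Qed.

End fixed_parameters.

End PI_operator_T.

(** * T as an isomorphism onto X(B) *)

Section isomorphism.
Context (R : realType) (a b c d : R) (n0 n1 n2 : nat).
Hypotheses (ab : a < b) (cd : c < d).
Local Notation ns := (n0 + (n1 + n2))%N.
Local Notation state := (R * R -> 'cV[R]_(n0 + (n1 + n2))).
Local Notation Om := (Omega a b c d).
Local Notation L2Om := (L2 (leb2 R) Om).
Local Notation L2X := (L2mx (leb2 R) Om).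
Local Notation wd := (wderiv a b c d).
Local Notation XS := (Xspace a b c d n0 n1 n2).
Local Notation st1 := (@st1 n0 n1 n2).
Local Notation st2 := (@st2 n0 n1 n2).
Local Notation f1 u k := (fun z => state1 u z k 0).
Local Notation f2 u k := (fun z => state2 u z k 0).

Lemma state0_coord (u : state) k : (fun z => state0 u z k 0) = (fun z => u z (lshift _ k) 0).
Proof. by apply/funext => z; rewrite mxE. Qed.

Lemma state1_coord (u : state) k : f1 u k = (fun z => u z (st1 k) 0).
Proof. by apply/funext => z; rewrite !mxE. Qed.

Lemma state2_coord (u : state) k : f2 u k = (fun z => u z (st2 k) 0).
Proof. by apply/funext => z; rewrite !mxE. Qed.

(* The inverse of T. *)
Definition opD (u : state) : state := fun z =>
  col_mx (state0 u z) (col_mx (wderivmx a b c d 1 1 (state1 u) z)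
    (wderivmx a b c d 2 2 (state2 u) z)).

Lemma opD_st0 u z k : opD u z (lshift _ k) 0 = u z (lshift _ k) 0.
Proof. by rewrite /opD col_mxEu mxE. Qed.

Lemma opD_st1 u k : (fun z => opD u z (st1 k) 0) = wd 1 1 (f1 u k).
Proof. by apply/funext => z; rewrite /opD col_mxEd col_mxEu mxE. Qed.

Lemma opD_st2 u k : (fun z => opD u z (st2 k) 0) = wd 2 2 (f2 u k).
Proof. by apply/funext => z; rewrite /opD col_mxEd col_mxEd mxE. Qed.

(** The scalar representations, chosen component by component, are stacked into a single w in the
    order fixed by [idx4] and [idx2]. No boundary condition enters yet. *)
Lemma in_H1_jets (u : state) : in_Hmx a b c d 1 (state1 u) -> in_Hmx a b c d 2 (state2 u) ->
  exists w : ZBC R n1 n2, [/\ in_Z a b c d w,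
    forall k, f1 u k = jet1 a c w (opD u) k 0 0 %[ae leb2 R in Om] &
    forall k, f2 u k = jet2 a c w (opD u) k 0 0 %[ae leb2 R in Om]].
Proof.
move=> h1 h2.
have /choice[p hp] : forall k, exists p : R * (R -> R) * (R -> R),
    [/\ L2 (leb1 R) `[a, b] p.1.2, L2 (leb1 R) `[c, d] p.2 &
      f1 u k = form1 a c p.1.1 p.1.2 p.2 (wd 1 1 (f1 u k)) 0 0 %[ae leb2 R in Om]].
  by move=> k; have [r [be [al h]]] := in_H1_form ab cd (h1 k); exists (r, be, al).
have /choice[q hq] : forall k, exists q : (R * R * R * R) * ((R -> R) * (R -> R) * (R -> R) * (R -> R)),
    [/\ L2 (leb1 R) `[a, b] q.2.1.1.1, L2 (leb1 R) `[a, b] q.2.1.1.2,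
        L2 (leb1 R) `[c, d] q.2.1.2, L2 (leb1 R) `[c, d] q.2.2 &
      f2 u k = form2 a c q.1.1.1.1 q.1.1.1.2 q.1.1.2 q.1.2 q.2.1.1.1 q.2.1.1.2 q.2.1.2 q.2.2
        (wd 2 2 (f2 u k)) 0 0 %[ae leb2 R in Om]].
  move=> k; have [k0 [k1 [k2 [k3 [b0 [b1 [a0 [a1 h]]]]]]]] := in_H2_form ab cd (h2 k).
  by exists ((k0, k1, k2, k3), (b0, b1, a0, a1)).
pose w : ZBC R n1 n2 :=
  (col_mx (\col_k (p k).1.1) (col4 (\col_k (q k).1.1.1.1) (\col_k (q k).1.1.1.2)
     (\col_k (q k).1.1.2) (\col_k (q k).1.2)),
   fun t => col_mx (\col_k (p k).1.2 t) (col_mx (\col_k (q k).2.1.1.1 t) (\col_k (q k).2.1.1.2 t)),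
   fun t => col_mx (\col_k (p k).2 t) (col_mx (\col_k (q k).2.1.2 t) (\col_k (q k).2.2 t))).
have wx1 k : (fun t => w.1.2 t (lshift _ k) 0) = (p k).1.2.
  by apply/funext => t; rewrite col_mxEu mxE.
have wy1 k : (fun t => w.2 t (lshift _ k) 0) = (p k).2.
  by apply/funext => t; rewrite col_mxEu mxE.
have wx2 r k : (fun t => w.1.2 t (rshift _ (idx2 r k)) 0) = if r then (q k).2.1.1.2 else (q k).2.1.1.1.
  by apply/funext => t; rewrite col_mxEd col2E; case: r; rewrite mxE.
have wy2 r k : (fun t => w.2 t (rshift _ (idx2 r k)) 0) = if r then (q k).2.2 else (q k).2.1.2.
  by apply/funext => t; rewrite col_mxEd col2E; case: r; rewrite mxE.
have wz2 r k : w.1.1 (rshift _ (idx4 r k)) 0 =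
    sel4 r (q k).1.1.1.1 (q k).1.1.1.2 (q k).1.1.2 (q k).1.2.
  by rewrite col_mxEd col4E; case: r => -[] []; rewrite !sel4E mxE.
exists w; split.
- split=> i j; rewrite ord1.
    case: (split_ordP i) => k ->; first by rewrite wx1; case: (hp k).
    by have [r [l ->]] := idx2P k; rewrite wx2; case: r; case: (hq l).
  case: (split_ordP i) => k ->; first by rewrite wy1; case: (hp k).
  by have [r [l ->]] := idx2P k; rewrite wy2; case: r; case: (hq l).
- move=> k; rewrite /jet1 wx1 wy1 opD_st1 col_mxEu mxE.
  by case: (hp k).
- move=> k; rewrite /jet2 !wx2 !wy2 opD_st2 !wz2.
  by case: (hq k).
Qed.

Section fixed_parameters.
Variables (B : BCparams R n1 n2) (E : BCinvparams R n1 n2).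
Hypotheses (hB : N011 a b c d B) (hBmaps : maps_Z a b c d (PI011 a b c d B)).
Hypotheses (hE : N011 a b c d E) (hwp : well_posed_bc a b c d B E).

Let T := @opT R a b c d n0 n1 n2 B E.
Local Notation bd := (bc_data a b c d B E).

Lemma state_L2 (u : state) : L2X u ->
  [/\ L2X (state0 u), forall k, L2Om (f1 u k) & forall k, L2Om (f2 u k)].
Proof.
move=> Lu; split=> [i j|k|k].
- by rewrite ord1 state0_coord; exact: Lu.
- by rewrite state1_coord; exact: Lu.
- by rewrite state2_coord; exact: Lu.
Qed.

Section image.
Variable v : state.
Hypothesis Lv : L2X v.

Let LT : L2X (T v). Proof. by move=> i j; exact: (opT_L2 ab cd hB hBmaps hE hwp Lv). Qed.

Lemma opT_state1 k : f1 (T v) k = jet1 a c (bd v) v k 0 0.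
Proof. by rewrite state1_coord; apply/funext => z; exact: opT_st1. Qed.

Lemma opT_state2 k z : Om z -> f2 (T v) k z = jet2 a c (bd v) v k 0 0 z.
Proof.
move=> Oz; rewrite [LHS](congr1 (@^~ z) (state2_coord (T v) k)).
exact: (opT_st2 ab cd hB hBmaps hE hwp k Lv Oz).
Qed.

Let obd : in_Z a b c d (bd v). Proof. exact: bc_data_in_Z Lv. Qed.

Let E1 k : f1 (T v) k = jet1 a c (bd v) v k 0 0 %[ae leb2 R in Om].
Proof. by apply: aeW => z _; rewrite -opT_state1. Qed.

Let E2 k : f2 (T v) k = jet2 a c (bd v) v k 0 0 %[ae leb2 R in Om].
Proof. by apply: aeW => z; exact: opT_state2. Qed.

(** Regularity is that of the forms; the boundary condition is the trivial case w = [bd v] of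
    [bc_iff]. *)
Lemma opT_in_X : in_X a b c d B (T v).
Proof.
have [L0 L1 L2] := state_L2 LT; split => //.
- move=> k; rewrite opT_state1; apply: (in_H_form1 ab cd) => //.
  + by case: obd => h _; exact: h.
  + by case: obd => _ h; exact: h.
- move=> k; apply: (@in_H_eq _ _ _ _ _ _ (jet2 a c (bd v) v k 0 0)).
    by move=> z Oz; rewrite -(opT_state2 _ Oz).
  case: obd => hx hy.
  exact: (in_H_form2 ab cd _ _ _ _ (hx _ _) (hx _ _) (hy _ _) (hy _ _) (Lv _ _)).
- have oL := Lambda_in_Z ab cd obd Lv L1 L2 E1 E2.
  apply: (bc_iff hB hBmaps hE hwp obd Lv oL (Lambda_jet ab cd obd Lv L1 L2 E1 E2)).2.
  by split => //; exact: ae_eq_refl.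
Qed.

Let mO := measurable_Om a b c d.

Lemma opT_nsq1 k i j : (i <= 1)%N -> (j <= 1)%N ->
  nsq (leb2 R) Om (wd i j (f1 (T v) k)) = nsq (leb2 R) Om (jet1 a c (bd v) v k i j).
Proof.
move=> i1 j1; have [_ L1 _] := state_L2 LT.
have [L e] := wderiv_jet1 ab cd obd Lv (L1 k) (E1 k) i1 j1.
have m1 := L2_measurable mO L.
have m2 := L2_measurable mO (jet1_L2 ab cd obd Lv k i j).
exact: (nsq_ae mO m1 m2 e).
Qed.

Lemma opT_nsq2 k i j : (i <= 2)%N -> (j <= 2)%N ->
  nsq (leb2 R) Om (wd i j (f2 (T v) k)) = nsq (leb2 R) Om (jet2 a c (bd v) v k i j).
Proof.
move=> i1 j1; have [_ _ L1] := state_L2 LT.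
have [L e] := wderiv_jet2 ab cd obd Lv (L1 k) (E2 k) i1 j1.
have m1 := L2_measurable mO L.
have m2 := L2_measurable mO (jet2_L2 ab cd obd Lv k i j).
exact: (nsq_ae mO m1 m2 e).
Qed.

End image.

Lemma opD_L2 (u : state) : in_X a b c d B u -> L2X (opD u).
Proof.
move=> [L0 h1 h2 _] i j; rewrite ord1; elim/st_case: i => k.
- rewrite (_ : (fun z => _) = (fun z => state0 u z k 0)); first exact: L0.
  by apply/funext => z; rewrite opD_st0 mxE.
- by rewrite opD_st1; case: (in_H_wderiv (h1 k) (i := 1) (j := 1) isT isT).
- by rewrite opD_st2; case: (in_H_wderiv (h2 k) (i := 2) (j := 2) isT isT).
Qed.

Lemma in_X_L2 (u : state) : in_X a b c d B u -> L2X u.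
Proof.
move=> [L0 h1 h2 _] i j; rewrite ord1; elim/st_case: i => k.
- by rewrite -state0_coord; exact: L0.
- by rewrite -state1_coord; case: (h1 k).
- by rewrite -state2_coord; case: (h2 k).
Qed.

(** Since u is the jet of some w and [opD u], its boundary condition forces w to be equivalent to
    the data that T builds from [opD u]. *)
Lemma opT_opD (u : state) : in_X a b c d B u -> T (opD u) = u %[ae leb2 R in Om].
Proof.
move=> Xu; have Lu := in_X_L2 Xu; have LD := opD_L2 Xu; have [_ h1 h2 bc] := Xu.
have [w [ow e1 e2]] := in_H1_jets h1 h2.
have [_ L1 L2] := state_L2 Lu.
have oL := Lambda_in_Z ab cd ow LD L1 L2 e1 e2.
have ew := (bc_iff hB hBmaps hE hwp ow LD oL (Lambda_jet ab cd ow LD L1 L2 e1 e2)).1 bc.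
have obd := bc_data_in_Z hB hBmaps hE hwp LD.
(* The two w agree only up to [eqZ], so the equality of jets is obtained from [good_cong] on
   pairs. *)
pose P := prod_space (Zspace a b c d (n1 + four n2) (n1 + two n2) (n1 + two n2)) XS.
have gW : goodZ a b c d (fun s : P => s.1).
  by apply: (goodZP a b c d _).2; exact: good_prod1.
have gV : goodX a b c d (fun s : P => s.2).
  by apply: (goodXP a b c d _).2; exact: good_prod2.
have oP w' : in_Z a b c d w' -> ok ((w', opD u) : P).
  move=> ow'; case; first exact: (ok_Zspace a b c d _).1 ow'.
  exact: (ok_Xspace a b c d _).1 LD.
have eP : eqv ((bd (opD u), opD u) : P) ((w, opD u) : P).
  case; last exact: (@eqv_refl _ XS).
  exact: (@eqv_sym _ (Zspace a b c d _ _ _) _ _ ((eqv_Zspace a b c d _ _).1 ew)).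
apply: (eqv_Xspace a b c d _ _).2 => i; elim/st_case: i => k.
- by apply: aeW => z _; rewrite /state_coord opT_st0 opD_st0.
- have h := good_cong (good_jet1 ab cd k 0 0 gW gV) (oP _ obd) (oP _ ow) eP.
  have h' : jet1 a c (bd (opD u)) (opD u) k 0 0 = f1 u k %[ae leb2 R in Om].
    exact: ae_eq_trans h (ae_eq_sym (e1 k)).
  by rewrite /state_coord -!state1_coord opT_state1.
- have h := good_cong (good_jet2 ab cd k 0 0 gW gV) (oP _ obd) (oP _ ow) eP.
  have h' : jet2 a c (bd (opD u)) (opD u) k 0 0 = f2 u k %[ae leb2 R in Om].
    exact: ae_eq_trans h (ae_eq_sym (e2 k)).
  rewrite /state_coord -!state2_coord; apply: ae_eq_trans _ h'.
  by apply: aeW => z Oz; exact: opT_state2.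
Qed.

Definition Xnormsq (u : state) : R :=
  L2normsq (leb2 R) Om (state0 u) + Hnormsq a b c d 1 (state1 u) + Hnormsq a b c d 2 (state2 u).

Lemma L2normsq_ge0 n (F : R * R -> 'cV[R]_n) : 0 <= L2normsq (leb2 R) Om F.
Proof. by rewrite L2normsq_coord; apply: sumr_ge0 => i _; exact: nsq_ge0. Qed.

Lemma Hnormsq_ge n k (F : R * R -> 'cV[R]_n) :
  L2normsq (leb2 R) Om (wderivmx a b c d k k F) <= Hnormsq a b c d k F.
Proof.
have S0 i : 0 <= \sum_(j < k.+1) L2normsq (leb2 R) Om (wderivmx a b c d i j F).
  by apply: sumr_ge0 => j _; exact: L2normsq_ge0.
rewrite /Hnormsq (bigD1 ord_max)//= (bigD1 ord_max)//= -addrA lerDl addr_ge0//.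
  by apply: sumr_ge0 => j _; exact: L2normsq_ge0.
by apply: sumr_ge0 => i _; exact: S0.
Qed.

Lemma L2normsq_wderivmx n (F : R * R -> 'cV[R]_n) i j :
  L2normsq (leb2 R) Om (wderivmx a b c d i j F) =
  \sum_k nsq (leb2 R) Om (wd i j (fun z => F z k 0)).
Proof. by rewrite L2normsq_coord; apply: eq_bigr => k _; rewrite wderivmxE. Qed.

Lemma L2normsq_state0 (u : state) :
  L2normsq (leb2 R) Om (state0 u) = \sum_k nsq (leb2 R) Om (fun z => u z (lshift _ k) 0).
Proof. by rewrite L2normsq_coord; apply: eq_bigr => k _; rewrite state0_coord. Qed.

Let gid : goodX a b c d (fun v : XS => v).
Proof. by apply: (goodXP a b c d _).2; exact: good_id. Qed.

(** Every derivative in the norm of X(B) is, up to a null set, a jet of T v, hence a bounded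
    operator of v. *)
Lemma opT_bounded : nq_bounded (fun v : XS => Xnormsq (T v)).
Proof.
have gbd := goodZ_bc_data hB hBmaps hE hwp gid.
apply: nq_boundedD; first apply: nq_boundedD.
- have hb : nq_bounded (fun v : XS => \sum_(k < n0)
      nq (state_coord a b c d (lshift (n1 + n2) k) v)).
    by apply: nq_bounded_sum => k; exact: good_nq_bounded (gid (lshift _ k)).
  apply: (nq_bounded_eq hb) => v ov; rewrite L2normsq_state0; apply: eq_bigr => k _.
  congr nsq; apply/funext => z; exact: opT_st0.
- apply: nq_bounded_sum => i; apply: nq_bounded_sum => j.
  have hb : nq_bounded (fun v : XS => \sum_k nq (jet1 a c (bd v) v k i j : FOm a b c d)).
    by apply: nq_bounded_sum => k; exact: good_nq_bounded (good_jet1 ab cd k i j gbd gid).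
  apply: (nq_bounded_eq hb) => v ov; rewrite L2normsq_wderivmx; apply: eq_bigr => k _.
  by apply: opT_nsq1; [exact: (ok_Xspace a b c d v).2|rewrite -ltnS|rewrite -ltnS].
- apply: nq_bounded_sum => i; apply: nq_bounded_sum => j.
  have hb : nq_bounded (fun v : XS => \sum_k nq (jet2 a c (bd v) v k i j : FOm a b c d)).
    by apply: nq_bounded_sum => k; exact: good_nq_bounded (good_jet2 ab cd k i j gbd gid).
  apply: (nq_bounded_eq hb) => v ov; rewrite L2normsq_wderivmx; apply: eq_bigr => k _.
  by apply: opT_nsq2; [exact: (ok_Xspace a b c d v).2|rewrite -ltnS|rewrite -ltnS].
Qed.

(** The constant is 1: the left side consists of the u_0 term and the top mixed derivative terms of
    the right side. *)
Lemma L2normsq_opT (v : state) : L2X v -> L2normsq (leb2 R) Om v <= Xnormsq (T v).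
Proof.
move=> Lv; rewrite L2normsq_coord !big_split_ord /= addrA.
apply: lerD; first apply: lerD.
- rewrite L2normsq_state0 le_eqVlt; apply/orP; left; apply/eqP; apply: eq_bigr => k _.
  congr nsq; apply/funext => z; exact/esym/opT_st0.
- apply: le_trans (Hnormsq_ge 1 _); rewrite L2normsq_wderivmx.
  by apply: ler_sum => k _; rewrite (opT_nsq1 Lv).
- apply: le_trans (Hnormsq_ge 2 _); rewrite L2normsq_wderivmx.
  by apply: ler_sum => k _; rewrite (opT_nsq2 Lv).
Qed.

(** The derivatives inside the norm are the same functions, by [wderiv_ae]. *)
Lemma Xnorm_ae (u u' : state) : L2X u -> L2X u' -> u = u' %[ae leb2 R in Om] ->
  Xnorm a b c d u = Xnorm a b c d u'.
Proof.
move=> Lu Lu' e; have [L0 L1 L2] := state_L2 Lu; have [L0' L1' L2'] := state_L2 Lu'.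
have ec := (eqv_Xspace a b c d _ _).1 e; have mO := measurable_Om a b c d.
have E0 : L2normsq (leb2 R) Om (state0 u) = L2normsq (leb2 R) Om (state0 u').
  rewrite !L2normsq_state0; apply: eq_bigr => k _.
  have m1 := L2_measurable mO (Lu (lshift _ k) 0).
  have m2 := L2_measurable mO (Lu' (lshift _ k) 0).
  exact: (nsq_ae mO m1 m2 (ec _)).
have E1 : Hnormsq a b c d 1 (state1 u) = Hnormsq a b c d 1 (state1 u').
  apply: eq_bigr => i _; apply: eq_bigr => j _; rewrite !L2normsq_wderivmx.
  apply: eq_bigr => k _.
  have ek : f1 u k = f1 u' k %[ae leb2 R in Om].
    by apply: filterS (ec (st1 k)) => z hz Oz; rewrite !mxE; exact: hz.
  by rewrite (wderiv_ae i j (L1 k) (L1' k) ek).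
have E2 : Hnormsq a b c d 2 (state2 u) = Hnormsq a b c d 2 (state2 u').
  apply: eq_bigr => i _; apply: eq_bigr => j _; rewrite !L2normsq_wderivmx.
  apply: eq_bigr => k _.
  have ek : f2 u k = f2 u' k %[ae leb2 R in Om].
    by apply: filterS (ec (st2 k)) => z hz Oz; rewrite !mxE; exact: hz.
  by rewrite (wderiv_ae i j (L2 k) (L2' k) ek).
by rewrite /Xnorm E0 E1 E2.
Qed.

End fixed_parameters.

End isomorphism.

(** A squeeze between 0 and C times the difference quotient that is known to tend to 0. The
    comparison is asked only for t + h >= 0, where the curves are controlled. *)
Lemma frechet_transfer (R : realType) (V V' : lmodType R) (N : V -> R) (N' : V' -> R)
    u u' (t C : R) v v' :
  (forall h, 0 <= t + h -> 0 <= N' (u' (t + h) - u' t - h *: v') <=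
    C * N (u (t + h) - u t - h *: v)) ->
  is_frechet N u t v -> is_frechet N' u' t v'.
Proof.
move=> hN hu.
have h0 : (fun h : R => C * (N (u (t + h) - u t - h *: v) / `|h|))
    @ within [set h : R | 0 <= t + h] 0^' --> (0 : R).
  by rewrite -[X in _ --> X](mulr0 C); apply: cvgM; [exact: cvg_cst|exact: hu].
apply: (squeeze_cvgr _ (cvg_cst 0) h0).
rewrite near_withinE; near=> h => /= th.
have /andP[N0 NC] := hN _ th.
rewrite mulr_ge0 ?invr_ge0//= mulrA ler_wpM2r ?invr_ge0//.
Unshelve. all: by end_near. Qed.

(** * Equivalence of the PIE and the PDE *)

Section equivalence.
Context (R : realType) (a b c d : R) (n0 n1 n2 : nat).
Hypotheses (ab : a < b) (cd : c < d).
Local Notation ns := (n0 + (n1 + n2))%N.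
Local Notation state := (R * R -> 'cV[R]_(n0 + (n1 + n2))).
Local Notation Om := (Omega a b c d).
Local Notation L2X := (L2mx (leb2 R) Om).
Local Notation XS := (Xspace a b c d n0 n1 n2).
Variables (B : BCparams R n1 n2) (E : BCinvparams R n1 n2).
Hypotheses (hB : N011 a b c d B) (hBmaps : maps_Z a b c d (PI011 a b c d B)).
Hypotheses (hE : N011 a b c d E) (hwp : well_posed_bc a b c d B E).

Let T := @opT R a b c d n0 n1 n2 B E.
Let gT := good_T n0 ab cd hB hBmaps hE hwp.
Local Notation XN := (@Xnorm R a b c d n0 n1 n2).
Local Notation LN := (L2norm (leb2 R) Om).

(** Turns the remainder in [is_frechet] into the linear combinations of [Xspace], to which [good_T]
    applies. *)
Lemma diffE (x y z : state) h : y - x - h *: z = state_lc (- h) z (state_lc (-1) x y).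
Proof.
by apply/funext => w; rewrite /state_lc !fctE scaleNr scaleN1r addrC [- x w + _]addrC.
Qed.

Lemma diff_L2 (x y z : state) h : L2X x -> L2X y -> L2X z -> L2X (y - x - h *: z).
Proof.
move=> /(ok_Xspace a b c d _).1 ox /(ok_Xspace a b c d _).1 oy /(ok_Xspace a b c d _).1 oz.
rewrite diffE; apply: (ok_Xspace a b c d _).2.
exact: (@ok_lc _ XS _ _ _ oz (@ok_lc _ XS _ _ _ ox oy)).
Qed.

Lemma opT_diff (x y z : state) h : L2X x -> L2X y -> L2X z ->
  T (y - x - h *: z) = T y - T x - h *: T z %[ae leb2 R in Om].
Proof.
move=> /(ok_Xspace a b c d _).1 ox /(ok_Xspace a b c d _).1 oy /(ok_Xspace a b c d _).1 oz.
have oxy := @ok_lc _ XS (-1) _ _ ox oy; have [_ lin _] := gT.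
rewrite !diffE; apply: (eqv_Xspace a b c d _ _).2.
apply: (@eqv_trans _ XS) (lin (- h) _ _ oz oxy) _.
by apply: (@eqv_lc _ XS); [exact: eqv_refl|exact: lin].
Qed.

Lemma opT_cong (x y : state) : L2X x -> L2X y -> x = y %[ae leb2 R in Om] ->
  T x = T y %[ae leb2 R in Om].
Proof.
move=> /(ok_Xspace a b c d _).1 ox /(ok_Xspace a b c d _).1 oy /(eqv_Xspace a b c d _ _).1 e.
exact: (eqv_Xspace a b c d _ _).2 (good_cong gT ox oy e).
Qed.

Lemma opT_LX (x : state) : L2X x -> L2X (T x).
Proof. by move=> Lx i j; exact: (opT_L2 ab cd hB hBmaps hE hwp Lx). Qed.

(** The derivative z' may differ from T z on a null set; this occurs on the way from the PDE, where
    z is [opD] of the given derivative. *)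
Lemma Xnorm_diff (x y z z' : state) h : L2X x -> L2X y -> L2X z -> L2X z' ->
  T z = z' %[ae leb2 R in Om] ->
  XN (T y - T x - h *: z') = XN (T (y - x - h *: z)).
Proof.
move=> Lx Ly Lz Lz' e; apply: Xnorm_ae.
- by apply: diff_L2 => //; exact: opT_LX.
- by apply: opT_LX; exact: diff_L2.
- apply: filterS2 (opT_diff h Lx Ly Lz) e => w h1 h2 Ow.
  by rewrite (h1 Ow) !fctE (h2 Ow).
Qed.

Lemma Xnorm_opT : exists C, forall x : state, L2X x -> XN (T x) <= C * LN x.
Proof.
have [C C0 hC] := opT_bounded n0 ab cd hB hBmaps hE hwp.
exists (Num.sqrt C) => x Lx; rewrite /L2norm -sqrtrM//; apply: ler_wsqrtr.
by rewrite (nq_Xspace a b c d x); apply: hC; exact: (ok_Xspace a b c d x).1.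
Qed.

Lemma L2norm_opT (x : state) : L2X x -> LN x <= XN (T x).
Proof. by move=> Lx; apply: ler_wsqrtr; exact: (L2normsq_opT ab cd hB hBmaps hE hwp Lx). Qed.

(** Injectivity from the lower bound [L2norm_opT], needed to recover the initial condition of the
    PIE. *)
Lemma opT_inj (x y : state) : L2X x -> L2X y -> T x = T y %[ae leb2 R in Om] ->
  x = y %[ae leb2 R in Om].
Proof.
move=> Lx Ly e; have ox := (ok_Xspace a b c d x).1 Lx; have oy := (ok_Xspace a b c d y).1 Ly.
(* The combination of y with itself plays the part of the zero vector, so both sides have the same
   shape under linearity. *)
pose dxy : state := state_lc (-1) y x; pose dyy : state := state_lc (-1) y y.
have os : ok (dxy : XS) by exact: (@ok_lc _ XS).
have oz : ok (dyy : XS) by exact: (@ok_lc _ XS).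
have Ls := (ok_Xspace a b c d _).2 os; have Lz := (ok_Xspace a b c d _).2 oz.
have [_ lin _] := gT; have [C hC] := Xnorm_opT.
have eT : T dxy = T dyy %[ae leb2 R in Om].
  apply: (eqv_Xspace a b c d _ _).2; apply: (@eqv_trans _ XS) (lin _ _ _ oy ox) _.
  apply: (@eqv_trans _ XS) (eqv_sym (lin _ _ _ oy oy)).
  apply: (@eqv_lc _ XS); first exact: eqv_refl.
  exact: (eqv_Xspace a b c d _ _).1.
have nz : LN dyy = 0.
  rewrite /L2norm (nq_Xspace a b c d dyy) ((nq_sub0 (l := XS) oy oy).1 (eqv_refl _)).
  exact: sqrtr0.
have n0' : LN dxy <= 0.
  apply: (le_trans (L2norm_opT Ls)); rewrite (Xnorm_ae (opT_LX Ls) (opT_LX Lz) eT).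
  by apply: (le_trans (hC _ Lz)); rewrite nz mulr0.
apply: (eqv_Xspace a b c d _ _).2; apply: (nq_sub0 (l := XS) ox oy).2.
apply/eqP; rewrite -[lc _ _ _]/dxy -(nq_Xspace a b c d dxy) eq_le L2normsq_ge0 andbT.
have : Num.sqrt (L2normsq (leb2 R) Om dxy) == 0 by rewrite eq_le sqrtr_ge0 andbT.
by rewrite sqrtr_eq0.
Qed.

(** [opA] applied to [uh t] is by definition the right-hand side of the PDE at T (uh t). What is to
    be proved concerns derivatives and initial values: T carries those of [uh] forward, [opD] and
    injectivity bring them back. *)
Lemma PIE_PDE (A : PDEcoefs R n0 n1 n2) (uhI : state) (LI : L2X uhI) (uh : R -> state) :
  (forall t, 0 <= t -> L2X (uh t)) ->
  solves_PIE a b c d T (opA a b c d A T) uhI uh <->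
  satisfies_PDE a b c d A B (T uhI) (fun t => T (uh t)).
Proof.
move=> Lu; have L0 : L2X (uh 0) by exact: Lu.
split=> [[du [e0 _ hdu eq]]|[du [e0 hX hdu eq]]].
- exists (fun t => T (du t)); split.
  + exact: opT_cong.
  + by move=> t t0; apply: (opT_in_X ab cd hB hBmaps hE hwp); exact: Lu.
  + move=> t t0; have [Ldu fdu] := hdu t t0; split.
      exact: (opT_in_X ab cd hB hBmaps hE hwp).
    have [C hC] := Xnorm_opT; apply: (frechet_transfer (C := C) _ fdu) => h th.
    rewrite (Xnorm_diff h (Lu _ t0) (Lu _ th) Ldu (opT_LX Ldu) (@ae_eq_refl _ _ _ _ _ _ _)).
    by rewrite sqrtr_ge0; apply: hC; apply: diff_L2 => //; exact: Lu.
  + exact: eq.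
(* The candidate derivative of [uh] is [opD] of that of T uh. This uses that [du t] lies in X(B), as
   demanded by [satisfies_PDE]. *)
- have hT t : 0 <= t -> T (opD a b c d (du t)) = du t %[ae leb2 R in Om].
    by move=> /hdu[Xdu _]; exact: (opT_opD ab cd hB hBmaps hE hwp).
  have LD t : 0 <= t -> L2X (opD a b c d (du t)).
    by move=> /hdu[Xdu _]; exact: (opD_L2 Xdu).
  exists (fun t => opD a b c d (du t)); split.
  + exact: opT_inj.
  + exact: Lu.
  + move=> t t0; split; first exact: LD.
    have [Xdu fdu] := hdu t t0; apply: (frechet_transfer (C := 1) _ fdu) => h th.
    rewrite mul1r (Xnorm_diff h (Lu _ t0) (Lu _ th) (LD _ t0) (in_X_L2 Xdu) (hT _ t0)).
    by rewrite sqrtr_ge0; apply: L2norm_opT; apply: diff_L2; [exact: Lu|exact: Lu|exact: LD].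
  + by move=> t t0; exact: ae_eq_trans (hT t t0) (eq t t0).
Qed.

End equivalence.

Unset Implicit Arguments.

Theorem lemma15 (R : realType) (a b c d : R) (n0 n1 n2 : nat)
  (hab : a < b) (hcd : c < d)
  (B : BCparams R n1 n2)
  (hB : N011 a b c d B)
  (hBmaps : maps_Z a b c d (PI011 a b c d B))
  (hBsep : separable011 a b c d B)
  (E : BCinvparams R n1 n2)
  (hE : N011 a b c d E)
  (hwp : well_posed_bc a b c d B E)
  (A : PDEcoefs R n0 n1 n2)
  (uhI : R * R -> 'cV[R]_(n0 + (n1 + n2)))
  (huhI : L2mx (leb2 R) (Omega a b c d) uhI)
  (uh : R -> R * R -> 'cV[R]_(n0 + (n1 + n2)))
  (huh : forall t, 0 <= t -> L2mx (leb2 R) (Omega a b c d) (uh t)) :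
  let T := opT a b c d B E in
  solves_PIE a b c d T (opA a b c d A T) uhI uh <->
  satisfies_PDE a b c d A B (T uhI) (fun t => T (uh t)).
Proof.
by move=> T; apply: PIE_PDE.
Qed.
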